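(* For every $T\ge0$ and every bounded measurable function $f:\mathbb{D}([0,T],\mathbb{R}^d)\to\mathbb{R}$, $$\eta^N_{0:T}(f)\longrightarrow\widetilde P_{0:T}(f)\quad\text{almost surely as }N\to+\infty.$$
   Context: **Setting.** $d\ge1$ and $0<\Lambda<\infty$ are fixed; $\mathbb{D}([0,T],\mathbb{R}^d)$ is the Skorohod space. $L$ is the generator of a Markov process on $\mathbb{R}^d$ with paths in $\mathbb{D}(\mathbb{R}_+,\mathbb{R}^d)$, acting on a domain $\mathcal{D}(L)\subset L^\infty(\mathbb{R}^d)$. $\widehat\mu(v,w,dh,dk)$ is a nonnegative kernel from $\mathbb{R}^{2d}$ to $\mathbb{R}^{2d}$, symmetric in the sense $\widehat\mu(v,w,dh,dk)=\widehat\mu(w,v,dk,dh)$, with $\sup_{x,a}\widehat\mu(x,a,\mathbb{R}^d\times\mathbb{R}^d)\le\Lambda$. $\mu(v,w,dh)$ is the marginal $\widehat\mu(v,w,dh\times\mathbb{R}^d)$ (its mass at $h=0$ is irrelevant). $\widetilde P_0$ is a probability law on $\mathbb{R}^d$. **Particle system.** For $N\ge2$, $\overline Z_t=(\overline Z^i_t)_{1\le i\le N}$, $t\ge 0$, is the system of $N$ particles in $\mathbb{R}^d$ such that: the $\overline Z^i_0$ are i.i.d. with law $\widetilde P_0$; between interaction times the particles evolve independently according to $L$; to each pair $i<j$ is attached a Poisson process of parameter $\Lambda/(N-1)$ (all independent), whose jump times are the interaction times between $i$ and $j$; at an interaction time $t$ between $i$ and $j$, with probability $\widehat\mu(\overline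 Z^i_{t-},\overline Z^j_{t-},\mathbb{R}^{2d})/\Lambda$ the particles jump: $\overline Z^i_t=\overline Z^i_{t-}+H$, $\overline Z^j_t=\overline Z^j_{t-}+K$, the others unchanged, with $(H,K)$ of law $\widehat\mu(\overline Z^i_{t-},\overline Z^j_{t-},\cdot)/\widehat\mu(\overline Z^i_{t-},\overline Z^j_{t-},\mathbb{R}^{2d})$ independent of everything else; with the complementary probability there is no jump. For a process $X$, $X_{0:T}=(X_s)_{0\le s\le T}$. The systems for the different values of $N$ are defined on a common probability space. The empirical measure is $\eta^N_{0:T}=\frac1N\sum_{i=1}^N\delta_{\overline Z^i_{0:T}}$. **Limit law.** Let $\xi$ be the canonical process on $\mathbb{D}(\mathbb{R}_+,\mathbb{R}^d)$. A probability $\widetilde P$ on this space solves the nonlinear martingale problem with initial condition $\widetilde P_0$ if its marginal at time $0$ is $\widetilde P_0$ and for all $\phi\in\mathcal{D}(L)$ $$\phi(\xi_t)-\phi(\xi_0)-\int_0^t\int_{a\in\mathbb{R}^d}\int_{h\in\mathbb{R}^d}\Big(L\phi(\xi_s)+(\phi(\xi_s+h)-\phi(\xi_s))\mu(\xi_s,a,dh)\Big)\widetilde P_s(da)\,ds$$ is a $\widetilde P$-martingale (the term $L\phi(\xi_s)$ is not integrated against $\mu$), $\widetilde P_s$ being the marginal at time $s$. By a known theorem of Graham and Méléard there is a solution such that, for all $t\ge0$ and $N$, $\|\mathcal{L}(\overline Z^1_{0:t})-\widetilde P_{0:t}\|_{TV}\le 6\frac{e^{\Lambda t}-1}{N+1}$,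 where $\widetilde P_{0:t}$ is the marginal of $\widetilde P$ on $\mathbb{D}([0,t],\mathbb{R}^d)$; $\widetilde P$ denotes this solution. *)

(* Defs.v *)
From HB Require Import structures.
From mathcomp Require Import all_boot all_order all_algebra.
From mathcomp Require Import all_classical all_reals all_analysis.

Set Implicit Arguments.
Unset Strict Implicit.
Unset Printing Implicit Defensive.

Import Order.TTheory GRing.Theory Num.Theory.
Import numFieldNormedType.Exports.

Local Open Scope classical_set_scope.
Local Open Scope ring_scope.

(* Sigma-algebra on T generated by a family of maps into a measurable space. *)
Definition gen_family (I T : Type) d (E : measurableType d) (X : I -> T -> E)
    : set (set T) :=
  [set A | exists i B, measurable B /\ A = X i @^-1` B].

(* The Borel sigma-algebra of R^d, as the product of d copies of that of R. *)
Definition rv_display : measure_display. Proof. exact: default_measure_display. Qed.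

Section rv_measurable.
Context (R : realType) (n : nat).

Definition rv_measurable : set (set 'rV[R]_n) :=
  <<s gen_family (fun (j : 'I_n) (v : 'rV[R]_n) => v ord0 j) >>.

HB.instance Definition _ := @isMeasurable.Build rv_display 'rV[R]_n
  rv_measurable (@sigma_algebra0 _ setT _) (@sigma_algebraC _ _)
  (@sigma_algebra_bigcup _ setT _).

End rv_measurable.

Section skorohod_space.
Context (R : realType) (d : nat).

Definition cadlag (f : R -> 'rV[R]_d) : Prop :=
  forall t, f x @[x --> t^'+] --> f t /\ cvg (f x @[x --> t^'-]).

(* Projection of the line onto [0, T], where T = +oo is allowed. *)
Definition clamp (T : \bar R) (t : R) : R :=
  if T is r%:E then Num.min (Num.max 0 t) r else Num.max 0 t.

Lemma clamp_idem T t : clamp T (clamp T t) = clamp T t.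
Proof.
have m0 : 0 <= Num.max 0 t by rewrite le_max lexx.
case: T => [r| |] /=; rewrite ?(max_r m0)//.
have [h|h] := leP (Num.max 0 t) r; first by rewrite (max_r m0) (min_l h).
by rewrite min_r// le_max lexx orbT.
Qed.

Lemma clamp_homo T : {homo clamp T : x y / x <= y}.
Proof.
move=> x y xy; have mxy : Num.max 0 x <= Num.max 0 y.
  by rewrite ge_max !le_max lexx xy orbT.
by case: T => [r| |] //=; rewrite le_min !ge_min mxy lexx orbT.
Qed.

Lemma clamp_continuous T : continuous (clamp T).
Proof.
have mc : continuous (fun t : R => Num.max 0 t).
  move=> t; apply: (@continuous_max R R (fun=> 0) id t); [exact: cvg_cst|exact: cvg_id].
case: T => [r| |] //= t.
apply: (@continuous_min R R (fun t => Num.max 0 t) (fun=> r) t); [exact: mc|exact: cvg_cst].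
Qed.

(* D([0, T], R^d), and D(R_+, R^d) for T = +oo.  A path on [0, T] is encoded by
   its unique extension to the line that is constant on both sides of [0, T];
   the extension is cadlag at each real iff the path is cadlag on [0, T]. *)
Record skorohod (T : \bar R) := Skorohod {
  path_fun :> R -> 'rV[R]_d ;
  path_cadlag : cadlag path_fun ;
  path_frozen : forall t, path_fun (clamp T t) = path_fun t }.

Lemma cadlag_cst (v : 'rV[R]_d) : cadlag (fun=> v).
Proof. by move=> t; split; [exact: cvg_cst|apply: is_cvg_cst]. Qed.

Lemma cadlag_comp (f : R -> 'rV[R]_d) (g : R -> R) :
  {homo g : x y / x <= y} -> continuous g -> cadlag f -> cadlag (f \o g).
Proof.
move=> gm gc cf t; have [fr fl] := cf (g t); split.
- move=> A fA.
  have h : nbhs (g t) [set y | g t < y -> A (f y)] := fr _ fA.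
  have h' : nbhs (g t) [set y | g t <= y -> A (f y)].
    apply: filterS h => y hy; rewrite /= le_eqVlt => /orP[/eqP <-|].
      exact: nbhs_singleton fA.
    exact: hy.
  have hg : nbhs t [set x | g t <= g x -> A (f (g x))] := gc t _ h'.
  suff : nbhs t [set x | t < x -> A (f (g x))] by [].
  by apply: filterS hg => x hx tx; exact/hx/gm/ltW.
- have [[x0 [x0t gx0]]|ng] := pselect (exists x0, x0 < t /\ g x0 = g t).
    apply/cvg_ex; exists (f (g t)).
    apply: cvg_near_cst; near=> x => /=; congr f; apply/eqP.
    have xt : x < t by near: x; exact: nbhs_left_lt.
    rewrite eq_le (gm _ _ (ltW xt)) -gx0 gm//; apply/ltW.
    by near: x; exact: nbhs_left_gt.
  apply/cvg_ex; move/cvg_ex: fl => [l fl]; exists l => A Al.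
  have h : nbhs (g t) [set y | y < g t -> A (f y)] := fl _ Al.
  have hg : nbhs t [set x | g x < g t -> A (f (g x))] := gc t _ h.
  suff : nbhs t [set x | x < t -> A (f (g x))] by [].
  apply: filterS hg => x hx xt; apply: hx.
  by rewrite lt_neqAle gm ?ltW// andbT; apply/eqP => e; apply: ng; exists x.
Unshelve. all: by end_near. Qed.

HB.instance Definition _ T := gen_eqMixin (skorohod T).
HB.instance Definition _ T := gen_choiceMixin (skorohod T).
HB.instance Definition _ T := isPointed.Build (skorohod T)
  (@Skorohod T (fun=> 0) (cadlag_cst 0) (fun=> erefl)).

Definition skorohod_display : measure_display.
Proof. exact: default_measure_display. Qed.

(* The Borel sigma-algebra of the Skorohod topology is generated by the
   evaluations. *)
Definition skorohod_measurable (T : \bar R) : set (set (skorohod T)) :=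
  <<s gen_family (fun (t : R) (w : skorohod T) => w t) >>.

HB.instance Definition _ T := @isMeasurable.Build skorohod_display (skorohod T)
  (@skorohod_measurable T) (@sigma_algebra0 _ setT _) (@sigma_algebraC _ _)
  (@sigma_algebra_bigcup _ setT _).

End skorohod_space.
Arguments skorohod {R} d T.

Section path_maps.
Context (R : realType) (d : nat).

Definition eval (T : \bar R) (t : R) (w : skorohod d T) : 'rV[R]_d := w t.

Lemma measurable_eval T t : measurable_fun setT (@eval T t).
Proof.
move=> _ B mB; rewrite setTI; apply: sub_gen_smallest.
by exists t, B.
Qed.

HB.instance Definition _ T t := isMeasurableFun.Build _ _ _ _
  (@eval T t) (@measurable_eval T t).

Lemma window_cadlag (a : R) (U : \bar R) (w : skorohod d (+oo : \bar R)) :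
  cadlag (fun t => w (a + clamp U t)).
Proof.
apply: (@cadlag_comp _ _ w (fun t => a + clamp U t)) (path_cadlag w).
  by move=> x y xy; rewrite lerD2l clamp_homo.
move=> t; apply: (@cvgD _ R); [exact: cvg_cst|exact: clamp_continuous].
Qed.

Lemma window_frozen (a : R) (U : \bar R) (w : skorohod d (+oo : \bar R)) t :
  w (a + clamp U (clamp U t)) = w (a + clamp U t).
Proof. by rewrite clamp_idem. Qed.

(* (w_(a + t))_(0 <= t <= U).  In particular, window 0 T w is w_(0:T), and
   window a +oo w is w shifted by a. *)
Definition window (a : R) (U : \bar R) (w : skorohod d (+oo : \bar R)) :
    skorohod d U :=
  Skorohod (window_cadlag a U w) (window_frozen a U w).

Lemma measurable_window a U : measurable_fun setT (window a U).
Proof.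
apply: (@measurability _ _ _ _ setT _ (gen_family (fun (t : R) (w : skorohod d U) => w t))) => //.
move=> _ [_ [t [B [mB ->]]] <-]; rewrite setTI.
by apply: sub_gen_smallest; exists (a + clamp U t), B.
Qed.

HB.instance Definition _ a U := isMeasurableFun.Build _ _ _ _
  (window a U) (@measurable_window a U).

Definition left_limit (f : R -> 'rV[R]_d) (t : R) : 'rV[R]_d :=
  lim (f x @[x --> t^'-]).

End path_maps.

Section empirical_measure.
Context d (T : measurableType d) (R : realType) (N : nat).
Local Open Scope ereal_scope.

Definition empirical (X : 'I_N -> T) (A : set T) : \bar R :=
  (N%:R^-1)%:E * \sum_(i < N) \d_(X i) A.

Let empirical0 X : empirical X set0 = 0.
Proof. by rewrite /empirical big1 ?mule0// => i _; rewrite measure0. Qed.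

Let empirical_ge0 X A : 0 <= empirical X A.
Proof.
by apply: mule_ge0; [rewrite lee_fin invr_ge0|apply: sume_ge0 => i _].
Qed.

Let empirical_sigma_additive X : semi_sigma_additive (empirical X).
Proof.
pose m (k : nat) : {measure set T -> \bar R} :=
  if insub k is Some i then \d_(X i) else mzero.
pose r : {nonneg R} := NngNum (etrans (invr_ge0 N%:R) (ler0n R N)).
suff -> : empirical X = mscale r (msum m N) by exact: measure_semi_sigma_additive.
apply/funext => A; congr (_ * _); apply: eq_bigr => i _.
by rewrite /m valK.
Qed.

HB.instance Definition _ X := isMeasure.Build _ _ _ (empirical X)
  (empirical0 X) (empirical_ge0 X) (@empirical_sigma_additive X).

End empirical_measure.

Section jump_kernel.
Context (R : realType) (d : nat).
Notation E := 'rV[R]_d.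
Variable muhat : R.-ker (E * E)%type ~> (E * E)%type.
Local Open Scope ereal_scope.

Definition jump_marginal (v w : E) : set E -> \bar R :=
  pushforward (muhat (v, w)) fst.

Let marginal0 v w : jump_marginal v w set0 = 0.
Proof. by rewrite /jump_marginal /pushforward preimage_set0 measure0. Qed.

Let marginal_ge0 v w A : 0 <= jump_marginal v w A.
Proof. exact: measure_ge0. Qed.

Let marginal_sigma_additive v w : semi_sigma_additive (jump_marginal v w).
Proof. exact: (@measure_semi_sigma_additive _ _ _ (pushforward (muhat (v, w)) (@fst E E))). Qed.

HB.instance Definition _ v w := isMeasure.Build _ _ _ (jump_marginal v w)
  (marginal0 v w) (marginal_ge0 v w) (@marginal_sigma_additive v w).

End jump_kernel.

Section markov_process.
Context (R : realType) (d : nat).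
Notation E := 'rV[R]_d.
Notation D := (skorohod d (+oo : \bar R)).

Definition canonical_filtration (s : R) : set (set D) :=
  <<s gen_family (fun (u : {u : R | 0 <= u <= s}) (w : D) => w (sval u)) >>.

Definition markov_process (Px : R.-pker E ~> D) : Prop :=
  (forall x, Px x [set w | w 0 = x] = 1%E) /\
  forall x s A B, 0 <= s -> canonical_filtration s A -> measurable B ->
    Px x (A `&` window s +oo @^-1` B) = (\int[Px x]_(w in A) Px (w s) B)%E.

Definition bounded_measurable (phi : E -> R) : Prop :=
  measurable_fun setT phi /\ exists C, forall x, `|phi x| <= C.

Definition semigroup (Px : R.-pker E ~> D) (t : R) (phi : E -> R) (x : E) : R :=
  \int[Px x]_w phi (w t).

(* L, on the domain DL of bounded measurable functions, acts as the generator
   of the process: L phi is the bounded pointwise limit of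
   (P_t phi - phi) / t.  Neither uniform convergence nor maximality of DL is
   required, so that the strong and the weak generator and their restrictions
   to smaller domains are all covered. *)
Definition is_generator (Px : R.-pker E ~> D)
    (DL : set (E -> R)) (L : (E -> R) -> E -> R) : Prop :=
  forall phi, DL phi ->
    [/\ bounded_measurable phi, bounded_measurable (L phi),
        exists C, forall t x, 0 < t ->
          `|(semigroup Px t phi x - phi x) / t| <= C &
        forall x, (semigroup Px t phi x - phi x) / t @[t --> 0^'+] --> L phi x].

End markov_process.

Definition martingale d (T : measurableType d) (R : realType)
    (P : probability T R) (F : R -> set (set T)) (M : R -> T -> R) : Prop :=
  [/\ forall t B, 0 <= t -> measurable B -> F t (M t @^-1` B),
      forall t, 0 <= t -> P.-integrable setT (EFin \o M t) &
      forall s t A, 0 <= s -> s <= t -> F s A ->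
        \int[P]_(x in A) M t x = \int[P]_(x in A) M s x].

Section nonlinear_martingale_problem.
Context (R : realType) (d : nat).
Notation E := 'rV[R]_d.
Notation D := (skorohod d (+oo : \bar R)).
Variables (DL : set (E -> R)) (L : (E -> R) -> E -> R).
Variable muhat : R.-ker (E * E)%type ~> (E * E)%type.

Definition marginal (Pt : probability D R) (s : R) := distribution Pt (eval s).

Definition nonlinear_drift (Pt : probability D R) (phi : E -> R) (s : R) (x : E)
    : R :=
  \int[marginal Pt s]_a
    (L phi x + \int[jump_marginal muhat x a]_h (phi (x + h) - phi x)).

Definition nonlinear_process (Pt : probability D R) (phi : E -> R) (t : R)
    (w : D) : R :=
  phi (w t) - phi (w 0)
  - \int[lebesgue_measure]_(s in `[0, t]) nonlinear_drift Pt phi s (w s).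

Definition solves_nonlinear_martingale_problem (P0 : probability E R)
    (Pt : probability D R) : Prop :=
  (forall B, measurable B -> marginal Pt 0 B = P0 B) /\
  forall phi, DL phi ->
    martingale Pt (@canonical_filtration R d) (nonlinear_process Pt phi).

End nonlinear_martingale_problem.

(* The supremum of |mu A - nu A|, i.e. half the norm of mu - nu as a signed
   measure: as an upper bound it is the weaker of the two usual conventions. *)
Definition tv_dist d (T : measurableType d) (R : realType)
    (mu nu : set T -> \bar R) : \bar R :=
  ereal_sup [set `|mu A - nu A|%E | A in measurable].

Section particle_system.
Context (R : realType) (d : nat).
Notation E := 'rV[R]_d.
Notation D := (skorohod d (+oo : \bar R)).

Definition pair_index (N : nat) := {p : 'I_N * 'I_N | (p.1 < p.2)%N}.
Definition lo_of N (p : pair_index N) : 'I_N := (val p).1.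
Definition hi_of N (p : pair_index N) : 'I_N := (val p).2.

Context (dO : measure_display) (Omega : measurableType dO).
Variable P : probability Omega R.

(* tau p n is the n-th (n >= 0) jump time of the clock of the pair p. *)
Definition gap N (tau : pair_index N -> nat -> {RV P >-> R}) (p : pair_index N) (n : nat)
    (omega : Omega) : R :=
  tau p n omega - (if n is m.+1 then tau p m omega else 0).

(* Independent Poisson processes: all the inter-arrival times of all the clocks
   are independent and exponential. *)
Definition poisson_clocks N (rate : R) (tau : pair_index N -> nat -> {RV P >-> R})
    : Prop :=
  forall (s : seq (pair_index N * nat)) (B : pair_index N * nat -> set R),
    uniq s -> (forall x, measurable (B x)) ->
    P (\bigcap_(x in [set` s]) gap tau x.1 x.2 @^-1` B x) =
    (\prod_(x <- s) exponential_prob rate (B x))%E.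

(* The time 0 or one of the interaction times. *)
Definition start_time N (tau : pair_index N -> nat -> {RV P >-> R})
    (e : option (pair_index N * nat)) (omega : Omega) : R :=
  if e is Some x then tau x.1 x.2 omega else 0.

Definition quiet N (tau : pair_index N -> nat -> {RV P >-> R}) (sigma : Omega -> R)
    (u : R) : set Omega :=
  [set omega | forall p n,
     ~ (sigma omega < tau p n omega <= sigma omega + u)].

Definition clock_events N (tau : pair_index N -> nat -> {RV P >-> R})
    : set (set Omega) :=
  gen_family (fun x : pair_index N * nat => tau x.1 x.2 : Omega -> R).

(* All the clocks, and the particles up to and including the time sigma. *)
Definition history N (tau : pair_index N -> nat -> {RV P >-> R})
    (Z : 'I_N -> {RV P >-> D}) (sigma : Omega -> R) : set (set Omega) :=
  <<s clock_events tau `|`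
      gen_family (fun (x : 'I_N * R) omega =>
        Z x.1 omega (Num.min x.2 (sigma omega))) >>.

(* All the clocks, and the particles strictly before the time sigma. *)
Definition strict_history N (tau : pair_index N -> nat -> {RV P >-> R})
    (Z : 'I_N -> {RV P >-> D}) (sigma : Omega -> R) : set (set Omega) :=
  <<s clock_events tau `|`
      [set A | exists i t B, [/\ 0 <= t, measurable B &
        A = [set omega | t < sigma omega /\ B (Z i omega t)]]] >>.

(* With probability muhat(v, w, E * E) / Lam, a jump with the normalised law
   muhat(v, w, .) / muhat(v, w, E * E); otherwise no jump. *)
Definition jump_law (Lam : R) (muhat : R.-ker (E * E)%type ~> (E * E)%type)
    (v w : E) (C : set (E * E)) : \bar R :=
  ((Lam^-1)%:E * muhat (v, w) C +
   (1 - (Lam^-1)%:E * muhat (v, w) setT) * \d_((0%R, 0%R) : E * E) C)%E.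

(* The law of the system is described by conditioning on all the clocks and on
   the past of the particles.  "Conditionally on the sigma-algebra G, the event
   V has probability Y" is written P (A `&` V) = \int[P]_(omega in A) Y omega
   for all A in G. *)
Record particle_system (Lam : R) (Px : R.-pker E ~> D)
    (muhat : R.-ker (E * E)%type ~> (E * E)%type) (P0 : probability E R)
    (N : nat) (tau : pair_index N -> nat -> {RV P >-> R})
    (Z : 'I_N -> {RV P >-> D}) : Prop := ParticleSystem {
  ps_clocks : poisson_clocks (Lam / N.-1%:R) tau ;
  (* i.i.d. initial positions, independent of the clocks *)
  ps_init : forall A (B : 'I_N -> set E),
    <<s clock_events tau >> A -> (forall i, measurable (B i)) ->
    P (A `&` [set omega | forall i, B i (Z i omega 0)]) =
    (P A * \prod_(i < N) P0 (B i))%E ;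
  (* from time 0, or from an interaction time, until the next interaction
     time: independent copies of the Markov process *)
  ps_evolution : forall e (u : R) A
      (B : 'I_N -> set (skorohod d (u%:E : \bar R))),
    let sigma := start_time tau e in
    0 <= u -> history tau Z sigma A -> (forall i, measurable (B i)) ->
    P (A `&` quiet tau sigma u `&`
       [set omega | forall i, B i (window (sigma omega) u%:E (Z i omega))]) =
    (\int[P]_(omega in A `&` quiet tau sigma u)
       \prod_(i < N)
         Px (Z i omega (sigma omega)) (window 0 u%:E @^-1` B i))%E ;
  ps_jump : forall p n A (C : set (E * E)),
    let sigma := tau p n in
    let i := lo_of p in
    let j := hi_of p in
    strict_history tau Z sigma A -> measurable C ->
    P (A `&` [set omega |
         C (Z i omega (sigma omega) - left_limit (Z i omega) (sigma omega),
            Z j omega (sigma omega) - left_limit (Z j omega) (sigma omega))]) =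
    (\int[P]_(omega in A)
       jump_law Lam muhat (left_limit (Z i omega) (sigma omega))
                          (left_limit (Z j omega) (sigma omega)) C)%E ;
  ps_others : forall p n k, k != lo_of p -> k != hi_of p ->
    {ae P, forall omega,
       Z k omega (tau p n omega) = left_limit (Z k omega) (tau p n omega)}
}.

End particle_system.

(* Main.v *)
(** Iterating the Duhamel formula between interaction times writes the law of
    the N-particle system on [0, T] as a series of pure iterations of the
    Markov kernel and of the pair jumps.  In this series, changing one of the
    particles influences a mean by at most a factor exp(Lam T), and a Hoeffding
    type induction bounds the exponential moments of sums of bounded functions
    of the particles, hence gives tails that are geometric in N.  By
    exchangeability all particles have the same mean, which tends to the limit
    mean by the total variation bound, and Borel-Cantelli concludes. *)
From HB Require Import structures.
From mathcomp Require Import all_boot all_order all_algebra.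
From mathcomp Require Import all_classical all_reals all_analysis measurable_realfun.
Require Import Defs.
From mathcomp Require Import ring lra.

Set Implicit Arguments.
Unset Strict Implicit.
Unset Printing Implicit Defensive.

Import Order.TTheory GRing.Theory Num.Theory.
Import numFieldNormedType.Exports.

Local Open Scope classical_set_scope.
Local Open Scope ring_scope.

(** The systems for different [N] may be coupled in any way, so almost sure convergence has to come
    from tails summable in [N]; a second moment of order [1 / N] would only give convergence in
    probability. Two obstacles shape the argument. The hypotheses describe the system by restarting
    all particles at every interaction time, whereas the bound on influence needs a step that
    touches two coordinates only. The Markov property lets the other paths run through, provided
    that each of them has its left limit as value at the interaction time. This holds for almost
    every time, since the interaction times end up integrated against Lebesgue measure and a cadlag
    path has countably many jumps. The other obstacle is that interactions come at a total rate of
    order [N]. The factor [exp (Lam * T)] does not see this, because the [N - 1] clocks of one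
    particle have total rate [Lam] and each of their rings at most doubles the influence of that
    particle. The remaining growth [exp (kap * T)] is common to all configurations and is cancelled
    by the probability that all clocks are silent. *)

Module PartA.

(** * Product spaces, cylinders and composition of probability kernels *)

Definition prod_display : measure_display. Proof. exact: default_measure_display. Qed.

(** A synonym of the function type, so that the product sigma-algebra does not attach to every
    function type. *)
Definition prodspace (I X : Type) := I -> X.

Section prodspace.
Context (I : Type) d (X : measurableType d).

HB.instance Definition _ := Pointed.copy (prodspace I X) (I -> X).

Definition prod_gen : set (set (prodspace I X)) :=
  gen_family (fun (i : I) (z : prodspace I X) => z i).

HB.instance Definition _ := @isMeasurable.Build prod_display (prodspace I X)
  <<s prod_gen >> (@sigma_algebra0 _ setT _) (@sigma_algebraC _ _)
  (@sigma_algebra_bigcup _ setT _).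

Lemma measurable_coord i : measurable_fun setT (fun z : prodspace I X => z i).
Proof.
by move=> _ B mB; rewrite setTI; apply: sub_gen_smallest; exists i, B.
Qed.

Lemma measurable_prodspace d' (W : measurableType d') (f : W -> prodspace I X) :
  (forall i, measurable_fun setT (fun w => f w i)) -> measurable_fun setT f.
Proof.
move=> mf; apply: (@measurability _ _ _ _ setT _ prod_gen) => //.
by move=> _ [_ [i [B [mB ->]]] <-]; rewrite setTI -[X in measurable X]setTI; exact: mf.
Qed.

End prodspace.

Section upd.
Context (I : eqType) d (X : measurableType d).

Definition upd (z : prodspace I X) i y : prodspace I X :=
  fun j => if j == i then y else z j.

Lemma updE z i y : upd z i y i = y. Proof. by rewrite /upd eqxx. Qed.

Lemma upd_neq z i y j : j != i -> upd z i y j = z j.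
Proof. by rewrite /upd => /negbTE ->. Qed.

Lemma upd_upd z i y y' : upd (upd z i y) i y' = upd z i y'.
Proof. by apply/funext => j; rewrite /upd; case: eqP. Qed.

Lemma updC z i j y y' : i != j -> upd (upd z i y) j y' = upd (upd z j y') i y.
Proof.
move=> ij; apply/funext => k; rewrite /upd; case: (eqVneq k j) => // ->.
by rewrite eq_sym (negbTE ij).
Qed.

Lemma measurable_upd d' (W : measurableType d') (f : W -> prodspace I X) i (g : W -> X) :
  measurable_fun setT f -> measurable_fun setT g ->
  measurable_fun setT (fun w => upd (f w) i (g w)).
Proof.
move=> mf mg; apply: measurable_prodspace => j; rewrite /upd.
case: eqP => // _; exact: (measurableT_comp (@measurable_coord I d X j) mf).
Qed.

End upd.

Section cylinders.
Context (I : choiceType) (T : pointedType) d (E : measurableType d) (X : I -> T -> E).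

(** A total family [B] with a finite list of active indices makes intersections easy: an inactive
    index contributes [setT]. Cylinders are the pi-system on which laws of gaps, paths and
    configurations are compared. *)
Definition cylinders : set (set T) :=
  [set A | exists (s : seq I) (B : I -> set E), uniq s /\ (forall i, measurable (B i)) /\
     A = [set t | forall i, i \in s -> B i (X i t)]].

Lemma setI_cylinders : setI_closed cylinders.
Proof.
move=> _ _ [s [B [us [mB ->]]]] [s' [B' [us' [mB' ->]]]].
exists (undup (s ++ s')),
  (fun i => (if i \in s then B i else setT) `&` (if i \in s' then B' i else setT)).
split; first exact: undup_uniq.
split; first by move=> i; apply: measurableI; case: ifP.
apply/seteqP; split => z /=.
  by move=> [h h'] i _; split; case: ifP => // ii; [exact: h|exact: h'].
move=> h; split => i ii.
  by have := h i; rewrite mem_undup mem_cat ii => /(_ isT) -[].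
by have := h i; rewrite mem_undup mem_cat ii orbT => /(_ isT) -[].
Qed.

Lemma cylindersT : cylinders setT.
Proof. by exists [::], (fun=> setT); split => //; split => //; apply/seteqP; split. Qed.

Lemma generated_cylinders : <<s gen_family X >> = <<s cylinders >>.
Proof.
apply/seteqP; split; apply: smallest_sub.
- exact: smallest_sigma_algebra.
- move=> _ [i [B [mB ->]]]; apply: sub_gen_smallest.
  exists [:: i], (fun=> B); split => //; split => //.
  apply/seteqP; split => z /= => [h j|h]; last by apply: h; rewrite inE.
  by rewrite inE => /eqP ->.
- exact: smallest_sigma_algebra.
- move=> _ [s [B [us [mB ->]]]].
  have -> : [set t | forall i, i \in s -> B i (X i t)] =
      \big[setI/setT]_(i <- s) (X i @^-1` B i).
    by rewrite -bigcap_seq; apply/seteqP; split => z h i /h.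
  apply: (@bigsetI_measurable _ (g_sigma_algebraType (gen_family X))) => i _.
  by apply: sub_gen_smallest; exists i, (B i).
Qed.

End cylinders.

Section kernels.
Context (R : realType).
Local Open Scope ereal_scope.

Section kcomap.
Context d1 d2 d3 (W : measurableType d1) (X : measurableType d2) (Y : measurableType d3).
Variables (f : W -> X) (k : R.-pker X ~> Y).

Definition kcomap of measurable_fun setT f : W -> {measure set Y -> \bar R} :=
  fun w => k (f w).

Variable mf : measurable_fun setT f.

Let measurable_kcomap U : measurable U -> measurable_fun [set: W] (kcomap mf ^~ U).
Proof.
move=> mU; change (measurable_fun setT ((k ^~ U) \o f)).
by apply: measurableT_comp mf; exact: measurable_kernel.
Qed.

HB.instance Definition _ := isKernel.Build _ _ _ _ _ (kcomap mf) measurable_kcomap.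

Let kcomap_prob w : kcomap mf w setT = 1. Proof. exact: prob_kernel. Qed.

HB.instance Definition _ := Kernel_isProbability.Build _ _ _ _ _ (kcomap mf) kcomap_prob.

End kcomap.

Section kbind.
Context d1 d2 d3 (X : measurableType d1) (Y : measurableType d2) (Z : measurableType d3).
Variables (k : R.-pker X ~> Y) (l : R.-pker (X * Y)%type ~> Z).

(** The second kernel sees the source as well as the outcome of the first, so that a later stage of
    a construction can read everything drawn before. *)
Definition kbind : X -> {measure set Z -> \bar R} := mkcomp k l.

Let measurable_kbind U : measurable U -> measurable_fun [set: X] (kbind ^~ U).
Proof. exact: measurable_fun_mkcomp_sfinite. Qed.

HB.instance Definition _ := isKernel.Build _ _ _ _ _ kbind measurable_kbind.

Let kbind_prob x : kbind x setT = 1.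
Proof.
rewrite /kbind /= /kcomp (eq_integral (cst 1)) => [|y _]; last exact: prob_kernel.
by rewrite integral_cst// mul1e; exact: prob_kernel.
Qed.

HB.instance Definition _ := Kernel_isProbability.Build _ _ _ _ _ kbind kbind_prob.

Lemma integral_kbind x (F : Z -> \bar R) : (forall z, 0 <= F z) ->
  measurable_fun setT F ->
  \int[kbind x]_z F z = \int[k x]_y \int[l (x, y)]_z F z.
Proof. by move=> F0 mF; exact: integral_kcomp. Qed.

End kbind.

Lemma integral_kdirac d1 d2 (X : measurableType d1) (Y : measurableType d2)
   (f : X -> Y) (mf : measurable_fun setT f) x (F : Y -> \bar R) :
  measurable_fun setT F -> \int[@kdirac _ _ _ _ R _ mf x]_y F y = F (f x).
Proof. by move=> mF; rewrite integral_dirac// diracT mul1e. Qed.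

Lemma measurable_integral_pker d1 d2 (X : measurableType d1) (Y : measurableType d2)
    (k : R.-pker X ~> Y) (F : X * Y -> \bar R) :
  (forall w, 0 <= F w) -> measurable_fun setT F ->
  measurable_fun setT (fun x => \int[k x]_y F (x, y)).
Proof. by move=> F0 mF; exact: measurable_fun_integral_sfinite_kernel. Qed.

End kernels.

End PartA.

(** * Conditional laws turned into identities between integrals *)

Module PartB.
Import PartA.

Section binding.
Context (R : realType).
Local Open Scope ereal_scope.

Lemma integral_mrestr d (W : measurableType d) (mu : {measure set W -> \bar R})
    O (mO : measurable O) (f : W -> \bar R) :
  measurable_fun setT f -> (forall w, 0 <= f w) ->
  \int[mrestr mu mO]_w f w = \int[mu]_(w in O) f w.
Proof.
move=> mf f0; rewrite -(setUv O) ge0_integral_setU//; last 3 first.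
- exact: measurableC.
- by rewrite setUv.
- by apply/disj_setPCl; rewrite ?setCK.
rewrite [X in _ + X]null_set_integral ?adde0; last 3 first.
- exact: measurableC.
- exact: measurable_funTS.
- by rewrite /= /mrestr setICl measure0.
by apply: eq_measure_integral => A mA AO; rewrite /= /mrestr setIidl.
Qed.

Section mbind.
Context d d' (W : measurableType d) (Y : measurableType d').
Variables (mu : {finite_measure set W -> \bar R}) (k : R.-pker W ~> Y).

Definition kfinite (_ : unit) : {measure set W -> \bar R} := mu.

Let measurable_kfinite U : measurable U -> measurable_fun [set: unit] (kfinite ^~ U).
Proof. by move=> _; exact: measurable_cst. Qed.

HB.instance Definition _ := isKernel.Build _ _ _ _ _ kfinite measurable_kfinite.

Let kfinite_uub : measure_fam_uub kfinite.
Proof.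
rewrite /measure_fam_uub; exists (fine (mu setT) + 1)%R; move=> ?.
rewrite EFinD fineK ?fin_num_measure//.
by rewrite lteDl ?fin_num_measure// lte_fin.
Qed.

HB.instance Definition _ := Kernel_isFinite.Build _ _ _ _ _ kfinite kfinite_uub.

Definition mbind : {measure set Y -> \bar R} :=
  mkcomp kfinite (kcomap k (@measurable_snd _ _ unit W)) tt.

Lemma mbindE U : mbind U = \int[mu]_w k w U.
Proof. by []. Qed.

Lemma integral_mbind f : (forall y, 0 <= f y) -> measurable_fun setT f ->
  \int[mbind]_y f y = \int[mu]_w \int[k w]_y f y.
Proof. by move=> f0 mf; rewrite integral_kcomp. Qed.

End mbind.

Section joint_law.
Context d1 d2 d3 (W : measurableType d1) (Y : measurableType d2) (V : measurableType d3).
Variables (P : probability W R) (O : set W) (h : W -> Y) (v : W -> V) (k : R.-pker Y ~> V).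
Variable G : set (set V).
Hypotheses (mO : measurable O) (mh : measurable_fun setT h) (mv : measurable_fun setT v).
Hypotheses (mG : @measurable _ V = <<s G >>) (GI : setI_closed G) (GT : G setT).
Hypothesis law : forall A B, measurable A -> G B ->
  P (O `&` h @^-1` A `&` v @^-1` B) = \int[P]_(w in O `&` h @^-1` A) k (h w) B.

Let Poo : (P O < +oo). Proof. by rewrite (le_lt_trans (probability_le1 P mO)) ?ltry. Qed.

Let mhv : measurable_fun setT (fun w => (h w, v w)).
Proof. exact: measurable_fun_pair. Qed.

Let k2 : R.-pker Y ~> (Y * V)%type :=
  kbind k (@kdirac _ _ _ _ R _ (@measurable_id _ (Y * V)%type setT)).

(** Only the second factor is restricted to a pi-system: the conditional law is given for all events
    of the past, but only on a pi-system of events of the future. *)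
Let prodG : set (set (Y * V)) :=
  [set C | exists A B, [/\ measurable A, G B & C = A `*` B]].

Let measurable_prodG : @measurable _ (Y * V)%type = <<s prodG >>.
Proof.
apply/seteqP; split; last first.
  apply: smallest_sub; first exact: sigma_algebra_measurable.
  move=> _ [A [B [mA GB ->]]]; apply: measurableX => //.
  by rewrite mG; exact: sub_gen_smallest.
rewrite measurable_prod_measurableType.
apply: smallest_sub; first exact: smallest_sigma_algebra.
move=> _ [A mA [B mB <-]].
(* For a fixed first factor, the sets whose rectangle is good form a lambda-system that contains
   [G]. *)
suff h1 : <<s G >> `<=` [set B | <<s prodG >> (A `*` B)] by apply: h1; rewrite -mG.
apply: lambda_system_subset => //.
  apply/dynkin_lambda_system; split.
  - by apply: sub_gen_smallest; exists A, setT.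
  - move=> C mC /=.
    have -> : A `*` (~` C) = (A `*` setT) `\` (A `*` C).
      apply/seteqP; split => -[a c] /=; first by move=> [? ?]; split => // -[].
      by move=> [[Aa _] h1]; split => // Cc; apply: h1.
    apply: (@measurableD _ (g_sigma_algebraType prodG)) => //.
    by apply: sub_gen_smallest; exists A, setT.
  - move=> F _ mF /=.
    have -> : A `*` (\bigcup_k F k) = \bigcup_k (A `*` F k).
      apply/seteqP; split => -[a c] /=; first by move=> [? [k' _ ?]]; exists k'.
      by move=> [k' _ [? ?]]; split => //; exists k'.
    exact: (@bigcupT_measurable _ (g_sigma_algebraType prodG)).
by move=> C GC; apply: sub_gen_smallest; exists A, C.
Qed.

(** The hypothesis [law] says that [k (h w)] is the conditional law of [v] given [h] on [O]. Both
    sides are integrals of [F] against finite measures on [Y * V] that agree on the pi-system of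
    rectangles. Through this lemma the conditional clauses of [particle_system] become statements
    about integrals. *)
Lemma integral_joint_law (F : Y * V -> \bar R) : (forall x, 0 <= F x) ->
  measurable_fun setT F ->
  \int[P]_(w in O) F (h w, v w) = \int[P]_(w in O) \int[k (h w)]_y F (h w, y).
Proof.
move=> F0 mF.
pose m := mfrestr mO Poo.
pose m1 := mbind m (@kdirac _ _ _ _ R _ mhv).
pose m2 := mbind m (kcomap k2 mh).
have k2E y (f : Y * V -> \bar R) : (forall x, 0 <= f x) -> measurable_fun setT f ->
    \int[k2 y]_x f x = \int[k y]_z f (y, z).
  by move=> f0 mf; rewrite integral_kbind//; apply: eq_integral => z _; rewrite integral_kdirac.
have mk2F f : (forall x, 0 <= f x) -> measurable_fun setT f ->
    measurable_fun [set: W] (fun w => \int[k (h w)]_y f (h w, y)).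
  move=> f0 mf; apply: (measurableT_comp (f := fun x => \int[k x]_y f (x, y))) => //.
  exact: measurable_integral_pker.
have e1 f : (forall x, 0 <= f x) -> measurable_fun setT f ->
    \int[m1]_x f x = \int[P]_(w in O) f (h w, v w).
  move=> f0 mf; rewrite integral_mbind// -(integral_mrestr _ mO)//; last first.
    exact: measurableT_comp.
  by apply: eq_integral => w _; rewrite integral_kdirac.
have e2 f : (forall x, 0 <= f x) -> measurable_fun setT f ->
    \int[m2]_x f x = \int[P]_(w in O) \int[k (h w)]_y f (h w, y).
  move=> f0 mf; rewrite integral_mbind// -(integral_mrestr _ mO)//; last 2 first.
  - exact: mk2F.
  - by move=> w; exact: integral_ge0.
  by apply: eq_integral => w _; rewrite -k2E.
rewrite -e1// -e2//; apply: eq_measure_integral => C mC _.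
apply: (@measure_unique _ R _ prodG (fun=> setT)) => //.
- move=> _ _ [A [B [mA GB ->]]] [A' [B' [mA' GB' ->]]].
  exists (A `&` A'), (B `&` B'); split; [exact: measurableI|exact: GI|].
  by rewrite setXI.
- by move=> _; exists setT, setT; split; rewrite ?setXTT.
- by rewrite bigcup_const//; exists O.
- move=> _ [A [B [mA GB ->]]].
  have mB : measurable B by rewrite mG; exact: sub_gen_smallest.
  have mAB : measurable (A `*` B) by exact: measurableX.
  have mhA : measurable (h @^-1` A) by rewrite -[X in measurable X]setTI; exact: mh.
  have mvB : measurable (v @^-1` B) by rewrite -[X in measurable X]setTI; exact: mv.
  have E1 : m1 (A `*` B) = P (O `&` h @^-1` A `&` v @^-1` B).
    transitivity (\int[m1]_x (\1_(A `*` B) x)%:E); first by rewrite integral_indic// setIT.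
    rewrite e1//; last by apply/measurable_EFinP; exact: measurable_indic.
    transitivity (\int[P]_(w in O) (\1_(h @^-1` A `&` v @^-1` B) w)%:E).
      by apply: eq_integral => w _; rewrite !indicE.
    by rewrite integral_indic ?[LHS]setIC// 1?setIC ?setIA//; exact: measurableI.
  have E2 : m2 (A `*` B) = \int[P]_(w in O `&` h @^-1` A) k (h w) B.
    transitivity (\int[m2]_x (\1_(A `*` B) x)%:E); first by rewrite integral_indic// setIT.
    rewrite e2//; last by apply/measurable_EFinP; exact: measurable_indic.
    rewrite integral_mkcondr.
    apply: eq_integral => w _.
    rewrite (_ : (fun y => _) = (fun y => (\1_A (h w))%:E * (\1_B y)%:E)); last first.
      by apply/funext => y; rewrite -EFinM; congr EFin; rewrite !indicE in_setX -natrM mulnb.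
    rewrite ge0_integralZl//.
    - rewrite integral_indic// setIT patchE indicE.
      rewrite (_ : (h w \in A) = (w \in h @^-1` A))//.
      by case: ifPn => _; rewrite ?mul1e ?mul0e.
    - by apply/measurable_EFinP; exact: measurable_indic.
  by rewrite E1 E2 law.
- move=> _; rewrite -[m1 _]mul1e -integral_cst// e1//=.
  by rewrite integral_cst// mul1e.
Qed.

End joint_law.
End binding.

End PartB.

(** * Products of kernels over a list of coordinates *)

Module PartC.
Import PartA PartB.

Section product_kernel.
Context (R : realType) (I : choiceType) dW dX (W : measurableType dW) (X : measurableType dX).
Variable k : I -> R.-pker W ~> X.
Local Open Scope ereal_scope.

Let mupd i : measurable_fun setT (fun x : W * X * prodspace I X => upd x.2 i x.1.2).
Proof.
apply: measurable_upd; first exact: measurable_snd.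
by apply: measurableT_comp; [exact: measurable_snd|exact: measurable_fst].
Qed.

(** Coordinates are drawn one at a time and written over the constant configuration [point]. Those
    outside the list keep this default, so this is the full product law only if the list exhausts
    [I]. A list lets later proofs choose the coordinate that is split off first. *)
Fixpoint prodker (s : seq I) : R.-pker W ~> prodspace I X :=
  if s is i :: s' then
    kbind (k i) (kbind (kcomap (prodker s') (@measurable_fst _ _ W X))
      (@kdirac _ _ _ _ R _ (@mupd i)))
  else @kdirac _ _ _ _ R _ (@measurable_cst _ _ W _ setT (point : prodspace I X)).

Lemma integral_prodker_nil w F : measurable_fun setT F ->
  \int[prodker [::] w]_z F z = F point.
Proof. by move=> mF; rewrite integral_kdirac. Qed.

Lemma integral_prodker_cons i s w F : (forall z, 0 <= F z) -> measurable_fun setT F ->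
  \int[prodker (i :: s) w]_z F z = \int[k i w]_y \int[prodker s w]_z F (upd z i y).
Proof.
move=> F0 mF; rewrite integral_kbind//; apply: eq_integral => y _.
by rewrite integral_kbind//; apply: eq_integral => z _; rewrite integral_kdirac.
Qed.

Lemma integral_prodker_prod (s : seq I) w (phi : I -> X -> \bar R) : uniq s ->
  (forall i y, 0 <= phi i y) -> (forall i, measurable_fun setT (phi i)) ->
  \int[prodker s w]_z (\prod_(i <- s) phi i (z i)) =
  \prod_(i <- s) \int[k i w]_y phi i y.
Proof.
move=> + phi0 mphi; have prod0 t z : 0 <= \prod_(i <- t) phi i (z i).
  by elim: t => [|i t ih]; rewrite ?big_nil// big_cons mule_ge0.
have mprod t : measurable_fun setT (fun z : prodspace I X => \prod_(i <- t) phi i (z i)).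
  elim: t => [|i t ih]; first by under eq_fun do rewrite big_nil; exact: measurable_cst.
  under eq_fun do rewrite big_cons; apply: emeasurable_funM => //.
  by apply: measurableT_comp => //; exact: measurable_coord.
elim: s => [_|i s ih /= /andP[si us]].
  by rewrite integral_prodker_nil// !big_nil.
rewrite integral_prodker_cons// big_cons -ih//.
under eq_integral => y _.
  under eq_integral => z _.
    rewrite big_cons updE (eq_big_seq (fun j => phi j (z j))); last first.
      by move=> j js; rewrite upd_neq//; apply: contraNneq si => <-.
    over.
  rewrite ge0_integralZl//.
  over.
by rewrite /= ge0_integralZr//; apply: integral_ge0.
Qed.

Lemma prodker_cylinder (s : seq I) w (B : I -> set X) : uniq s ->
  (forall i, measurable (B i)) ->
  prodker s w [set z | forall i, i \in s -> B i (z i)] = \prod_(i <- s) k i w (B i).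
Proof.
move=> us mB.
have mC : measurable [set z : prodspace I X | forall i, i \in s -> B i (z i)].
  have -> : [set z : prodspace I X | forall i, i \in s -> B i (z i)] =
      \big[setI/setT]_(i <- s) ((fun z => z i) @^-1` B i).
    by rewrite -bigcap_seq; apply/seteqP; split => z h i /h.
  apply: bigsetI_measurable => i _; rewrite -[X in measurable X]setTI.
  exact: measurable_coord.
rewrite -[LHS]mul1e.
transitivity (\int[prodker s w]_z (\prod_(i <- s) (\1_(B i) (z i))%:E)).
  rewrite mul1e -[in LHS](setIT [set z | _]) -integral_indic//.
  apply: eq_integral => z _; rewrite indicE prodEFin; congr EFin.
  case: (boolP (z \in _)) => [|/negP] zB.
    rewrite big_seq big1// => i is_; rewrite indicE mem_set//.
    by move: zB; rewrite inE => /(_ i is_).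
  apply/esym/eqP; rewrite prodf_seq_eq0; apply/hasP.
  apply: contrapT => h; apply: zB; rewrite inE /= => i is_.
  apply: contrapT => nB; apply: h; exists i => //=.
  by rewrite indicE memNset.
rewrite (@integral_prodker_prod s w (fun i y => (\1_(B i) y)%:E))//.
- by apply: eq_bigr => i _; rewrite integral_indic// setIT.
- by move=> i; apply/measurable_EFinP; exact: measurable_indic.
Qed.

Section resample.
Variable G : I -> X -> X -> X.
Hypothesis mG : forall i x, measurable_fun setT (G i x).

(** Coordinate [i] is updated through its own old value [z i]. This rewrites a product integral as
    the iterated one-site updates of the particle dynamics. *)
Fixpoint resample w (s : seq I) (F : prodspace I X -> \bar R) (z : prodspace I X) : \bar R :=
  if s is i :: s' then
    \int[k i w]_y resample w s' F (upd z i (G i (z i) y)) else F z.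

Lemma integral_prodker_resample w s (F : prodspace I X -> \bar R) z : uniq s ->
  (forall z, 0 <= F z) -> measurable_fun setT F ->
  \int[prodker s w]_y F (fun i => if i \in s then G i (z i) (y i) else z i) =
  resample w s F z.
Proof.
move=> + F0 mF.
have mH z' (t : seq I) : measurable_fun setT (fun y : prodspace I X =>
    (fun i => if i \in t then G i (z' i) (y i) else z' i) : prodspace I X).
  apply: measurable_prodspace => i; case: (i \in t); last exact: measurable_cst.
  by apply: measurableT_comp => //; exact: measurable_coord.
elim: s z => [z _|i s ih z]; first by rewrite (integral_prodker_nil w (measurable_cst (F z))).
rewrite cons_uniq => /andP[si us].
rewrite integral_prodker_cons//; last exact: measurableT_comp (mH _ _).
rewrite [RHS]/=; apply: eq_integral => y _; rewrite -ih//; apply: eq_integral => t _.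
congr F; apply/funext => j; rewrite inE /upd; case: eqVneq => [->|ij] /=.
  by rewrite (negbTE si).
by [].
Qed.

End resample.

End product_kernel.

End PartC.

(** * Approximation of times by countably many values *)

Module PartD.
Import PartA.

Section dyadic.
Context (R : realType).

(** Successor and predecessor make the two approximations strict: right continuity is used along
    times above [t], left limits along times below [t]. *)
Definition right_approx n (t : R) : R := (Num.truncn (t * n.+1%:R)).+1%:R / n.+1%:R.
Definition left_approx n (t : R) : R := (Num.truncn (t * n.+1%:R)).-1%:R / n.+1%:R.

Lemma right_approx_gt n t : t < right_approx n t.
Proof. by rewrite /right_approx ltr_pdivlMr ?ltr0n// truncnS_gt. Qed.

Lemma left_approx_lt n t : 0 < t -> left_approx n t < t.
Proof.
move=> t0; rewrite /left_approx ltr_pdivrMr ?ltr0n//.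
have h : 0 < t * n.+1%:R by rewrite mulr_gt0// ltr0n.
case E : (Num.truncn (t * n.+1%:R)) => [//|m] /=.
have := truncn_le (t * n.+1%:R); rewrite E (ltW h) => h1.
by apply: lt_le_trans h1; rewrite ltr_nat.
Qed.

Lemma left_approx_ge0 n t : 0 <= left_approx n t.
Proof. by rewrite /left_approx divr_ge0. Qed.

Lemma cvg_right_approx t : 0 <= t -> right_approx n t @[n --> \oo] --> t.
Proof.
move=> t0; apply: (@squeeze_cvgr _ _ _ _ (fun=> t) (fun n => t + n.+1%:R^-1)).
- near=> n; apply/andP; split; first exact/ltW/right_approx_gt.
  rewrite /right_approx ler_pdivrMr ?ltr0n// mulrDl mulVf ?pnatr_eq0//.
  by rewrite -natr1 lerD2r truncn_le mulr_ge0.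
- exact: cvg_cst.
- rewrite -[X in _ --> X]addr0; apply: cvgD; [exact: cvg_cst|exact: cvg_harmonic].
Unshelve. all: by end_near. Qed.

Lemma cvg_left_approx t : 0 < t -> left_approx n t @[n --> \oo] --> t.
Proof.
move=> t0; apply: (@squeeze_cvgr _ _ _ _ (fun n => t - (n.+1%:R^-1 + n.+1%:R^-1)) (fun=> t)).
- near=> n; apply/andP; split; last exact/ltW/left_approx_lt.
  rewrite /left_approx ler_pdivlMr ?ltr0n// mulrBl mulrDl mulVf ?pnatr_eq0//.
  rewrite lerBlDr; apply/ltW/(lt_le_trans (truncnS_gt _)).
  by rewrite -[1 + 1]/(2%:R) -natrD ler_nat addn2; case: Num.truncn.
- rewrite -[X in _ --> X]subr0 -[X in _ - X]addr0.
  by apply: cvgB; [exact: cvg_cst|apply: cvgD; exact: cvg_harmonic].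
- exact: cvg_cst.
Unshelve. all: by end_near. Qed.

(** The preimage splits according to the value of [idx]. With a time rounded to a grid this gives
    measurability of evaluations at random times. *)
Lemma measurable_nat_select dW dY (W : measurableType dW) (Y : measurableType dY)
    (D : set W) (idx : W -> nat) (h : nat -> W -> Y) :
  (forall k, measurable (D `&` [set w | idx w = k])) ->
  (forall k, measurable_fun D (h k)) ->
  measurable_fun D (fun w => h (idx w) w).
Proof.
move=> mi mh mD B mB.
have -> : D `&` (fun w => h (idx w) w) @^-1` B =
    \bigcup_k ((D `&` [set w | idx w = k]) `&` (D `&` h k @^-1` B)).
  apply/seteqP; split => [w [Dw Bw]|w [k _ [[Dw /= ->] [_ Bw]]]] //.
  by exists (idx w).
by apply: bigcupT_measurable => k; apply: measurableI; [exact: mi|exact: mh].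
Qed.

Lemma measurable_truncn_eq dW (W : measurableType dW) (f : W -> R) k :
  measurable_fun setT f -> measurable [set w | Num.truncn (f w) = k].
Proof.
(* [Num.truncn] sends every number below 1 to 0, negative ones included. *)
move=> mf; rewrite (_ : [set _ | _] = f @^-1`
    (if k is 0%N then `]-oo, 1[ else `[k%:R, k.+1%:R[)%classic).
  by rewrite -[X in measurable X]setTI; apply: mf => //; case: k => *; exact: measurable_itv.
apply/seteqP; split => w /=; case: k => [|k]; rewrite /= in_itv/=.
- by move=> h; have := truncnS_gt (f w); rewrite h.
- by move=> h; rewrite -truncn_gt_nat -truncn_le_nat h leqnn.
- by move=> h; apply/eqP; rewrite -leqn0 truncn_le_nat.
- by rewrite -truncn_gt_nat -truncn_le_nat => h; apply/eqP; rewrite eqn_leq andbC.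
Qed.

End dyadic.

End PartD.

(** * Gluing, stopping and extending paths *)

Module PartF.
Import PartA PartD.

Section paths.
Context (R : realType) (dim : nat).
Notation E := 'rV[R]_dim.
Notation D := (skorohod dim (+oo : \bar R)).

Lemma path_ext T (z w : skorohod dim T) : (forall t, z t = w t :> E) -> z = w.
Proof.
case: z w => [z cz fz] [w cw fw] /= /funext zw; subst w.
by congr Skorohod; exact: Prop_irrelevance.
Qed.

Lemma path_max0 (z : D) t : z (Num.max 0 t) = z t.
Proof. exact: (path_frozen z t). Qed.

Lemma near_at_left_eq_cvg (f g : R -> E) t :
  (\forall x \near t^'-, f x = g x) -> cvg (g x @[x --> t^'-]) -> cvg (f x @[x --> t^'-]).
Proof.
move=> fg /cvg_ex[l gl]; apply/cvg_ex; exists l; apply: cvg_trans gl.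
by apply: near_eq_cvg; near=> x; apply/esym; near: x.
Unshelve. all: by end_near. Qed.

Definition glue_fun (z : D) (s : R) (w : D) (t : R) : E :=
  if Num.max 0 t < s then z t else w (Num.max 0 t - s).

Lemma glue_cadlag z s w : cadlag (glue_fun z s w).
Proof.
pose h u := if u < s then z u else w (u - s).
have -> : glue_fun z s w = h \o clamp +oo%E.
  by apply/funext => t; rewrite /h /glue_fun /= path_max0.
apply: cadlag_comp; [exact: clamp_homo|exact: clamp_continuous|].
have cw : cadlag (fun u => w (u - s)).
  apply: (@cadlag_comp R dim w (fun u => u - s)); last exact: path_cadlag.
  - by move=> x y xy; rewrite lerD2r.
  - by move=> t; apply: (@cvgB _ R); [exact: cvg_id|exact: cvg_cst].
move=> t; have [tr tl] := path_cadlag z t; have [wr wl] := cw t.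
have [ts|ts|ts] := ltgtP t s; last subst t.
- split.
    rewrite {2}/h ts; apply: cvg_trans tr; apply: near_eq_cvg; near=> x.
    by rewrite /h ifT//; near: x; exact: nbhs_right_lt.
  apply: near_at_left_eq_cvg tl; near=> x.
  by rewrite /h ifT// (lt_trans _ ts)//; near: x; exact: nbhs_left_lt.
- split.
    rewrite {2}/h ifF; last by apply/negbTE; rewrite -leNgt ltW.
    apply: cvg_trans wr; apply: near_eq_cvg; near=> x.
    rewrite /h ifF//; apply/negbTE; rewrite -leNgt (le_trans (ltW ts))// ltW//.
  apply: near_at_left_eq_cvg wl; near=> x.
  rewrite /h ifF//; apply/negbTE; rewrite -leNgt ltW//.
- split.
    rewrite {2}/h ltxx; apply: cvg_trans wr; apply: near_eq_cvg; near=> x.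
    rewrite /h ifF//; apply/negbTE; rewrite -leNgt ltW//.
  apply: near_at_left_eq_cvg tl; near=> x.
  by rewrite /h ifT//; near: x; exact: nbhs_left_lt.
Unshelve. all: by end_near. Qed.

Lemma glue_frozen z s w t : glue_fun z s w (clamp +oo%E t) = glue_fun z s w t.
Proof. by rewrite /glue_fun /= max_r ?le_max ?lexx// path_max0. Qed.

(* The path that follows z before time s, and w (started afresh) from time s on. *)
Definition glue z s w : D := Skorohod (glue_cadlag z s w) (@glue_frozen z s w).

Definition stop (z : D) (s : R) : D.
Proof.
refine (@Skorohod R dim +oo%E (fun t => z (clamp s%:E t)) _ _).
- apply: (@cadlag_comp R dim z); [exact: clamp_homo|exact: clamp_continuous|exact: path_cadlag].
- by move=> t /=; rewrite (max_r (_ : 0 <= Num.max 0 t)) ?le_max ?lexx.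
Defined.

Definition extend (u : R) (y : skorohod dim (u%:E : \bar R)) : D.
Proof.
refine (@Skorohod R dim +oo%E y (path_cadlag y) _) => t.
rewrite -(path_frozen y) -[RHS](path_frozen y); congr (path_fun y _).
by rewrite /= (max_r (_ : 0 <= Num.max 0 t)) ?le_max ?lexx.
Defined.

Definition cst_path (v : E) : D := @Skorohod R dim +oo%E (fun=> v) (cadlag_cst v) (fun=> erefl).

(** The default for [t <= 0], here and in [prestop], makes both depend only on the path strictly
    before [t]: at time 0 nothing has been seen yet. *)
Definition left_val (z : D) t : E := if 0 < t then left_limit z t else 0.

Definition prestop (z : D) t : D := if 0 < t then glue z t (cst_path (left_limit z t)) else point.

Lemma glueE z s w t : glue z s w t = if Num.max 0 t < s then z t else w (Num.max 0 t - s).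
Proof. by []. Qed.

Lemma stopE z s t : stop z s t = z (Num.min (Num.max 0 t) s).
Proof. by []. Qed.

Lemma left_limit_near (f g : R -> E) t : (\forall x \near t^'-, f x = g x) ->
  left_limit f t = left_limit g t.
Proof.
move=> fg; rewrite /left_limit; congr (lim _); apply/seteqP; split; apply: near_eq_cvg => //.
by near=> x; apply/esym; near: x.
Unshelve. all: by end_near. Qed.

Lemma left_val_prestop z t : left_val (prestop z t) t = left_val z t.
Proof.
rewrite /left_val /prestop; case: (boolP (0 < t)) => // t0.
apply: left_limit_near; near=> x.
rewrite glueE ifT// gt_max t0/=; near: x; exact: nbhs_left_lt.
Unshelve. all: by end_near. Qed.

Lemma glue_prestop z t w : 0 < t -> glue (prestop z t) t w = glue z t w.
Proof.
by move=> t0; apply: path_ext => u; rewrite /prestop t0 !glueE; case: ifP => // ->.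
Qed.

Lemma prestop_cst z t : 0 < t -> prestop z t = glue z t (cst_path (left_val z t)).
Proof. by move=> t0; rewrite /prestop /left_val t0. Qed.

Lemma glue0 z w : glue z 0 w = w.
Proof.
by apply: path_ext => t; rewrite glueE ltNge le_max lexx/= subr0 path_max0.
Qed.

(** Splits a stopped path into its past up to [s] and the next [u] units of time, the two objects
    that [ps_evolution] relates. *)
Lemma stop_glue z s u : 0 <= s -> 0 <= u ->
  stop z (s + u) = glue (stop z s) s (stop (window s +oo%E z) u).
Proof.
move=> s0 u0; apply: path_ext => t; rewrite glueE !stopE.
have m0 : 0 <= Num.max 0 t by rewrite le_max lexx.
case: ltP => ts.
  by rewrite !min_l// ?ltW// (lt_le_trans ts)// lerDl.
rewrite /= (max_r (_ : 0 <= Num.max 0 t - s)) ?subr_ge0//.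
rewrite (max_r (_ : 0 <= Num.min (Num.max 0 t - s) u)) ?le_min ?u0 ?subr_ge0 ?ts//.
by congr (path_fun z _); rewrite addr_minr [s + (_ - s)]addrCA subrr addr0.
Qed.

(** The second restart acts on the fresh piece [w], at its own time [t - s]; this is where the
    Markov property of [w] can be applied. *)
Lemma glue_glue z s w t w' : 0 <= s -> s <= t ->
  glue (glue z s w) t w' = glue z s (glue w (t - s) w').
Proof.
move=> s0 st; apply: path_ext => u; rewrite !glueE.
have [us|us] := ltP (Num.max 0 u) s.
  by rewrite (lt_le_trans us).
rewrite (max_r (_ : 0 <= Num.max 0 u - s)) ?subr_ge0// ltrD2r.
case: ltP => // _; congr (path_fun w' _).
by rewrite opprB addrA subrK.
Qed.

Lemma glue_stop z s u w : u <= s -> glue (stop z s) u w = glue z u w.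
Proof.
move=> us; apply: path_ext => t; rewrite !glueE stopE; case: ltP => // tu.
by rewrite min_l ?path_max0// (le_trans (ltW tu)).
Qed.

Lemma glue_same z t w w' : glue (glue z t w) t w' = glue z t w'.
Proof. by apply: path_ext => u; rewrite !glueE; case: ltP. Qed.

Lemma prestop_glue z t w : 0 < t -> prestop (glue z t w) t = prestop z t.
Proof.
move=> t0; rewrite /prestop t0 glue_same; congr (glue _ _ (cst_path _)).
apply: left_limit_near; near=> x; rewrite glueE ifT// gt_max t0/=.
by near: x; exact: nbhs_left_lt.
Unshelve. all: by end_near. Qed.

End paths.

End PartF.

(** * Measurability of path operations at random times *)

Module PartH.
Import PartA PartD PartF.

Section measurable_paths.
Context (R : realType) (dim : nat).
Notation E := 'rV[R]_dim.
Notation D := (skorohod dim (+oo : \bar R)).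

Section maps.
Context dW (W : measurableType dW).

Lemma measurable_rV (f : W -> E) :
  (forall j, measurable_fun setT (fun w => f w ord0 j)) -> measurable_fun setT f.
Proof.
move=> mf; apply: (@measurability _ _ _ _ setT _
  (gen_family (fun (j : 'I_dim) (v : E) => v ord0 j))) => //.
by move=> _ [_ [j [B [mB ->]]] <-]; rewrite setTI -[X in measurable X]setTI; exact: mf.
Qed.

Lemma measurable_rV_coord j : measurable_fun setT (fun v : E => v ord0 j).
Proof. by move=> _ B mB; rewrite setTI; apply: sub_gen_smallest; exists j, B. Qed.

Lemma measurable_path T (f : W -> skorohod dim T) :
  (forall t, measurable_fun setT (fun w => f w t : E)) -> measurable_fun setT f.
Proof.
move=> mf; apply: (@measurability _ _ _ _ setT _
  (gen_family (fun (t : R) (w : skorohod dim T) => w t))) => //.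
by move=> _ [_ [t [B [mB ->]]] <-]; rewrite setTI -[X in measurable X]setTI; exact: mf.
Qed.

Lemma measurable_fun_ite dY (Y : measurableType dY) (A : set W) (f g : W -> Y) :
  measurable A -> (forall B, measurable B -> measurable (A `&` f @^-1` B)) ->
  (forall B, measurable B -> measurable (~` A `&` g @^-1` B)) ->
  measurable_fun setT (fun w => if w \in A then f w else g w).
Proof.
move=> mA mf mg _ B mB; rewrite setTI.
rewrite (_ : _ @^-1` _ = (A `&` f @^-1` B) `|` (~` A `&` g @^-1` B)).
  by apply: measurableU; [exact: mf|exact: mg].
apply/seteqP; split => w /=.
  by case: ifPn => [/set_mem|/negP]; [left|rewrite in_setE; right].
by move=> [[Aw Bw]|[nA Bw]]; [rewrite mem_set|rewrite memNset].
Qed.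

Lemma measurable_ltr (f g : W -> R) : measurable_fun setT f -> measurable_fun setT g ->
  measurable [set w | f w < g w].
Proof.
by move=> mf mg; rewrite -[X in measurable X]setTI; exact: measurable_fun_ltr.
Qed.

End maps.

Lemma cvg_coord (F : set_system R) (f : R -> E) (l : E) j : Filter F ->
  f x @[x --> F] --> l -> f x ord0 j @[x --> F] --> l ord0 j.
Proof.
move=> FF fl.
by apply: (@cvg_comp _ _ _ f (fun M : E => M ord0 j) _ _ _ fl); exact: coord_continuous.
Qed.

Lemma left_limit_coord (z : D) t j :
  z x ord0 j @[x --> t^'-] --> left_limit z t ord0 j.
Proof. by apply: cvg_coord; have [] := path_cadlag z t. Qed.

Section prestop.
Context dW (W : measurableType dW) (sigma : W -> R) (X : W -> D).
Hypothesis msigma : measurable_fun setT sigma.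
Hypothesis mX : forall s B, 0 <= s -> measurable B ->
  measurable [set w | s < sigma w /\ B (X w s)].

Let D0 : set W := [set w | 0 < sigma w].

Let mD0 : measurable D0. Proof. by apply: measurable_ltr => //; exact: measurable_cst. Qed.

Let approx t n w := X w (Num.min (Num.max 0 t) (left_approx n (sigma w))).

Let measurable_approx t n j : measurable_fun D0 (fun w => approx t n w ord0 j).
Proof.
pose r k := Num.min (Num.max 0 t) (k%:R / n.+1%:R) : R.
have r0 k : 0 <= r k by rewrite /r le_min le_max lexx/= divr_ge0.
pose idx w := (Num.truncn (sigma w * n.+1%:R)).-1.
(* A grid time is used only where it precedes [sigma], as [mX] demands; elsewhere the default 0
   keeps [h k] measurable. *)
pose h k w : R := if w \in [set w | r k < sigma w] then X w (r k) ord0 j else 0.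
apply: (@eq_measurable_fun _ _ _ _ D0 (fun w => h (idx w) w)).
  move=> w; rewrite inE => w0; rewrite /h /approx ifT//.
  rewrite inE /= /r gt_min; apply/orP; right; exact: left_approx_lt.
apply: measurable_nat_select => k.
  apply: measurableI => //.
  have mt i : measurable [set w | Num.truncn (sigma w * n.+1%:R) = i].
    by apply: measurable_truncn_eq; exact: measurable_funM.
  (* The predecessor in [left_approx] identifies the truncations 0 and 1. *)
  case: k => [|k].
    rewrite (_ : [set w | _] = [set w | Num.truncn (sigma w * n.+1%:R) = 0%N] `|`
        [set w | Num.truncn (sigma w * n.+1%:R) = 1%N]); first exact: measurableU.
    apply/seteqP; split => w /=; rewrite /idx; case: Num.truncn => [|[|m]] //= h0;
      by [left|right|case: h0].
  rewrite (_ : [set w | _] = [set w | Num.truncn (sigma w * n.+1%:R) = k.+2])//.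
  by apply/seteqP; split => w /=; rewrite /idx; case: Num.truncn => [|m]//=; [move=> ->|case].
apply: measurable_funTS; apply: measurable_fun_ite => [|B mB|B mB].
- by apply: measurable_ltr => //; exact: measurable_cst.
- rewrite (_ : _ `&` _ = [set w | r k < sigma w /\ [set v : E | B (v ord0 j)] (X w (r k))])//.
  apply: mX => //; rewrite -[X in measurable X]setTI; exact: measurable_rV_coord.
- apply: measurableI; last by rewrite -[X in measurable X]setTI; exact: measurable_cst.
  by apply: measurableC; apply: measurable_ltr => //; exact: measurable_cst.
Qed.

(** Measurability of [X] is assumed only for values at times [s] on the event [s < sigma]. This weak
    form matters: it holds for the sigma-algebra of [strict_history], which does not contain the
    later path. The prestopped path is a limit of values at grid times strictly below [sigma]. *)
Lemma measurable_prestop_hist : measurable_fun setT (fun w => prestop (X w) (sigma w)).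
Proof.
apply: measurable_path => t; apply: measurable_rV => j.
pose g w : R := if w \in D0 then prestop (X w) (sigma w) t ord0 j else 0.
have -> : (fun w => prestop (X w) (sigma w) t ord0 j) = g.
  apply/funext => w; rewrite /g; case: ifPn => //; rewrite notin_setE /D0 /= => /negP h.
  by rewrite /prestop (negbTE h) /= mxE.
apply: measurable_fun_ite => // [B mB|B mB]; last first.
  apply: measurableI; first exact: measurableC.
  by rewrite -[X in measurable X]setTI; exact: measurable_cst.
suff : measurable_fun D0 (fun w => prestop (X w) (sigma w) t ord0 j) by exact.
apply: (@measurable_fun_cvg _ _ _ _ (fun n w => approx t n w ord0 j)) => // w D0w.
rewrite /prestop D0w glueE /approx.
case: ltP => [ts|ts].
  apply: cvg_near_cst; near=> n; rewrite min_l ?path_max0//; apply: ltW.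
  near: n; apply: (cvgr_gt (sigma w)) => //; exact: cvg_left_approx.
(* From [sigma] on the prestopped path is the left limit, reached along [left_approx]. *)
have /cvg_at_leftP/(_ (fun n => left_approx n (sigma w))) h :=
  @left_limit_coord (X w) (sigma w) j.
apply: cvg_trans (h _).
  by apply: near_eq_cvg; near=> n; rewrite min_r// (le_trans _ ts)// ltW// left_approx_lt.
by split; [move=> n; exact: left_approx_lt|exact: cvg_left_approx].
Unshelve. all: by end_near. Qed.

End prestop.

Section maps2.
Context dW (W : measurableType dW).

(** Right continuity: evaluate at grid times above [t] and pass to the limit. *)
Lemma measurable_eval_at (z : W -> D) (t : W -> R) :
  measurable_fun setT z -> measurable_fun setT t ->
  measurable_fun setT (fun w => z w (t w) : E).
Proof.
move=> mz mt; apply: measurable_rV => j.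
have mt0 : measurable_fun setT (fun w => Num.max 0 (t w)).
  by apply: measurable_maxr => //; exact: measurable_cst.
apply: (@measurable_fun_cvg _ _ _ _
  (fun n w => z w (right_approx n (Num.max 0 (t w))) ord0 j)) => [n|w _].
  apply: (@measurable_nat_select _ _ _ _ setT
    (fun w => Num.truncn (Num.max 0 (t w) * n.+1%:R)) 
    (fun k w => z w (k.+1%:R / n.+1%:R) ord0 j)) => k.
    by rewrite setTI; apply: measurable_truncn_eq; exact: measurable_funM.
  apply: (measurableT_comp (f := fun v : E => v ord0 j)); first exact: measurable_rV_coord.
  by apply: (measurableT_comp (f := @eval R dim +oo%E _)).
rewrite -(path_max0 _ (t w)).
have /cvg_at_rightP : z w x ord0 j @[x --> (Num.max 0 (t w))^'+] -->
    z w (Num.max 0 (t w)) ord0 j.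
  by apply: cvg_coord; have [] := path_cadlag (z w) (Num.max 0 (t w)).
apply; split; first by move=> n; exact: right_approx_gt.
by apply: cvg_right_approx; rewrite le_max lexx.
Qed.

Lemma measurable_prestop (z : W -> D) (t : W -> R) :
  measurable_fun setT z -> measurable_fun setT t ->
  measurable_fun setT (fun w => prestop (z w) (t w)).
Proof.
move=> mz mt; apply: measurable_prestop_hist => // s B s0 mB.
rewrite (_ : [set w | _] = [set w | s < t w] `&` (fun w => z w s : E) @^-1` B)//.
apply: measurableI; first by apply: measurable_ltr => //; exact: measurable_cst.
rewrite -[X in measurable X]setTI; apply: measurable_eval_at => //; exact: measurable_cst.
Qed.

Lemma measurable_left_val (z : W -> D) (t : W -> R) :
  measurable_fun setT z -> measurable_fun setT t ->
  measurable_fun setT (fun w => left_val (z w) (t w)).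
Proof.
move=> mz mt.
have -> : (fun w => left_val (z w) (t w)) =
    (fun w => if w \in [set w | 0 < t w] then prestop (z w) (t w) (t w) else 0).
  apply/funext => w; rewrite /left_val /prestop.
  have [t0|t0] := boolP (0 < t w); last by rewrite memNset//; exact/negP.
  by rewrite mem_set// glueE max_r ?ltxx// ltW.
have m0 : measurable [set w | 0 < t w].
  by apply: measurable_ltr => //; exact: measurable_cst.
apply: measurable_fun_ite => // [B mB|B mB]; apply: measurableI => //.
- rewrite -[X in measurable X]setTI; apply: measurable_eval_at => //.
  exact: measurable_prestop.
- exact: measurableC.
- by rewrite -[X in measurable X]setTI; exact: measurable_cst.
Qed.

Lemma measurable_glue (z w : W -> D) (s : W -> R) :
  measurable_fun setT z -> measurable_fun setT s -> measurable_fun setT w ->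
  measurable_fun setT (fun x => glue (z x) (s x) (w x)).
Proof.
move=> mz ms mw; apply: measurable_path => t.
have -> : (fun x => glue (z x) (s x) (w x) t) = (fun x =>
    if x \in [set x | Num.max 0 t < s x] then z x t else w x (Num.max 0 t - s x)).
  by apply/funext => x; rewrite glueE; congr (if _ then _ else _); apply/idP/idP; rewrite inE.
have m0 : measurable [set w | Num.max 0 t < s w].
  by apply: measurable_ltr => //; exact: measurable_cst.
apply: measurable_fun_ite => // [B mB|B mB]; apply: measurableI => //.
- rewrite -[X in measurable X]setTI; apply: measurable_eval_at => //; exact: measurable_cst.
- exact: measurableC.
- rewrite -[X in measurable X]setTI; apply: measurable_eval_at => //.
  by apply: measurable_funB => //; exact: measurable_cst.
Qed.

Lemma measurable_stop (z : W -> D) (s : W -> R) :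
  measurable_fun setT z -> measurable_fun setT s ->
  measurable_fun setT (fun x => stop (z x) (s x)).
Proof.
move=> mz ms; apply: measurable_path => t; under eq_fun do rewrite stopE.
apply: measurable_eval_at => //; by apply: measurable_minr => //; exact: measurable_cst.
Qed.

Lemma measurable_shift (z : W -> D) (s : W -> R) :
  measurable_fun setT z -> measurable_fun setT s ->
  measurable_fun setT (fun x => window (s x) +oo%E (z x)).
Proof.
move=> mz ms; apply: measurable_path => t.
apply: (@measurable_eval_at z (fun w => s w + clamp +oo%E t)) => //.
by apply: measurable_funD => //; exact: measurable_cst.
Qed.

Lemma measurable_cst_path (f : W -> E) : measurable_fun setT f ->
  measurable_fun setT (fun x => cst_path (f x)).
Proof. by move=> mf; exact: measurable_path. Qed.

Lemma measurable_rVD (f g : W -> E) : measurable_fun setT f -> measurable_fun setT g ->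
  measurable_fun setT (fun x => f x + g x).
Proof.
move=> mf mg; apply: measurable_rV => j; under eq_fun do rewrite mxE.
by apply: measurable_funD; apply: (measurableT_comp (measurable_rV_coord j)).
Qed.

Lemma measurable_rVB (f g : W -> E) : measurable_fun setT f -> measurable_fun setT g ->
  measurable_fun setT (fun x => f x - g x).
Proof.
move=> mf mg; apply: measurable_rV => j; under eq_fun do rewrite !mxE.
by apply: measurable_funB; apply: (measurableT_comp (measurable_rV_coord j)).
Qed.

Lemma measurable_eq_rV (f g : W -> E) : measurable_fun setT f -> measurable_fun setT g ->
  measurable [set w | f w = g w].
Proof.
move=> mf mg.
rewrite (_ : [set w | _] = \bigcap_(j in [set: 'I_dim]) [set w | f w ord0 j = g w ord0 j]).
  apply: fin_bigcap_measurable => // j _.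
  rewrite (_ : [set w | _] = (fun w => f w ord0 j - g w ord0 j) @^-1` [set 0]).
    rewrite -[X in measurable X]setTI; apply: measurable_funB => //;
    exact: (measurableT_comp (measurable_rV_coord j)).
  by apply/seteqP; split => w /=; [move=> ->; rewrite subrr|move=> /eqP; rewrite subr_eq0 => /eqP].
apply/seteqP; split => w /=; first by move=> e j _ /=; rewrite e.
by move=> h; apply/rowP => j; exact: h.
Qed.

End maps2.

Lemma measurable_extend u : measurable_fun setT (@extend R dim u).
Proof.
apply: measurable_path => t; exact: (@measurable_eval R dim u%:E t).
Qed.

End measurable_paths.

End PartH.

(** * Countability of the jump times of a cadlag path *)

Module PartK.
Import PartA PartD PartF PartH.

Section jumps.
Context (R : realType).

(** Each point of [A] is followed by a gap free of [A], and a rational chosen in that gap determines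
    the point. *)
Lemma right_isolated_countable (A : set R) :
  (forall t, A t -> exists2 e, t < e & forall t', t < t' -> t' < e -> ~ A t') ->
  countable A.
Proof.
move=> hA.
have /choice[r hr] : forall t, exists r : rat, A t ->
    t < ratr r /\ forall t', t < t' -> t' <= ratr r -> ~ A t'.
  move=> t; have [At|nAt] := pselect (A t); last by exists 0%Q.
  have [e te he] := hA t At; have [q] := rat_in_itvoo te.
  rewrite in_itv/= => /andP[tq qe]; exists q => _; split => // t' tt' t'q.
  by apply: he => //; exact: le_lt_trans qe.
apply/countable_injP; exists (pickle \o r) => t t' /set_mem At /set_mem At' /= rE.
have {}rE : r t = r t' by apply: (pcan_inj pickleK).
have [h1 h2] := hr t At; have [h1' h2'] := hr t' At'.
have [tt'|tt'|//] := ltgtP t t'.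
  by case: (h2 t') => //; rewrite rE ltW.
by case: (h2' t) => //; rewrite -rE ltW.
Qed.

(** A rational [q] between left limit and value sorts the jumps. Right after a jump across [q] the
    path stays above [q], so its left limits are at least [q] and no further jump across [q] follows
    closely. *)
Lemma upward_jumps_countable (c l : R -> R) :
  (forall t, c x @[x --> t^'+] --> c t) -> (forall t, c x @[x --> t^'-] --> l t) ->
  countable [set t | l t < c t].
Proof.
move=> cr cl.
rewrite (_ : [set t | _] = \bigcup_(q in [set: rat]) [set t | l t < ratr q < c t]); last first.
  apply/seteqP; split => t /=; last by move=> [q _ /= /andP[]]; exact: lt_trans.
  by move=> /rat_in_itvoo[q]; rewrite in_itv/= => h; exists q.
apply: bigcup_countable; first exact: countableP.
move=> q _; apply: right_isolated_countable => t /= /andP[_ qc].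
have : \forall x \near t^'+, ratr q < c x by exact: (cvgr_gt _ (cr t)).
move=> /nbhs_right0P[e /= e0 he].
exists (t + e); first by rewrite ltrDl.
move=> t' tt' t'e /andP[+ _]; apply/negP; rewrite -leNgt.
apply: (cvgr_to_ge (cl t')); near=> x.
have tx : t < x by near: x; exact: nbhs_left_gt.
have xt' : x < t' by near: x; exact: nbhs_left_lt.
apply/ltW; have := he (x - t); rewrite /= [t + _]addrCA subrr addr0; apply.
  by rewrite sub0r normrN gtr0_norm ?subr_gt0// ltrBlDl (lt_trans xt').
by rewrite subr_gt0.
Unshelve. all: by end_near. Qed.

(** A jump of a vector path is an upward jump of some coordinate or of its opposite. *)
Lemma jumps_countable (dim : nat) (z : skorohod dim (+oo%E : \bar R)) :
  countable [set t | left_limit z t <> z t].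
Proof.
rewrite (_ : [set t | _] = \bigcup_(j in [set: 'I_dim * bool])
   (if j.2 then [set t | left_limit z t ord0 j.1 < z t ord0 j.1] else
    [set t | - left_limit z t ord0 j.1 < - z t ord0 j.1])); last first.
  apply/seteqP; split => t /=.
    move=> h; apply: contrapT => nh; apply: h; apply/rowP => j.
    apply/eqP; rewrite eq_le !leNgt; apply/andP; split; apply/negP => h; apply: nh.
      by exists (j, false) => //=; rewrite ltrN2.
    by exists (j, true).
  by move=> [[j []] _ /=] + e; rewrite e ltxx.
apply: bigcup_countable; first exact: countableP.
move=> [j []] _ /=.
  apply: upward_jumps_countable => t; last exact: left_limit_coord.
  by apply: cvg_coord; have [] := path_cadlag z t.
apply: (@upward_jumps_countable (fun t => - z t ord0 j) (fun t => - left_limit z t ord0 j)) => t;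
  apply: cvgN; last exact: left_limit_coord.
by apply: cvg_coord; have [] := path_cadlag z t.
Qed.

End jumps.

End PartK.

(** * Densities, and Tonelli for measures of total mass 1 *)

Module PartL.
Import PartA.

Section density.
Context (R : realType) d (T : measurableType d) (mu nu : {measure set T -> \bar R}).
Variable p : T -> R.
Hypotheses (p0 : forall x, 0 <= p x) (mp : measurable_fun setT p).
Hypothesis nuE : forall A, measurable A -> nu A = (\int[mu]_(x in A) (p x)%:E)%E.
Local Open Scope ereal_scope.
Import HBNNSimple.

Let mpE : measurable_fun setT (EFin \o p). Proof. exact/measurable_EFinP. Qed.

Let density_nnsfun (f : {nnsfun T >-> R}) :
  \int[nu]_x (f x)%:E = \int[mu]_x ((f x)%:E * (p x)%:E).
Proof.
have e1 r : measurable_fun setT (fun x => (r * \1_(f @^-1` [set r]) x)%:E).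
  by apply/measurable_EFinP; apply: measurable_funM.
have nn r x : 0 <= (r * \1_(f @^-1` [set r]) x)%:E by rewrite EFinM nnfun_muleindic_ge0.
transitivity (\sum_(r \in range f) \int[nu]_x (r * \1_(f @^-1` [set r]) x)%:E).
  under eq_integral do rewrite fimfunE -fsumEFin//.
  by rewrite ge0_integral_fsum.
transitivity (\sum_(r \in range f) \int[mu]_x ((r * \1_(f @^-1` [set r]) x)%:E * (p x)%:E)).
  apply: eq_fsbigr => r _; have [r0|r0] := leP 0%R r; last first.
    have h x : (r * \1_(f @^-1` [set r]) x = 0)%R.
      by rewrite preimage_nnfun0// indic0 mulr0.
    by rewrite !integral0_eq// => x _; rewrite h ?mul0e.
  rewrite (eq_integral (fun x => r%:E * (\1_(f @^-1` [set r]) x)%:E))//.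
  rewrite [RHS](eq_integral (fun x => r%:E * ((\1_(f @^-1` [set r]) x)%:E * (p x)%:E))); last first.
    by move=> x _; rewrite EFinM muleA.
  rewrite !ge0_integralZl//.
  - rewrite integral_indic// setIT nuE//; congr (_ * _).
    rewrite integral_mkcond; apply: eq_integral => x _.
    by rewrite patchE indicE; case: ifPn => _; rewrite ?mul1e ?mul0e.
  - by apply: emeasurable_funM => //; apply/measurable_EFinP.
  - by move=> x _; apply: mule_ge0; rewrite lee_fin.
  - exact/measurable_EFinP.
rewrite -ge0_integral_fsum//.
- apply: eq_integral => x _; rewrite -ge0_mule_fsuml; last by move=> r; exact: nn.
  by rewrite fsumEFin// -fimfunE.
- by move=> r; apply: emeasurable_funM.
- by move=> r x _; apply: mule_ge0; rewrite ?nn// lee_fin.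
Qed.

Lemma integral_density (f : T -> \bar R) : (forall x, 0 <= f x) ->
  measurable_fun setT f -> \int[nu]_x f x = \int[mu]_x (f x * (p x)%:E).
Proof.
move=> f0 mf; pose f_ := nnsfun_approx measurableT mf.
have cf x : (f_ n x)%:E @[n --> \oo] --> f x by exact: cvg_nnsfun_approx.
transitivity (\int[nu]_x (lim ((f_ n x)%:E @[n --> \oo]))).
  by apply: eq_integral => x _; apply/esym/cvg_lim.
rewrite monotone_convergence//; last 3 first.
- by move=> n; exact/measurable_EFinP.
- by move=> n x _; rewrite lee_fin.
- by move=> x _ a b ab; rewrite lee_fin; exact/lefP/nd_nnsfun_approx.
rewrite (_ : (fun _ => _) = (fun n => \int[mu]_x ((f_ n x)%:E * (p x)%:E))); last first.
  by apply/funext => n; exact: density_nnsfun.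
rewrite -monotone_convergence//; last 3 first.
- by move=> n; apply: emeasurable_funM => //; exact/measurable_EFinP.
- by move=> n x _; rewrite mule_ge0 ?lee_fin.
- move=> x _ a b ab; rewrite lee_wpmul2r ?lee_fin//.
  exact/lefP/nd_nnsfun_approx.
apply: eq_integral => x _; apply/cvg_lim => //.
by apply: cvgeMr => //; rewrite fin_numE.
Qed.

End density.

Section gaps.
Context (R : realType) (lam : R) (lam0 : 0 < lam).

Definition expm : probability (measurableTypeR R) R :=
  exponential_distribution_exponential_prob__canonical__probability_measure_Probability lam0.

Lemma integral_expm (f : R -> \bar R) : (forall x, (0 <= f x)%E) ->
  measurable_fun setT f ->
  (\int[expm]_x f x = \int[lebesgue_measure]_x (f x * (exponential_pdf lam x)%:E))%E.
Proof.
move=> f0 mf; apply: integral_density => //.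
- by move=> x; apply: exponential_pdf_ge0; exact: ltW.
- exact: measurable_exponential_pdf.
Qed.

End gaps.

Section tonelli.
Context (R : realType).
Local Open Scope ereal_scope.

(** Measures produced by kernels are known to be probabilities only through an equation on their
    total mass; packing them makes Tonelli applicable. *)
Lemma prob_pack d (X : measurableType d) (m : {measure set X -> \bar R}) :
  m setT = 1 -> exists P : probability X R, P = m :> {measure set X -> \bar R}.
Proof.
move=> m1; exists (mnormalize m (\d_(point : X))).
apply: eq_measure; rewrite /= /mnormalize (_ : m [set: X] = 1)// onee_eq0 /= invr1.
by apply/funext => A; rewrite mule1.
Qed.

Lemma prob_tonelli d d' (X : measurableType d) (Y : measurableType d')
    (m : {measure set X -> \bar R}) (m' : {measure set Y -> \bar R}) (F : X -> Y -> \bar R) :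
  m setT = 1 -> m' setT = 1 -> (forall x y, 0 <= F x y) ->
  measurable_fun setT (fun p : X * Y => F p.1 p.2) ->
  \int[m]_x \int[m']_y F x y = \int[m']_y \int[m]_x F x y.
Proof.
move=> /prob_pack[P <-] /prob_pack[P' <-] F0 mF.
exact: (@fubini_tonelli _ _ _ _ _ P P' (fun p => F p.1 p.2) mF (fun p => F0 p.1 p.2)).
Qed.

Lemma time_tonelli d (X : measurableType d) (m : {measure set X -> \bar R})
    (F : R -> X -> \bar R) (A : set R) : m setT = 1 -> measurable A ->
  (forall t x, 0 <= F t x) -> measurable_fun setT (fun p : R * X => F p.1 p.2) ->
  \int[lebesgue_measure]_(t in A) \int[m]_x F t x =
  \int[m]_x \int[lebesgue_measure]_(t in A) F t x.
Proof.
move=> /prob_pack[P <-] mA F0 mF.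
pose G (p : measurableTypeR R * X) := F p.1 p.2 * (\1_A p.1)%:E.
have mG : measurable_fun setT G.
  apply: emeasurable_funM => //; apply/measurable_EFinP.
  have m1 : measurable_fun [set: measurableTypeR R] (\1_A : R -> R) by exact: measurable_indic.
  exact: (measurableT_comp m1 measurable_fst).
transitivity (\int[lebesgue_measure]_t \int[P]_x G (t, x)).
  rewrite integral_mkcond; apply: eq_integral => t _; rewrite patchE /G /= indicE.
  case: ifPn => _; first by apply: eq_integral => x _; rewrite mule1.
  by rewrite integral0_eq// => x _; rewrite mule0.
rewrite fubini_tonelli//; last by move=> x; rewrite /G mule_ge0// lee_fin.
apply: eq_integral => x _; rewrite [RHS]integral_mkcond.
apply: eq_integral => t _; rewrite patchE /G /= indicE.
by case: ifPn => _; rewrite ?mule1 ?mule0.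
Qed.

(* Time integrals of a jointly measurable function are measurable. *)
Lemma measurable_time_integral d (X : measurableType d) (a : X -> R) (b : R)
    (F : R -> X -> \bar R) : measurable_fun setT a ->
  (forall t x, 0 <= F t x) -> measurable_fun setT (fun p : R * X => F p.1 p.2) ->
  measurable_fun setT (fun x => \int[lebesgue_measure]_(t in `]a x, b]) F t x).
Proof.
move=> ma F0 mF.
pose A : set (X * measurableTypeR R) := [set p | a p.1 < p.2 <= b]%R.
have mA : measurable A.
  have m1 : measurable_fun [set: X * measurableTypeR R] (fun p => a p.1 : R).
    exact: (measurableT_comp ma measurable_fst).
  have m2 : measurable_fun [set: X * measurableTypeR R] (fun p => p.2 : R) by exact: measurable_snd.
  have m3 : measurable_fun [set: X * measurableTypeR R] (fun p => b) by exact: measurable_cst.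
  rewrite (_ : A = [set p | a p.1 < p.2]%R `&` [set p | p.2 <= b]%R); last first.
    by apply/seteqP; split => p /=; [move=> /andP|move=> [? ?]; apply/andP].
  apply: measurableI; rewrite -[X in measurable X]setTI.
    exact: (measurable_fun_ltr m1 m2).
  exact: (measurable_fun_ler m2 m3).
pose G (p : X * measurableTypeR R) := F p.2 p.1 * (\1_A p)%:E.
have mG : measurable_fun setT G.
  apply: emeasurable_funM; last by apply/measurable_EFinP; exact: measurable_indic.
  have msw : measurable_fun [set: X * measurableTypeR R] (fun p => (p.2, p.1) : R * X).
    by apply: measurable_fun_pair; [exact: measurable_snd|exact: measurable_fst].
  exact: (measurableT_comp mF msw).
have G0 p : 0 <= G p by rewrite mule_ge0// lee_fin.
have := @measurable_fun_fubini_tonelli_F _ _ X (measurableTypeR R) R lebesgue_measure G mG G0.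
apply: eq_measurable_fun => x _; rewrite /fubini_F.
rewrite [RHS]integral_mkcond; apply: eq_integral => t _.
rewrite patchE /G indicE /=; rewrite (_ : (t \in `]a x, b]%classic) = ((x, t) \in A)).
  by case: ifPn => _; rewrite ?mule1 ?mule0.
by apply/idP/idP; rewrite !inE /A /= ?in_itv.
Qed.

End tonelli.

End PartL.

(** * Ordered lists of interactions and the operators along them *)

Module PartM.
Import PartA PartB PartL.

Lemma measurable_fun2 dA dB dY dW (A : measurableType dA) (B : measurableType dB)
    (Y : measurableType dY) (W : measurableType dW) (F : A -> B -> Y) (a : W -> A) (b : W -> B) :
  measurable_fun setT (fun p : A * B => F p.1 p.2) ->
  measurable_fun setT a -> measurable_fun setT b ->
  measurable_fun setT (fun w => F (a w) (b w)).
Proof.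
move=> mF ma mb; have mab : measurable_fun setT (fun w => (a w, b w)) by exact: measurable_fun_pair.
exact: (measurableT_comp mF mab).
Qed.

Section clocks.
Context (R : realType) (lam : R) (lam0 : 0 < lam) (Q : finType) (T : R).
Notation gapsp := (prodspace (Q * nat)%type R).

(** Rings are counted from 1, with [tm g q 0 = 0]; for the gaps of the system, [tau q n] is
    therefore [tm g q n.+1]. *)
Definition tm (g : gapsp) (q : Q) (n : nat) : R := \sum_(0 <= m < n) g (q, m).

Lemma tm0 g q : tm g q 0 = 0. Proof. by rewrite /tm big_geq. Qed.

Lemma tmS g q n : tm g q n.+1 = tm g q n + g (q, n).
Proof. by rewrite /tm big_nat_recr. Qed.

Lemma tm_upd g q n q' n' r : (q == q') && (n' < n)%N = false ->
  tm (upd g (q', n') r) q n = tm g q n.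
Proof.
move=> h; rewrite /tm; apply: eq_big_nat => m /andP[_ mn]; rewrite upd_neq//.
by apply: contraFneq h => -[-> <-]; rewrite eqxx.
Qed.

Definition last_time (g : gapsp) (l : seq Q) : R :=
  if l is p :: l' then tm g p (count_mem p l').+1 else 0.

(* Event lists are most recent first: the interactions of l occur in this order in [0, T]. *)
Fixpoint in_order (g : gapsp) (l : seq Q) : bool :=
  if l is p :: l' then in_order g l' && (last_time g l' < last_time g l <= T) else true.

(** The rings of a clock are consumed in order, so every ring used by [l] is at or before its last
    event. *)
Lemma tm_le_last_time g l p : in_order g l -> tm g p (count_mem p l) <= last_time g l.
Proof.
elim: l => [_|q l ih] /=; first by rewrite tm0.
move=> /andP[/ih tl /andP[lq _]]; case: eqVneq => [->|qp]; first by rewrite add1n.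
by rewrite add0n (le_trans tl)// ltW.
Qed.

Lemma last_time_leT g l : 0 <= T -> in_order g l -> last_time g l <= T.
Proof. by case: l => [|q l] //= T0 /andP[_ /andP[]]. Qed.

Lemma last_time_ge0 g l : in_order g l -> 0 <= last_time g l.
Proof. by elim: l => //= q l ih /andP[/ih h /andP[/ltW + _]]; apply: le_trans. Qed.

(** Gaps of [p] beyond the first [count_mem p l] do not enter the event times of [l], hence the next
    one can be drawn again freely. *)
Lemma last_time_upd g l p k r : (count_mem p l <= k)%N ->
  last_time (upd g (p, k) r) l = last_time g l.
Proof.
case: l => [|q l] //= h; rewrite tm_upd//; case: (eqVneq q p) h => //= ->.
by rewrite add1n ltnS => /leq_ltn_trans/(_ (ltnSn _)); rewrite ltnS leqNgt => h; apply/negbTE.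
Qed.

Lemma in_order_upd g l p k r : (count_mem p l <= k)%N ->
  in_order (upd g (p, k) r) l = in_order g l.
Proof.
elim: l => [|q l ih] // h.
have h' : (count_mem p l <= k)%N by rewrite (leq_trans _ h)//= leq_addl.
by rewrite /= ih// -!/(last_time _ (q :: l)) !last_time_upd.
Qed.

Lemma measurable_tm dW (W : measurableType dW) (g : W -> gapsp) q n :
  measurable_fun setT g -> measurable_fun setT (fun w => tm (g w) q n).
Proof.
move=> mg; elim: n => [|n ih]; first by under eq_fun do rewrite tm0; exact: measurable_cst.
under eq_fun do rewrite tmS; apply: measurable_funD => //.
exact: (measurableT_comp (@measurable_coord _ _ _ _) mg).
Qed.

Lemma measurable_last_time dW (W : measurableType dW) (g : W -> gapsp) l :
  measurable_fun setT g -> measurable_fun setT (fun w => last_time (g w) l).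
Proof. by case: l => [|q l] mg; [exact: measurable_cst|exact: measurable_tm]. Qed.

Lemma measurable_in_order dW (W : measurableType dW) (g : W -> gapsp) l :
  measurable_fun setT g -> measurable_fun setT (fun w => in_order (g w) l).
Proof.
move=> mg; elim: l => [|q l ih]; first exact: measurable_cst.
apply: measurable_and => //; apply: measurable_and.
  by apply: measurable_fun_ltr; [exact: measurable_last_time|exact: measurable_tm].
by apply: measurable_fun_ler; [exact: measurable_tm|exact: measurable_cst].
Qed.

Local Open Scope ereal_scope.

Section chain.
Context dZ (Z : measurableType dZ) (J : Q -> R.-pker (R * Z)%type ~> Z) (nu : probability Z R).

Definition jop (p : Q) (t : R) (F : Z -> \bar R) (z : Z) : \bar R := \int[J p (t, z)]_y F y.

(** Functions are pulled back in time: the operator of the most recent interaction acts on [F]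
    first, that of the oldest is outermost. *)
Fixpoint chain (g : gapsp) (l : seq Q) (F : Z -> \bar R) : Z -> \bar R :=
  if l is p :: l' then chain g l' (jop p (last_time g l) F) else F.

Lemma jop_ge0 p t F z : (forall z, 0 <= F z) -> 0 <= jop p t F z.
Proof. by move=> F0; exact: integral_ge0. Qed.

Lemma chain_ge0 g l F z : (forall z, 0 <= F z) -> 0 <= chain g l F z.
Proof. by elim: l F => [|p l ih] F F0 //=; apply: ih => y; exact: jop_ge0. Qed.

Lemma measurable_jop dW (W : measurableType dW) p (t : W -> R) (F : W -> Z -> \bar R) (z : W -> Z) :
  (forall w z, 0 <= F w z) -> measurable_fun setT t -> measurable_fun setT z ->
  measurable_fun setT (fun x : W * Z => F x.1 x.2) ->
  measurable_fun setT (fun w => jop p (t w) (F w) (z w)).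
Proof.
move=> F0 mt mz mF.
have mtz : measurable_fun setT (fun w => (t w, z w)) by exact: measurable_fun_pair.
exact: (@measurable_integral_pker R _ _ _ _ (kcomap (J p) mtz) (fun x => F x.1 x.2)).
Qed.

Lemma measurable_jop_pair dW (W : measurableType dW) p (t : W -> R) (F : W -> Z -> \bar R) :
  (forall w z, 0 <= F w z) -> measurable_fun setT t ->
  measurable_fun setT (fun x : W * Z => F x.1 x.2) ->
  measurable_fun setT (fun x : W * Z => jop p (t x.1) (F x.1) x.2).
Proof.
move=> F0 mt mF; apply: (@measurable_jop _ (W * Z)%type p (t \o fst) (F \o fst) snd) => //.
- by move=> w z; exact: F0.
- exact: (measurableT_comp mt measurable_fst).
- apply: (measurable_fun2 (F := F)) => //.
  exact: (measurableT_comp measurable_fst measurable_fst).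
Qed.

Lemma measurable_chain dW (W : measurableType dW) (g : W -> gapsp) l (F : W -> Z -> \bar R) :
  (forall w z, 0 <= F w z) -> measurable_fun setT g ->
  measurable_fun setT (fun x : W * Z => F x.1 x.2) ->
  measurable_fun setT (fun x : W * Z => chain (g x.1) l (F x.1) x.2).
Proof.
move=> F0 mg; elim: l F F0 => [|p l ih] F F0 mF //=.
apply: (ih (fun w => jop p (last_time (g w) (p :: l)) (F w))).
  by move=> w z; exact: jop_ge0.
apply: (@measurable_jop_pair _ W p (fun w => last_time (g w) (p :: l)) F) => //.
exact: measurable_last_time.
Qed.

Lemma jop_time_integral p t (F : R -> Z -> \bar R) (A : set R) z : measurable A ->
  (forall s z, 0 <= F s z) -> measurable_fun setT (fun x : R * Z => F x.1 x.2) ->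
  jop p t (fun z => \int[lebesgue_measure]_(s in A) F s z) z =
  \int[lebesgue_measure]_(s in A) jop p t (F s) z.
Proof. by move=> mA F0 mF; rewrite /jop time_tonelli//; exact: prob_kernel. Qed.

(** The time of a further, more recent event is integrated innermost; Tonelli carries this integral
    out through all earlier operators. *)
Lemma chain_time_integral g l (F : R -> Z -> \bar R) (A : set R) z : measurable A ->
  (forall s z, 0 <= F s z) -> measurable_fun setT (fun x : R * Z => F x.1 x.2) ->
  chain g l (fun z => \int[lebesgue_measure]_(s in A) F s z) z =
  \int[lebesgue_measure]_(s in A) chain g l (F s) z.
Proof.
move=> mA; elim: l F z => [//|p l ih] F z F0 mF.
rewrite [LHS]/= -ih.
- congr (chain g l _ z); apply/funext => y; exact: jop_time_integral.
- by move=> s y; exact: jop_ge0.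
- exact: (@measurable_jop_pair _ R p (fun=> last_time g (p :: l)) F).
Qed.

(** One Duhamel step, over the time of the next interaction after [s]. It carries no exponential
    weight: the probabilities of silence are collected into one constant in [chain_law]. *)
Definition bop (p : Q) (F : R -> Z -> \bar R) (s : R) (z : Z) : \bar R :=
  \int[lebesgue_measure]_(r in `]s, T]) jop p r (F r) z.

Fixpoint biter (l : seq Q) (F : R -> Z -> \bar R) : R -> Z -> \bar R :=
  if l is p :: l' then biter l' (bop p F) else F.

Lemma bop_ge0 p F s z : (forall s z, 0 <= F s z) -> 0 <= bop p F s z.
Proof. by move=> F0; apply: integral_ge0 => r _; exact: jop_ge0. Qed.

Lemma biter_ge0 l F s z : (forall s z, 0 <= F s z) -> 0 <= biter l F s z.
Proof. by elim: l F => [|p l ih] F F0 //=; apply: ih => ? ?; exact: bop_ge0. Qed.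

Lemma measurable_bop p F : (forall s z, 0 <= F s z) ->
  measurable_fun setT (fun x : R * Z => F x.1 x.2) ->
  measurable_fun setT (fun x : R * Z => bop p F x.1 x.2).
Proof.
move=> F0 mF.
apply: (@measurable_time_integral _ _ (R * Z)%type fst T (fun r x => jop p r (F r) x.2)) => //.
  by move=> t x; exact: jop_ge0.
apply: (@measurable_jop _ (R * (R * Z))%type p fst (fun x => F x.1) (fun x => x.2.2)) => //.
- exact: (measurableT_comp measurable_snd measurable_snd).
- apply: (measurable_fun2 (F := F)) => //.
  exact: (measurableT_comp measurable_fst measurable_fst).
Qed.

Lemma measurable_biter l F : (forall s z, 0 <= F s z) ->
  measurable_fun setT (fun x : R * Z => F x.1 x.2) ->
  measurable_fun setT (fun x : R * Z => biter l F x.1 x.2).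
Proof.
elim: l F => [|p l ih] F F0 mF //=; apply: ih => [s z|]; first exact: bop_ge0.
exact: measurable_bop.
Qed.

End chain.
End clocks.

End PartM.

(** * Exponential waiting times *)

Module PartO.
Import PartA PartB PartL PartM.

Section exponential.
Context (R : realType) (lam : R) (lam0 : 0 < lam).
Local Open Scope ereal_scope.

Lemma lebesgue_measure_translate (a : R) (A : set R) : measurable A ->
  pushforward lebesgue_measure ((fun x => x + a)%R : _ -> measurableTypeR R) A =
  lebesgue_measure A.
Proof.
have mt : measurable_fun setT ((fun x => x + a)%R : measurableTypeR R -> measurableTypeR R).
  by apply: measurable_funD => //; exact: measurable_cst.
move=> mA; apply/esym/lebesgue_measure_unique => //= _ [[x y]] _ <-.
rewrite /pushforward.
rewrite (_ : _ @^-1` _ = `](x - a)%R, (y - a)%R]%classic); last first.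
  by apply/seteqP; split => r /=; rewrite !in_itv/= ltrBlDr lerBrDr.
by rewrite !lebesgue_measure_itv/= !lte_fin ltrD2r -!EFinB opprB addrA subrK.
Qed.

Lemma integral_translate (a : R) (f : R -> \bar R) : (forall x, 0 <= f x) ->
  measurable_fun setT f ->
  \int[lebesgue_measure]_x f (x + a)%R = \int[lebesgue_measure]_x f x.
Proof.
move=> f0 mf.
have mt : measurable_fun setT ((fun x => x + a)%R : measurableTypeR R -> measurableTypeR R).
  by apply: measurable_funD => //; exact: measurable_cst.
rewrite -[LHS](@ge0_integral_pushforward _ _ _ _ R _ mt lebesgue_measure setT f)//.
by apply: eq_measure_integral => A mA _; exact: lebesgue_measure_translate.
Qed.

Lemma expm_neg : expm lam0 `]-oo, 0%R[%classic = 0.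
Proof.
rewrite /= /exponential_prob integral0_eq// => x; rewrite /= in_itv/= => x0.
by rewrite lt0_exponential_pdf.
Qed.

Lemma expm_tail (c : R) : (0 <= c)%R ->
  expm lam0 `]c, +oo[%classic = (expR (- lam * c))%:E.
Proof.
move=> c0.
have e1 : expm lam0 `[0%R, c]%classic = 1 - (expR (- lam * c))%:E.
  move: c0; rewrite le_eqVlt => /orP[/eqP <-|c0]; last exact: exponential_prob_itv0c.
  rewrite mulr0 expR0 subee// set_itv1 /= /exponential_prob.
  by rewrite integral_set1.
have fin : expm lam0 `]c, +oo[%classic \is a fin_num by exact: fin_num_measure.
have : expm lam0 `]c, +oo[%classic + (1 - (expR (- lam * c))%:E) = 1.
  transitivity (expm lam0 setT); last exact: probability_setT.
  rewrite -(setUv `]c, +oo[%classic) measureU//; last 2 first.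
  - exact: measurableC.
  - by rewrite setICr.
  rewrite setCitvr.
  have -> : `]-oo, c]%classic = `]-oo, 0%R[%classic `|` `[0%R, c]%classic :> set (measurableTypeR R).
    by rewrite -itv_bndbnd_setU// ?bnd_simp.
  rewrite measureU//; last first.
    apply/seteqP; split => // x [] /=; rewrite !in_itv/= => x0 /andP[].
    by rewrite leNgt x0.
  by rewrite [X in _ = _ + (X + _)]expm_neg add0e [X in _ = _ + X]e1.
move: fin; case: (expm lam0 `]c, +oo[%classic) => // r _; rewrite -EFinB -EFinD => -[h].
by congr EFin; apply: (addIr (1 - expR (- lam * c))%R); rewrite h addrCA subrr addr0.
Qed.

(* The next time of a clock that last rang at a, weighted by the probability that
   the clock then stays silent until T. *)
Lemma expm_next (a L T : R) (c : R -> \bar R) : (a <= L)%R ->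
  (forall s, 0 <= c s) -> measurable_fun setT c ->
  \int[expm lam0]_r (((L < a + r <= T)%R%:R * expR (- lam * (T - (a + r))))%:E * c (a + r)%R) =
  (lam * expR (- lam * (T - a)))%:E * \int[lebesgue_measure]_(s in `]L, T]) c s.
Proof.
move=> aL c0 mc.
pose h s := (((L < s <= T)%R%:R * expR (- lam * (T - s)) * exponential_pdf lam (s - a))%:E * c s).
have mh1 (b : R) : measurable_fun [set: R] (fun s : R => (L < b + s <= T)%R%:R : R).
  have mb : measurable_fun [set: R] (fun s : R => b + s)%R by apply: measurable_funD => //; exact: measurable_cst.
  apply: (measurableT_comp (f := fun x : bool => x%:R : R)) => //.
  apply: measurable_and; first exact: measurable_fun_ltr.
  exact: measurable_fun_ler.
have me (b : R) : measurable_fun [set: R] (fun s : R => expR (- lam * (T - (b + s))))%R.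
  apply: measurableT_comp => //; apply: measurable_funM => //; apply: measurable_funB => //.
  by apply: measurable_funD => //; exact: measurable_cst.
have mca : measurable_fun [set: R] (fun s => c (a + s)%R).
  apply: (measurableT_comp mc); by apply: measurable_funD => //; exact: measurable_cst.
rewrite integral_expm//; last 2 first.
- by move=> r; rewrite mule_ge0// lee_fin mulr_ge0// expR_ge0.
- apply: emeasurable_funM => //; apply/measurable_EFinP; exact: measurable_funM.
transitivity (\int[lebesgue_measure]_r h (r + a)%R).
  apply: eq_integral => r _; rewrite /h addrK [(r + a)%R]addrC muleAC -EFinM.
  by congr (_ * _).
rewrite integral_translate//; last 2 first.
- move=> r; rewrite /h mule_ge0// lee_fin mulr_ge0// ?mulr_ge0 ?expR_ge0//.
  by apply: exponential_pdf_ge0; exact: ltW.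
- apply: emeasurable_funM => //; apply/measurable_EFinP.
  apply: measurable_funM.
    apply: measurable_funM.
      by have := mh1 0%R; apply: eq_measurable_fun => s _; rewrite add0r.
    by have := me 0%R; apply: eq_measurable_fun => s _; rewrite add0r.
  apply: measurableT_comp; first exact: measurable_exponential_pdf.
  by apply: measurable_funB => //; exact: measurable_cst.
rewrite -ge0_integralZl//; last 2 first.
- exact: measurable_funTS.
- by rewrite lee_fin mulr_ge0// ?expR_ge0// ltW.
rewrite [RHS]integral_mkcond; apply: eq_integral => s _; rewrite patchE /h.
have -> : (s \in `]L, T]%classic) = (L < s <= T)%R by apply/idP/idP; rewrite inE/= in_itv.
case: ifPn => [/andP[Ls sT]|_]; last by rewrite mul0r mul0r mul0e.
(* The survival factor from [s] to [T] and the density from [a] to [s] multiply to a factor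
   independent of [s]; this is why no weight remains inside the time integrals. *)
congr (_%:E * _); rewrite mul1r exponential_pdfE ?subr_ge0 ?(le_trans aL (ltW Ls))//.
by rewrite mulrCA -expRD -mulrDr addrA subrK.
Qed.

End exponential.

End PartO.

(** * Law of the ordered interaction times *)

Module PartS.
Import PartA PartB PartL PartM PartO.

Section clock_law.
Context (R : realType) (lam : R) (lam0 : 0 < lam) (Q : finType) (T : R) (T0 : 0 <= T).
Notation gapsp := (prodspace (Q * nat)%type R).
Context dO (Omega : measurableType dO) (P : probability Omega R) (g : Omega -> gapsp).
Hypothesis mg : measurable_fun setT g.
Hypothesis indep : forall (s : seq (Q * nat)) (B : Q * nat -> set R), uniq s ->
  (forall x, measurable (B x)) ->
  P (\bigcap_(x in [set` s]) (fun w => g w x) @^-1` B x) =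
  (\prod_(x <- s) expm lam0 (B x))%E.
Local Open Scope ereal_scope.

(** The gap [x] is exponential and independent of the others, so drawing it again does not change
    the law of all gaps. Both laws are compared on cylinders, where the factor of [x] is split off
    from the product. *)
Lemma resample_gap x (F : gapsp -> \bar R) : (forall y, 0 <= F y) -> measurable_fun setT F ->
  \int[P]_w F (g w) = \int[P]_w \int[expm lam0]_r F (upd (g w) x r).
Proof.
move=> F0 mF.
have mu : measurable_fun setT (fun p : Omega * measurableTypeR R => upd (g p.1) x p.2).
  apply: measurable_upd; last exact: measurable_snd.
  exact: (measurableT_comp mg measurable_fst).
have mc : measurable_fun [set: Omega] (fun=> tt) by exact: measurable_cst.
pose ke : R.-pker Omega ~> (measurableTypeR R) :=
  kprobability (measurable_cst (expm lam0 : pprobability _ _) : measurable_fun [set: Omega] _).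
pose k : R.-pker Omega ~> gapsp := kbind ke (@kdirac _ _ _ _ R _ mu).
have kE w f : (forall y, 0 <= f y) -> measurable_fun setT f ->
    \int[k w]_y f y = \int[expm lam0]_r f (upd (g w) x r).
  by move=> f0 mf; rewrite integral_kbind//; apply: eq_integral => r _; rewrite integral_kdirac.
under [RHS]eq_integral do rewrite -kE//.
rewrite -integral_mbind//.
rewrite -[LHS](@ge0_integral_pushforward _ _ _ _ R _ mg P setT F)//.
apply: eq_measure_integral => A mA _.
apply: (@measure_unique _ R _ (cylinders (fun i (z : gapsp) => z i)) (fun=> setT)) => //.
- exact: generated_cylinders.
- exact: setI_cylinders.
- by move=> _; exact: cylindersT.
- by rewrite bigcup_const//; exists 0%N.
- move=> C [s [B [us [mB CE]]]].
  pose s' := [seq i <- s | i != x].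
  pose C' := [set z : gapsp | forall i, i \in s' -> B i (z i)].
  (* If the cylinder does not constrain [x], its factor is the total mass 1. *)
  pose Bx := if x \in s then B x else setT.
  have mBx : measurable Bx by rewrite /Bx; case: ifP => // _; exact: mB.
  have mcyl (t : seq (Q * nat)) : uniq t ->
      measurable [set z : gapsp | forall i, i \in t -> B i (z i)].
    move=> ut; suff : <<s prod_gen (X := R) >> [set z : gapsp | forall i, i \in t -> B i (z i)] by [].
    by rewrite /prod_gen generated_cylinders; apply: sub_gen_smallest; exists t, B.
  have Pcyl (t : seq (Q * nat)) : uniq t ->
      P (g @^-1` [set z | forall i, i \in t -> B i (z i)]) = \prod_(i <- t) expm lam0 (B i).
    by move=> ut; rewrite -indep//; congr (P _); apply/seteqP; split => w /= h i /h.
  have mC : measurable C by rewrite CE; exact: mcyl.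
  have us' : uniq s' by exact: filter_uniq.
  have kC w : k w C = (\1_C' (g w))%:E * expm lam0 Bx.
    transitivity (\int[k w]_y (\1_C y)%:E); first by rewrite integral_indic// setIT.
    rewrite kE//; last by apply/measurable_EFinP; exact: measurable_indic.
    transitivity (\int[expm lam0]_r ((\1_C' (g w))%:E * (\1_Bx r)%:E)).
      apply: eq_integral => r _; rewrite -EFinM !indicE -natrM mulnb; congr (_%:R%:E); congr nat_of_bool.
      rewrite CE; apply/idP/andP => [/set_mem /= h|[/set_mem h1 /set_mem h2]].
        split; apply/mem_set.
          by move=> i; rewrite mem_filter => /andP[ix /h]; rewrite upd_neq.
        by rewrite /Bx; case: ifPn => // /h; rewrite updE.
      apply/mem_set => /= i is_; case: (eqVneq i x) => [ix|ix].
        by rewrite ix updE; move: h2; rewrite /Bx -ix is_.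
      by rewrite upd_neq//; apply: h1; rewrite mem_filter ix.
    rewrite ge0_integralZl//; first by rewrite integral_indic// setIT.
    by apply/measurable_EFinP; exact: measurable_indic.
  rewrite mbindE; under eq_integral do rewrite kC.
  rewrite ge0_integralZr//; last first.
    apply/measurable_EFinP; apply: (measurableT_comp _ mg); apply: measurable_indic; exact: mcyl.
  rewrite (_ : (fun w => (\1_C' (g w))%:E) = (fun w => (\1_(g @^-1` C') w)%:E))//.
  rewrite integral_indic ?setIT//; last by rewrite -[X in measurable X]setTI; apply: mg => //; exact: mcyl.
  transitivity (\prod_(i <- s) expm lam0 (B i)); first by rewrite /= /pushforward CE; exact: Pcyl.
  transitivity ((\prod_(i <- s') expm lam0 (B i)) * expm lam0 Bx); last first.
    by congr (_ * _); exact/esym/Pcyl.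
  rewrite /Bx; case: ifPn => xs.
    by rewrite (bigD1_seq x)//= muleC /s' big_filter.
  rewrite probability_setT mule1 /s' (_ : [seq _ <- _ | _] = s)//.
  by apply/all_filterP/allP => i is_; apply: contraNneq xs => <-.
- by move=> _; rewrite /= /pushforward preimage_setT probability_setT ltry.
Qed.

(** Clocks are treated one at a time. The gap after ring [cnt q] occurs only in the indicator of
    [q], so drawing it again replaces this indicator by an exponential tail. That [H] vanishes
    unless ring [cnt q] is at most [T] keeps the argument of the tail nonnegative. *)
Lemma survival (cnt : Q -> nat) (s : seq Q) (H : gapsp -> \bar R) : uniq s ->
  (forall y, 0 <= H y) -> measurable_fun setT H ->
  (forall q y r, H (upd y (q, cnt q) r) = H y) ->
  (forall q y, H y != 0 -> (tm y q (cnt q) <= T)%R) ->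
  \int[P]_w (H (g w) * \prod_(q <- s) (T < tm (g w) q (cnt q).+1)%R%:R%:E) =
  \int[P]_w (H (g w) * \prod_(q <- s) (expR (- lam * (T - tm (g w) q (cnt q))))%:E).
Proof.
move=> + + + + HT; elim: s H HT => [|q s ih] H HT us H0 mH Hu.
  by under eq_integral do rewrite big_nil; under [RHS]eq_integral do rewrite big_nil.
move: us => /= /andP[qs us].
pose ind (t : seq Q) y : \bar R := \prod_(q <- t) (T < tm y q (cnt q).+1)%R%:R%:E.
pose ex q y : \bar R := (expR (- lam * (T - tm y q (cnt q))))%:E.
have ind0 t y : 0 <= ind t y.
  by rewrite /ind; elim: t => [|a t iht]; rewrite ?big_nil// big_cons mule_ge0.
have mtm q' n : measurable_fun setT (fun y : gapsp => tm y q' n).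
  exact: (measurable_tm q' n (@measurable_id _ gapsp setT)).
have mind t : measurable_fun setT (ind t).
  rewrite /ind; elim: t => [|a t iht].
    by under eq_fun do rewrite big_nil; exact: measurable_cst.
  under eq_fun do rewrite big_cons; apply: emeasurable_funM => //; apply/measurable_EFinP.
  apply: (measurableT_comp (f := fun x : bool => x%:R : R)) => //.
  by apply: measurable_fun_ltr => //; exact: measurable_cst.
have mex q' : measurable_fun setT (ex q').
  apply/measurable_EFinP; apply: measurableT_comp => //; apply: measurable_funM => //.
  by apply: measurable_funB => //; exact: measurable_cst.
transitivity (\int[P]_w ((H (g w) * ex q (g w)) * ind s (g w))).
  rewrite (@resample_gap (q, cnt q) (fun y => H y * ind (q :: s) y)); last 2 first.
  - by move=> y; rewrite mule_ge0.
  - exact: emeasurable_funM.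
  apply: eq_integral => w _.
  have e1 r : ind (q :: s) (upd (g w) (q, cnt q) r) =
      ind s (g w) * (T < tm (g w) q (cnt q) + r)%R%:R%:E.
    rewrite /ind big_cons muleC tmS updE tm_upd ?ltnn ?andbF//; congr (_ * _).
    rewrite !big_seq; apply: eq_bigr => q' q's; rewrite tm_upd//.
    by case: (eqVneq q' q) q's qs => [->|//] ->.
  under eq_integral do rewrite Hu e1 muleA.
  rewrite ge0_integralZl//; last 2 first.
  - apply/measurable_EFinP; apply: (measurableT_comp (f := fun x : bool => x%:R : R)) => //.
    by apply: measurable_fun_ltr => //; apply: measurable_funD => //; exact: measurable_cst.
  - by rewrite mule_ge0.
  rewrite -muleA [RHS]muleAC -[RHS]muleA.
  have [->|Hn0] := eqVneq (H (g w)) 0; first by rewrite !mul0e.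
  congr (_ * (_ * _)); rewrite /ex -expm_tail; last by rewrite subr_ge0; exact: HT.
  rewrite -[in RHS](setIT `](T - tm (g w) q (cnt q))%R, +oo[%classic) -integral_indic//.
  apply: eq_integral => r _; rewrite indicE; congr (_%:R%:E); congr nat_of_bool.
  by apply/idP/idP; rewrite inE/= in_itv/= andbT ltrBlDl.
rewrite (ih (fun y => H y * ex q y))//.
- by apply: eq_integral => w _; rewrite big_cons muleA.
- by move=> q' y; rewrite mule_eq0 negb_or => /andP[/HT].
- by move=> y; rewrite mule_ge0// lee_fin expR_ge0.
- exact: emeasurable_funM.
- move=> q' y r; rewrite Hu /ex tm_upd//.
  by case: (eqVneq q q') => //= ->; rewrite ltnn.
Qed.

Section chain_law.
Context dZ (Z : measurableType dZ) (J : Q -> R.-pker (R * Z)%type ~> Z) (nu : probability Z R).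

(** The conditional probability that no clock rings again before [T], given the rings counted in
    [l], when these are at most [T]. *)
Definition weight (l : seq Q) (y : gapsp) : \bar R :=
  \prod_(q : Q) (expR (- lam * (T - tm y q (count_mem q l))))%:E.

Lemma chain_upd l F y p k r : (count_mem p l <= k)%N ->
  chain J (upd y (p, k) r) l F = chain J y l F.
Proof.
elim: l F => [//|q l ih] F h.
have h' : (count_mem p l <= k)%N by rewrite (leq_trans _ h)//= leq_addl.
by rewrite /= ih// -!/(last_time _ (q :: l)) last_time_upd.
Qed.

Lemma weight_ge0 l y : 0 <= weight l y.
Proof. by apply: prode_ge0 => q _; rewrite lee_fin expR_ge0. Qed.

Lemma measurable_weight l : measurable_fun setT (weight l).
Proof.
rewrite /weight; elim: (index_enum Q) => [|a t iht].
  by under eq_fun do rewrite big_nil; exact: measurable_cst.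
under eq_fun do rewrite big_cons; apply: emeasurable_funM => //; apply/measurable_EFinP.
apply: measurableT_comp => //; apply: measurable_funM => //.
apply: measurable_funB; first exact: measurable_cst.
exact: (measurable_tm _ _ (@measurable_id _ gapsp setT)).
Qed.

Lemma measurable_nu_chain l (F : R -> Z -> \bar R) : (forall s z, 0 <= F s z) ->
  measurable_fun setT (fun x : R * Z => F x.1 x.2) ->
  measurable_fun setT (fun y : gapsp => \int[nu]_z chain J y l (F (last_time y l)) z).
Proof.
move=> F0 mF.
have := @measurable_fun_fubini_tonelli_F _ _ gapsp Z R nu
  (fun x => chain J x.1 l (F (last_time x.1 l)) x.2); apply.
  apply: (@measurable_chain _ _ _ _ _ _ gapsp id l (fun y => F (last_time y l))) => //.
  apply: (measurable_fun2 (F := F)) => //.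
  apply: (measurable_last_time l); exact: measurable_fst.
by move=> x; exact: chain_ge0.
Qed.

(** Induction on the list, integrating out the gap of its most recent event. By [expm_next] this
    yields a factor [lam], a time integral and the weight of the shorter list. At the empty list
    each clock leaves the constant [expR (- lam * T)]. *)
Lemma weighted_chain_law l (F : R -> Z -> \bar R) : (forall s z, 0 <= F s z) ->
  measurable_fun setT (fun x : R * Z => F x.1 x.2) ->
  \int[P]_w (((in_order T (g w) l)%:R%:E * weight l (g w)) *
             \int[nu]_z chain J (g w) l (F (last_time (g w) l)) z) =
  (lam ^+ size l * expR (- lam * T) ^+ #|Q|)%:E * \int[nu]_z biter T J l F 0%R z.
Proof.
elim: l F => [|p l ih] F F0 mF.
  rewrite (eq_integral (fun=> (expR (- lam * T) ^+ #|Q|)%:E * \int[nu]_z F 0%R z)).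
    by rewrite integral_cst//= probability_setT mule1 mul1r.
  move=> w _ /=; rewrite mul1e; congr (_ * _); rewrite /weight.
  under eq_bigr do rewrite tm0 subr0.
  by rewrite prodEFin prodr_const.
(* Gap [k] of [p] fixes the time of the head event, and nothing about the tail [l] depends on it. *)
pose k := count_mem p l.
rewrite (@resample_gap (p, k) (fun y => ((in_order T y (p :: l))%:R%:E *
    weight (p :: l) y) * \int[nu]_z chain J y (p :: l) (F (last_time y (p :: l))) z)); last 2 first.
- move=> y; rewrite mule_ge0//; first by rewrite mule_ge0// weight_ge0.
  by apply: integral_ge0 => z _; exact: chain_ge0.
- apply: emeasurable_funM; last exact: measurable_nu_chain.
  apply: emeasurable_funM; last exact: measurable_weight.
  apply/measurable_EFinP; apply: (measurableT_comp (f := fun x : bool => x%:R : R)) => //.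
  exact: measurable_in_order.
transitivity (\int[P]_w (lam%:E * (((in_order T (g w) l)%:R%:E * weight l (g w)) *
    \int[nu]_z chain J (g w) l (bop T J p F (last_time (g w) l)) z))); last first.
  rewrite ge0_integralZl//; last 3 first.
  - apply: emeasurable_funM.
      apply: emeasurable_funM; last exact: (measurableT_comp (measurable_weight l) mg).
      apply/measurable_EFinP; apply: (measurableT_comp (f := fun x : bool => x%:R : R)) => //.
      exact: measurable_in_order.
    have h : measurable_fun setT (fun y : gapsp =>
        \int[nu]_z chain J y l (bop T J p F (last_time y l)) z).
      by apply: measurable_nu_chain => [s z|]; [exact: bop_ge0|exact: measurable_bop].
    exact: (measurableT_comp h mg).
  - move=> w _; rewrite mule_ge0//; first by rewrite mule_ge0// weight_ge0.
    by apply: integral_ge0 => z _; apply: chain_ge0 => y; exact: bop_ge0.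
  - by rewrite lee_fin ltW.
  rewrite ih; last 2 first.
  - by move=> s z; exact: bop_ge0.
  - exact: measurable_bop.
  by rewrite muleA -EFinM mulrA -exprS.
apply: eq_integral => w _; set y := g w; set a := tm y p k.
have ko : (count_mem p l <= k)%N by [].
(* The weight of the other clocks, which the new gap leaves unchanged. *)
pose W' : \bar R := \prod_(q | q != p) (expR (- lam * (T - tm y q (count_mem q l))))%:E.
have wE : weight l y = W' * (expR (- lam * (T - a)))%:E.
  by rewrite /weight (bigD1 p)//= muleC.
have lE r : last_time (upd y (p, k) r) (p :: l) = (a + r)%R.
  by rewrite /= tmS updE tm_upd// ltnn andbF.
have w'E r : weight (p :: l) (upd y (p, k) r) = W' * (expR (- lam * (T - (a + r))))%:E.
  rewrite /weight (bigD1 p)//= eqxx add1n muleC; congr (_ * (expR (- lam * (T - _)))%:E).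
    apply: eq_bigr => q qp; rewrite eq_sym (negbTE qp) add0n tm_upd//.
    by rewrite (negbTE qp).
  exact: lE.
(* The contribution of the list if its head event takes place at time [s]. *)
pose c s := \int[nu]_z chain J y l (jop J p s (F s)) z.
have c0 s : 0 <= c s by apply: integral_ge0 => z _; apply: chain_ge0 => z'; exact: jop_ge0.
have mjF : measurable_fun setT (fun x : R * Z => jop J p x.1 (F x.1) x.2).
  exact: (@measurable_jop_pair _ _ _ _ J _ R p id F).
have mcF : measurable_fun setT (fun x : R * Z => chain J y l (jop J p x.1 (F x.1)) x.2).
  apply: (@measurable_chain _ _ _ _ J _ R (fun=> y) l (fun s => jop J p s (F s))) => //.
  by move=> s z; exact: jop_ge0.
have mc : measurable_fun [set: R] c.
  apply: (@measurable_fun_fubini_tonelli_F _ _ R Z R nu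
    (fun x => chain J y l (jop J p x.1 (F x.1)) x.2)) => // x.
  by apply: chain_ge0 => z'; exact: jop_ge0.
transitivity (\int[expm lam0]_r (((in_order T y l)%:R%:E * W') *
   (((last_time y l < a + r <= T)%R%:R * expR (- lam * (T - (a + r))))%:E * c (a + r)%R))).
  apply: eq_integral => r _; rewrite w'E [in_order _ _ _]/= -!/(last_time _ (p :: l)).
  rewrite in_order_upd// last_time_upd// lE [chain _ _ _ _]/= -/(last_time _ (p :: l)) lE.
  rewrite chain_upd// -/(c _) EFinM -mulnb natrM EFinM.
  rewrite !muleA; congr (_ * _ * _).
  by rewrite muleAC.
have W'0 : 0 <= W' by apply: prode_ge0 => q _; rewrite lee_fin expR_ge0.
rewrite ge0_integralZl//; last 3 first.
- have mar : measurable_fun [set: R] (fun r => a + r)%R.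
    by apply: measurable_funD => //; exact: measurable_cst.
  apply: emeasurable_funM; last exact: (measurableT_comp mc mar).
  apply/measurable_EFinP; apply: measurable_funM.
    apply: (measurableT_comp (f := fun x : bool => x%:R : R)) => //.
    apply: measurable_and; first exact: measurable_fun_ltr.
    exact: measurable_fun_ler.
  apply: measurableT_comp => //; apply: measurable_funM => //.
  by apply: measurable_funB => //; exact: measurable_cst.
- by move=> r _; rewrite mule_ge0// lee_fin mulr_ge0// expR_ge0.
- by rewrite mule_ge0.
have [yl|yl] := boolP (in_order T y l); last by rewrite !mul0e mule0.
rewrite expm_next//; last exact: tm_le_last_time yl.
rewrite !mul1e wE.
have -> : \int[nu]_z chain J y l (bop T J p F (last_time y l)) z =
    \int[lebesgue_measure]_(s in `]last_time y l, T]) c s.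
  rewrite /c time_tonelli//; last 2 first.
  - exact: probability_setT.
  - by move=> t x; apply: chain_ge0 => z'; exact: jop_ge0.
  apply: eq_integral => z _; rewrite -chain_time_integral// => s x.
  exact: jop_ge0.
by rewrite EFinM !muleA; congr (_ * _); rewrite [lam%:E * W']muleC.
Qed.

Definition all_silent (l : seq Q) (y : gapsp) : bool :=
  [forall q, T < tm y q (count_mem q l).+1]%R.

(** By [survival], silence after the last event is replaced by its conditional probability [weight],
    which is the form that [weighted_chain_law] integrates. *)
Theorem chain_law l (F : Z -> \bar R) : (forall z, 0 <= F z) -> measurable_fun setT F ->
  \int[P]_w (((in_order T (g w) l && all_silent l (g w))%:R%:E) *
             \int[nu]_z chain J (g w) l F z) =
  (lam ^+ size l * expR (- lam * T) ^+ #|Q|)%:E * \int[nu]_z biter T J l (fun=> F) 0%R z.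
Proof.
move=> F0 mF; pose G (s : R) := F.
have mG : measurable_fun setT (fun x : R * Z => G x.1 x.2).
  exact: (measurableT_comp mF measurable_snd).
rewrite -(@weighted_chain_law l G)//.
pose H y : \bar R := (in_order T y l)%:R%:E * \int[nu]_z chain J y l F z.
have mH : measurable_fun setT H.
  apply: emeasurable_funM; last exact: (@measurable_nu_chain l G).
  apply/measurable_EFinP; apply: (measurableT_comp (f := fun x : bool => x%:R : R)) => //.
  exact: measurable_in_order.
have H0 y : 0 <= H y.
  by rewrite /H mule_ge0//; apply: integral_ge0 => z _; exact: chain_ge0.
have Hu q y r : H (upd y (q, count_mem q l) r) = H y.
  by rewrite /H in_order_upd// chain_upd.
have HT q y : H y != 0 -> (tm y q (count_mem q l) <= T)%R.
  rewrite /H; case: (boolP (in_order T y l)) => yl; last by rewrite mul0e eqxx.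
  by move=> _; rewrite (le_trans (tm_le_last_time q yl))// last_time_leT.
have := @survival (fun q => count_mem q l) (index_enum Q) H (index_enum_uniq Q) H0 mH Hu HT.
move=> e; transitivity (\int[P]_w (H (g w) *
    \prod_(q : Q) (T < tm (g w) q (count_mem q l).+1)%R%:R%:E)).
  apply: eq_integral => w _; rewrite /H muleAC; congr (_ * _).
  rewrite -mulnb natrM EFinM; congr (_ * _); rewrite prodEFin; congr EFin.
  rewrite /all_silent; case: (boolP [forall q, _]) => [/forallP h|].
    by rewrite big1// => q _; rewrite h.
  rewrite negb_forall => /existsP[q hq]; rewrite (bigD1 q)//= (negbTE hq).
  by rewrite mul0r.
by rewrite e; apply: eq_integral => w _; rewrite /H /weight muleAC.
Qed.

End chain_law.

End clock_law.

End PartS.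

(** * Kernels that act on one or two coordinates *)

Module PartU.
Import PartA PartB PartL.

Section site_kernels.
Context (R : realType) (I : choiceType) dX (X : measurableType dX).
Notation conf := (prodspace I X).
Local Open Scope ereal_scope.

Section site.
Variables (k : R.-pker (R * X)%type ~> X) (l : I).

Let mread : measurable_fun setT (fun x : R * conf => (x.1, x.2 l)).
Proof.
apply: measurable_fun_pair; first exact: measurable_fst.
exact: (measurableT_comp (@measurable_coord _ _ X l) measurable_snd).
Qed.

Let mwrite : measurable_fun setT (fun x : R * conf * X => upd x.1.2 l x.2).
Proof.
apply: measurable_upd; last exact: measurable_snd.
exact: (measurableT_comp measurable_snd measurable_fst).
Qed.

Definition site : R.-pker (R * conf)%type ~> conf :=
  kbind (kcomap k mread) (@kdirac _ _ _ _ R _ mwrite).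

Lemma integral_site t z F : (forall z, 0 <= F z) -> measurable_fun setT F ->
  \int[site (t, z)]_y F y = \int[k (t, z l)]_y F (upd z l y).
Proof.
by move=> F0 mF; rewrite integral_kbind//; apply: eq_integral => y _; rewrite integral_kdirac.
Qed.

End site.

Section pair.
Variables (k : R.-pker (R * (X * X))%type ~> (X * X)%type) (i j : I).

Let mread : measurable_fun setT (fun x : R * conf => (x.1, (x.2 i, x.2 j))).
Proof.
apply: measurable_fun_pair; first exact: measurable_fst.
by apply: measurable_fun_pair; apply: (measurableT_comp (@measurable_coord _ _ X _) measurable_snd).
Qed.

Let mwrite : measurable_fun setT
  (fun x : R * conf * (X * X) => upd (upd x.1.2 i x.2.1) j x.2.2).
Proof.
apply: measurable_upd; last exact: (measurableT_comp measurable_snd measurable_snd).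
apply: measurable_upd; last exact: (measurableT_comp measurable_fst measurable_snd).
exact: (measurableT_comp measurable_snd measurable_fst).
Qed.

Definition pairk : R.-pker (R * conf)%type ~> conf :=
  kbind (kcomap k mread) (@kdirac _ _ _ _ R _ mwrite).

Lemma integral_pairk t z F : (forall z, 0 <= F z) -> measurable_fun setT F ->
  \int[pairk (t, z)]_y F y = \int[k (t, (z i, z j))]_y F (upd (upd z i y.1) j y.2).
Proof.
by move=> F0 mF; rewrite integral_kbind//; apply: eq_integral => y _; rewrite integral_kdirac.
Qed.

End pair.

Section compose.
Context dZ (Z : measurableType dZ).

Let mnext : measurable_fun setT (fun x : R * Z * Z => (x.1.1, x.2)).
Proof.
apply: measurable_fun_pair; last exact: measurable_snd.
exact: (measurableT_comp measurable_fst measurable_fst).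
Qed.

(* First k, then k', at the same time. *)
Definition kthen (k k' : R.-pker (R * Z)%type ~> Z) : R.-pker (R * Z)%type ~> Z :=
  kbind k (kcomap k' mnext).

Lemma integral_kthen k k' t z F : (forall z, 0 <= F z) -> measurable_fun setT F ->
  \int[kthen k k' (t, z)]_y F y = \int[k (t, z)]_x \int[k' (t, x)]_y F y.
Proof. by move=> F0 mF; rewrite integral_kbind. Qed.

End compose.

Lemma measurable_kint dZ (Z : measurableType dZ) (k : R.-pker (R * Z)%type ~> Z) t F :
  (forall z, 0 <= F z) -> measurable_fun setT F ->
  measurable_fun setT (fun z => \int[k (t, z)]_y F y).
Proof.
move=> F0 mF.
have mt : measurable_fun setT (fun z : Z => (t, z)).
  by apply: measurable_fun_pair => //; exact: measurable_cst.
have mF2 : measurable_fun setT (fun x : Z * Z => F x.2).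
  exact: (measurableT_comp mF measurable_snd).
exact: (@measurable_integral_pker R _ _ _ _ (kcomap k mt) _ (fun x => F0 x.2) mF2).
Qed.

Definition sites (k : R.-pker (R * X)%type ~> X) (s : seq I) : R.-pker (R * conf)%type ~> conf :=
  foldr (fun l => kthen (site k l)) (@kdirac _ _ _ _ R _ (@measurable_snd _ _ R conf)) s.

Lemma integral_sites_nil k t z F : measurable_fun setT F -> \int[sites k [::] (t, z)]_y F y = F z.
Proof. by move=> mF; rewrite integral_kdirac. Qed.

Lemma integral_sites_cons k l s t z F : (forall z, 0 <= F z) -> measurable_fun setT F ->
  \int[sites k (l :: s) (t, z)]_y F y = \int[site k l (t, z)]_x \int[sites k s (t, x)]_y F y.
Proof. by move=> F0 mF; rewrite integral_kthen. Qed.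

(** The two kernels read and write disjoint coordinates, so Tonelli exchanges their draws. *)
Lemma site_pairk_comm k k2 l i j t s z F : l != i -> l != j ->
  (forall z, 0 <= F z) -> measurable_fun setT F ->
  \int[pairk k2 i j (t, z)]_x \int[site k l (s, x)]_y F y =
  \int[site k l (s, z)]_x \int[pairk k2 i j (t, x)]_y F y.
Proof.
move=> li lj F0 mF.
rewrite integral_pairk; last 2 first.
- by move=> x; exact: integral_ge0.
- exact: measurable_kint.
rewrite integral_site; last 2 first.
- by move=> x; exact: integral_ge0.
- exact: measurable_kint.
under eq_integral => y _ do rewrite integral_site// (upd_neq _ _ lj) (upd_neq _ _ li).
under [RHS]eq_integral => y _.
  rewrite integral_pairk// (upd_neq _ _ (_ : i != l)) 1?eq_sym//.
  rewrite (upd_neq _ _ (_ : j != l)) 1?eq_sym//.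
  over.
rewrite (@prob_tonelli _ _ _ _ _ _ _ (fun x y => F (upd (upd (upd z i x.1) j x.2) l y)))//.
- apply: eq_integral => y _; apply: eq_integral => x _.
  by rewrite updC// 1?eq_sym// (updC _ _ _ (_ : i != l)) 1?eq_sym// updC.
- exact: prob_kernel.
- exact: prob_kernel.
- apply: measurableT_comp => //; apply: measurable_upd; last exact: measurable_snd.
  apply: measurable_upd; last exact: (measurableT_comp measurable_snd measurable_fst).
  apply: measurable_upd; last exact: (measurableT_comp measurable_fst measurable_fst).
  exact: measurable_cst.
Qed.

Lemma sites_pairk_comm k k2 (s : seq I) i j t z F : i \notin s -> j \notin s ->
  (forall z, 0 <= F z) -> measurable_fun setT F ->
  \int[pairk k2 i j (t, z)]_x \int[sites k s (t, x)]_y F y =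
  \int[sites k s (t, z)]_x \int[pairk k2 i j (t, x)]_y F y.
Proof.
elim: s z => [|l s ih] z; rewrite ?inE ?negb_or.
  move=> _ _ F0 mF; rewrite integral_sites_nil; last exact: measurable_kint.
  by apply: eq_integral => x _; rewrite integral_sites_nil.
move=> /andP[il si] /andP[jl sj] F0 mF.
under eq_integral do rewrite integral_sites_cons//.
rewrite site_pairk_comm//; last 4 first.
- by rewrite eq_sym.
- by rewrite eq_sym.
- by move=> x; exact: integral_ge0.
- exact: measurable_kint.
rewrite integral_sites_cons//; last 2 first.
- by move=> x; exact: integral_ge0.
- exact: measurable_kint.
by apply: eq_integral => x _; exact: ih.
Qed.

End site_kernels.

End PartU.

(** * Kernels on paths: jumps, restarts and the Markov property *)

Module PartV.
Import PartA PartB PartD PartF PartH PartK PartL PartU.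

Section path_kernels.
Context (R : realType) (dim : nat).
Notation E := 'rV[R]_dim.
Notation D := (skorohod dim (+oo : \bar R)).
Variables (Lam : R) (hLam : 0 < Lam).
Variables (Px : R.-pker E ~> D) (hPx : markov_process Px).
Variable muhat : R.-ker (E * E)%type ~> (E * E)%type.
Hypothesis muhat_bound : forall v w, (muhat (v, w) setT <= Lam%:E)%E.
Local Open Scope ereal_scope.

Section jump_kernel.

Let muhat_fin v : muhat v setT \is a fin_num.
Proof.
rewrite ge0_fin_numE//; case: v => v w.
by rewrite (le_lt_trans (muhat_bound v w)) ?ltry.
Qed.

Let no_jump v : R := (1 - Lam^-1 * fine (muhat v setT))%R.

Let no_jump_ge0 v : (0 <= no_jump v)%R.
Proof.
rewrite subr_ge0 mulrC ler_pdivrMr// mul1r -lee_fin fineK//.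
by case: v => v w; exact: muhat_bound.
Qed.

Let jump0 : (0 <= Lam^-1)%R. Proof. by rewrite invr_ge0 ltW. Qed.

(** [jump_law] as a measure: [muhat_bound] makes the probability of no jump nonnegative. *)
Definition jumpm (v : E * E) : {measure set (E * E) -> \bar R} :=
  measure_add (mscale (NngNum jump0) (muhat v))
              (mscale (NngNum (no_jump_ge0 v)) (\d_((0%R, 0%R) : E * E))).

Lemma jumpmE v C : jumpm v C = jump_law Lam muhat v.1 v.2 C.
Proof.
transitivity (mscale (NngNum jump0) (muhat v) C +
  mscale (NngNum (no_jump_ge0 v)) (\d_((0%R, 0%R) : E * E)) C); first exact: measure_addE.
rewrite /jump_law -surjective_pairing; congr (_ + _).
by rewrite /mscale /= /no_jump EFinB EFinM fineK.
Qed.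

Let measurable_jumpm U : measurable U -> measurable_fun [set: E * E] (jumpm ^~ U).
Proof.
move=> mU; under eq_fun do rewrite jumpmE /jump_law.
have mk V : measurable V -> measurable_fun [set: E * E] (fun v => (Lam^-1)%:E * muhat (v.1, v.2) V).
  move=> mV; apply: emeasurable_funM; first exact: measurable_cst.
  by have := measurable_kernel muhat V mV; apply: eq_measurable_fun => v _; case: v.
apply: emeasurable_funD; first exact: mk.
apply: emeasurable_funM; last exact: measurable_cst.
apply: emeasurable_funB; [exact: measurable_cst|exact: mk].
Qed.

HB.instance Definition _ := isKernel.Build _ _ _ _ _ jumpm measurable_jumpm.

Let jumpm_prob v : jumpm v setT = 1.
Proof.
rewrite jumpmE /jump_law -surjective_pairing diracT mule1 addeC subeK//.
by rewrite fin_numM.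
Qed.

HB.instance Definition _ := Kernel_isProbability.Build _ _ _ _ _ jumpm jumpm_prob.

End jump_kernel.

Definition jk : R.-pker (E * E)%type ~> (E * E)%type := jumpm.

Section resampling.
Variable val : D -> R -> E.
Hypothesis mval : measurable_fun setT (fun x : R * D => val x.2 x.1).

Let mglue : measurable_fun setT (fun x : R * D * D => glue x.1.2 x.1.1 x.2).
Proof.
apply: measurable_glue; last exact: measurable_snd.
- exact: (measurableT_comp measurable_snd measurable_fst).
- exact: (measurableT_comp measurable_fst measurable_fst).
Qed.

Definition refresh : R.-pker (R * D)%type ~> D :=
  kbind (kcomap Px mval) (@kdirac _ _ _ _ R _ mglue).

Lemma integral_refresh t y F : (forall z, 0 <= F z) -> measurable_fun setT F ->
  \int[refresh (t, y)]_z F z = \int[Px (val y t)]_w F (glue y t w).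
Proof.
by move=> F0 mF; rewrite integral_kbind//; apply: eq_integral => w _; rewrite integral_kdirac.
Qed.

End resampling.

Let meval : measurable_fun setT (fun x : R * D => (fun (z : D) t => z t : E) x.2 x.1).
Proof. by apply: measurable_eval_at; [exact: measurable_snd|exact: measurable_fst]. Qed.

Let mleft : measurable_fun setT (fun x : R * D => left_val x.2 x.1).
Proof. by apply: measurable_left_val; [exact: measurable_snd|exact: measurable_fst]. Qed.

(* Resample the path after time t, from its value at t or from its left limit at t. *)
Definition krefresh := refresh meval.
Definition krefresh_left := refresh mleft.

Lemma integral_krefresh t y F : (forall z, 0 <= F z) -> measurable_fun setT F ->
  \int[krefresh (t, y)]_z F z = \int[Px (y t)]_w F (glue y t w).
Proof. exact: integral_refresh. Qed.

Lemma integral_krefresh_left t y F : (forall z, 0 <= F z) -> measurable_fun setT F ->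
  \int[krefresh_left (t, y)]_z F z = \int[Px (left_val y t)]_w F (glue y t w).
Proof. exact: integral_refresh. Qed.

Section interaction.
Let W := (R * (D * D))%type.

Let m1 dY (Y : measurableType dY) (f : W -> Y) dZ (Z : measurableType dZ) :
  measurable_fun setT f -> measurable_fun setT (fun x : W * Z => f x.1).
Proof. by move=> mf; exact: (measurableT_comp mf measurable_fst). Qed.

Let mt : measurable_fun setT (fun x : W => x.1). Proof. exact: measurable_fst. Qed.
Let my1 : measurable_fun setT (fun x : W => x.2.1).
Proof. exact: (measurableT_comp measurable_fst measurable_snd). Qed.
Let my2 : measurable_fun setT (fun x : W => x.2.2).
Proof. exact: (measurableT_comp measurable_snd measurable_snd). Qed.
Let ml1 : measurable_fun setT (fun x : W => left_val x.2.1 x.1).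
Proof. exact: measurable_left_val. Qed.
Let ml2 : measurable_fun setT (fun x : W => left_val x.2.2 x.1).
Proof. exact: measurable_left_val. Qed.

Let mread : measurable_fun setT (fun x : W => (left_val x.2.1 x.1, left_val x.2.2 x.1)).
Proof. exact: measurable_fun_pair. Qed.

Let mp1 : measurable_fun setT (fun x : W * (E * E) => left_val x.1.2.1 x.1.1 + x.2.1)%R.
Proof.
apply: measurable_rVD; first exact: (m1 ml1).
exact: (measurableT_comp measurable_fst measurable_snd).
Qed.

Let mp2 : measurable_fun setT
  (fun x : W * (E * E) * D => left_val x.1.1.2.2 x.1.1.1 + x.1.2.2)%R.
Proof.
apply: measurable_rVD; first exact: (measurableT_comp (m1 ml2) measurable_fst).
apply: (measurableT_comp measurable_snd).
exact: (measurableT_comp measurable_snd measurable_fst).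
Qed.

Let mout : measurable_fun setT (fun x : W * (E * E) * D * D =>
  (glue x.1.1.1.2.1 x.1.1.1.1 x.1.2, glue x.1.1.1.2.2 x.1.1.1.1 x.2)).
Proof.
have m11 dY (Y : measurableType dY) (f : W -> Y) : measurable_fun setT f ->
    measurable_fun setT (fun x : W * (E * E) * D * D => f x.1.1.1).
  move=> mf; apply: (measurableT_comp mf).
  by do 2 apply: measurableT_comp => //.
apply: measurable_fun_pair; apply: measurable_glue.
- exact: m11 my1.
- exact: m11 mt.
- exact: (measurableT_comp measurable_snd measurable_fst).
- exact: m11 my2.
- exact: m11 mt.
- exact: measurable_snd.
Qed.

(* At time t the two particles jump and their later paths are resampled. *)
Definition kinteract : R.-pker W ~> (D * D)%type :=
  kbind (kcomap jk mread) (kbind (kcomap Px mp1) (kbind (kcomap Px mp2)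
    (@kdirac _ _ _ _ R _ mout))).

Lemma integral_kinteract t y1 y2 F : (forall z, 0 <= F z) -> measurable_fun setT F ->
  \int[kinteract (t, (y1, y2))]_z F z =
  \int[jk (left_val y1 t, left_val y2 t)]_h
    \int[Px (left_val y1 t + h.1)%R]_w \int[Px (left_val y2 t + h.2)%R]_w'
      F (glue y1 t w, glue y2 t w').
Proof.
move=> F0 mF; rewrite integral_kbind//; apply: eq_integral => h _.
rewrite integral_kbind//; apply: eq_integral => w _.
by rewrite integral_kbind//; apply: eq_integral => w' _; rewrite integral_kdirac.
Qed.

End interaction.

(** The hypothesis [hPx] speaks of one event of the past and one of the shifted future. The two laws
    are therefore compared on cylinders, each of which splits at [t] into such a pair. *)
Lemma markov_refresh x t F : (0 <= t)%R -> (forall z, 0 <= F z) -> measurable_fun setT F ->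
  \int[Px x]_w \int[Px (w t)]_w' F (glue w t w') = \int[Px x]_w F w.
Proof.
move=> t0 F0 mF.
have mt : measurable_fun setT (fun w : D => (t, w)).
  by apply: measurable_fun_pair => //; exact: measurable_cst.
have mc : measurable_fun [set: E] (fun=> tt) by exact: measurable_cst.
have mtx : measurable_fun setT (fun w : E * D => (t, w.2)).
  by apply: measurable_fun_pair => //; exact: measurable_cst.
pose k : R.-pker E ~> D := kbind Px (kcomap krefresh mtx).
transitivity (\int[k x]_w F w).
  by rewrite integral_kbind//; apply: eq_integral => w _; rewrite -integral_krefresh.
apply: eq_measure_integral => A mA _.
apply: (@measure_unique _ R _ (cylinders (fun (s : R) (w : D) => w s : E)) (fun=> setT)) => //.
- exact: generated_cylinders.
- exact: setI_cylinders.
- by move=> _; exact: cylindersT.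
- by rewrite bigcup_const//; exists 0%N.
- move=> C [S [B [_ [mB CE]]]].
  (* Conditions at times before [t] form [A1]; later ones are read on the restarted path, [t] units
     earlier, and form [B1]. *)
  pose A1 := [set w : D | forall s, s \in S -> (Num.max 0%R s < t)%R -> B s (w s)].
  pose B1 := [set w : D | forall s, s \in S -> (t <= Num.max 0%R s)%R -> B s (w (Num.max 0%R s - t)%R)].
  have gl w w' : (glue w t w' \in C) = (w \in A1) && (w' \in B1).
    apply/idP/andP => [/set_mem|[/set_mem h1 /set_mem h2]].
      rewrite CE /= => h; split; apply/mem_set => s sS st.
        by have := h _ sS; rewrite /= /glue_fun st.
      by have := h _ sS; rewrite /= /glue_fun ltNge st.
    by apply/mem_set; rewrite CE => s sS; rewrite /= /glue_fun; case: ltP => st; [exact: h1|exact: h2].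
  have mev s : measurable_fun setT (fun w : D => w s : E) by exact: (@measurable_eval R dim +oo%E s).
  have mB1 : measurable B1.
    rewrite (_ : B1 = \big[setI/setT]_(s <- S | (t <= Num.max 0%R s)%R)
        ((fun w : D => w (Num.max 0%R s - t)%R : E) @^-1` B s)).
      by apply: bigsetI_measurable => s _; rewrite -[X in measurable X]setTI; exact: mev.
    by rewrite -bigcap_seq_cond; apply/seteqP; split => w h s /=;
      [move=> /andP[sS ts]; exact: h|move=> sS ts; apply: h; rewrite /= sS ts].
  have hA1 : canonical_filtration t A1.
    rewrite (_ : A1 = \big[setI/setT]_(s <- S | (Num.max 0%R s < t)%R)
        ((fun w : D => w s : E) @^-1` B s)); last first.
      rewrite -bigcap_seq_cond; apply/seteqP; split => w h s /=;
        [by move=> /andP[sS ts]; exact: h|by move=> sS ts; apply: h; rewrite /= sS ts].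
    apply: (@bigsetI_measurable _ (g_sigma_algebraType (gen_family
       (fun (u : {u : R | (0 <= u <= t)%R}) (w : D) => w (sval u) : E)))) => s st.
    apply: sub_gen_smallest.
    have h : (0 <= Num.max 0%R s <= t)%R by rewrite le_max lexx /= ltW.
    exists (@exist R (fun u => (0 <= u <= t)%R) _ h), (B s); split => //=; apply/seteqP; split => w; by rewrite /= path_max0.
  have mA1 : measurable A1.
    apply: (smallest_sub (@sigma_algebra_measurable _ D) _ hA1) => _ [u [B0 [mB0 ->]]].
    by rewrite -[X in measurable X]setTI; exact: mev.
  have mC : measurable C.
    rewrite CE (_ : [set _ | _] = \big[setI/setT]_(s <- S) ((fun w : D => w s : E) @^-1` B s)).
      by apply: bigsetI_measurable => s _; rewrite -[X in measurable X]setTI; exact: mev.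
    by rewrite -bigcap_seq; apply/seteqP; split => w h s /h.
  have mPx : measurable_fun setT (fun w : D => Px (w t) B1).
    exact: (measurableT_comp (measurable_kernel Px B1 mB1) (mev t)).
  transitivity (\int[k x]_w (\1_C w)%:E); first by rewrite integral_indic ?setIT.
  rewrite integral_kbind//; last by apply/measurable_EFinP; exact: measurable_indic.
  transitivity (\int[Px x]_(w in A1) Px (w t) B1).
    rewrite [RHS]integral_mkcond; apply: eq_integral => w _.
    rewrite integral_krefresh//; last by apply/measurable_EFinP; exact: measurable_indic.
    rewrite patchE; case: ifPn => wA.
      transitivity (\int[Px (w t)]_w' (\1_B1 w')%:E); last by rewrite integral_indic ?setIT.
      by apply: eq_integral => w' _; rewrite !indicE gl wA.
    by rewrite integral0_eq// => w' _; rewrite indicE gl (negbTE wA).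
  rewrite -(hPx.2 x t A1 B1)//; congr (Px x _); apply/seteqP; split => w /=.
    move=> [h1 h2]; rewrite CE => s sS /=; have [st|ts] := ltP (Num.max 0%R s) t; first exact: h1.
    have := h2 s sS ts; rewrite /= (max_r (_ : (0 <= Num.max 0%R s - t)%R)) ?subr_ge0//.
    by rewrite [(t + _)%R]addrC subrK path_max0.
  rewrite CE /= => h; split => [s sS _|s sS ts]; first exact: h.
  rewrite /= (max_r (_ : (0 <= Num.max 0%R s - t)%R)) ?subr_ge0//.
  by rewrite [(t + _)%R]addrC subrK path_max0; exact: h.
- by move=> _; rewrite prob_kernel ltry.
Qed.

End path_kernels.

End PartV.

(** * Restarting only the interacting particles *)

Module PartW.
Import PartA PartB PartD PartF PartH PartK PartL PartU PartV PartM.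

Section merging.
#[local] Opaque kbind krefresh krefresh_left site sites pairk kinteract kthen.
Context (R : realType) (dim : nat).
Notation E := 'rV[R]_dim.
Notation D := (skorohod dim (+oo : \bar R)).
Variables (Lam : R) (hLam : 0 < Lam).
Variables (Px : R.-pker E ~> D) (hPx : markov_process Px).
Variable muhat : R.-ker (E * E)%type ~> (E * E)%type.
Hypothesis muhat_bound : forall v w, (muhat (v, w) setT <= Lam%:E)%E.
Variables (N : nat) (T : R).
Notation conf := (prodspace 'I_N D).
Notation Q := (pair_index N).
Local Open Scope ereal_scope.

Definition others (p : Q) : seq 'I_N :=
  [seq l <- enum 'I_N | (l != lo_of p) && (l != hi_of p)].

Lemma lo_neq_hi (p : Q) : lo_of p != hi_of p.
Proof. by apply/eqP => h; have := valP p; rewrite /lo_of /hi_of in h *; rewrite h ltnn. Qed.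

Definition pair_step (p : Q) : R.-pker (R * conf)%type ~> conf :=
  pairk (kinteract hLam Px muhat_bound) (lo_of p) (hi_of p).

(** The step dictated by [particle_system]: every particle starts afresh after an interaction, the
    spectators from their left limits. [pair_step] leaves the spectators alone; the aim of this part
    is that both have the same time integrals under a law that is fresh. *)
Definition full_step (p : Q) : R.-pker (R * conf)%type ~> conf :=
  kthen (pair_step p) (sites (krefresh_left Px) (others p)).

(** A restart at [t] of a path already restarted at [r] is a restart of the fresh piece at time
    [t - r], which the Markov property absorbs. *)
Lemma refresh_glue x y r t F : (0 <= r <= t)%R -> (forall z, 0 <= F z) -> measurable_fun setT F ->
  \int[Px x]_w \int[krefresh Px (t, glue y r w)]_u F u = \int[Px x]_w F (glue y r w).
Proof.
move=> /andP[r0 rt] F0 mF.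
have tr : (0 <= t - r)%R by rewrite subr_ge0.
rewrite -[RHS](markov_refresh hPx x tr)//; last first.
  apply: measurableT_comp => //; apply: measurable_glue => //; exact: measurable_cst.
apply: eq_integral => w _; rewrite integral_krefresh// glueE.
have t0 : (0 <= t)%R := le_trans r0 rt.
rewrite (max_r t0) ltNge rt /=; apply: eq_integral => w' _.
by rewrite glue_glue.
Qed.

(** Both interacting paths are fresh from [r] on, so a later restart of one of them changes nothing.
    For [lo_of p] the two integrals are exchanged first, to bring its draw inside. *)
Lemma site_pair_step p r t l z F : (0 <= r <= t)%R -> (l == lo_of p) || (l == hi_of p) ->
  (forall z, 0 <= F z) -> measurable_fun setT F ->
  \int[pair_step p (r, z)]_x \int[site (krefresh Px) l (t, x)]_y F y =
  \int[pair_step p (r, z)]_y F y.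
Proof.
move=> rt lp F0 mF; have ij := lo_neq_hi p; move: lp; rewrite /pair_step.
set i := lo_of p in ij *; set j := hi_of p in ij *.
have mu2 z' : measurable_fun setT (fun y : D * D => upd (upd z' i y.1) j y.2).
  apply: measurable_upd; last exact: measurable_snd.
  by apply: measurable_upd; [exact: measurable_cst|exact: measurable_fst].
have mF2 : measurable_fun setT (fun y : D * D => F (upd (upd z i y.1) j y.2)).
  exact: (measurableT_comp mF (mu2 z)).
have mG := measurable_kint (site (krefresh Px) l) t F0 mF.
have mG2 := measurableT_comp mG (mu2 z).
have G0 x : 0 <= \int[site (krefresh Px) l (t, x)]_y F y by exact: integral_ge0.
rewrite (integral_pairk _ _ _ _ _ G0 mG) (integral_pairk _ _ _ _ _ F0 mF).
rewrite (integral_kinteract hLam Px muhat_bound r (z i) (z j) (fun y => G0 _) mG2).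
rewrite (integral_kinteract hLam Px muhat_bound r (z i) (z j) (fun y => F0 _) mF2).
have mg y : measurable_fun setT (fun w : D => glue y r w).
  by apply: measurable_glue => //; exact: measurable_cst.
have mF3 : measurable_fun setT (fun x : D * D =>
    F (upd (upd z i (glue (z i) r x.1)) j (glue (z j) r x.2))).
  apply: measurableT_comp => //; apply: measurable_upd; [apply: measurable_upd|].
  - exact: measurable_cst.
  - exact: (measurableT_comp (mg _) measurable_fst).
  - exact: (measurableT_comp (mg _) measurable_snd).
move=> lp; apply: eq_integral => h _.
have mupdk z' k : measurable_fun setT (fun u : D => F (upd z' k u)).
  apply: measurableT_comp => //; apply: measurable_upd => //; exact: measurable_cst.
case/orP: lp => /eqP ->.
- rewrite [LHS](@prob_tonelli _ _ _ _ _ _ _ (fun w w' : D =>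
    \int[site (krefresh Px) i (t, upd (upd z i (glue (z i) r w)) j (glue (z j) r w'))]_y F y)).
  + rewrite [RHS](prob_tonelli (prob_kernel _) (prob_kernel _) (fun w w' => F0 _) mF3).
    apply: eq_integral => w' _.
    rewrite -(@refresh_glue _ (z i) r t (fun u => F (upd (upd z i u) j (glue (z j) r w'))))//.
      apply: eq_integral => w _; rewrite integral_site//.
      rewrite (upd_neq _ _ ij) updE; apply: eq_integral => u _.
      by rewrite (@updC _ _ _ (upd z i _) j i) 1?eq_sym// upd_upd.
    under eq_fun do rewrite (updC _ _ _ ij); exact: mupdk.
  + exact: prob_kernel.
  + exact: prob_kernel.
  + by move=> *; exact: integral_ge0.
  + have := measurable_kint (site (krefresh Px) i) t F0 mF => mGi.
    apply: (measurableT_comp mGi).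
    apply: measurable_upd; [apply: measurable_upd|].
    * exact: measurable_cst.
    * exact: (measurableT_comp (mg _) measurable_fst).
    * exact: (measurableT_comp (mg _) measurable_snd).
- apply: eq_integral => w _.
  rewrite -(@refresh_glue _ (z j) r t (fun u => F (upd (upd z i (glue (z i) r w)) j u)))//.
  apply: eq_integral => w' _; rewrite integral_site// updE; apply: eq_integral => u _.
  by rewrite upd_upd.
Qed.

(** Where no path of the list jumps, left limit and value agree and so do the two restarts; without
    repetitions in the list, each site is still untouched when its turn comes. *)
Lemma sites_left_continuous (s : seq 'I_N) r (z : conf) (F : conf -> \bar R) : uniq s -> (0 < r)%R ->
  (forall l, l \in s -> left_limit (z l) r = z l r) ->
  (forall z, 0 <= F z) -> measurable_fun setT F ->
  \int[sites (krefresh_left Px) s (r, z)]_y F y = \int[sites (krefresh Px) s (r, z)]_y F y.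
Proof.
elim: s z => [|l s ih] z.
  by move=> _ _ _ F0 mF; rewrite !integral_sites_nil.
rewrite cons_uniq => /andP[ls us] r0 zc F0 mF.
have I0 k x : 0 <= \int[sites k s (r, x)]_y F y by exact: integral_ge0.
have sE k : \int[sites k (l :: s) (r, z)]_y F y =
    \int[k (r, z l)]_u \int[sites k s (r, upd z l u)]_y F y.
  by rewrite integral_sites_cons// (integral_site _ _ _ _ (I0 _) (measurable_kint _ r F0 mF)).
apply: (etrans (sE _)); apply: (etrans _ (esym (sE _))).
have mI k : measurable_fun setT (fun u : D => \int[sites k s (r, upd z l u)]_y F y).
  apply: (measurableT_comp (measurable_kint (sites k s) r F0 mF)).
  apply: measurable_upd => //; exact: measurable_cst.
rewrite (integral_krefresh_left _ _ _ (fun u => I0 _ _) (mI _)).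
rewrite (integral_krefresh _ _ _ (fun u => I0 _ _) (mI _)).
have -> : left_val (z l) r = z l r by rewrite /left_val r0 zc// inE eqxx.
apply: eq_integral => w _.
apply: ih => // k ks; rewrite upd_neq; last by apply: contraNneq ls => <-.
by apply: zc; rewrite inE ks orbT.
Qed.

(* Under nu, the path of each particle after any time t >= s is a Markov
   path started afresh from its value at time t. *)
Definition fresh_after (s : R) (nu : {measure set conf -> \bar R}) : Prop :=
  forall t l F, (s <= t)%R -> (forall z, 0 <= F z) -> measurable_fun setT F ->
    \int[nu]_z \int[site (krefresh Px) l (t, z)]_y F y = \int[nu]_z F z.

Lemma fresh_sites s nu (ls : seq 'I_N) t F : fresh_after s nu -> (s <= t)%R ->
  (forall z, 0 <= F z) -> measurable_fun setT F ->
  \int[nu]_z \int[sites (krefresh Px) ls (t, z)]_y F y = \int[nu]_z F z.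
Proof.
move=> hnu st F0 mF; elim: ls => [|l ls ih].
  by apply: eq_integral => z _; rewrite integral_sites_nil.
apply: etrans ih; apply: etrans (hnu t l _ st (fun z => integral_ge0 _ (fun y _ => F0 y))
  (measurable_kint _ t F0 mF)).
by apply: eq_integral => z _; exact: integral_sites_cons.
Qed.

Let at_time (r : R) : measurable_fun setT (fun z : conf => (r, z)).
Proof. by apply: measurable_fun_pair => //; exact: measurable_cst. Qed.

(** Members of the pair are fresh by [site_pair_step]. For any other particle the restart commutes
    with the interaction, and the freshness of [nu] applies. *)
Lemma fresh_pair_step s (nu : probability conf R) p r : (0 <= r)%R -> (s <= r)%R ->
  fresh_after s nu -> fresh_after r (mbind nu (kcomap (pair_step p) (@at_time r))).
Proof.
move=> r0 sr hnu t l F rt F0 mF.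
have mk k := measurable_kint k t F0 mF.
have I0 z : 0 <= \int[site (krefresh Px) l (t, z)]_y F y by exact: integral_ge0.
apply: (etrans (integral_mbind _ _ I0 (mk _))); apply: (etrans _ (esym (integral_mbind _ _ F0 mF))).
rewrite /kcomap; case: (boolP ((l == lo_of p) || (l == hi_of p))) => lp.
  by apply: eq_integral => z _; apply: site_pair_step => //; rewrite r0.
move: lp; rewrite negb_or => /andP[li lj].
under eq_integral do rewrite site_pairk_comm//.
exact: (hnu t l _ (le_trans sr rt) (fun z => integral_ge0 _ (fun y _ => F0 y))
  (measurable_kint _ r F0 mF)).
Qed.

Lemma uniq_others p : uniq (others p).
Proof. by rewrite filter_uniq// enum_uniq. Qed.

(** The interaction time is integrated against Lebesgue measure, so the countably many jump times of
    the configuration form a null set. Off this set the spectators restart from their values, and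
    [fresh_after] absorbs these restarts. *)
Lemma bop_full_step s (nu : probability conf R) p F : (0 <= s)%R -> fresh_after s nu ->
  (forall r z, 0 <= F r z) -> measurable_fun setT (fun x : R * conf => F x.1 x.2) ->
  \int[nu]_z bop T full_step p F s z = \int[nu]_z bop T pair_step p F s z.
Proof.
move=> s0 hnu F0 mF.
have mFr r : measurable_fun setT (F r).
  exact: (measurableT_comp mF (@at_time r)).
pose G r z := jop pair_step p r (F r) z.
have G0 r z : 0 <= G r z by exact: jop_ge0.
have mG : measurable_fun setT (fun x : R * conf => G x.1 x.2).
  exact: (@measurable_jop_pair R Q _ conf pair_step _ R p id).
have mGr r : measurable_fun setT (G r) := measurableT_comp mG (@at_time r).
have jE r z : jop full_step p r (F r) z =
    \int[sites (krefresh_left Px) (others p) (r, z)]_y G r y.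
  (* Spectators and pair occupy different coordinates, so the spectators may be restarted before the
     interaction, where [nu] sees them directly. *)
  rewrite /jop integral_kthen// /G /pair_step sites_pairk_comm//;
    by rewrite mem_filter eqxx ?andbF.
pose H r z := \int[sites (krefresh Px) (others p) (r, z)]_y G r y.
have mS (k : R.-pker (R * D)%type ~> D) :
    measurable_fun setT (fun x : R * conf => \int[sites k (others p) (x.1, x.2)]_y G x.1 y).
  exact: (@measurable_jop_pair R Q _ conf (fun p => sites k (others p)) _ R p id G).
have H0 r z : 0 <= H r z by exact: integral_ge0.
transitivity (\int[nu]_z \int[lebesgue_measure]_(r in `]s, T]) H r z).
  apply: eq_integral => z _; rewrite /bop.
  under eq_integral do rewrite jE.
  have mz k : measurable_fun `]s, T]%classic
      (fun r : R => \int[sites k (others p) (r, z)]_y G r y).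
    apply: measurable_funTS.
    have mcz : measurable_fun [set: R] (fun=> z) by exact: measurable_cst.
    exact: (measurable_fun2 (F := fun r z => \int[sites k (others p) (r, z)]_y G r y) (mS k)
      (@measurable_id _ R setT) mcz).
  apply: ae_eq_integral; [exact: measurable_itv|exact: mz|exact: mz|].
  have cJ : countable (\bigcup_(l in [set: 'I_N]) [set t : R | left_limit (z l) t <> z l t]).
    by apply: bigcup_countable => // l _; exact: jumps_countable.
  exists (\bigcup_(l in [set: 'I_N]) [set t : R | left_limit (z l) t <> z l t]); split.
  - exact: countable_measurable.
  - exact: countable_lebesgue_measure0.
  - move=> r /= h; apply: contrapT => nj; apply: h; rewrite in_itv/= => /andP[sr _].
    have zc l : l \in others p -> left_limit (z l) r = z l r.
      by move=> _; apply: contrapT => h; apply: nj; exists l.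
    exact: (sites_left_continuous (uniq_others p) (le_lt_trans s0 sr) zc (G0 r) (mGr r)).
have n1 : nu setT = 1 by exact: probability_setT.
have mI : measurable (`]s, T]%classic : set R) by exact: measurable_itv.
apply: (etrans (esym (time_tonelli n1 mI H0 (mS _)))).
apply: (etrans _ (time_tonelli n1 mI G0 mG)).
apply: eq_integral => r; rewrite inE/= in_itv/= => /andP[/ltW sr _].
exact: (fresh_sites (others p) hnu sr (G0 r) (mGr r)).
Qed.

Lemma biter_rcons dZ (Z : measurableType dZ) (J : Q -> R.-pker (R * Z)%type ~> Z) l p F :
  biter T J (rcons l p) F = bop T J p (biter T J l F).
Proof. by elim: l F => [|q l ih] F //=; rewrite ih. Qed.

Lemma biter_full_step l s (nu : probability conf R) F : (0 <= s)%R -> fresh_after s nu ->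
  (forall r z, 0 <= F r z) -> measurable_fun setT (fun x : R * conf => F x.1 x.2) ->
  \int[nu]_z biter T full_step l F s z = \int[nu]_z biter T pair_step l F s z.
Proof.
(* The oldest event is removed first, because freshness propagates forward in time: the law [nu']
   after that event is fresh from [r] on, and the induction hypothesis applies to it. *)
elim/last_ind: l s nu => [//|l p ih] s nu s0 hnu F0 mF; rewrite !biter_rcons.
have mb J := measurable_biter T J l F0 mF.
have b0 J r z : 0 <= biter T J l F r z by exact: biter_ge0.
have mbr J r : measurable_fun setT (biter T J l F r) := measurableT_comp (mb J) (@at_time r).
apply: (etrans (bop_full_step p s0 hnu (b0 _) (mb _))).
have n1 : nu setT = 1 by exact: probability_setT.
have mI : measurable (`]s, T]%classic : set R) by exact: measurable_itv.
have mj J : measurable_fun setT (fun x : R * conf => jop pair_step p x.1 (biter T J l F x.1) x.2).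
  exact: (@measurable_jop_pair R Q _ conf pair_step _ R p id _ (b0 J)).
have j0 J r z : 0 <= jop pair_step p r (biter T J l F r) z by exact: jop_ge0.
apply: (etrans (esym (time_tonelli n1 mI (j0 _) (mj _)))).
apply: (etrans _ (time_tonelli n1 mI (j0 _) (mj _))).
apply: eq_integral => r; rewrite inE/= in_itv/= => /andP[/ltW sr _].
have r0 := le_trans s0 sr.
have hr := fresh_pair_step p r0 sr hnu.
have [nu' nuE] : exists nu' : probability conf R, nu' =
    mbind nu (kcomap (pair_step p) (@at_time r)) :> {measure set conf -> \bar R}.
  apply: prob_pack; rewrite mbindE.
  under eq_integral do rewrite /= prob_kernel.
  by rewrite integral_cst// mul1e; exact: probability_setT.
have {hr}hr : fresh_after r nu' by rewrite nuE.
have iE G : \int[nu']_z G z = \int[mbind nu (kcomap (pair_step p) (@at_time r))]_z G z.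
  exact: (congr1 (fun m : {measure set conf -> \bar R} => \int[m]_z G z) nuE).
have mE J : \int[nu']_z biter T J l F r z = \int[nu]_z jop pair_step p r (biter T J l F r) z.
  exact: (etrans (iE _) (integral_mbind nu (kcomap (pair_step p) (@at_time r)) (b0 J r) (mbr J r))).
exact: (etrans (esym (mE full_step)) (etrans (ih r nu' r0 hr F0 mF) (mE pair_step))).
Qed.

End merging.

End PartW.

(** * Evolution of the system between interaction times *)

Module PartX1.
Import PartA PartB PartC PartD PartF PartH PartL PartM PartU PartV PartW.

Section configurations.
Context (R : realType) (dim N : nat).
Notation E := 'rV[R]_dim.
Notation D := (skorohod dim (+oo : \bar R)).
Notation conf := (prodspace 'I_N D).

Definition glue_all (z : conf) s (w : conf) : conf := fun i => glue (z i) s (w i).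
Definition stop_all (z : conf) s : conf := fun i => stop (z i) s.
Definition prestop_all (z : conf) s : conf := fun i => prestop (z i) s.
Definition shift_all (z : conf) s : conf := fun i => window s +oo%E (z i).
Definition values (z : conf) s : prodspace 'I_N E := fun i => z i s.

Context dW (W : measurableType dW).
Implicit Types (z w : W -> conf) (s : W -> R).

Let mc z i : measurable_fun setT z -> measurable_fun setT (fun x => z x i).
Proof. exact: (measurableT_comp (@measurable_coord _ _ _ _)). Qed.

Lemma measurable_glue_all z s w : measurable_fun setT z -> measurable_fun setT s ->
  measurable_fun setT w -> measurable_fun setT (fun x => glue_all (z x) (s x) (w x)).
Proof.
move=> mz ms mw; apply: measurable_prodspace => i.
by apply: measurable_glue => //; exact: mc.
Qed.

Lemma measurable_stop_all z s : measurable_fun setT z -> measurable_fun setT s ->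
  measurable_fun setT (fun x => stop_all (z x) (s x)).
Proof.
move=> mz ms; apply: measurable_prodspace => i.
by apply: measurable_stop => //; exact: mc.
Qed.

Lemma measurable_prestop_all z s : measurable_fun setT z -> measurable_fun setT s ->
  measurable_fun setT (fun x => prestop_all (z x) (s x)).
Proof.
move=> mz ms; apply: measurable_prodspace => i.
by apply: measurable_prestop => //; exact: mc.
Qed.

Lemma measurable_shift_all z s : measurable_fun setT z -> measurable_fun setT s ->
  measurable_fun setT (fun x => shift_all (z x) (s x)).
Proof.
move=> mz ms; apply: measurable_prodspace => i.
by apply: measurable_shift => //; exact: mc.
Qed.

Lemma measurable_values z s : measurable_fun setT z -> measurable_fun setT s ->
  measurable_fun setT (fun x => values (z x) (s x)).
Proof.
move=> mz ms; apply: measurable_prodspace => i.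
by apply: measurable_eval_at => //; exact: mc.
Qed.

End configurations.

Lemma extend_window (R : realType) (dim : nat) (s u : R) (z : skorohod dim (+oo%E : \bar R)) :
  0 <= u -> extend (window s u%:E z) = stop (window s +oo%E z) u.
Proof.
move=> u0; apply: path_ext => t; rewrite /= (max_r (_ : 0 <= Num.min _ u))//.
by rewrite le_min u0 le_max lexx.
Qed.

Lemma extend_window0 (R : realType) (dim : nat) (u : R) (z : skorohod dim (+oo%E : \bar R)) :
  0 <= u -> extend (window 0 u%:E z) = stop z u.
Proof. by move=> u0; apply: path_ext => t; rewrite /= add0r. Qed.

Lemma shift_glue (R : realType) (dim : nat) (s : R) (z w : skorohod dim (+oo%E : \bar R)) :
  0 <= s -> window s +oo%E (glue z s w) = w.
Proof.
move=> s0; apply: path_ext => t; rewrite /= /glue_fun.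
have h : 0 <= s + Num.max 0 t by rewrite addr_ge0// le_max lexx.
by rewrite (max_r h) ltNge lerDl le_max lexx /= [s + _]addrC addrK path_max0.
Qed.

(** The pi-system may generate a smaller sigma-algebra than that of [T], such as the observable
    past; the two measures may differ outside it. *)
Lemma eq_on_generated (R : realType) dT (T : measurableType dT)
    (m1 m2 : {measure set T -> \bar R}) (G : set (set T)) :
  setI_closed G -> G setT -> G `<=` measurable -> (m1 setT < +oo)%E ->
  (forall C, G C -> m1 C = m2 C) -> forall C, <<s G>> C -> m1 C = m2 C.
Proof.
move=> GI GT Gm fin eqG.
have mG C : <<s G>> C -> measurable C.
  by apply: smallest_sub => //; exact: sigma_algebra_measurable.
have fin2 : (m2 setT < +oo)%E by rewrite -eqG.
suff h : <<s G>> `<=` [set C | <<s G>> C /\ m1 C = m2 C] by move=> C /h[].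
apply: lambda_system_subset => //.
  apply/dynkin_lambda_system; split.
  - by split; [exact: sub_gen_smallest|exact: eqG].
  - move=> C [sC eC]; split.
      exact: (@measurableC _ (g_sigma_algebraType G)).
    have mC := mG _ sC.
    have h (m : {measure set T -> \bar R}) : (m setT < +oo -> m (~` C) = m setT - m C)%E.
      by move=> f; rewrite -setTD measureD// setTI.
    by rewrite !h// eC (eqG _ GT).
  - move=> F tF hF; split.
      by apply: (@bigcupT_measurable _ (g_sigma_algebraType G)) => i; exact: (hF i).1.
    rewrite !measure_bigcup//; [|by move=> i _; apply: mG; exact: (hF i).1..].
    by apply: eq_eseriesr => i _; exact: (hF i).2.
by move=> C GC; split; [exact: sub_gen_smallest|exact: eqG].
Qed.

Section evolution.
Context (R : realType) (dim N : nat).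
Notation E := 'rV[R]_dim.
Notation D := (skorohod dim (+oo : \bar R)).
Notation conf := (prodspace 'I_N D).
Notation Q := (pair_index N).
Notation gapsp := (prodspace (Q * nat)%type R).
Variables (Lam : R) (Px : R.-pker E ~> D) (muhat : R.-ker (E * E)%type ~> (E * E)%type).
Variables (P0 : probability E R) (dO : measure_display) (Omega : measurableType dO).
Variables (P : probability Omega R) (tau : Q -> nat -> {RV P >-> R}) (Z : 'I_N -> {RV P >-> D}).
Hypothesis hps : particle_system Lam Px muhat P0 tau Z.
Local Open Scope ereal_scope.

Definition clocks (w : Omega) : gapsp := fun x => gap tau x.1 x.2 w.
Definition particles (w : Omega) : conf := fun i => Z i w.

Lemma measurable_particles : measurable_fun setT particles.
Proof. by apply: measurable_prodspace => i; exact: measurable_funPT. Qed.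

Lemma measurable_clocks_sub (H : set (set Omega)) :
  (forall p n, measurable_fun [set: g_sigma_algebraType H] (tau p n : Omega -> R)) ->
  measurable_fun [set: g_sigma_algebraType H] clocks.
Proof.
move=> mt; apply: measurable_prodspace => -[p n]; rewrite /clocks /gap /=.
case: n => [|n]; apply: measurable_funB => //; exact: measurable_cst.
Qed.

Lemma measurable_clocks : measurable_fun setT clocks.
Proof.
apply: measurable_prodspace => -[p n]; rewrite /clocks /gap /=.
case: n => [|n]; apply: measurable_funB => //; exact: measurable_cst.
Qed.

Definition startk (ls : seq 'I_N) : R.-pker (prodspace 'I_N E) ~> conf :=
  prodker (fun i => kcomap Px (@measurable_coord _ _ E i)) ls.

Variables (ls : seq 'I_N).
Hypotheses (uls : uniq ls) (fls : forall i, i \in ls).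

Section constant_delay.
Variables (e : option (Q * nat)) (q : R) (A : set gapsp) (s : gapsp -> R).
Hypotheses (q0 : (0 <= q)%R) (mA : measurable A) (ms : measurable_fun setT s).
Hypothesis s0 : forall c, (0 <= s c)%R.
Hypothesis sE : forall w, A (clocks w) -> start_time tau e w = s (clocks w).
Hypothesis Aq : forall w, A (clocks w) -> quiet tau (start_time tau e) q w.

Let O := clocks @^-1` A.
Let mO : measurable O.
Proof. by rewrite -[X in measurable X]setTI; exact: measurable_clocks. Qed.

Let sigma := start_time tau e.
Let msigma : measurable_fun setT sigma.
Proof. by rewrite /sigma; case: e => [x|]; [exact: measurable_funPT|exact: measurable_cst]. Qed.

Let h w := (clocks w, stop_all (particles w) (sigma w)).
Let v w := stop_all (shift_all (particles w) (sigma w)) q.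

Let mh : measurable_fun setT h.
Proof.
apply: measurable_fun_pair; first exact: measurable_clocks.
by apply: measurable_stop_all => //; exact: measurable_particles.
Qed.

Let mv : measurable_fun setT v.
Proof.
apply: measurable_stop_all; last exact: measurable_cst.
by apply: measurable_shift_all => //; exact: measurable_particles.
Qed.

Let mread : measurable_fun setT (fun x : gapsp * conf => values x.2 (s x.1)).
Proof.
apply: measurable_values; first exact: measurable_snd.
exact: (measurableT_comp ms measurable_fst).
Qed.

Let mstopq dW (W : measurableType dW) : measurable_fun setT (fun x : W * conf => stop_all x.2 q).
Proof. by apply: measurable_stop_all; [exact: measurable_snd|exact: measurable_cst]. Qed.

Let k : R.-pker (gapsp * conf)%type ~> conf :=
  kbind (kcomap (startk ls) mread) (@kdirac _ _ _ _ R _ (@mstopq _ (gapsp * conf)%type)).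

Let kC x (B : 'I_N -> set D) : (forall i, measurable (B i)) ->
  k x [set z | forall i, i \in ls -> B i (z i)] =
  \prod_(i < N) Px (x.2 i (s x.1)) ((fun w => stop w q) @^-1` B i).
Proof.
move=> mB.
have mC : measurable [set z : conf | forall i, i \in ls -> B i (z i)].
  have -> : [set z : conf | forall i, i \in ls -> B i (z i)] =
      \big[setI/setT]_(i <- ls) ((fun z => z i) @^-1` B i).
    by rewrite -bigcap_seq; apply/seteqP; split => z hz i /hz.
  apply: bigsetI_measurable => i _; rewrite -[X in measurable X]setTI.
  exact: measurable_coord.
have mi : measurable_fun setT (fun z : conf => (\1_[set z : conf | forall i, i \in ls -> B i (z i)] z)%:E : \bar R).
  by apply/measurable_EFinP; exact: measurable_indic.
have mst : measurable_fun setT (fun w : D => stop w q).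
  by apply: measurable_stop => //; exact: measurable_cst.
have mB' i : measurable ((fun w : D => stop w q) @^-1` B i).
  by rewrite -[X in measurable X]setTI; exact: mst.
have i0 z : 0 <= (\1_[set z : conf | forall i, i \in ls -> B i (z i)] z)%:E :> \bar R.
  by rewrite lee_fin.
transitivity (\int[k x]_z (\1_[set z : conf | forall i, i \in ls -> B i (z i)] z)%:E).
  by rewrite integral_indic ?setIT.
apply: (etrans (integral_kbind _ _ _ i0 mi)).
transitivity (startk ls (values x.2 (s x.1))
    [set z | forall i, i \in ls -> ((fun w : D => stop w q) @^-1` B i) (z i)]).
  have mC' : measurable [set z : conf | forall i, i \in ls -> B i (stop_all z q i)].
    rewrite -[X in measurable X]setTI.
    by apply: (@measurable_stop_all R dim N _ conf id (cst q)) mC => //; exact: measurable_cst.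
  transitivity (\int[startk ls (values x.2 (s x.1))]_z
      (\1_[set z : conf | forall i, i \in ls -> B i (stop_all z q i)] z)%:E).
    by apply: eq_integral => z _; rewrite integral_kdirac.
  by rewrite integral_indic ?setIT.
apply: (etrans (prodker_cylinder _ _ uls mB')).
rewrite [RHS](perm_big ls) //.
rewrite uniq_perm ?index_enum_uniq// => i; by rewrite mem_index_enum fls.
Qed.

Let Hgen : set (set Omega) := clock_events tau `|`
  gen_family (fun (x : 'I_N * R) w => Z x.1 w (Num.min x.2 (sigma w)) : E).

Let hist A' : measurable A' -> history tau Z sigma (O `&` h @^-1` A').
Proof.
move=> mA'; have mcl : measurable_fun [set: g_sigma_algebraType Hgen] clocks.
  apply: measurable_clocks_sub => p n _ B mB; rewrite setTI.
  by apply: sub_gen_smallest; left; exists (p, n), B.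
have mst : measurable_fun [set: g_sigma_algebraType Hgen] (fun w => stop_all (particles w) (sigma w)).
  apply: measurable_prodspace => i; apply: measurable_path => t _ B mB; rewrite setTI.
  by apply: sub_gen_smallest; right; exists (i, Num.max 0%R t), B.
have mhs : measurable_fun [set: g_sigma_algebraType Hgen] h by exact: measurable_fun_pair.
apply: (@measurableI _ (g_sigma_algebraType Hgen)); rewrite -[X in measurable X]setTI.
  exact: mcl.
exact: mhs.
Qed.

Let law A' B : measurable A' -> cylinders (fun i (z : conf) => z i) B ->
  P (O `&` h @^-1` A' `&` v @^-1` B) = \int[P]_(w in O `&` h @^-1` A') k (h w) B.
Proof.
move=> mA' [S [B0 [_ [mB0 BE]]]].
(* Coordinates left free by the cylinder receive the whole space, which gives a condition on all
   particles. *)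
pose B1 i := if i \in S then B0 i else setT.
have mB1 i : measurable (B1 i) by rewrite /B1; case: ifP.
have {}BE : B = [set z | forall i, i \in ls -> B1 i (z i)].
  rewrite BE; apply/seteqP; split => z hz i.
    by move=> _; rewrite /B1; case: ifP => // iS; exact: hz.
  by move=> iS; have := hz i (fls i); rewrite /B1 iS.
pose B2 i := (@extend R dim q) @^-1` B1 i.
have mB2 i : measurable (B2 i).
  by rewrite -[X in measurable X]setTI; exact: measurable_extend.
(* On [O] the interval is quiet, so the event [quiet] can be inserted into and removed from the
   intersection. *)
have OQ : O `&` h @^-1` A' `&` quiet tau sigma q = O `&` h @^-1` A'.
  by apply/seteqP; split => w; [case|move=> [Ow hw]; do !split => //; exact: Aq].
have := @ps_evolution _ _ _ _ _ _ _ _ _ _ _ _ hps e q _ B2 q0 (hist mA') mB2.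
rewrite OQ => ev; transitivity (P (O `&` h @^-1` A' `&`
   [set w | forall i, B2 i (window (sigma w) q%:E (Z i w))])).
  congr (P (_ `&` _)); apply/seteqP; split => w; rewrite BE /= => hw i.
    by rewrite /B2 /= extend_window//; exact: hw.
  by move=> _; have := hw i; rewrite /B2 /= extend_window.
rewrite ev; apply: eq_integral => w /set_mem[Ow _].
rewrite BE kC//; apply: eq_bigr => i _.
have -> : stop_all (particles w) (sigma w) i (s (clocks w)) = Z i w (sigma w) :> E.
  rewrite /stop_all stopE -(sE Ow) -/sigma min_r// ?le_max ?lexx ?orbT//.
congr (Px _ _); apply/seteqP; split => y; by rewrite /B2 /= extend_window0.
Qed.

(** [ps_evolution] for a fixed delay [q], on an event [O] of the clocks that excludes any ring
    within [q] of the start. The joint law of the clocks, the past and the next [q] units of time is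
    computed, and [stop_glue] reassembles the path. *)
Lemma evolution_delay F : (forall x, 0 <= F x) -> measurable_fun [set: gapsp * conf] F ->
  \int[P]_(w in O) F (clocks w, stop_all (particles w) (s (clocks w) + q)%R) =
  \int[P]_(w in O) \int[startk ls (values (particles w) (s (clocks w)))]_y
    F (clocks w, stop_all (glue_all (particles w) (s (clocks w)) y) (s (clocks w) + q)%R).
Proof.
move=> F0 mF.
pose F' (x : (gapsp * conf) * conf) := F (x.1.1, glue_all x.1.2 (s x.1.1) x.2).
have mF' : measurable_fun setT F'.
  apply: measurableT_comp => //; apply: measurable_fun_pair.
    exact: (measurableT_comp measurable_fst measurable_fst).
  apply: measurable_glue_all; last exact: measurable_snd.
    exact: (measurableT_comp measurable_snd measurable_fst).
  apply: (measurableT_comp ms).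
  exact: (measurableT_comp measurable_fst measurable_fst).
have main := @integral_joint_law _ _ _ _ _ _ _ P O h v k
  (cylinders (fun i (z : conf) => z i)) mO mh mv (@generated_cylinders _ _ _ _ _)
  (@setI_cylinders _ _ _ _ _) (@cylindersT _ _ _ _ _) law F' (fun x => F0 _) mF'.
have sg w : O w -> sigma w = s (clocks w) by move=> Ow; exact: sE.
have vE z r : (0 <= r)%R ->
    glue_all (stop_all z r) r (stop_all (shift_all z r) q) = stop_all z (r + q)%R.
  by move=> r0; apply/funext => i; rewrite /glue_all /stop_all stop_glue.
transitivity (\int[P]_(w in O) F' (h w, v w)).
  apply: eq_integral => w /set_mem Ow; rewrite /F' /h /v /= (sg w Ow) vE//.
rewrite main; apply: eq_integral => w /set_mem Ow.
have mFh : measurable_fun setT (fun y => F' (h w, y)).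
  by apply: measurableT_comp => //; apply: measurable_fun_pair => //; exact: measurable_cst.
apply: (etrans (integral_kbind _ _ _ (fun y => F0 _) mFh)).
have vh : values (h w).2 (s (h w).1) = values (particles w) (s (clocks w)).
  apply/funext => i; rewrite /values [RHS](_ : _ = stop (Z i w) (sigma w) (s (clocks w)))//.
  by rewrite stopE (sg w Ow) min_r// le_max lexx orbT.
transitivity (\int[startk ls (values (h w).2 (s (h w).1))]_y F' (h w, stop_all y q)).
  by apply: eq_integral => y _; exact: (integral_kdirac _ _ mFh).
rewrite vh; apply: eq_integral => y _; rewrite /F' /h /= (sg w Ow) -vE//.
congr (F (_, _)); apply/funext => i; rewrite /glue_all /stop_all /shift_all /=.
by rewrite shift_glue// !glue_stop// glue_same.
Qed.

End constant_delay.
Section until_next.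
Variables (e : option (Q * nat)) (A : set gapsp) (s u : gapsp -> R).
Hypotheses (mA : measurable A) (ms : measurable_fun setT s) (mu : measurable_fun setT u).
Hypothesis s0 : forall c, (0 <= s c)%R.
Hypothesis su : forall c, (s c < u c)%R.
Hypothesis sE : forall w, A (clocks w) -> start_time tau e w = s (clocks w).
Hypothesis Au : forall w p n, A (clocks w) -> ~ (s (clocks w) < tau p n w < u (clocks w))%R.

Let O := clocks @^-1` A.
Let mO : measurable O.
Proof. by rewrite -[X in measurable X]setTI; exact: measurable_clocks. Qed.

Let Poo : P O < +oo. Proof. by rewrite (le_lt_trans (probability_le1 P mO)) ?ltry. Qed.

Let psi (x : gapsp * conf) := (x.1, prestop_all x.2 (u x.1)).

(** Events that can be read at a fixed delay after [s] and still before [u]. They form a pi-system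
    because an observation up to the later of two delays contains the one up to the earlier. *)
Let G : set (set (gapsp * conf)) := [set C | exists q B, [/\ (0 <= q)%R, measurable B &
  C = [set x | (s x.1 + q < u x.1)%R /\ B (x.1, stop_all x.2 (s x.1 + q)%R)]]].

Let mfst : measurable_fun [set: gapsp * conf] fst. Proof. exact: measurable_fst. Qed.
Let msq q : measurable_fun setT (fun x : gapsp * conf => s x.1 + q)%R.
Proof. by apply: measurable_funD; [exact: (measurableT_comp ms)|exact: measurable_cst]. Qed.
Let mst q : measurable_fun setT
  (fun x : gapsp * conf => (x.1, stop_all x.2 (s x.1 + q)%R)).
Proof.
apply: measurable_fun_pair => //; apply: measurable_stop_all => //; exact: measurable_snd.
Qed.

Let mG : G `<=` measurable.
Proof.
move=> _ [q [B [q0 mB ->]]].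
rewrite (_ : [set _ | _] = [set x | s x.1 + q < u x.1]%R `&`
  (fun x => (x.1, stop_all x.2 (s x.1 + q)%R)) @^-1` B)//.
apply: measurableI; first by apply: measurable_ltr => //; exact: (measurableT_comp mu).
by rewrite -[X in measurable X]setTI; exact: mst.
Qed.

Let GT : G setT.
Proof.
exists 0%R, setT; split => //; apply/seteqP; split => // x _ /=.
by rewrite addr0; split.
Qed.

Let GI : setI_closed G.
Proof.
suff h q B q' B' : (0 <= q <= q')%R -> measurable B -> measurable B' ->
    G ([set x | (s x.1 + q < u x.1)%R /\ B (x.1, stop_all x.2 (s x.1 + q)%R)] `&`
       [set x | (s x.1 + q' < u x.1)%R /\ B' (x.1, stop_all x.2 (s x.1 + q')%R)]).
  move=> _ _ [q [B [q0 mB ->]]] [q' [B' [q'0 mB' ->]]].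
  have [qq'|/ltW qq'] := leP q q'; first by apply: h => //; rewrite q0.
  by rewrite setIC; apply: h => //; rewrite q'0.
move=> /andP[q0 qq'] mB mB'.
exists q', (B' `&` ((fun x => (x.1, stop_all x.2 (s x.1 + q)%R)) @^-1` B)); split.
- exact: le_trans qq'.
- by apply: measurableI => //; rewrite -[X in measurable X]setTI; exact: mst.
have sst (x : gapsp * conf) : stop_all (stop_all x.2 (s x.1 + q')) (s x.1 + q) = stop_all x.2 (s x.1 + q).
  apply/funext => i; apply: path_ext => t; rewrite /stop_all !stopE.
  have sq : (0 <= s x.1 + q)%R by rewrite addr_ge0.
  rewrite (max_r (_ : (0 <= Num.min (Num.max 0%R t) (s x.1 + q))%R)); last first.
    by rewrite le_min sq le_max lexx.
  by congr (path_fun _ _); rewrite min_l// ge_min lerD2l qq' orbT.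
apply/seteqP; split => x /=.
  by move=> [[h1 h2] [h3 h4]]; split => //; split => //; rewrite sst.
move=> [h1 [h2 h3]]; rewrite -sst; split => //; split => //.
by rewrite (le_lt_trans _ h1)// lerD2l.
Qed.

(** For [t < u] some rational delay [q >= 0] has [t <= s + q < u], so rational delays reveal the
    whole path strictly before [u]; [su] leaves room for them when [t] precedes [s]. *)
Let mpsi : measurable_fun [set: g_sigma_algebraType G] psi.
Proof.
have gfst : measurable_fun [set: g_sigma_algebraType G] (fst : gapsp * conf -> gapsp).
  move=> _ B mB; rewrite setTI; apply: sub_gen_smallest.
  exists 0%R, (B `*` setT); split => //; first exact: measurableX.
  by apply/seteqP; split => x /=; [move=> Bx; rewrite addr0; do !split|move=> [_ []]].
apply: measurable_fun_pair => //; apply: measurable_prodspace => i.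
apply: (@measurable_prestop_hist R dim _ (g_sigma_algebraType G) (u \o fst)
   (fun x : gapsp * conf => x.2 i)).
  exact: (measurableT_comp mu gfst).
move=> t B t0 mB.
rewrite (_ : [set w | _] = \bigcup_(q in [set: rat])
  (if (0 <= ratr q :> R)%R then [set x | (s x.1 + ratr q < u x.1)%R /\
     [set y : gapsp * conf | (t <= s y.1 + ratr q)%R /\ B (y.2 i t)]
       (x.1, stop_all x.2 (s x.1 + ratr q)%R)] else set0)); last first.
  have key (x : gapsp * conf) (q : R) : (t <= s x.1 + q)%R ->
      stop_all x.2 (s x.1 + q) i t = x.2 i t.
    by move=> h; rewrite /stop_all stopE (max_r t0) min_l.
  apply/seteqP; split => x /=.
    move=> [tu Bx]; have /rat_in_itvoo[q] : (Num.max 0%R (t - s x.1) < u x.1 - s x.1)%R.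
      by rewrite gt_max subr_gt0 su ltrD2r.
    rewrite in_itv/= gt_max => /andP[/andP[q0 q1] q2].
    exists q => //; rewrite (ltW q0) /=.
    have tq : (t <= s x.1 + ratr q)%R by rewrite addrC -lerBlDr ltW.
    split; first by rewrite addrC -ltrBrDr.
    by split => //; move: Bx; rewrite -(key x _ tq).
  move=> [q _]; case: ifP => // q0 /= [h1 [h2 h3]].
  by split; [exact: le_lt_trans h1|rewrite -(key x _ h2); exact: h3].
apply: bigcupT_measurable_rat => q; case: ifP => q0; last exact: measurable0.
apply: sub_gen_smallest.
exists (ratr q), [set y : gapsp * conf | (t <= s y.1 + ratr q)%R /\ B (y.2 i t)]; split => //.
rewrite (_ : [set _ | _] = [set y : gapsp * conf | t <= s y.1 + ratr q]%R `&`
  (fun y : gapsp * conf => y.2 i t : E) @^-1` B)//.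
apply: measurableI.
  rewrite -[X in measurable X]setTI; apply: measurable_fun_ler => //; exact: measurable_cst.
rewrite -[X in measurable X]setTI.
apply: (measurable_eval_at (t := fun=> t)) => //.
exact: (measurableT_comp (@measurable_coord _ _ _ i) measurable_snd).
Qed.

Let m := mfrestr mO Poo.
Let mcp : measurable_fun setT (fun w => (clocks w, particles w)).
Proof. by apply: measurable_fun_pair; [exact: measurable_clocks|exact: measurable_particles]. Qed.

Let mread : measurable_fun setT (fun w => values (particles w) (s (clocks w))).
Proof.
apply: measurable_values; first exact: measurable_particles.
exact: (measurableT_comp ms measurable_clocks).
Qed.

Let mout : measurable_fun setT
  (fun x : Omega * conf => (clocks x.1, glue_all (particles x.1) (s (clocks x.1)) x.2)).
Proof.
apply: measurable_fun_pair; first exact: (measurableT_comp measurable_clocks measurable_fst).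
apply: measurable_glue_all; last exact: measurable_snd.
  exact: (measurableT_comp measurable_particles measurable_fst).
apply: (measurableT_comp ms); exact: (measurableT_comp measurable_clocks measurable_fst).
Qed.

Let m1 := mbind m (@kdirac _ _ _ _ R _ mcp).
Let m2 := mbind m (kbind (kcomap (startk ls) mread) (@kdirac _ _ _ _ R _ mout)).

Let e1 f : (forall x, 0 <= f x) -> measurable_fun setT f ->
  \int[m1]_x f x = \int[P]_(w in O) f (clocks w, particles w).
Proof.
move=> f0 mf; apply: (etrans (integral_mbind _ _ f0 mf)).
rewrite -(integral_mrestr _ mO)//; last exact: measurableT_comp.
by apply: eq_integral => w _; rewrite integral_kdirac.
Qed.

Let e2 f : (forall x, 0 <= f x) -> measurable_fun setT f ->
  \int[m2]_x f x = \int[P]_(w in O)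
    \int[startk ls (values (particles w) (s (clocks w)))]_y
      f (clocks w, glue_all (particles w) (s (clocks w)) y).
Proof.
move=> f0 mf; apply: (etrans (integral_mbind _ _ f0 mf)).
have mk : measurable_fun setT (fun w => \int[kcomap (startk ls) mread w]_y
    f (clocks w, glue_all (particles w) (s (clocks w)) y)).
  exact: (measurable_integral_pker (kcomap (startk ls) mread) (fun x => f0 _) (measurableT_comp mf mout)).
rewrite -(integral_mrestr _ mO mk)//; last by move=> w; exact: integral_ge0.
apply: eq_integral => w _; apply: (etrans (integral_kbind _ _ _ f0 mf)).
by apply: eq_integral => y _; rewrite integral_kdirac.
Qed.

Let eqG C : G C -> m1 C = m2 C.
Proof.
move=> GC; have mC := mG GC; case: GC => q [B [q0 mB CE]].
have mi : measurable_fun setT (fun x => (\1_C x)%:E : \bar R).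
  by apply/measurable_EFinP; exact: measurable_indic.
have i0 x : 0 <= (\1_C x)%:E :> \bar R by rewrite lee_fin.
transitivity (\int[m1]_x (\1_C x)%:E); first by rewrite integral_indic ?setIT.
transitivity (\int[m2]_x (\1_C x)%:E); last by rewrite integral_indic ?setIT.
apply: (etrans (e1 i0 mi)); apply: (etrans _ (esym (e2 i0 mi))).
(* Restricting to clocks with [s + q < u] makes the delay [q] admissible for [evolution_delay]. *)
pose Aq := A `&` [set c | s c + q < u c]%R.
have mAq : measurable Aq.
  apply: measurableI => //; apply: measurable_ltr => //.
  by apply: measurable_funD => //; exact: measurable_cst.
pose F x := (\1_B x)%:E : \bar R.
have mF : measurable_fun setT F by apply/measurable_EFinP; exact: measurable_indic.
have F0 x : 0 <= F x by rewrite lee_fin.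
have := @evolution_delay e q Aq s q0 mAq ms s0 _ _ F F0 mF.
have sub (f f' : Omega -> \bar R) : (forall w, O w -> f w = if clocks w \in Aq then f' w else 0) ->
    \int[P]_(w in O) f w = \int[P]_(w in clocks @^-1` Aq) f' w.
  move=> ff; rewrite integral_mkcond [RHS]integral_mkcond; apply: eq_integral => w _.
  rewrite !patchE; case: ifPn => wO.
    rewrite ff ?inE//; last exact: set_mem.
    have -> : (w \in clocks @^-1` Aq) = (clocks w \in Aq) by apply/idP/idP => /set_mem h; apply/mem_set.
  by rewrite ifN//; apply: contraNN wO => /set_mem[h _]; apply/mem_set.
move=> main; rewrite (sub _ (fun w => F (clocks w, stop_all (particles w) (s (clocks w) + q)%R))).
  rewrite main.
  - apply/esym/sub => w Ow; case: ifPn => wA.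
      apply: eq_integral => y _; rewrite /F !indicE; congr (_%:R%:E); congr nat_of_bool.
      apply/idP/idP => [/set_mem|/set_mem h]; first by rewrite CE => -[_ h]; exact: mem_set.
      by apply/mem_set; rewrite CE; split => //; have [_] := set_mem wA.
    rewrite integral0_eq// => y _; rewrite indicE memNset// CE => -[h _].
    by move/negP: wA; apply; apply/mem_set; split.
  - by move=> w [Aw _]; exact: sE.
  - move=> w [Aw h] p n /andP[h1 h2]; apply: (@Au w p n Aw); rewrite -(sE Aw) h1 /=.
    by rewrite (le_lt_trans h2)// sE.
move=> w Ow; rewrite /F !indicE CE; case: ifPn => wA.
  congr (_%:R%:E); congr nat_of_bool; have [_ wA2] := set_mem wA.
  by apply/idP/idP => /set_mem h; apply/mem_set; [case: h|split].
rewrite memNset// => -[h _]; by move/negP: wA; apply; apply/mem_set; split.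
Qed.

(** The time until the next event is random, whereas [ps_evolution] has a fixed delay. Fixed delays
    identify the two laws on [G], hence on the sigma-algebra of the clocks and the paths strictly
    before [u], and by [hF] the integrand depends on nothing else. *)
Lemma evolution_until F : (forall x, 0 <= F x) -> measurable_fun [set: gapsp * conf] F ->
  (forall c z, A c -> F (c, z) = F (c, prestop_all z (u c))) ->
  \int[P]_(w in O) F (clocks w, particles w) =
  \int[P]_(w in O) \int[startk ls (values (particles w) (s (clocks w)))]_y
    F (clocks w, glue_all (particles w) (s (clocks w)) y).
Proof.
move=> F0 mF hF.
have mpsi' : measurable_fun setT psi.
  apply: measurable_fun_pair => //; apply: measurable_prestop_all; first exact: measurable_snd.
  exact: (measurableT_comp mu).
have mFp : measurable_fun setT (F \o psi) by exact: measurableT_comp.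
have Fp0 x : 0 <= (F \o psi) x by exact: F0.
transitivity (\int[m1]_x (F \o psi) x).
  apply: (etrans _ (esym (e1 Fp0 mFp))).
  by apply: eq_integral => w /set_mem Ow; exact: hF.
transitivity (\int[m2]_x (F \o psi) x); last first.
  apply: (etrans (e2 Fp0 mFp)).
  by apply: eq_integral => w /set_mem Ow; apply: eq_integral => y _; apply/esym/hF.
have push (mm : {measure set (gapsp * conf)%type -> \bar R}) :
    \int[pushforward mm psi]_x F x = \int[mm]_x (F \o psi) x.
  by rewrite ge0_integral_pushforward.
rewrite -!push.
apply: eq_measure_integral => C mC _; rewrite /pushforward.
apply: (eq_on_generated GI GT mG _ eqG); last first.
  by rewrite -[X in <<s _ >> X]setTI; exact: mpsi.
rewrite /m1 mbindE (eq_integral (cst 1)); last by move=> w _; exact: prob_kernel.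
by rewrite integral_cst// mul1e; exact: fin_num_fun_lty.
Qed.

End until_next.
End evolution.

End PartX1.

(** * One interaction: jump, then restart *)

Module PartX2.
Import PartA PartB PartC PartD PartF PartH PartL PartM PartU PartV PartW PartX1.

Section event_step.
Context (R : realType) (dim N : nat).
Notation E := 'rV[R]_dim.
Notation D := (skorohod dim (+oo : \bar R)).
Notation conf := (prodspace 'I_N D).
Notation Q := (pair_index N).
Notation gapsp := (prodspace (Q * nat)%type R).
Variables (Lam : R) (hLam : 0 < Lam) (Px : R.-pker E ~> D).
Variables (muhat : R.-ker (E * E)%type ~> (E * E)%type).
Hypothesis muhat_bound : forall v w, (muhat (v, w) setT <= Lam%:E)%E.
Variables (P0 : probability E R) (dO : measure_display) (Omega : measurableType dO).
Variables (P : probability Omega R) (tau : Q -> nat -> {RV P >-> R}) (Z : 'I_N -> {RV P >-> D}).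
Hypothesis hps : particle_system Lam Px muhat P0 tau Z.
Local Open Scope ereal_scope.
Notation clocks := (clocks tau).
Notation particles := (particles Z).

Let mclocks := measurable_clocks tau.
Let mparticles := measurable_particles Z.

Section jump.
Variables (p : Q) (n : nat) (A : set gapsp) (s : gapsp -> R).
Hypotheses (mA : measurable A) (ms : measurable_fun setT s).
Hypothesis s0 : forall c, (0 < s c)%R.
Hypothesis sE : forall w, A (clocks w) -> tau p n w = s (clocks w) :> R.

Let O := clocks @^-1` A.
Let mO : measurable O.
Proof. by rewrite -[X in measurable X]setTI; exact: mclocks. Qed.

Definition displacement (z : conf) (t : R) (i : 'I_N) : E := (z i t - left_val (z i) t)%R.

Lemma measurable_displacement dW (W : measurableType dW) (z : W -> conf) (t : W -> R) i :
  measurable_fun setT z -> measurable_fun setT t ->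
  measurable_fun setT (fun w => displacement (z w) (t w) i).
Proof.
move=> mz mt; have mzi := measurableT_comp (@measurable_coord _ _ D i) mz.
by apply: measurable_rVB; [exact: measurable_eval_at|exact: measurable_left_val].
Qed.

Let h w := (clocks w, prestop_all (particles w) (tau p n w)).
Let v w := (displacement (particles w) (s (clocks w)) (lo_of p),
            displacement (particles w) (s (clocks w)) (hi_of p)).

Let msc : measurable_fun setT (fun w => s (clocks w)).
Proof. exact: (measurableT_comp ms mclocks). Qed.

Let mh : measurable_fun setT h.
Proof. by apply: measurable_fun_pair => //; apply: measurable_prestop_all => //; exact: measurable_funPT. Qed.

Let mv : measurable_fun setT v.
Proof. by apply: measurable_fun_pair; exact: measurable_displacement. Qed.

Let mcoord (i : 'I_N) : measurable_fun setT (fun x : gapsp * conf => x.2 i).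
Proof. exact: (measurableT_comp (@measurable_coord _ _ _ _) measurable_snd). Qed.

Let mleft : measurable_fun setT (fun x : gapsp * conf =>
  (left_val (x.2 (lo_of p)) (s x.1), left_val (x.2 (hi_of p)) (s x.1))).
Proof.
have ms1 : measurable_fun setT (fun x : gapsp * conf => s x.1).
  exact: (measurableT_comp ms measurable_fst).
by apply: measurable_fun_pair; apply: measurable_left_val.
Qed.

Let Hgen : set (set Omega) := clock_events tau `|`
  [set A | exists i t B, [/\ (0 <= t)%R, measurable B &
    A = [set omega | (t < tau p n omega)%R /\ B (Z i omega t)]]].

Let hist A' : measurable A' -> strict_history tau Z (tau p n) (O `&` h @^-1` A').
Proof.
move=> mA'; have mtau q m : measurable_fun [set: g_sigma_algebraType Hgen] (tau q m : Omega -> R).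
  move=> _ B mB; rewrite setTI.
  by apply: sub_gen_smallest; left; exists (q, m), B.
have mcl : measurable_fun [set: g_sigma_algebraType Hgen] clocks.
  exact: measurable_clocks_sub.
have mst : measurable_fun [set: g_sigma_algebraType Hgen] (fun w => prestop_all (particles w) (tau p n w)).
  apply: measurable_prodspace => i.
  apply: (@measurable_prestop_hist R dim _ (g_sigma_algebraType Hgen) (tau p n) (Z i)) => //.
  by move=> t B t0 mB; apply: sub_gen_smallest; right; exists i, t, B.
have mhs : measurable_fun [set: g_sigma_algebraType Hgen] h by exact: measurable_fun_pair.
apply: (@measurableI _ (g_sigma_algebraType Hgen)); rewrite -[X in measurable X]setTI.
  exact: mcl.
exact: mhs.
Qed.

Let law A' B : measurable A' -> measurable B ->
  P (O `&` h @^-1` A' `&` v @^-1` B) =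
  \int[P]_(w in O `&` h @^-1` A') kcomap (jk hLam muhat_bound) mleft (h w) B.
Proof.
move=> mA' mB.
have := @ps_jump _ _ _ _ _ _ _ _ _ _ _ _ hps p n _ B (hist mA') mB.
move=> hj; apply: etrans (etrans hj _).
  congr (P _); apply/seteqP; split => w /= [[Ow hw] Bw]; (split; first by []);
  move: Bw; rewrite /v /displacement /left_val /= s0 -!(sE Ow).
    by [].
  by [].
apply: eq_integral => w /set_mem[Ow _].
rewrite /kcomap /jk /= jumpmE /h /= -(sE Ow) /prestop_all !left_val_prestop.
by rewrite /left_val (sE Ow) s0.
Qed.

(** The integrand sees the configuration only through [prestop_all] and the displacements, so it
    suffices to know the law of the latter given the clocks and the strict past, which is
    [ps_jump]. *)
Lemma jump_at_event F : (forall x, 0 <= F x) -> measurable_fun [set: (gapsp * conf) * (E * E)] F ->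
  \int[P]_(w in O) F ((clocks w, prestop_all (particles w) (s (clocks w))), v w) =
  \int[P]_(w in O) \int[jk hLam muhat_bound (left_val (Z (lo_of p) w) (s (clocks w)),
      left_val (Z (hi_of p) w) (s (clocks w)))]_y
    F ((clocks w, prestop_all (particles w) (s (clocks w))), y).
Proof.
move=> F0 mF.
have gen : @measurable _ (E * E)%type = <<s measurable >>.
  by rewrite sigma_algebra_id//; exact: sigma_algebra_measurable.
have main := @integral_joint_law _ _ _ _ _ _ _ P O h v (kcomap (jk hLam muhat_bound) mleft)
  measurable mO mh mv gen (@measurableI _ _) (@measurableT _ _) law F F0 mF.
transitivity (\int[P]_(w in O) F (h w, v w)).
  by apply: eq_integral => w /set_mem Ow; rewrite /h (sE Ow).
rewrite main; apply: eq_integral => w /set_mem Ow.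
rewrite /h (sE Ow) /=.
by rewrite -(left_val_prestop (Z (lo_of p) w)) -(left_val_prestop (Z (hi_of p) w)).
Qed.

End jump.
(** Links the product law of all restarts with the sequential kernel [sites]: restarting one site
    does not change the left limits from which the other ones start. *)
Lemma resample_sites (x : prodspace 'I_N E) (t : seq 'I_N) (r : R) (z : conf) (F : conf -> \bar R) :
  uniq t -> (forall i, i \in t -> x i = left_val (z i) r) ->
  (forall z, 0 <= F z) -> measurable_fun setT F ->
  resample (fun i => kcomap Px (@measurable_coord _ _ E i)) (fun=> fun a b => glue a r b) x t F z =
  \int[sites (krefresh_left Px) t (r, z)]_y F y.
Proof.
elim: t z => [|i t ih] z; first by move=> _ _ F0 mF; rewrite integral_sites_nil.
rewrite cons_uniq => /andP[it ut] xt F0 mF.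
have I0 y : 0 <= \int[sites (krefresh_left Px) t (r, y)]_y F y by exact: integral_ge0.
have mI := measurable_kint (sites (krefresh_left Px) t) r F0 mF.
have mI2 : measurable_fun setT (fun y : D => \int[sites (krefresh_left Px) t (r, upd z i y)]_y F y).
  apply: (measurableT_comp mI); apply: measurable_upd => //; exact: measurable_cst.
apply: (etrans _ (esym (integral_sites_cons _ i t r z F0 mF))).
apply: (etrans _ (esym (integral_site _ i r z I0 mI))).
apply: (etrans _ (esym (integral_krefresh_left _ r (z i) (fun y => I0 _) mI2))).
rewrite /= -xt ?inE ?eqxx//; apply: eq_integral => y _; apply: ih => // j jt.
rewrite upd_neq; last by apply: contraNneq it => <-.
by apply: xt; rewrite inE jt orbT.
Qed.

Definition landing (p : Q) (z : conf) (t : R) (h : E * E) : prodspace 'I_N E := fun i =>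
  (left_val (z i) t + (if i == lo_of p then h.1 else if i == hi_of p then h.2 else 0))%R.

(** The interacting particles come first, so that the iterated integral of the product law takes the
    shape of [full_step]. *)
Definition event_order (p : Q) := [:: lo_of p, hi_of p & others p].

Lemma uniq_event_order p : uniq (event_order p).
Proof.
rewrite /event_order !cons_uniq uniq_others inE negb_or lo_neq_hi !mem_filter !eqxx ?andbF.
by rewrite ?andFb.
Qed.

Lemma mem_event_order p i : i \in event_order p.
Proof. by rewrite !inE mem_filter mem_enum; case: eqP => //= _; case: eqP. Qed.

Lemma landing_full_step p (z : conf) (t : R) (F : conf -> \bar R) : (forall z, 0 <= F z) -> measurable_fun setT F ->
  \int[jk hLam muhat_bound (left_val (z (lo_of p)) t, left_val (z (hi_of p)) t)]_h
    \int[startk Px (event_order p) (landing p z t h)]_y F (glue_all z t y) =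
  jop (@full_step _ _ _ hLam Px _ muhat_bound N) p t F z.
Proof.
move=> F0 mF; have ij := lo_neq_hi p; have uo := uniq_event_order p.
set i := lo_of p in ij *; set j := hi_of p in ij *.
have I0 y : 0 <= \int[sites (krefresh_left Px) (others p) (t, y)]_y F y by exact: integral_ge0.
have mI := measurable_kint (sites (krefresh_left Px) (others p)) t F0 mF.
have mI2 : measurable_fun setT (fun y : D * D =>
    \int[sites (krefresh_left Px) (others p) (t, upd (upd z i y.1) j y.2)]_y F y).
  apply: (measurableT_comp mI); apply: measurable_upd; last exact: measurable_snd.
  by apply: measurable_upd; [exact: measurable_cst|exact: measurable_fst].
apply: (etrans _ (esym (integral_kthen _ _ t z F0 mF))).
apply: (etrans _ (esym (integral_pairk _ i j t z I0 mI))).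
apply: (etrans _ (esym (integral_kinteract hLam Px muhat_bound t (z i) (z j) (fun y => I0 _) mI2))).
apply: eq_integral => h _.
have mG (k : 'I_N) (y : D) : measurable_fun setT ((fun a b => glue a t b) y : D -> D).
  by apply: measurable_glue => //; exact: measurable_cst.
have -> : (fun y => F (glue_all z t y)) = (fun y : conf => F (fun k => if k \in event_order p
    then glue (z k) t (y k) else z k)).
  by apply/funext => y; congr F; apply/funext => k; rewrite mem_event_order.
have res := @integral_prodker_resample R 'I_N _ _ _ _ (fun k => kcomap Px (@measurable_coord _ _ E k))
  (fun=> fun a b => glue a t b) mG (landing p z t h) (event_order p) F z uo F0 mF.
apply: (etrans res).
have <- : landing p z t h i = (left_val (z i) t + h.1)%R by rewrite /landing eqxx.
have <- : landing p z t h j = (left_val (z j) t + h.2)%R.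
  by rewrite /landing (eq_sym j) (negbTE ij) eqxx.
apply: eq_integral => y _; apply: eq_integral => y' _.
rewrite (upd_neq _ _ (_ : hi_of p != lo_of p)) 1?eq_sym//.
apply: resample_sites => //; first exact: uniq_others.
move=> k; rewrite mem_filter => /andP[/andP[ki kj] _].
by rewrite /landing (negbTE ki) (negbTE kj) addr0 (upd_neq _ _ kj) (upd_neq _ _ ki).
Qed.

(** Three clauses are combined: by [ps_evolution] all particles start afresh from their positions at
    the ring, by [ps_others] spectators sit at their left limits, and by [ps_jump] the pair has
    moved by a draw from the jump law. *)
Lemma event_step p n (A : set gapsp) (s u : gapsp -> R) (F : gapsp * conf -> \bar R) : measurable A -> measurable_fun setT s -> measurable_fun setT u ->
  (forall c, 0 < s c)%R -> (forall c, s c < u c)%R ->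
  (forall w, A (clocks w) -> tau p n w = s (clocks w) :> R) ->
  (forall w q m, A (clocks w) -> ~ (s (clocks w) < tau q m w < u (clocks w))%R) ->
  (forall x, 0 <= F x) -> measurable_fun [set: gapsp * conf] F ->
  (forall c z, A c -> F (c, z) = F (c, prestop_all z (u c))) ->
  \int[P]_(w in clocks @^-1` A) F (clocks w, particles w) =
  \int[P]_(w in clocks @^-1` A)
    jop (@full_step _ _ _ hLam Px _ muhat_bound N) p (s (clocks w)) (fun z => F (clocks w, z)) (particles w).
Proof.
move=> mA ms mu s0 su sE Au F0 mF hF.
have uo := uniq_event_order p; have fo := mem_event_order p.
have mO : measurable (clocks @^-1` A).
  by rewrite -[X in measurable X]setTI; exact: mclocks.
have msc : measurable_fun setT (fun w => s (clocks w)) by exact: (measurableT_comp ms mclocks).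
apply: (etrans (evolution_until hps uo fo (e := Some (p, n)) mA ms mu (fun c => ltW (s0 c)) su sE Au F0 mF hF)).
pose G (x : (gapsp * conf) * prodspace 'I_N E) := \int[startk Px (event_order p) x.2]_y
  F (x.1.1, glue_all x.1.2 (s x.1.1) y).
have G0 x : 0 <= G x by exact: integral_ge0.
have ms1 : measurable_fun setT (fun x : (gapsp * conf) * prodspace 'I_N E => s x.1.1).
  apply: (measurableT_comp ms); exact: (measurableT_comp measurable_fst measurable_fst).
have mz1 : measurable_fun setT (fun x : (gapsp * conf) * prodspace 'I_N E => x.1.2).
  exact: (measurableT_comp measurable_snd measurable_fst).
have mG : measurable_fun setT G.
  apply: (@measurable_integral_pker R _ _ _ _ (kcomap (startk Px (event_order p))
    (@measurable_snd _ _ (gapsp * conf)%type (prodspace 'I_N E)))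
    (fun x => F (x.1.1.1, glue_all x.1.1.2 (s x.1.1.1) x.2))) => [x|]; first exact: F0.
  apply: measurableT_comp => //; apply: measurable_fun_pair.
    apply: (measurableT_comp measurable_fst).
    exact: (measurableT_comp measurable_fst measurable_fst).
  apply: measurable_glue_all; last exact: measurable_snd.
    exact: (measurableT_comp mz1 measurable_fst).
  exact: (measurableT_comp ms1 measurable_fst).
(* The restart overwrites the paths from [s] on, so [G] reads the configuration only in the strict
   past, on which the jump is conditioned. *)
have GE c z x : G (c, z, x) = G (c, prestop_all z (s c), x).
  rewrite /G /=; apply: eq_integral => y _; congr (F (_, _)); apply/funext => i.
  by rewrite /glue_all /prestop_all glue_prestop.
pose ds w := (displacement (particles w) (s (clocks w)) (lo_of p),
              displacement (particles w) (s (clocks w)) (hi_of p)).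
have lE z t h : (0 < t)%R -> landing p (prestop_all z t) t h = landing p z t h.
  by move=> t0; apply/funext => i; rewrite /landing /prestop_all left_val_prestop.
pose H (x : (gapsp * conf) * (E * E)) := G (x.1, landing p x.1.2 (s x.1.1) x.2).
have H0 x : 0 <= H x by exact: G0.
have ml : measurable_fun setT (fun x : (gapsp * conf) * (E * E) => landing p x.1.2 (s x.1.1) x.2).
  apply: measurable_prodspace => i; rewrite /landing; apply: measurable_rVD.
    apply: measurable_left_val.
      have mz2 : measurable_fun setT (fun x : (gapsp * conf) * (E * E) => x.1.2).
        exact: (measurableT_comp measurable_snd measurable_fst).
      exact: (measurableT_comp (@measurable_coord _ _ D i) mz2).
    apply: (measurableT_comp ms); exact: (measurableT_comp measurable_fst measurable_fst).
  case: (i == lo_of p); first exact: (measurableT_comp measurable_fst measurable_snd).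
  case: (i == hi_of p); last exact: measurable_cst.
  exact: (measurableT_comp measurable_snd measurable_snd).
have mH : measurable_fun setT H.
  by apply: measurableT_comp => //; apply: measurable_fun_pair => //; exact: measurable_fst.
have mcp : measurable_fun setT (fun w => (clocks w, particles w)) by exact: measurable_fun_pair.
have mcps : measurable_fun setT (fun w => (clocks w, prestop_all (particles w) (s (clocks w)))).
  by apply: measurable_fun_pair => //; exact: measurable_prestop_all.
transitivity (\int[P]_(w in clocks @^-1` A)
    H ((clocks w, prestop_all (particles w) (s (clocks w))), ds w)).
  apply: ae_eq_integral; [exact: mO| | |].
  - have mcv : measurable_fun setT (fun w => ((clocks w, particles w), values (particles w) (s (clocks w)))).
      by apply: measurable_fun_pair => //; exact: measurable_values.
    exact: (measurable_funTS (measurableT_comp mG mcv)).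
  - have mcd : measurable_fun setT (fun w => ((clocks w, prestop_all (particles w) (s (clocks w))), ds w)).
      by apply: measurable_fun_pair => //; apply: measurable_fun_pair; exact: measurable_displacement.
    exact: (measurable_funTS (measurableT_comp mH mcd)).
  (* Almost surely no spectator jumps at the ring, so the positions at [s] are those given by
     [landing]. *)
  have hoth : {ae P, forall w, forall k : 'I_N, k != lo_of p -> k != hi_of p ->
      Z k w (tau p n w) = left_limit (Z k w) (tau p n w)}.
    apply: filter_forall => k; case: (boolP ((k != lo_of p) && (k != hi_of p))) => [/andP[k1 k2]|kk].
      have := ps_others hps n k1 k2; apply: filterS => w hw _ _; exact: hw.
    by apply: aeW => w k1 k2; move: kk; rewrite k1 k2.
  apply: filterS hoth => w hw Aw.
  apply: (etrans (GE _ _ _)); rewrite /H; congr (G (_, _)); rewrite /= lE//; apply/funext => i.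
  rewrite /values /landing /ds /displacement /=.
  case: eqVneq => [->|i1]; first by rewrite addrC subrK.
  case: eqVneq => [->|i2]; first by rewrite addrC subrK.
  by rewrite addr0 /left_val s0 -(sE _ Aw) hw.
apply: (etrans (jump_at_event mA ms s0 sE H0 mH)).
apply: eq_integral => w _.
have mFc : measurable_fun setT (fun z => F (clocks w, z)).
  by apply: measurableT_comp => //; apply: measurable_fun_pair => //; exact: measurable_cst.
apply: (etrans _ (landing_full_step p (particles w) (s (clocks w)) (fun z => F0 _) mFc)).
apply: eq_integral => y _.
exact: (etrans (congr1 (fun x => G (clocks w, prestop_all (particles w) (s (clocks w)), x))
  (lE (particles w) (s (clocks w)) y (s0 _)))
  (esym (GE (clocks w) (particles w) (landing p (particles w) (s (clocks w)) y)))).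
Qed.

End event_step.

End PartX2.

(** * The configuration as a chain of interaction steps *)

Module PartX3.
Import PartA PartB PartC PartD PartF PartH PartL PartM PartU PartV PartW PartX1 PartX2.

Section constant_kernel.
Context (R : realType) dX dY (X : measurableType dX) (Y : measurableType dY) (mu : probability Y R).

Definition constk (_ : X) : {measure set Y -> \bar R} := mu.

Let measurable_constk U : measurable U -> measurable_fun [set: X] (constk ^~ U).
Proof. by move=> _; exact: measurable_cst. Qed.

HB.instance Definition _ := isKernel.Build _ _ _ _ _ constk measurable_constk.

Let constk_prob x : constk x setT = 1%E. Proof. exact: probability_setT. Qed.

HB.instance Definition _ := Kernel_isProbability.Build _ _ _ _ _ constk constk_prob.

End constant_kernel.

Section representation.
Context (R : realType) (dim N : nat).
Notation E := 'rV[R]_dim.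
Notation D := (skorohod dim (+oo : \bar R)).
Notation conf := (prodspace 'I_N D).
Notation Q := (pair_index N).
Notation gapsp := (prodspace (Q * nat)%type R).
Variables (Lam : R) (hLam : 0 < Lam) (Px : R.-pker E ~> D).
Variables (muhat : R.-ker (E * E)%type ~> (E * E)%type).
Hypothesis muhat_bound : forall v w, (muhat (v, w) setT <= Lam%:E)%E.
Variables (P0 : probability E R) (dO : measure_display) (Omega : measurableType dO).
Variables (P : probability Omega R) (tau : Q -> nat -> {RV P >-> R}) (Z : 'I_N -> {RV P >-> D}).
Hypothesis hps : particle_system Lam Px muhat P0 tau Z.
Variable T : R.
Local Open Scope ereal_scope.
Notation clocks := (clocks tau).
Notation particles := (particles Z).
Notation fstep := (@full_step _ _ _ hLam Px _ muhat_bound N).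

Let mclocks := measurable_clocks tau.
Let mparticles := measurable_particles Z.

Lemma tau_tm p n w : tau p n w = tm (clocks w) p n.+1 :> R.
Proof.
elim: n => [|n ih]; rewrite tmS; first by rewrite tm0 add0r /clocks /gap /= subr0.
by rewrite -ih /clocks /gap /= addrC subrK.
Qed.

Lemma tm_mono (c : gapsp) q n m : (forall x, 0 < c x)%R -> (n <= m)%N -> (tm c q n <= tm c q m)%R.
Proof.
move=> c0 /subnK <-; elim: (m - n)%N => [//|k ih].
by rewrite addSn tmS (le_trans ih)// lerDl ltW.
Qed.

(** Rings counted in [l] are not after its last event, and the next ring of each clock is not before
    [u]; monotonicity of [tm] covers all other rings. *)
Lemma no_clock (c : gapsp) l (u : R) : (forall x, 0 < c x)%R -> in_order T c l ->
  (forall q, u <= tm c q (count_mem q l).+1)%R ->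
  forall q m, ~ (last_time c l < tm c q m.+1 < u)%R.
Proof.
move=> c0 ol hu q m /andP[h1 h2]; have [hm|hm] := leqP m.+1 (count_mem q l).
  have := lt_le_trans h1 (tm_mono q c0 hm); rewrite ltNge => /negP; apply.
  exact: tm_le_last_time ol.
have := lt_le_trans h2 (hu q); rewrite ltNge => /negP; apply; exact: tm_mono.
Qed.

Lemma measurable_ite_cst dW (W : measurableType dW) (A : set W) (f : W -> R) (r : R) :
  measurable A -> measurable_fun setT f ->
  measurable_fun setT (fun w => if w \in A then f w else r).
Proof.
move=> mA mf; apply: measurable_fun_ite => // B mB; apply: measurableI => //.
- by rewrite -[X in measurable X]setTI; exact: mf.
- exact: measurableC.
- by rewrite -[X in measurable X]setTI; exact: measurable_cst.
Qed.

(** The step overwrites everything from [t] on and reads only left limits, so it depends on the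
    strict past alone. This lets the induction in [representation] remove one more event. *)
Lemma jop_prestop p (z : conf) (t : R) (F : conf -> \bar R) : (0 < t)%R ->
  (forall z, 0 <= F z) -> measurable_fun setT F ->
  jop fstep p t F z = jop fstep p t F (prestop_all z t).
Proof.
move=> t0 F0 mF; rewrite -(landing_full_step hLam Px muhat_bound p z t F0 mF).
rewrite -(landing_full_step hLam Px muhat_bound p (prestop_all z t) t F0 mF) /prestop_all !left_val_prestop.
apply: eq_integral => h _.
have -> : landing p (fun i => prestop (z i) t) t h = landing p z t h.
  by apply/funext => i; rewrite /landing left_val_prestop.
apply: eq_integral => y _; congr F; apply/funext => i.
by rewrite /glue_all glue_prestop.
Qed.

Variable nu0 : probability conf R.
Hypothesis nu0E : forall F, (forall z, 0 <= F z) -> measurable_fun setT F ->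
  \int[nu0]_z F z =
  \int[prodker (fun=> constk P0) (enum 'I_N) tt]_x \int[startk Px (enum 'I_N) x]_y F y.

(** Evolution from time 0, where gluing discards the old path entirely; the initial positions have a
    product law and are independent of the clocks. *)
Lemma initial_step (A : set gapsp) (u : gapsp -> R) (F : gapsp * conf -> \bar R) :
  measurable A -> measurable_fun setT u -> (forall c, 0 < u c)%R ->
  (forall w q m, A (clocks w) -> ~ (0 < tau q m w < u (clocks w))%R) ->
  (forall x, 0 <= F x) -> measurable_fun [set: gapsp * conf] F ->
  (forall c z, A c -> F (c, z) = F (c, prestop_all z (u c))) ->
  \int[P]_(w in clocks @^-1` A) F (clocks w, particles w) =
  \int[P]_(w in clocks @^-1` A) \int[nu0]_z F (clocks w, z).
Proof.
move=> mA mu u0 Au F0 mF hF.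
have mO : measurable (clocks @^-1` A).
  by rewrite -[X in measurable X]setTI; exact: mclocks.
have ms : measurable_fun [set: gapsp] (fun=> 0%R : R) by exact: measurable_cst.
have ue := enum_uniq 'I_N; have fe := mem_enum 'I_N.
apply: (etrans (evolution_until hps ue fe (e := None) (s := fun=> 0%R) mA ms mu (fun=> lexx _) u0
  (fun w _ => erefl) Au F0 mF hF)).
have g0 z y : glue_all z 0%R y = y by apply/funext => i; exact: glue0.
under eq_integral do under eq_integral do rewrite g0.
pose G (x : gapsp * prodspace 'I_N E) := \int[startk Px (enum 'I_N) x.2]_y F (x.1, y).
have G0 x : 0 <= G x by exact: integral_ge0.
have mG : measurable_fun setT G.
  apply: (@measurable_integral_pker R _ _ _ _ (kcomap (startk Px (enum 'I_N))
    (@measurable_snd _ _ gapsp (prodspace 'I_N E)))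
    (fun x => F (x.1.1, x.2))) => [x|]; first exact: F0.
  apply: measurableT_comp => //; apply: measurable_fun_pair; last exact: measurable_snd.
  exact: (measurableT_comp measurable_fst measurable_fst).
have mv : measurable_fun setT (fun w => values (particles w) 0%R).
  by apply: measurable_values => //; exact: measurable_cst.
pose k : R.-pker gapsp ~> prodspace 'I_N E :=
  kcomap (prodker (fun=> constk P0) (enum 'I_N)) (@measurable_cst _ _ gapsp unit setT tt).
have law A' B : measurable A' -> cylinders (fun i (x : prodspace 'I_N E) => x i) B ->
    P (clocks @^-1` A `&` clocks @^-1` A' `&` (fun w => values (particles w) 0%R) @^-1` B) =
    \int[P]_(w in clocks @^-1` A `&` clocks @^-1` A') k (clocks w) B.
  move=> mA' [S [B0 [_ [mB0 BE]]]].
  pose B1 i := if i \in S then B0 i else setT.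
  have mB1 i : measurable (B1 i) by rewrite /B1; case: ifP.
  have {}BE : B = [set z | forall i, i \in enum 'I_N -> B1 i (z i)].
    rewrite BE; apply/seteqP; split => z hz i.
      by move=> _; rewrite /B1; case: ifP => // iS; exact: hz.
    by move=> iS; have := hz i (fe i); rewrite /B1 iS.
  have hA : <<s clock_events tau >> (clocks @^-1` A `&` clocks @^-1` A').
    have mcl : measurable_fun [set: g_sigma_algebraType (clock_events tau)] clocks.
      apply: measurable_clocks_sub => p n _ C mC; rewrite setTI.
      by apply: sub_gen_smallest; exists (p, n), C.
    by apply: (@measurableI _ (g_sigma_algebraType (clock_events tau)));
      rewrite -[X in measurable X]setTI; exact: mcl.
  have mO' : measurable (clocks @^-1` A').
    by rewrite -[X in measurable X]setTI; exact: mclocks.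
  transitivity (P (clocks @^-1` A `&` clocks @^-1` A') * \prod_(i < N) P0 (B1 i)).
    rewrite -(ps_init hps hA mB1); congr (P (_ `&` _)).
    apply/seteqP; split => w; rewrite BE /= => hw i; last by move=> _; exact: hw.
    exact: hw (fe i).
  have kB c : k c B = \prod_(i < N) P0 (B1 i).
    rewrite BE; apply: (etrans (prodker_cylinder _ _ ue mB1)).
    by rewrite [RHS](perm_big (enum 'I_N)) // enumT.
  transitivity (\int[P]_(w in clocks @^-1` A `&` clocks @^-1` A') cst (\prod_(i < N) P0 (B1 i)) w).
    by rewrite (integral_cst P (measurableI _ _ mO mO')) muleC.
  by apply: eq_integral => w _; rewrite kB.
have main := @integral_joint_law _ _ _ _ _ _ _ P (clocks @^-1` A) clocks
  (fun w => values (particles w) 0%R) k (cylinders (fun i (x : prodspace 'I_N E) => x i))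
  mO mclocks mv (@generated_cylinders _ _ _ _ _)
  (@setI_cylinders _ _ _ _ _) (@cylindersT _ _ _ _ _) law G G0 mG.
apply: (etrans main); apply: eq_integral => w _.
have mFc : measurable_fun setT (fun z => F (clocks w, z)).
  by apply: measurableT_comp => //; apply: measurable_fun_pair => //; exact: measurable_cst.
exact: (esym (nu0E (fun z => F0 _) mFc)).
Qed.

(** Induction from the most recent event. On [A] the events of [l] are the only rings before [u], so
    [event_step] handles the last one. What remains depends on the path strictly before that event,
    whose time becomes the new horizon. *)
Lemma representation l (A : set gapsp) (u : gapsp -> R) (F : gapsp * conf -> \bar R) :
  measurable A -> measurable_fun setT u ->
  (forall c, A c -> [/\ in_order T c l, forall x, (0 < c x)%R, (last_time c l < u c)%R &
     forall q, (u c <= tm c q (count_mem q l).+1)%R]) ->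
  (forall x, 0 <= F x) -> measurable_fun [set: gapsp * conf] F ->
  (forall c z, A c -> F (c, z) = F (c, prestop_all z (u c))) ->
  \int[P]_(w in clocks @^-1` A) F (clocks w, particles w) =
  \int[P]_(w in clocks @^-1` A) \int[nu0]_z
    chain fstep (clocks w) l (fun z => F (clocks w, z)) z.
Proof.
elim: l A u F => [|p l ih] A u F mA mu hA F0 mF hF.
  (* Outside [A] the horizon is replaced by a constant, because positivity is required for all gap
     sequences. *)
  pose u' (c : gapsp) := if c \in A then u c else 1%R.
  have uE c : A c -> u' c = u c by move=> Ac; rewrite /u' mem_set.
  apply: (@initial_step A u') => //.
  - exact: measurable_ite_cst.
  - by move=> c; rewrite /u'; case: ifPn => // /set_mem/hA[].
  - move=> w q m Aw; have [ol c0 _ hu] := hA _ Aw; rewrite uE// tau_tm.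
    exact: (no_clock c0 ol hu).
  - by move=> c z Ac; rewrite uE//; exact: hF.
pose s (c : gapsp) : R := last_time c (p :: l).
have ms : measurable_fun setT s.
  exact: (@measurable_last_time R Q _ gapsp id (p :: l) (@measurable_id _ gapsp setT)).
(* The defaults 1 and 2 ensure [0 < s' < u'] outside [A]. *)
pose s' (c : gapsp) := if c \in A then s c else 1%R.
pose u' (c : gapsp) := if c \in A then u c else 2%R.
have uE c : A c -> u' c = u c by move=> Ac; rewrite /u' mem_set.
have sE c : A c -> s' c = s c by move=> Ac; rewrite /s' mem_set.
have s0 c : A c -> (0 < s c)%R.
  move=> /hA[/= /andP[ol /andP[h _]] _ _ _]; apply: le_lt_trans h; exact: last_time_ge0 ol.
have F0c c z : 0 <= F (c, z) by exact: F0.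
have mFc c : measurable_fun setT (fun z => F (c, z)).
  by apply: measurableT_comp => //; apply: measurable_fun_pair => //; exact: measurable_cst.
pose F2 (x : gapsp * conf) := jop fstep p (s x.1) (fun z => F (x.1, z)) x.2.
have F20 x : 0 <= F2 x by exact: jop_ge0.
have mF2 : measurable_fun [set: gapsp * conf] F2.
  apply: (@measurable_jop_pair R Q _ conf fstep _ gapsp p s (fun c z => F (c, z))) => //.
  by apply: eq_measurable_fun mF => x _; case: x.
transitivity (\int[P]_(w in clocks @^-1` A) F2 (clocks w, particles w)).
  have mA1 := measurable_ite_cst 1%R mA ms; have mA2 := measurable_ite_cst 2%R mA mu.
  apply: (etrans (event_step hLam muhat_bound hps (p := p) (n := count_mem p l) (s := s') (u := u')
     mA mA1 mA2 _ _ _ _ F0 mF _)).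
  - by move=> c; rewrite /s'; case: ifPn => // /set_mem/s0.
  - move=> c; rewrite /s' /u'; case: ifPn => [/set_mem/hA[]//|_].
    by rewrite ltr1n.
  - by move=> w Aw; rewrite sE// tau_tm.
  - move=> w q m Aw; have [ol c0 _ hu] := hA _ Aw; rewrite sE// uE// tau_tm.
    exact: (no_clock c0 ol hu).
  - by move=> c z Ac; rewrite uE//; exact: hF.
  - by apply: eq_integral => w /set_mem Aw; rewrite sE.
have hA' c : A c -> [/\ in_order T c l, forall x, (0 < c x)%R, (last_time c l < s c)%R &
    forall q, (s c <= tm c q (count_mem q l).+1)%R].
  (* For the clock [p] the next ring is the removed event itself, with equality; the other clocks do
     not ring before [u], hence not before [s]. *)
  move=> Ac; have [/= /andP[ol /andP[h _]] c0 hu hq] := hA _ Ac; split => // q.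
  have [->|qp] := eqVneq q p; first by rewrite /s /=.
  by have := hq q; rewrite /= eq_sym (negbTE qp) add0n; apply: le_trans; exact: ltW.
have hF' c z : A c -> F2 (c, z) = F2 (c, prestop_all z (s c)).
  by move=> Ac; exact: (jop_prestop p z (s0 c Ac) (F0c c) (mFc c)).
exact: (ih A s F2 mA ms hA' F20 mF2 hF').
Qed.

End representation.

End PartX3.

(** * The initial configuration as a product law *)

Module PartY1.
Import PartA PartB PartC PartD PartF PartH PartL PartM PartU PartV PartW PartX1 PartX2 PartX3.

Section product_uniqueness.
Context (R : realType) (I : finType) dW dX (W : measurableType dW) (X : measurableType dX).
Variable k : I -> R.-pker W ~> X.
Local Open Scope ereal_scope.

Lemma measurable_box (B : I -> set X) : (forall i, measurable (B i)) ->
  measurable [set z : prodspace I X | forall i, B i (z i)].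
Proof.
move=> mB; have -> : [set z : prodspace I X | forall i, B i (z i)] =
    \big[setI/setT]_(i <- enum I) ((fun z => z i) @^-1` B i).
  by rewrite -bigcap_seq; apply/seteqP; split => z h i => [_|]; apply: h; rewrite /= mem_enum.
apply: bigsetI_measurable => i _; rewrite -[X in measurable X]setTI.
exact: measurable_coord.
Qed.

(** A law with product masses on boxes is the product law, in whatever order the list enumerates the
    coordinates. This permits putting a chosen particle first. *)
Lemma integral_prodker_unique (s : seq I) w (mu : probability (prodspace I X) R) F :
  uniq s -> (forall i, i \in s) ->
  (forall B : I -> set X, (forall i, measurable (B i)) ->
     mu [set z | forall i, B i (z i)] = \prod_i k i w (B i)) ->
  (forall z, 0 <= F z) -> measurable_fun setT F ->
  \int[mu]_z F z = \int[prodker k s w]_z F z.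
Proof.
move=> us fs muE F0 mF; apply: eq_measure_integral => A mA _.
apply: (@measure_unique _ R _ (cylinders (fun (i : I) (z : prodspace I X) => z i)) (fun=> setT)) => //.
- exact: generated_cylinders.
- exact: setI_cylinders.
- by move=> _; exact: cylindersT.
- by rewrite bigcup_const//; exists 0%N.
- move=> C [S [B [_ [mB CE]]]].
  pose B1 i := if i \in S then B i else setT.
  have mB1 i : measurable (B1 i) by rewrite /B1; case: ifP.
  have CE1 : C = [set z | forall i, B1 i (z i)].
    rewrite CE; apply/seteqP; split => z hz i; first by rewrite /B1; case: ifP => // iS; exact: hz.
    by move=> iS; have := hz i; rewrite /B1 iS.
  have CE2 : C = [set z | forall i, i \in s -> B1 i (z i)].
    by rewrite CE1; apply/seteqP; split => z hz i => [_|]; apply: hz.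
  transitivity (\prod_i k i w (B1 i)); first by rewrite CE1; exact: muE.
  rewrite CE2; apply: etrans (esym (prodker_cylinder k w us mB1)).
  apply: perm_big; apply: uniq_perm => //; first exact: index_enum_uniq.
  by move=> i; rewrite mem_index_enum fs.
- by move=> _; apply: (le_lt_trans (probability_le1 mu measurableT)); rewrite ltry.
Qed.

End product_uniqueness.

Section initial_law.
Context (R : realType) (dim N : nat).
Notation E := 'rV[R]_dim.
Notation D := (skorohod dim (+oo : \bar R)).
Notation conf := (prodspace 'I_N D).
Variables (Px : R.-pker E ~> D) (P0 : probability E R).
Local Open Scope ereal_scope.

(* The law of one particle that never interacts. *)
Definition free_law : R.-pker unit ~> D :=
  kbind (@constk R _ _ unit E P0) (kcomap Px (@measurable_snd _ _ unit E)).

Lemma integral_free_law F : (forall z, 0 <= F z) -> measurable_fun setT F ->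
  \int[free_law tt]_y F y = \int[P0]_x \int[Px x]_y F y.
Proof. by move=> F0 mF; exact: (integral_kbind _ _ _ F0 mF). Qed.

Lemma prod_perm_enum (s : seq 'I_N) (f : 'I_N -> \bar R) : uniq s -> (forall i, i \in s) ->
  \prod_(i < N) f i = \prod_(i <- s) f i.
Proof.
move=> us fs; apply: perm_big; apply: uniq_perm => //; first exact: index_enum_uniq.
by move=> i; rewrite mem_index_enum fs.
Qed.

Variable nu0 : probability conf R.
Hypothesis nu0_free : nu0 = prodker (fun=> free_law) (enum 'I_N) tt :> {measure set conf -> \bar R}.

Lemma nu0_box (B : 'I_N -> set D) : (forall i, measurable (B i)) ->
  nu0 [set z | forall i, B i (z i)] = \prod_(i < N) free_law tt (B i).
Proof.
move=> mB; have ue := enum_uniq 'I_N; have fe := mem_enum 'I_N.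
transitivity ((nu0 : {measure set conf -> \bar R}) [set z | forall i, B i (z i)]) => //.
rewrite nu0_free.
have -> : [set z : conf | forall i, B i (z i)] = [set z | forall i, i \in enum 'I_N -> B i (z i)].
  by apply/seteqP; split => z hz i => [_|]; apply: hz.
apply: etrans (prodker_cylinder _ tt ue mB) _.
by rewrite (@prod_perm_enum (enum 'I_N)).
Qed.

Lemma nu0_prodker (s : seq 'I_N) F : uniq s -> (forall i, i \in s) ->
  (forall z, 0 <= F z) -> measurable_fun setT F ->
  \int[nu0]_z F z = \int[prodker (fun=> free_law) s tt]_z F z.
Proof. by move=> us fs; apply: integral_prodker_unique => //; exact: nu0_box. Qed.

(** Drawing all positions and then all paths, or each particle with its path in turn, gives the same
    masses on boxes. *)
Lemma nu0_start F : (forall z, 0 <= F z) -> measurable_fun setT F ->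
  \int[nu0]_z F z =
  \int[prodker (fun=> @constk R _ _ unit E P0) (enum 'I_N) tt]_x
    \int[startk Px (enum 'I_N) x]_y F y.
Proof.
move=> F0 mF; have ue := enum_uniq 'I_N; have fe := mem_enum 'I_N.
pose k1 := prodker (fun=> @constk R _ _ unit E P0 : R.-pker unit ~> E) (enum 'I_N).
pose k2 : R.-pker (unit * prodspace 'I_N E)%type ~> conf :=
  kcomap (startk Px (enum 'I_N)) (@measurable_snd _ _ unit (prodspace 'I_N E)).
pose k : R.-pker unit ~> conf := kbind k1 k2.
have [mu muE] : exists mu : probability conf R, mu = k tt :> {measure set conf -> \bar R}.
  by apply: prob_pack; exact: prob_kernel.
rewrite (nu0_prodker ue fe F0 mF).
suff mu_box B : (forall i, measurable (B i)) ->
    mu [set z | forall i, B i (z i)] = \prod_(i < N) free_law tt (B i).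
  apply: (etrans (esym (integral_prodker_unique ue fe mu_box F0 mF))).
  have e := integral_kbind k1 k2 tt F0 mF.
  exact: (etrans (congr1 (fun m : {measure set conf -> \bar R} => \int[m]_z F z) muE) e).
move=> mB; have mC := measurable_box mB.
have mi : measurable_fun setT (fun z => (\1_[set z : conf | forall i, B i (z i)] z)%:E : \bar R).
  by apply/measurable_EFinP; exact: measurable_indic.
have i0 z : 0 <= (\1_[set z : conf | forall i, B i (z i)] z)%:E :> \bar R by rewrite lee_fin.
transitivity (\int[k tt]_z (\1_[set z : conf | forall i, B i (z i)] z)%:E).
  rewrite integral_indic// setIT.
  exact: (congr1 (fun m : {measure set conf -> \bar R} => m [set z | forall i, B i (z i)]) muE).
have e := integral_kbind k1 k2 tt i0 mi.
apply: (etrans e); rewrite (@prod_perm_enum (enum 'I_N))//.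
have mP i : measurable_fun setT (fun x : E => Px x (B i)) by exact: measurable_kernel.
have fE i : free_law tt (B i) = \int[constk P0 tt]_x Px x (B i).
  transitivity (\int[free_law tt]_y (\1_(B i) y)%:E); first by rewrite integral_indic ?setIT.
  rewrite integral_free_law//; last by apply/measurable_EFinP; exact: measurable_indic.
  by apply: eq_integral => x _; rewrite integral_indic ?setIT.
under eq_bigr do rewrite fE.
rewrite -(integral_prodker_prod (fun=> @constk R _ _ unit E P0) tt (phi := fun i x => Px x (B i)) ue)//.
apply: eq_integral => x _.
transitivity (startk Px (enum 'I_N) x [set z | forall i, i \in enum 'I_N -> B i (z i)]).
  have -> : [set z : conf | forall i, i \in enum 'I_N -> B i (z i)] = [set z | forall i, B i (z i)].
    by apply/seteqP; split => z hz i => [|_]; apply: hz.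
  by rewrite integral_indic ?setIT.
exact: (prodker_cylinder _ x ue mB).
Qed.

(** With [l] at the head of the enumeration, Tonelli brings its path inside, where [markov_refresh]
    applies. *)
Lemma nu0_fresh : markov_process Px -> fresh_after Px 0%R nu0.
Proof.
move=> hPx t l F t0 F0 mF.
have mK := measurable_kint (site (krefresh Px) l) t F0 mF.
have K0 z : 0 <= \int[site (krefresh Px) l (t, z)]_y F y by exact: integral_ge0.
pose s := l :: rem l (enum 'I_N).
have us : uniq s by rewrite /s /= rem_uniq ?enum_uniq// mem_rem_uniq ?enum_uniq// !inE eqxx.
have fs i : i \in s by rewrite /s inE mem_rem_uniq ?enum_uniq// !inE mem_enum andbT orbN.
rewrite (nu0_prodker us fs K0 mK) (nu0_prodker us fs F0 mF).
apply: (etrans (integral_prodker_cons _ _ _ _ K0 mK)).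
apply: (etrans _ (esym (integral_prodker_cons _ _ _ _ F0 mF))).
have mu2 : measurable_fun setT (fun x : D * conf => upd x.2 l x.1).
  by apply: measurable_upd; [exact: measurable_snd|exact: measurable_fst].
have mK2 := measurableT_comp mK mu2; have mF2 := measurableT_comp mF mu2.
apply: (etrans (prob_tonelli (prob_kernel _) (prob_kernel _) (fun y z => K0 _) mK2)).
apply: (etrans _ (esym (prob_tonelli (prob_kernel _) (prob_kernel _) (fun y z => F0 _) mF2))).
apply: eq_integral => z _.
pose G y := F (upd z l y).
have mG : measurable_fun setT G.
  apply: (measurableT_comp mF); apply: measurable_upd => //; exact: measurable_cst.
have G0 y : 0 <= G y by exact: F0.
have mt : measurable_fun setT (fun w : D => (t, w)).
  by apply: measurable_fun_pair => //; exact: measurable_cst.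
have mR : measurable_fun setT (fun y => \int[krefresh Px (t, y)]_u G u).
  exact: (@measurable_integral_pker R _ _ _ _ (kcomap (krefresh Px) mt) (fun x => G x.2)
    (fun x => G0 _) (measurableT_comp mG measurable_snd)).
transitivity (\int[free_law tt]_y \int[krefresh Px (t, y)]_u G u).
  apply: eq_integral => y _; apply: (etrans (integral_site _ l t (upd z l y) F0 mF)).
  by rewrite updE; apply: eq_integral => u _; rewrite upd_upd.
rewrite (integral_free_law (fun y => integral_ge0 _ (fun u _ => G0 u)) mR).
rewrite (integral_free_law G0 mG); apply: eq_integral => x _.
rewrite -[RHS](markov_refresh hPx x t0 G0 mG).
by apply: eq_integral => y _; exact: (integral_krefresh _ t y G0 mG).
Qed.

Definition permute (g : 'I_N -> 'I_N) (z : conf) : conf := fun i => z (g i).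

Lemma measurable_permute g : measurable_fun setT (permute g).
Proof. by apply: measurable_prodspace => i; exact: measurable_coord. Qed.

Lemma nu0_permute (g : 'I_N -> 'I_N) F : involutive g ->
  (forall z, 0 <= F z) -> measurable_fun setT F ->
  \int[nu0]_z F (permute g z) = \int[nu0]_z F z.
Proof.
move=> gK F0 mF; have ue := enum_uniq 'I_N; have fe := mem_enum 'I_N.
pose k : R.-pker conf ~> conf := @kdirac _ _ _ _ R _ (@measurable_permute g).
have [mu muE] : exists mu : probability conf R, mu = mbind nu0 k :> {measure set conf -> \bar R}.
  apply: prob_pack; rewrite mbindE (eq_integral (cst 1)); last by move=> w _; exact: prob_kernel.
  by rewrite integral_cst// mul1e; exact: probability_setT.
have iE G : (forall z, 0 <= G z) -> measurable_fun setT G ->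
    \int[mu]_z G z = \int[nu0]_z G (permute g z).
  move=> G0 mG; apply: (etrans (congr1 (fun m : {measure set conf -> \bar R} => \int[m]_z G z) muE)).
  apply: (etrans (integral_mbind nu0 k G0 mG)).
  by apply: eq_integral => z _; exact: integral_kdirac.
rewrite -(iE F F0 mF).
suff mu_box B : (forall i, measurable (B i)) ->
    mu [set z | forall i, B i (z i)] = \prod_(i < N) free_law tt (B i).
  apply: (etrans (integral_prodker_unique ue fe mu_box F0 mF)).
  exact: (esym (nu0_prodker ue fe F0 mF)).
move=> mB; have mC := measurable_box mB.
have mC' : measurable (permute g @^-1` [set z | forall i, B i (z i)]).
  by rewrite -[X in measurable X]setTI; exact: measurable_permute.
have mi : measurable_fun setT (fun z => (\1_[set z : conf | forall i, B i (z i)] z)%:E : \bar R).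
  by apply/measurable_EFinP; exact: measurable_indic.
have i0 z : 0 <= (\1_[set z : conf | forall i, B i (z i)] z)%:E :> \bar R by rewrite lee_fin.
transitivity (\int[mu]_z (\1_[set z : conf | forall i, B i (z i)] z)%:E).
  by rewrite integral_indic// setIT.
rewrite (iE _ i0 mi).
transitivity (nu0 (permute g @^-1` [set z | forall i, B i (z i)])).
  by rewrite -[X in nu0 X]setIT -integral_indic.
rewrite (_ : permute g @^-1` _ = [set z | forall i, B (g i) (z i)]); last first.
  apply/seteqP; split => z /= hz i; first by have := hz (g i); rewrite /permute gK.
  by have := hz (g i); rewrite gK.
apply: (etrans (nu0_box (fun i => mB (g i)))).
apply/esym; apply: (reindex_inj (can_inj gK)).
Qed.

End initial_law.

End PartY1.

(** * The contribution of one list of interactions *)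

Module PartY2.
Import PartA PartB PartC PartD PartF PartH PartL PartM PartO PartS PartU PartV PartW PartX1 PartX2 PartX3 PartY1.

Section event_lists.
Context (R : realType) (Q : finType) (T : R).
Notation gapsp := (prodspace (Q * nat)%type R).

(** If the heads differed, equal counts would put the head event of each list among the earlier
    events of the other, and each last time would be smaller than the other. *)
Lemma in_order_inj (c : gapsp) l l' : in_order T c l -> in_order T c l' ->
  (forall q, count_mem q l = count_mem q l') -> l = l'.
Proof.
have front p m p' m' : in_order T c (p :: m) -> in_order T c (p' :: m') ->
    (forall q, count_mem q (p :: m) = count_mem q (p' :: m')) -> p != p' ->
    last_time c (p' :: m') < last_time c (p :: m).
  move=> /= /andP[om /andP[h1 _]] /andP[om' /andP[h1' _]] cm pp'.
  rewrite (le_lt_trans _ h1)//; have := cm p'.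
  rewrite /= eqxx (negbTE pp') add0n add1n => <-; exact: tm_le_last_time om.
elim: l l' => [|p m ih] [|p' m'] //.
- by move=> _ _ /(_ p'); rewrite /= eqxx.
- by move=> _ _ /(_ p); rewrite /= eqxx.
move=> o o' cm; have pp' : p = p'.
  apply/eqP; apply: contraT => pp'.
  have h1 := front _ _ _ _ o o' cm pp'.
  have h2 := front _ _ _ _ o' o (fun q => esym (cm q)) (_ : p' != p); rewrite eq_sym in h2.
  by have := lt_trans h1 (h2 pp'); rewrite ltxx.
subst p'; congr (_ :: _); apply: ih.
- by move: o => /= /andP[].
- by move: o' => /= /andP[].
- by move=> q; have := cm q => /= /addnI.
Qed.

(** Lists grow at the end, by an older event, to match iterates of [total_op], whose outermost
    factor is the oldest event. *)
Fixpoint lists (n : nat) : seq (seq Q) :=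
  if n is m.+1 then [seq rcons l p | p <- enum Q, l <- lists m] else [:: [::]].

Lemma size_lists n l : l \in lists n -> size l = n.
Proof.
elim: n l => [|n ih] l /=; first by rewrite inE => /eqP ->.
by move=> /allpairsP[[p m] [_ /= /ih <- ->]]; rewrite size_rcons.
Qed.

Lemma uniq_lists n : uniq (lists n).
Proof.
elim: n => [//|n ih] /=; apply: allpairs_uniq => //; first exact: enum_uniq.
by move=> [p l] [p' l'] _ _ /= /eqP; rewrite eqseq_rcons => /andP[/eqP -> /eqP ->].
Qed.

Context dZ (Z : measurableType dZ) (J : Q -> R.-pker (R * Z)%type ~> Z).
Local Open Scope ereal_scope.

Definition total_op (F : R -> Z -> \bar R) (s : R) (z : Z) : \bar R :=
  \sum_(p <- enum Q) bop T J p F s z.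

Lemma bop_sum (I : eqType) (r : seq I) p (F : I -> R -> Z -> \bar R) s z :
  (forall i s z, 0 <= F i s z) ->
  (forall i, measurable_fun setT (fun x : R * Z => F i x.1 x.2)) ->
  bop T J p (fun s z => \sum_(i <- r) F i s z) s z = \sum_(i <- r) bop T J p (F i) s z.
Proof.
move=> F0 mF; have mFr i t : measurable_fun setT (F i t).
  have mt : measurable_fun setT (fun z : Z => (t, z)).
    by apply: measurable_fun_pair => //; exact: measurable_cst.
  exact: (measurableT_comp (mF i) mt).
rewrite /bop -ge0_integral_sum//.
- by apply: eq_integral => t _; rewrite /jop ge0_integral_sum.
- move=> i; apply: measurable_funTS.
  have mj := @measurable_jop_pair R Q _ Z J _ R p id (F i) (F0 i) (@measurable_id _ R setT) (mF i).
  have mz : measurable_fun [set: R] (fun=> z) by exact: measurable_cst.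
  exact: (measurable_fun2 (F := fun r z => jop J p r (F i r) z) mj (@measurable_id _ R setT) mz).
- by move=> i t _; exact: jop_ge0.
Qed.

Lemma iter_total_op n F s z : (forall s z, 0 <= F s z) ->
  measurable_fun setT (fun x : R * Z => F x.1 x.2) ->
  iter n total_op F s z = \sum_(l <- lists n) biter T J l F s z.
Proof.
move=> F0 mF; elim: n s z => [|n ih] s z; first by rewrite /= big_seq1.
have mb l := measurable_biter T J l F0 mF.
have b0 l r y : 0 <= biter T J l F r y by exact: biter_ge0.
rewrite iterS /total_op big_allpairs_dep /=; apply: eq_bigr => p _.
have -> : iter n total_op F = fun s z => \sum_(l <- lists n) biter T J l F s z.
  by apply/funext => r; apply/funext => y; exact: ih.
rewrite bop_sum//; apply: eq_bigr => l _.
by elim: l F {F0 mF ih mb b0} => [|q l ih] F //=; rewrite ih.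
Qed.

End event_lists.

Lemma integral_monomial (R : realType) (s T : R) n : s <= T ->
  (\int[lebesgue_measure]_(r in `]s, T]) ((T - r) ^+ n)%:E = ((T - s) ^+ n.+1 / n.+1%:R)%:E)%E.
Proof.
rewrite le_eqVlt => /orP[/eqP ->|sT].
  by rewrite set_itvoc0 integral_set0 subrr expr0n /= mul0r.
pose F r : R := - ((T - r) ^+ n.+1 / n.+1%:R).
have dF r : is_derive r (1:R) F ((T - r) ^+ n).
  have n0 : n.+1%:R != 0 :> R by rewrite pnatr_eq0.
  have d1 := is_deriveB (is_derive_cst T r (1:R)) (is_derive_id r (1:R)).
  have := is_deriveZ (- n.+1%:R^-1) (is_deriveX n.+1 d1).
  have -> : (- n.+1%:R^-1 \*: (cst T - id) ^+ n.+1) = F :> (R -> R).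
    have eX x : ((cst T - id) ^+ n.+1 : R -> R) x = (T - x) ^+ n.+1 by rewrite exprfctE.
    apply/funext => x; rewrite /F mulrC -mulNr.
    exact: (congr1 (fun y => - n.+1%:R^-1 * y) (eX x)).
  rewrite sub0r /GRing.scale /= => h; apply: (is_derive_eq h).
  by rewrite mulrN1 mulrNN mulrA mulVf// mul1r.
have cf x : {for x, continuous (fun r => (T - r) ^+ n)}.
  apply: (@continuous_comp _ _ _ (fun r : R => T - r) (fun y => y ^+ n)).
    by apply: (@cvgB _ R); [exact: cvg_cst|exact: cvg_id].
  exact: (@exprn_continuous R n).
have cF x : {for x, continuous F}.
  by apply: differentiable_continuous; apply/derivable1_diffP; have [] := dF x.
rewrite integral_itv_obnd_cbnd; last first.
  apply/measurable_EFinP/measurable_funTS; apply: measurable_funX.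
  by apply: measurable_funB; [exact: measurable_cst|exact: measurable_id].
rewrite (@continuous_FTC2 R (fun r => (T - r) ^+ n) F s T sT).
- by rewrite -EFinB /F subrr expr0n /= mul0r oppr0 sub0r opprK.
- by apply: continuous_in_subspaceT => x _; exact: cf.
- split.
  + by move=> x _; have [] := dF x.
  + exact: (cvg_at_right_filter (cF s)).
  + exact: (cvg_at_left_filter (cF T)).
- by move=> x _; rewrite derive1E; have [_] := dF x.
Qed.

Section event_formula.
Context (R : realType) (dim N : nat).
Notation E := 'rV[R]_dim.
Notation D := (skorohod dim (+oo : \bar R)).
Notation conf := (prodspace 'I_N D).
Notation Q := (pair_index N).
Notation gapsp := (prodspace (Q * nat)%type R).
Variables (Lam : R) (hLam : 0 < Lam) (Px : R.-pker E ~> D) (hPx : markov_process Px).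
Variables (muhat : R.-ker (E * E)%type ~> (E * E)%type).
Hypothesis muhat_bound : forall v w, (muhat (v, w) setT <= Lam%:E)%E.
Variables (P0 : probability E R) (dO : measure_display) (Omega : measurableType dO).
Variables (P : probability Omega R) (tau : Q -> nat -> {RV P >-> R}) (Z : 'I_N -> {RV P >-> D}).
Hypothesis hps : particle_system Lam Px muhat P0 tau Z.
Variables (T : R) (T0 : 0 <= T).
Let lam := Lam / N.-1%:R.
Hypothesis lam0 : 0 < lam.
Variable nu0 : probability conf R.
Local Open Scope ereal_scope.
Hypothesis nu0_free : nu0 = prodker (fun=> free_law Px P0) (enum 'I_N) tt :> {measure set conf -> \bar R}.
Notation clocks := (clocks tau).
Notation particles := (particles Z).
Notation fstep := (@full_step _ _ _ hLam Px _ muhat_bound N).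
Notation pstep := (@pair_step _ _ _ hLam Px _ muhat_bound N).

Let mclocks := measurable_clocks tau.
Let mparticles := measurable_particles Z.

Let indep (s : seq (Q * nat)) (B : Q * nat -> set R) : uniq s ->
  (forall x, measurable (B x)) ->
  P (\bigcap_(x in [set` s]) (fun w => clocks w x) @^-1` B x) =
  \prod_(x <- s) expm lam0 (B x).
Proof. by move=> us mB; rewrite (ps_clocks hps us mB). Qed.

Let gaps_pos : {ae P, forall w, forall x, (0 < clocks w x)%R}.
Proof.
have h x : {ae P, forall w, (0 < clocks w x)%R}.
  have mx : measurable_fun setT (fun w => clocks w x).
    exact: (measurableT_comp (@measurable_coord _ _ _ x) mclocks).
  have mpos : measurable ((fun w => clocks w x) @^-1` `]0%R, +oo[%classic).
    by rewrite -[X in measurable X]setTI; apply: mx => //; exact: measurable_itv.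
  have p1 : P ((fun w => clocks w x) @^-1` `]0%R, +oo[%classic) = 1.
    have := @indep [:: x] (fun=> `]0%R, +oo[%classic) isT (fun=> measurable_itv _).
    rewrite big_seq1 (expm_tail lam0 (lexx 0%R)) mulr0 expR0 => <-.
    congr (P _); apply/seteqP; split => w /=.
      by move=> hw y yx; have /eqP -> : y == x by move: yx; rewrite /= ?inE ?orbF.
    by apply; rewrite /= ?inE eqxx.
  exists (~` ((fun w => clocks w x) @^-1` `]0%R, +oo[%classic)); split.
  - exact: measurableC.
  - by rewrite probability_setC// p1 subee.
  - by move=> w /= nw hw; apply: nw; move: hw; rewrite in_itv/= andbT.
have h2 : {ae P, forall w, forall n : nat, forall q : Q, (0 < clocks w (q, n))%R}.
  by apply/ae_foralln => n; apply: filter_forall => q; exact: h.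
by apply: filterS h2 => w hw [q n]; exact: hw.
Qed.

(** Up to [T] exactly the interactions of [l] occur, in this order. Gaps are positive only almost
    surely, so positivity is made part of the event. *)
Definition event_set (l : seq Q) : set gapsp :=
  [set c | in_order T c l && all_silent T l c /\ forall x, (0 < c x)%R].

Let measurable_silent l : measurable_fun [set: gapsp] (fun c : gapsp => all_silent T l c).
Proof.
have -> : (fun c : gapsp => all_silent T l c) = (fun c =>
    all (fun q => T < tm c q (count_mem q l).+1)%R (enum {: Q})).
  apply/funext => c; apply/forallP/allP => [h q _|h q]; first exact: h.
  by apply: h; rewrite mem_enum.
elim: (enum {: Q}) => [|q r ih] /=; first exact: measurable_cst.
apply: measurable_and => //; apply: measurable_fun_ltr; first exact: measurable_cst.
exact: (measurable_tm (g := id)).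
Qed.

Let mbool (b : gapsp -> bool) : measurable_fun setT b -> measurable [set c | b c].
Proof.
move=> mb; rewrite (_ : [set c | b c] = b @^-1` [set true])//.
by rewrite -[X in measurable X]setTI; exact: mb.
Qed.

Let mpos : measurable [set c : gapsp | forall x, (0 < c x)%R].
Proof.
rewrite (_ : [set c | _] = \bigcap_(n in [set: nat]) \bigcap_(q in [set: Q])
   [set c : gapsp | 0 < c (q, n)]%R).
  apply: bigcapT_measurable => n; apply: fin_bigcap_measurable => [|q _].
    exact: (@finite_finset (Specif_sig__canonical__fintype_Finite (fun p : 'I_N * 'I_N => (p.1 < p.2)%N)) setT).
  apply: measurable_ltr; [exact: measurable_cst|exact: measurable_coord].
by apply/seteqP; split => c /= h => [n _ q _|[q n]]; [exact: h|exact: h].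
Qed.

Lemma measurable_event_set l : measurable (event_set l).
Proof.
rewrite (_ : event_set l = [set c | in_order T c l && all_silent T l c] `&` [set c | forall x, (0 < c x)%R])//.
apply: measurableI => //; apply: mbool; apply: measurable_and => //.
exact: (measurable_in_order T (g := id)).
Qed.

(** The first ring after the events of [l], capped at [T + 1] so that it makes sense even without
    clocks; on [event_set] it exceeds [T]. *)
Let horizon l (c : gapsp) : R :=
  foldr (fun q r => Num.min (tm c q (count_mem q l).+1) r) (T + 1)%R (enum {: Q}).

Let measurable_horizon l : measurable_fun setT (horizon l).
Proof.
rewrite /horizon; elim: (enum {: Q}) => [|q r ih] /=; first exact: measurable_cst.
apply: measurable_minr => //; exact: (measurable_tm (g := id)).
Qed.

Let horizon_le l c q : (horizon l c <= tm c q (count_mem q l).+1)%R.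
Proof.
rewrite /horizon; have : q \in enum {: Q} by rewrite mem_enum.
elim: (enum {: Q}) => [//|p r ih]; rewrite inE /= ge_min => /orP[/eqP ->|/ih ->]; first by rewrite lexx.
by rewrite orbT.
Qed.

Let horizon_gt l c : all_silent T l c -> (T < horizon l c)%R.
Proof.
move=> /forallP h; rewrite /horizon; elim: (enum {: Q}) => [|p r ih] /=; first by rewrite ltrDl.
by rewrite lt_min h.
Qed.

(** [representation] expresses the left side through the gaps, [chain_law] integrates the gaps out,
    and [biter_full_step] replaces full steps by pair steps. As the horizon is beyond [T], a
    function of the paths stopped at [T] is read strictly before it. *)
Lemma event_formula l (Phi : conf -> \bar R) : (forall z, 0 <= Phi z) -> measurable_fun setT Phi ->
  (forall z, Phi z = Phi (stop_all z T)) ->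
  \int[P]_(w in clocks @^-1` event_set l) Phi (particles w) =
  (lam ^+ size l * expR (- lam * T) ^+ #|{: Q}|)%:E * \int[nu0]_z biter T pstep l (fun=> Phi) 0%R z.
Proof.
move=> Phi0 mPhi hPhi.
have mA := measurable_event_set l.
have mF : measurable_fun setT (fun x : R * conf => Phi x.2).
  exact: (measurableT_comp mPhi measurable_snd).
rewrite -(@biter_full_step _ _ _ hLam _ hPx _ muhat_bound N T l 0%R nu0 (fun=> Phi) (lexx 0%R)
  (nu0_fresh nu0_free hPx) (fun=> Phi0) mF).
have := chain_law T0 mclocks indep fstep nu0 l Phi0 mPhi.
move=> <-.
have mFc : measurable_fun [set: gapsp * conf] (fun x => Phi x.2).
  exact: (measurableT_comp mPhi measurable_snd).
apply: (etrans (representation hLam muhat_bound hps (T := T) (nu0_start nu0_free)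
   (l := l) (F := fun x => Phi x.2) mA (measurable_horizon l) _ (fun x => Phi0 _) mFc _)).
- move=> c [/andP[ol sl] c0]; split => //.
  exact: le_lt_trans (last_time_leT T0 ol) (horizon_gt sl).
- move=> c z [/andP[ol sl] c0] /=; rewrite hPhi [RHS]hPhi; congr Phi; apply/funext => i.
  have Tu := horizon_gt sl; apply: path_ext => t.
  rewrite /stop_all !stopE /prestop_all /prestop (le_lt_trans T0 Tu) glueE.
  have m0 : (0 <= Num.min (Num.max 0%R t) T)%R by rewrite le_min T0 le_max lexx.
  by rewrite (max_r m0) (le_lt_trans _ Tu)// ge_min lexx orbT.
have mO : measurable (clocks @^-1` event_set l).
  by rewrite -[X in measurable X]setTI; exact: mclocks.
pose G (c : gapsp) : \bar R := \int[nu0]_z chain fstep c l Phi z.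
have mG : measurable_fun setT G by exact: (measurable_nu_chain fstep nu0 l (F := fun=> Phi) (fun=> Phi0) mF).
have mGc : measurable_fun setT (fun w => G (clocks w)) by exact: (measurableT_comp mG mclocks).
rewrite integral_mkcond; apply: ae_eq_integral; [exact: measurableT| | |].
- by apply/(measurable_restrictT _ mO); apply: measurable_funTS.
- apply: emeasurable_funM; last exact: mGc.
  apply/measurable_EFinP; apply: (measurableT_comp (f := fun x : bool => x%:R : R)) => //.
  apply: measurable_and; first exact: measurable_in_order.
  exact: (measurableT_comp (@measurable_silent l) mclocks).
apply: filterS gaps_pos => w hw _; rewrite patchE.
have -> : (w \in clocks @^-1` event_set l) =
    in_order T (clocks w) l && all_silent T l (clocks w).
  by apply/idP/idP => [/set_mem[]//|h]; apply/mem_set; split.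
by case: (_ && _); rewrite ?mul1e ?mul0e.
Qed.

End event_formula.

End PartY2.

(** * Summation over all lists of interactions *)

Module PartY2b.
Import PartA PartB PartC PartD PartF PartH PartL PartM PartO PartS PartU PartV PartW PartX1 PartX2 PartX3 PartY1 PartY2.

Section poisson_mass.
Context (R : realType) (Q : finType) (T : R).
Context dZ (Z : measurableType dZ) (J : Q -> R.-pker (R * Z)%type ~> Z).
Local Open Scope ereal_scope.

(** The volume of the simplex of [n] ordered times, with [#|Q|] choices of a clock for each. *)
Lemma iter_total_op1 n s z : (s <= T)%R ->
  iter n (total_op T J) (fun _ _ => 1) s z = ((#|Q|%:R * (T - s)) ^+ n / n`!%:R)%:E.
Proof.
elim: n s z => [|n ih] s z sT; first by rewrite /= expr0 fact0 divr1.
rewrite iterS /total_op.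
have bE p : bop T J p (iter n (total_op T J) (fun _ _ => 1)) s z =
    ((#|Q|%:R ^+ n / n`!%:R)%:E * ((T - s) ^+ n.+1 / n.+1%:R)%:E).
  have mm : measurable_fun (`]s, T]%classic : set R) (fun r : R => ((T - r) ^+ n)%:E).
    apply/measurable_EFinP/measurable_funTS; apply: measurable_funX.
    by apply: measurable_funB; [exact: measurable_cst|exact: measurable_id].
  have mI : measurable (`]s, T]%classic : set (measurableTypeR R)) by exact: measurable_itv.
  rewrite -integral_monomial//.
  rewrite -(ge0_integralZl lebesgue_measure mI mm); last 2 first.
  - by move=> r /=; rewrite in_itv/= => /andP[_ rT]; rewrite lee_fin exprn_ge0// subr_ge0.
  - by rewrite lee_fin divr_ge0.
  apply: eq_integral => r; rewrite inE /= in_itv/= => /andP[_ rT].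
  rewrite /jop (eq_integral (cst ((#|Q|%:R * (T - r)) ^+ n / n`!%:R)%:E)); last first.
    by move=> y _; rewrite ih.
  rewrite integral_cst// (@prob_kernel _ _ _ _ _ (J p)) mule1 -EFinM exprMn.
  by rewrite mulrAC.
under eq_bigr do rewrite bE -EFinM.
rewrite sumEFin big_const_seq count_predT -cardE iter_addr_0; congr EFin.
have f0 : n`!%:R != 0%R :> R by rewrite pnatr_eq0 -lt0n fact_gt0.
have n0 : n.+1%:R != 0%R :> R by rewrite pnatr_eq0.
rewrite exprMn factS natrM -[LHS]mulr_natl.
apply: (mulIf (mulf_neq0 n0 f0)); rewrite mulfVK ?mulf_neq0// (exprS (#|Q|%:R)%R n).
rewrite (_ : _ * _ * _ = #|Q|%:R * #|Q|%:R ^+ n * (T - s) ^+ n.+1 *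
  (n.+1%:R^-1 * n.+1%:R) * (n`!%:R^-1 * n`!%:R))%R; last by ring.
by rewrite !mulVf// !mulr1.
Qed.

End poisson_mass.

Section total_formula.
Context (R : realType) (dim N : nat).
Notation E := 'rV[R]_dim.
Notation D := (skorohod dim (+oo : \bar R)).
Notation conf := (prodspace 'I_N D).
Notation Q := (pair_index N).
Notation gapsp := (prodspace (Q * nat)%type R).
Variables (Lam : R) (hLam : 0 < Lam) (Px : R.-pker E ~> D) (hPx : markov_process Px).
Variables (muhat : R.-ker (E * E)%type ~> (E * E)%type).
Hypothesis muhat_bound : forall v w, (muhat (v, w) setT <= Lam%:E)%E.
Variables (P0 : probability E R) (dO : measure_display) (Omega : measurableType dO).
Variables (P : probability Omega R) (tau : Q -> nat -> {RV P >-> R}) (Z : 'I_N -> {RV P >-> D}).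
Hypothesis hps : particle_system Lam Px muhat P0 tau Z.
Variables (T : R) (T0 : 0 <= T).
Let lam := Lam / N.-1%:R.
Hypothesis lam0 : 0 < lam.
Variable nu0 : probability conf R.
Local Open Scope ereal_scope.
Hypothesis nu0_free : nu0 = prodker (fun=> free_law Px P0) (enum 'I_N) tt :> {measure set conf -> \bar R}.
Notation clocks := (clocks tau).
Notation particles := (particles Z).
Notation pstep := (@pair_step _ _ _ hLam Px _ muhat_bound N).

Let mclocks := measurable_clocks tau.
Let mparticles := measurable_particles Z.

Let weight n : R := (lam ^+ n * expR (- lam * T) ^+ #|{: Q}|)%R.

Let weight_ge0 n : (0 <= weight n)%R.
Proof. by rewrite mulr_ge0// exprn_ge0// ?ltW// expR_ge0. Qed.

Let ev l : set Omega := clocks @^-1` event_set T l.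

Let mev l : measurable (ev l).
Proof. by rewrite -[X in measurable X]setTI; apply: mclocks => //; exact: measurable_event_set. Qed.

(** If one list had more rings of some clock than the other, the extra ring would be both at most
    [T] and after [T]. Equal counts then determine the list. *)
Let ev_disjoint l l' w : ev l w -> ev l' w -> l = l'.
Proof.
move=> [/andP[ol sl] c0] [/andP[ol2 sl2] _].
move/forallP : sl => sl; move/forallP : sl2 => sl2.
apply: (in_order_inj ol ol2) => q; apply/eqP; rewrite eqn_leq.
suff key m m' : in_order T (clocks w) m -> (forall q, T < tm (clocks w) q (count_mem q m').+1)%R ->
    (count_mem q m <= count_mem q m')%N by rewrite !key.
move=> om sm; rewrite leqNgt; apply/negP => h.
have := le_lt_trans (tm_le_last_time q om) (le_lt_trans (last_time_leT T0 om) (sm q)).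
by rewrite ltNge tm_mono.
Qed.

Let level n : set Omega := \big[setU/set0]_(l <- lists {: Q} n) ev l.

Let mlevel n : measurable (level n).
Proof. by apply: bigsetU_measurable. Qed.

Let levelP n w : level n w -> exists2 l, size l = n & ev l w.
Proof. by rewrite /level -bigcup_seq => -[l /= /size_lists ls hl]; exists l. Qed.

Let level_formula n (Phi : conf -> \bar R) : (forall z, 0 <= Phi z) -> measurable_fun setT Phi ->
  (forall z, Phi z = Phi (stop_all z T)) ->
  \int[P]_(w in level n) Phi (particles w) =
  (weight n)%:E * \int[nu0]_z iter n (total_op T pstep) (fun=> Phi) 0%R z.
Proof.
move=> Phi0 mPhi hPhi.
have mF : measurable_fun setT (fun x : R * conf => Phi x.2).
  exact: (measurableT_comp mPhi measurable_snd).
have mPp : measurable_fun setT (fun w => Phi (particles w)) by exact: (measurableT_comp mPhi mparticles).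
rewrite /level ge0_integral_bigsetU//; last 3 first.
- exact: uniq_lists.
- by move=> l l' _ _ [w [h h']]; exact: ev_disjoint h h'.
- exact: measurable_funTS.
under [X in _ = _ * X]eq_integral do rewrite iter_total_op//.
have mb l : measurable_fun setT (fun z => biter T pstep l (fun=> Phi) 0%R z).
  have mt : measurable_fun setT (fun z : conf => (0%R : R, z)).
    by apply: measurable_fun_pair => //; exact: measurable_cst.
  exact: (measurableT_comp (measurable_biter T pstep l (fun=> Phi0) mF) mt).
rewrite ge0_integral_sum//; last by move=> l z _; exact: biter_ge0.
rewrite ge0_sume_distrr; last first.
  by move=> l _; apply: integral_ge0 => z _; exact: biter_ge0.
rewrite big_seq [RHS]big_seq; apply: eq_bigr => l /size_lists ls.
apply: etrans (event_formula hLam hPx muhat_bound hps T0 lam0 nu0_free l Phi0 mPhi hPhi) _.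
by rewrite /weight ls.
Qed.

Let tlevel : trivIset setT level.
Proof.
move=> n m _ _ [w [/levelP[l <- hl] /levelP[l' <- hl']]].
by congr size; exact: ev_disjoint hl hl'.
Qed.

Let levels_formula (Phi : conf -> \bar R) : (forall z, 0 <= Phi z) -> measurable_fun setT Phi ->
  (forall z, Phi z = Phi (stop_all z T)) ->
  \int[P]_(w in \bigcup_n level n) Phi (particles w) =
  \sum_(n <oo) (weight n)%:E * \int[nu0]_z iter n (total_op T pstep) (fun=> Phi) 0%R z.
Proof.
move=> Phi0 mPhi hPhi.
have mPp : measurable_fun setT (fun w => Phi (particles w)) by exact: (measurableT_comp mPhi mparticles).
rewrite ge0_integral_bigcup//; last exact: measurable_funTS.
by apply: eq_eseriesr => n _; exact: level_formula.
Qed.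

(** That almost surely finitely many rings occur up to [T] is obtained without studying the clocks:
    with [Phi = 1] the formula gives the total mass of all levels as the sum of the Poisson weights
    of mean [lam * #|Q| * T], which is 1. *)
Let full_mass : P (\bigcup_n level n) = 1.
Proof.
have := @levels_formula (fun=> 1) (fun=> lee01) (@measurable_cst _ _ _ _ _ _) (fun=> erefl).
have mB : measurable (\bigcup_n level n) by apply: bigcup_measurable.
rewrite integral_cst// mul1e => ->.
pose x := (lam * (#|{: Q}|%:R * T))%R.
have wE n : (weight n)%:E * \int[nu0]_z iter n (total_op T pstep) (fun _ _ => 1) 0%R z =
    (expR (- x))%:E * (exp_coeff x n)%:E.
  rewrite (eq_integral (cst ((#|{: Q}|%:R * (T - 0)) ^+ n / n`!%:R)%:E)); last first.
    by move=> z _; rewrite iter_total_op1.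
  have n1 : nu0 setT = 1 by exact: probability_setT.
  rewrite integral_cst// [X in _ * (_ * X)]n1 mule1 -!EFinM subr0; congr EFin.
  rewrite /weight /exp_coeff /= -expRM_natl.
  have -> : (#|{: Q}|%:R * (- lam * T))%R = (- x)%R by rewrite /x mulNr mulrN mulrCA.
  rewrite (_ : x ^+ n = lam ^+ n * (#|{: Q}|%:R * T) ^+ n)%R; last by rewrite /x exprMn.
  ring.
under eq_eseriesr do rewrite wE.
have c0 n : 0 <= (exp_coeff x n)%:E :> \bar R.
  have x0 : (0 <= x)%R by apply: mulr_ge0; [exact: ltW|exact: mulr_ge0].
  by rewrite lee_fin exp_coeff_ge0.
rewrite nneseriesZl//.
have -> : \sum_(n <oo) (exp_coeff x n)%:E = (expR x)%:E.
  rewrite /expR -EFin_lim; last exact: is_cvg_series_exp_coeff.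
  by congr (limn _); apply/funext => n; rewrite /= /series /= sumEFin.
by rewrite -EFinM -expRD addNr expR0.
Qed.

Theorem total_formula (Phi : conf -> \bar R) : (forall z, 0 <= Phi z) -> measurable_fun setT Phi ->
  (forall z, Phi z = Phi (stop_all z T)) ->
  \int[P]_w Phi (particles w) =
  \sum_(n <oo) (lam ^+ n * expR (- lam * T) ^+ #|{: Q}|)%:E *
    \int[nu0]_z iter n (total_op T pstep) (fun=> Phi) 0%R z.
Proof.
move=> Phi0 mPhi hPhi; rewrite -levels_formula//.
have mB : measurable (\bigcup_n level n) by apply: bigcup_measurable.
have mPp : measurable_fun setT (fun w => Phi (particles w)) by exact: (measurableT_comp mPhi mparticles).
rewrite -(setUv (\bigcup_n level n)) ge0_integral_setU//; last 3 first.
- exact: measurableC.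
- by rewrite setUv.
- exact/disj_setPCl.
rewrite [X in _ + X]null_set_integral ?adde0//; first exact: measurableC.
- exact: measurable_funTS.
- apply: (etrans (probability_setC P mB)).
  by rewrite full_mass subee.
Qed.

End total_formula.

End PartY2b.

(** * Exponential inequalities and a comparison lemma in time *)

Module PartY3.
Import PartA PartL PartM PartO.

(** Multiplying [1 - x <= expR (- x)] by [expR x] gives [expR x * (1 - x) <= 1], and
    [1 <= (1 + x + 2 * x ^+ 2) * (1 - x)] for [x <= 2^-1]. *)
Lemma expR_le_quadratic (R : realType) (x : R) : x <= 2^-1 -> expR x <= 1 + x + 2 * x ^+ 2.
Proof.
move=> x1; have h := expR_ge1Dx (- x); have p : 0 < 1 - x by lra.
have e : expR x * expR (- x) = 1 by rewrite -expRD subrr expR0.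
have h1 := ler_wpM2l (expR_ge0 x) h; rewrite e in h1.
rewrite -(ler_pM2r p); apply: (le_trans h1).
rewrite expr2; nra.
Qed.

Section exp_step.
Context (R : realType) d (X : measurableType d) (mu : {measure set X -> \bar R}).
Hypothesis mu1 : mu setT = 1%E.

(** The reference [b] need not be the mean. It is the mean in [prodker_exp]; for the jump dynamics
    it is the value before the jump, where the first order term [m - b] has to be kept. *)
Lemma exp_step (f : X -> R) (b m eta : R) : measurable_fun setT f -> (forall y, 0 <= f y) ->
  0 <= b -> eta <= 2^-1 -> (forall y, `|f y - b| <= eta) -> (\int[mu]_y (f y)%:E = m%:E)%E ->
  (\int[mu]_y (expR (f y))%:E <= (expR b * (1 + m - b + 2 * eta ^+ 2))%:E)%E.
Proof.
move=> mf f0 b0 eta1 fb fm.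
have mef : measurable_fun setT (fun y => (expR (f y))%:E).
  by apply/measurable_EFinP; exact: measurableT_comp.
have mEf : measurable_fun setT (fun y => (f y)%:E) by exact/measurable_EFinP.
have cst c : (\int[mu]_y (cst c%:E) y = c%:E)%E.
  by rewrite integral_cst// mu1 mule1.
have e0 : 0 <= expR b by exact: expR_ge0.
have pt y : expR (f y) + expR b * b <= expR b * (1 + 2 * eta ^+ 2) + expR b * f y.
  rewrite -[X in expR X](subrK b) expRD [expR (_ - b) * _]mulrC.
  have h := fb y; have /expR_le_quadratic : f y - b <= 2^-1 by rewrite (le_trans (ler_norm _))// (le_trans h).
  have : (f y - b) ^+ 2 <= eta ^+ 2.
    by rewrite -real_normK ?num_real// ler_pXn2r// nnegrE// (le_trans _ h).
  move=> h1 h2; have := ler_wpM2l e0 h2; have := ler_wpM2l e0 h1; rewrite !mulrDr mulrN mulr1.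
  lra.
(* Negative terms are moved across, so that only nonnegative functions are integrated. *)
have key : (\int[mu]_y (expR (f y))%:E + (expR b * b)%:E <=
    (expR b * (1 + 2 * eta ^+ 2))%:E + (expR b)%:E * m%:E)%E.
  rewrite -fm -ge0_integralZl//; [|by move=> y _; rewrite lee_fin..].
  have c0 : 0 <= expR b * b by rewrite mulr_ge0.
  have c1 : 0 <= expR b * (1 + 2 * eta ^+ 2) by rewrite mulr_ge0// addr_ge0// mulr_ge0// sqr_ge0.
  rewrite -(cst (expR b * b)) -(cst (expR b * (1 + 2 * eta ^+ 2))) -!ge0_integralD//.
  - apply: ge0_le_integral => //.
    + by move=> y _; rewrite -EFinD lee_fin addr_ge0// expR_ge0.
    + by apply: emeasurable_funD => //; exact: measurable_cst.
    + apply: emeasurable_funD; first exact: measurable_cst.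
      by apply: emeasurable_funM => //; exact: measurable_cst.
    + by move=> y _; rewrite /= -EFinM -!EFinD lee_fin.
  - by move=> y _; rewrite -EFinM lee_fin mulr_ge0.
  - by apply: emeasurable_funM => //; exact: measurable_cst.
have -> : (expR b * (1 + m - b + 2 * eta ^+ 2))%:E =
   ((expR b * (1 + 2 * eta ^+ 2))%:E + (expR b)%:E * m%:E - (expR b * b)%:E)%E.
  by congr EFin; ring.
by rewrite leeBrDr.
Qed.

End exp_step.

Section supersolution.
Context (R : realType) (kap K A B T s0 : R) (w a : R -> R) (q : R -> \bar R).
Hypotheses (kap0 : 0 <= kap) (K0 : 0 <= K) (A0 : 0 <= A) (B0 : 0 <= B) (s0T : s0 <= T).
Hypothesis wB : forall r, s0 <= r <= T -> 0 <= w r <= B.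
Hypothesis aA : forall r, s0 < r <= T -> 0 <= a r <= A.
Hypotheses (ma : measurable_fun setT a) (mq : measurable_fun setT q) (q0 : forall r, (0 <= q r)%E).
Hypothesis wa : forall s t, s0 <= s -> s <= t -> t <= T ->
  (\int[lebesgue_measure]_(r in `]s, t]) (a r)%:E = (w s - w t)%:E)%E.

Let theta r := expR (- (kap * (T - r))).
Let X r := K * (T - r) + theta r * w r.
Hypothesis qX : forall r, s0 < r <= T ->
  (q r <= (expR (X r) * (K + theta r * (a r - kap * w r)))%:E)%E.

Let itvm (s t : R) : measurable (`]s, t]%classic : set (measurableTypeR R)).
Proof. exact: measurable_itv. Qed.

Let leb (s t c : R) : s <= t ->
  (\int[lebesgue_measure]_(r in `]s, t]) (cst c%:E) r = (c * (t - s))%:E)%E.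
Proof.
move=> st; rewrite integral_cst//= lebesgue_measure_itv/= lte_fin.
move: st; rewrite le_eqVlt => /orP[/eqP ->|st]; first by rewrite ltxx subrr mulr0 mule0.
by rewrite st -EFinB -EFinM.
Qed.

Let th r t : r <= t -> t <= T -> [/\ 0 <= theta r, theta r <= theta t & theta t <= 1].
Proof.
move=> rt tT; split; first exact: expR_ge0.
- by rewrite ler_expR lerN2 ler_wpM2l// lerD2l lerN2.
- by rewrite -expR0 ler_expR oppr_le0 mulr_ge0// subr_ge0.
Qed.

Let wdec s t : s0 <= s -> s <= t -> t <= T -> 0 <= w s - w t <= A * (t - s).
Proof.
move=> h1 h2 h3; rewrite -!lee_fin -wa// -leb//; apply/andP; split.
  apply: integral_ge0 => r; rewrite /= in_itv/= => /andP[h4 h5].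
  by rewrite lee_fin; have /aA/andP[] : s0 < r <= T by rewrite (le_lt_trans h1) ?(le_trans h5).
apply: ge0_le_integral => //.
- move=> r; rewrite /= in_itv/= => /andP[h4 h5].
  by rewrite lee_fin; have /aA/andP[] : s0 < r <= T by rewrite (le_lt_trans h1) ?(le_trans h5).
- exact/measurable_EFinP/measurable_funTS.
- move=> r; rewrite /= in_itv/= => /andP[h4 h5].
  by rewrite lee_fin; have /aA/andP[] : s0 < r <= T by rewrite (le_lt_trans h1) ?(le_trans h5).
Qed.

(** [C5] bounds how much [X] grows backward in time per unit length, [C1] the second order error due
    to the variation of [theta] and [w], and [Ym] bounds [expR (X t)]. *)
Let C1 := kap * (A + kap * B).
Let C5 := K + A.
Let Ym := expR (K * (T - s0) + B).

(** The comparison on a short interval, with an error quadratic in its length. As [theta] increases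
    and [w] decreases, the factors can be frozen at the ends of the interval. *)
Let local s t : s0 <= s -> s <= t -> t <= T ->
  (\int[lebesgue_measure]_(r in `]s, t]) q r <=
    (expR (C5 * (t - s)) * (expR (X s) - expR (X t) + Ym * C1 * (t - s) ^+ 2))%:E)%E.
Proof.
move=> h1 st h3.
have [ts0 tst tt1] := th st h3.
have /andP[wt0 wtB] := wB (introT andP (conj (le_trans h1 st) h3)).
have /andP[ws0 wsB] := wB (introT andP (conj h1 (le_trans st h3))).
have /andP[dw0 dwA] := wdec h1 st h3.
have kst : 0 <= kap * (t - s) by rewrite mulr_ge0// subr_ge0.
set E0 := expR (X t + C5 * (t - s)).
have E00 : 0 <= E0 by exact: expR_ge0.
pose c := kap * theta s * w t.
have c0 : 0 <= c by rewrite /c !mulr_ge0.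
(* The term with [- kap * w] is bounded by its frozen value [c] and added on the left, again to
   integrate nonnegative functions only. *)
have pt r : s < r <= t -> (q r + (E0 * c)%:E <= (E0 * (K + theta t * a r))%:E)%E.
  move=> /andP[sr rt]; have rT := le_trans rt h3.
  have s0r : s0 <= r := le_trans h1 (ltW sr).
  have ri : s0 < r <= T by rewrite (le_lt_trans h1).
  have := qX ri; have /andP[ar0 arA] := aA ri.
  have [_ tsr _] := th (ltW sr) rT; have [tr0 trt _] := th rt h3.
  have /andP[drt0 drtA] := wdec s0r rt h3.
  have /andP[wr0 _] := wB (introT andP (conj s0r rT)).
  set h := K + _ => qh.
  have hge : 0 <= h.
    have : (0%:E <= (expR (X r) * h)%:E)%E by apply: le_trans qh; exact: q0.
    by rewrite lee_fin pmulr_rge0// expR_gt0.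
  have hle : h + c <= K + theta t * a r.
    have e1 : theta r * a r <= theta t * a r by rewrite ler_wpM2r.
    have e2 : theta s * w t <= theta r * w r by rewrite ler_pM//; lra.
    have e3 := ler_wpM2l kap0 e2; rewrite /h /c; nra.
  have Xr : X r <= X t + C5 * (t - s).
    have e1 : theta r * w r <= theta t * w r by rewrite ler_wpM2r.
    have e2 : theta t * (w r - w t) <= w r - w t by rewrite ler_piMl.
    have e3 : A * (t - r) <= A * (t - s) by rewrite ler_wpM2l//; lra.
    have e4 : K * (t - r) <= K * (t - s) by rewrite ler_wpM2l//; lra.
    rewrite /X /C5; nra.
  have eX : expR (X r) * h <= E0 * h by rewrite ler_wpM2r// ler_expR.
  have fin : (q r <= (E0 * h)%:E)%E by rewrite (le_trans qh)// lee_fin.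
  apply: (@le_trans _ _ ((E0 * h)%:E + (E0 * c)%:E)%E); first exact: leeD2r.
  by rewrite -EFinD lee_fin -mulrDr ler_wpM2l.
have Ec0 : 0 <= E0 * c by rewrite mulr_ge0.
have mqi : measurable_fun (`]s, t]%classic : set (measurableTypeR R)) q.
  exact: measurable_funTS.
have mai : measurable_fun (`]s, t]%classic : set (measurableTypeR R)) (fun r => (a r)%:E).
  exact/measurable_EFinP/measurable_funTS.
have apos r : `]s, t]%classic r -> (0 <= (a r)%:E)%E.
  rewrite /= in_itv/= => /andP[h4 h5]; rewrite lee_fin.
  by have /aA/andP[] : s0 < r <= T by rewrite (le_lt_trans h1) ?(le_trans h5).
have int_le : (\int[lebesgue_measure]_(r in `]s, t]) q r + (E0 * c * (t - s))%:E <=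
    (E0 * K * (t - s))%:E + (E0 * theta t)%:E * (w s - w t)%:E)%E.
  rewrite -wa// -ge0_integralZl//; last by rewrite lee_fin mulr_ge0// (le_trans ts0).
  rewrite -!leb// -!ge0_integralD//.
  - apply: ge0_le_integral => //.
    + by move=> r _; rewrite adde_ge0// ?lee_fin.
    + by apply: emeasurable_funD => //; exact: measurable_cst.
    + apply: emeasurable_funD; first exact: measurable_cst.
      by apply: emeasurable_funM => //; exact: measurable_cst.
    + move=> r; rewrite /= in_itv/= => /pt h; apply: (le_trans h).
      by rewrite -EFinM -EFinD lee_fin mulrDr mulrA.
  - by move=> r _; rewrite lee_fin mulr_ge0.
  - by move=> r rr; apply: mule_ge0; [rewrite lee_fin mulr_ge0// (le_trans ts0)|exact: apos].
  - by apply: emeasurable_funM => //; exact: measurable_cst.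
rewrite -leeBrDr// in int_le.
apply: (le_trans int_le).
have -> : ((E0 * K * (t - s))%:E + (E0 * theta t)%:E * (w s - w t)%:E - (E0 * c * (t - s))%:E)%E =
    (E0 * (K * (t - s) + theta t * (w s - w t) - c * (t - s)))%:E by congr EFin; ring.
rewrite lee_fin.
have dth : theta t - theta s <= kap * (t - s) * theta t.
  have -> : theta s = theta t * expR (- (kap * (t - s))).
    by rewrite /theta -expRD; congr expR; ring.
  have := expR_ge1Dx (- (kap * (t - s))); have tt0 : 0 <= theta t by exact: expR_ge0.
  nra.
have step : K * (t - s) + theta t * (w s - w t) - c * (t - s) <= X s - X t + C1 * (t - s) ^+ 2.
  have e1 : (theta t - theta s) * w s <= kap * (t - s) * theta t * w s by rewrite ler_wpM2r.
  have e2 : theta t * (w s - w t) <= A * (t - s) by rewrite (le_trans _ dwA)// ler_piMl.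
  have e3 : (theta t - theta s) * w t <= kap * (t - s) * B.
    have h : theta t - theta s <= kap * (t - s) by rewrite (le_trans dth)// ler_piMr.
    by rewrite ler_pM// subr_ge0.
  have e4 := ler_wpM2l kst (lerD e2 e3).
  rewrite /X /C1 /c expr2; nra.
have -> : E0 = expR (C5 * (t - s)) * expR (X t) by rewrite /E0 addrC expRD.
rewrite -[X in X <= _]mulrA; apply: ler_wpM2l; first exact: expR_ge0.
apply: (le_trans (ler_wpM2l (expR_ge0 _) step)).
have eXt : expR (X t) <= Ym.
  rewrite ler_expR /X; have e1 : K * (T - t) <= K * (T - s0) by rewrite ler_wpM2l//; lra.
  have e2 : theta t * w t <= w t by rewrite ler_piMl.
  lra.
have C10 : 0 <= C1 * (t - s) ^+ 2.
  by rewrite mulr_ge0 ?sqr_ge0// /C1 mulr_ge0// addr_ge0// mulr_ge0.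
have e5 := ler_wpM2r C10 eXt.
(* Convexity turns the difference of the exponents into a difference of exponentials. *)
have e6 : expR (X t) * (X s - X t) <= expR (X s) - expR (X t).
  have -> : expR (X s) = expR (X t) * expR (X s - X t) by rewrite -expRD; congr expR; ring.
  have := ler_wpM2l (expR_ge0 (X t)) (expR_ge1Dx (X s - X t)); rewrite mulrDr mulr1; lra.
rewrite mulrDr; lra.
Qed.

(** Formally [w' = - a], and the bound in [qX] is minus the derivative of [expR (X r)]. As [a] is
    only measurable, [w] is known through its increments alone; the integral is therefore estimated
    on a partition whose mesh tends to 0. *)
Lemma exp_supersolution :
  (\int[lebesgue_measure]_(r in `]s0, T]) q r <= (expR (X s0) - expR (X T))%:E)%E.
Proof.
pose L := T - s0; have L0 : 0 <= L by rewrite subr_ge0.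
have part (n k : nat) : (k <= n.+1)%N ->
    (\int[lebesgue_measure]_(r in `]s0, (s0 + k%:R * (L / n.+1%:R))%R]) q r <=
    (expR (C5 * (L / n.+1%:R)) * (expR (X s0) - expR (X (s0 + k%:R * (L / n.+1%:R))) +
       k%:R * (Ym * C1 * (L / n.+1%:R) ^+ 2)))%:E)%E.
  set tt := L / n.+1%:R; have t0 : 0 <= tt by rewrite divr_ge0.
  elim: k => [_|k ih kn].
    by rewrite !mul0r !addr0 subrr mulr0 set_itvoc0 integral_set0.
  have km : s0 + k%:R * tt <= s0 + k.+1%:R * tt by rewrite lerD2l ler_wpM2r// ler_nat.
  have kT : s0 + k.+1%:R * tt <= T.
    rewrite -lerBrDl /tt mulrA ler_pdivrMr ?ltr0n// mulrC -/L ler_wpM2l// ler_nat.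
    by [].
  have k0 : s0 <= s0 + k%:R * tt by rewrite lerDl mulr_ge0.
  have h := local k0 km kT.
  have e : s0 + k.+1%:R * tt - (s0 + k%:R * tt) = tt by rewrite -natr1; ring.
  rewrite e in h.
  have -> : (`]s0, (s0 + k.+1%:R * tt)]%classic : set R) =
      `]s0, (s0 + k%:R * tt)]%classic `|` `](s0 + k%:R * tt), (s0 + k.+1%:R * tt)]%classic.
    by rewrite -itv_bndbnd_setU// bnd_simp.
  rewrite ge0_integral_setU//; last 2 first.
  - exact: measurable_funTS.
  - apply/disj_setPS => x [] /=; rewrite !in_itv/= => /andP[_ h4] /andP[h5 _].
    by have := le_lt_trans h4 h5; rewrite ltxx.
  apply: (le_trans (leeD (ih (ltnW kn)) h)); rewrite -EFinD lee_fin -mulrDr.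
  by rewrite ler_wpM2l ?expR_ge0// -natr1; lra.
(* Over [n + 1] equal pieces the quadratic errors add up to a multiple of [harmonic n]. *)
have lim n : (\int[lebesgue_measure]_(r in `]s0, T]) q r <=
    (expR (C5 * L * harmonic n) * (expR (X s0) - expR (X T) + Ym * C1 * L ^+ 2 * harmonic n))%:E)%E.
  have := part n n.+1 (leqnn _).
  have n0 : n.+1%:R != 0 :> R by rewrite pnatr_eq0.
  have -> : n.+1%:R * (L / n.+1%:R) = L by rewrite mulrC divfK.
  rewrite /L addrC subrK -/L => /le_trans; apply; rewrite lee_fin /harmonic.
  rewrite mulrA ler_wpM2l ?expR_ge0// lerD2l expr2 le_eqVlt; apply/orP; left; apply/eqP.
  rewrite (_ : n.+1%:R * _ = Ym * C1 * (L * L) * n.+1%:R^-1 * (n.+1%:R * n.+1%:R^-1)); last by ring.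
  by rewrite mulfV// mulr1 expr2.
have fin : (\int[lebesgue_measure]_(r in `]s0, T]) q r)%E \is a fin_num.
  rewrite ge0_fin_numE; last by apply: integral_ge0.
  exact: (le_lt_trans (lim 0%N) (ltry _)).
rewrite -(fineK fin) lee_fin.
have hc : @harmonic R @ \oo --> (0 : R) := cvg_harmonic.
have c1 : (fun n => C5 * L * harmonic n) @ \oo --> C5 * L * 0.
  by apply: cvgM => //; exact: cvg_cst.
have c2 : (fun n => expR (C5 * L * harmonic n)) @ \oo --> expR (C5 * L * 0).
  exact: (cvg_comp _ _ c1 (@continuous_expR R _)).
have c3 : (fun n => expR (C5 * L * harmonic n) *
   (expR (X s0) - expR (X T) + Ym * C1 * L ^+ 2 * harmonic n)) @ \oo -->
   expR (C5 * L * 0) * (expR (X s0) - expR (X T) + Ym * C1 * L ^+ 2 * 0).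
  apply: cvgM => //; apply: cvgD; first exact: cvg_cst.
  by apply: cvgM => //; exact: cvg_cst.
rewrite !mulr0 expR0 mul1r addr0 in c3.
rewrite -(cvg_lim _ c3)//; apply: limr_ge; first by apply/cvg_ex; eexists; exact: c3.
by near=> n; rewrite -lee_fin fineK.
Unshelve. all: by end_near. Qed.

End supersolution.

End PartY3.

(** * The jump series as the solution of a backward equation *)

Module PartY4a.
Import PartA PartL PartM PartO PartY2 PartY3.

Section picard_series.
Context (R : realType) (Q : finType) (T lam : R) (lam0 : 0 < lam).
Context dZ (Z : measurableType dZ) (J : Q -> R.-pker (R * Z)%type ~> Z).
Local Open Scope ereal_scope.
Implicit Types (F G : R -> Z -> \bar R).

Definition jump_rate (r : R) (f : Z -> \bar R) (z : Z) : \bar R :=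
  lam%:E * \sum_(p <- enum Q) jop J p r f z.

(** Each clock jumps at rate [lam], without the compensating factor of silence. The series is
    therefore not normalised and has mass [expR (lam * #|Q| * (T - s))]. *)
Definition picard F (s : R) (z : Z) : \bar R :=
  \int[lebesgue_measure]_(r in `]s, T]) jump_rate r (F r) z.

Definition meas2 F := measurable_fun setT (fun x : R * Z => F x.1 x.2).

Lemma meas2_section F r : meas2 F -> measurable_fun setT (F r).
Proof.
move=> mF; have mt : measurable_fun setT (fun z : Z => (r, z)).
  by apply: measurable_fun_pair => //; exact: measurable_cst.
exact: (measurableT_comp mF mt).
Qed.

Lemma meas2_time F z : meas2 F -> measurable_fun [set: R] (F ^~ z).
Proof.
move=> mF; have mz : measurable_fun [set: R] (fun=> z) by exact: measurable_cst.
exact: (measurable_fun2 (F := F) mF (@measurable_id _ R setT) mz).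
Qed.

Lemma jump_rate_ge0 r f z : (forall z, 0 <= f z) -> 0 <= jump_rate r f z.
Proof.
move=> f0; apply: mule_ge0; first by rewrite lee_fin ltW.
by apply: sume_ge0 => p _; exact: jop_ge0.
Qed.

Lemma meas2_jop p F : (forall r z, 0 <= F r z) -> meas2 F -> meas2 (fun r => jop J p r (F r)).
Proof. by move=> F0 mF; exact: (@measurable_jop_pair R Q _ Z J _ R p id F F0 (@measurable_id _ R setT) mF). Qed.

Lemma meas2_jump_rate F : (forall r z, 0 <= F r z) -> meas2 F ->
  meas2 (fun r => jump_rate r (F r)).
Proof.
move=> F0 mF; apply: emeasurable_funM; first exact: measurable_cst.
by apply: emeasurable_sum => p; exact: meas2_jop.
Qed.

Lemma picard_ge0 F s z : (forall r z, 0 <= F r z) -> 0 <= picard F s z.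
Proof. by move=> F0; apply: integral_ge0 => r _; exact: jump_rate_ge0. Qed.

Lemma picardE F s z : (forall r z, 0 <= F r z) -> meas2 F ->
  picard F s z = lam%:E * total_op T J F s z.
Proof.
move=> F0 mF; rewrite /picard /jump_rate.
have mj p : measurable_fun `]s, T]%classic (fun r => jop J p r (F r) z).
  exact: (measurable_funTS (meas2_time z (meas2_jop p F0 mF))).
rewrite ge0_integralZl; [|exact: measurable_itv| | |by rewrite lee_fin ltW]; last 2 first.
- by apply: emeasurable_sum => p; exact: mj.
- by move=> r _; apply: sume_ge0 => p _; exact: jop_ge0.
congr (_ * _); rewrite ge0_integral_sum//; last by move=> p r _; exact: jop_ge0.
Qed.

Lemma meas2_picard F : (forall r z, 0 <= F r z) -> meas2 F -> meas2 (picard F).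
Proof.
move=> F0 mF.
apply: (@measurable_time_integral _ _ (R * Z)%type fst T (fun r x => jump_rate r (F r) x.2)) => //.
  by move=> t x; exact: jump_rate_ge0.
apply: (measurable_fun2 (F := fun r => jump_rate r (F r))).
- exact: meas2_jump_rate.
- exact: measurable_fst.
- exact: (measurableT_comp measurable_snd measurable_snd).
Qed.

Lemma le_jump_rate r f g z : (forall z, 0 <= f z) -> measurable_fun setT f ->
  measurable_fun setT g -> (forall z, f z <= g z) -> jump_rate r f z <= jump_rate r g z.
Proof.
move=> f0 mf mg fg; apply: lee_wpmul2l; first by rewrite lee_fin ltW.
by apply: lee_sum => p _; apply: ge0_le_integral => //.
Qed.

Lemma jump_rate_cst r (c : R) z : (0 <= c)%R ->
  jump_rate r (fun=> c%:E) z = (lam * #|Q|%:R * c)%:E.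
Proof.
move=> c0; rewrite /jump_rate.
have jE p : jop J p r (fun=> c%:E) z = c%:E.
  by rewrite /jop integral_cst// (@prob_kernel _ _ _ _ _ (J p)) mule1.
under eq_bigr do rewrite jE.
by rewrite sumEFin big_const_seq count_predT -cardE iter_addr_0 -EFinM -mulrA mulr_natl.
Qed.

Lemma jump_rateD r f g z : (forall z, 0 <= f z) -> (forall z, 0 <= g z) ->
  measurable_fun setT f -> measurable_fun setT g ->
  jump_rate r (fun z => f z + g z) z = jump_rate r f z + jump_rate r g z.
Proof.
move=> f0 g0 mf mg; rewrite /jump_rate -ge0_muleDr; last 2 first.
- by apply: sume_ge0 => p _; exact: jop_ge0.
- by apply: sume_ge0 => p _; exact: jop_ge0.
congr (_ * _); rewrite -big_split /=; apply: eq_bigr => p _.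
by rewrite /jop ge0_integralD.
Qed.

Lemma picard_nneseries (F : nat -> R -> Z -> \bar R) s z :
  (forall n r z, 0 <= F n r z) -> (forall n, meas2 (F n)) ->
  picard (fun r z => \sum_(n <oo) F n r z) s z = \sum_(n <oo) picard (F n) s z.
Proof.
move=> F0 mF; rewrite /picard -integral_nneseries; last 3 first.
- exact: measurable_itv.
- by move=> n; exact: (measurable_funTS (meas2_time z (meas2_jump_rate (F0 n) (mF n)))).
- by move=> n r _; exact: jump_rate_ge0.
apply: eq_integral => r _; rewrite /jump_rate nneseriesZl; last first.
  by move=> n _; apply: sume_ge0 => p _; apply: jop_ge0 => y; exact: F0.
congr (_ * _); rewrite nneseries_sum; last by move=> p n _; apply: jop_ge0 => y; exact: F0.
apply: eq_bigr => p _; rewrite /jop integral_nneseries// => n.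
exact: meas2_section.
Qed.

Section source.
Variable Phi : Z -> \bar R.
Hypotheses (Phi0 : forall z, 0 <= Phi z) (mPhi : measurable_fun setT Phi).

Let source (_ : R) := Phi.
Let msource : meas2 source.
Proof. exact: (measurableT_comp mPhi measurable_snd). Qed.

Lemma iter_picard_ge0 n s z : 0 <= iter n picard source s z.
Proof. by elim: n s z => [//|n ih] s z; exact: picard_ge0. Qed.

Lemma meas2_iter_picard n : meas2 (iter n picard source).
Proof. by elim: n => [//|n ih]; apply: meas2_picard => //; exact: iter_picard_ge0. Qed.

Lemma iter_picardE n s z :
  iter n picard source s z = (lam ^+ n)%:E * iter n (total_op T J) source s z.
Proof.
have t0 m r y : 0 <= iter m (total_op T J) source r y.
  rewrite iter_total_op//; apply: sume_ge0 => l _; exact: biter_ge0.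
have mt m : meas2 (iter m (total_op T J) source).
  have -> : iter m (total_op T J) source = fun r y => \sum_(l <- lists Q m) biter T J l source r y.
    by apply/funext => r; apply/funext => y; rewrite iter_total_op.
  by rewrite /meas2; apply: emeasurable_sum => l; exact: measurable_biter.
elim: n s z => [|n ih] s z; first by rewrite expr0 mul1e.
rewrite iterS (_ : iter n picard source = fun s z => (lam ^+ n)%:E * iter n (total_op T J) source s z); last first.
  by apply/funext => r; apply/funext => y.
have ln : 0 <= (lam ^+ n)%:E :> \bar R by rewrite lee_fin exprn_ge0// ltW.
rewrite picardE; last 2 first.
- by move=> r y; exact: mule_ge0.
- have mc : measurable_fun [set: R * Z] (cst (lam ^+ n)%:E : _ -> \bar R) by exact: measurable_cst.
  exact: (emeasurable_funM mc (mt n)).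
rewrite iterS exprS EFinM -muleA; congr (_ * _).
rewrite /total_op ge0_sume_distrr; last by move=> p _; exact: bop_ge0.
apply: eq_bigr => p _; rewrite /bop -ge0_integralZl//.
- apply: eq_integral => r _; rewrite /jop ge0_integralZl//; exact: meas2_section.
- exact: (measurable_funTS (meas2_time z (meas2_jop p (t0 n) (mt n)))).
- by move=> r _; exact: jop_ge0.
Qed.

Definition solution (s : R) (z : Z) : \bar R := \sum_(n <oo) iter n picard source s z.

Lemma solution_ge0 s z : 0 <= solution s z.
Proof. by apply: nneseries_ge0 => n _ _; exact: iter_picard_ge0. Qed.

Lemma meas2_solution : meas2 solution.
Proof.
apply: (@ge0_emeasurable_sum _ _ R setT (fun n (x : R * Z) => iter n picard source x.1 x.2) xpredT).
- by move=> n x *; exact: iter_picard_ge0.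
- by move=> n *; exact: meas2_iter_picard.
Qed.

Lemma solution_fix s z : solution s z = Phi z + picard solution s z.
Proof.
rewrite /solution (nneseries_recl (P := xpredT) (fun n _ => iter_picard_ge0 n s z) isT).
congr (_ + _); rewrite picard_nneseries; [|exact: iter_picard_ge0|exact: meas2_iter_picard].
rewrite -(@nneseries_addn R (fun n => iter n picard source s z) 1%N); last by move=> n; exact: iter_picard_ge0.
by apply: eq_eseriesr => n _; rewrite addn1 iterS.
Qed.

(* Any supersolution of the fixed-point equation dominates the Picard series. *)
Lemma solution_le G s z : (forall r z, 0 <= G r z) -> meas2 G ->
  (forall r z, (s <= r <= T)%R -> Phi z + picard G r z <= G r z) -> (s <= T)%R ->
  solution s z <= G s z.
Proof.
move=> G0 mG hG sT.
pose S n r y := \sum_(m < n) iter m picard source r y.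
have S0 n r y : 0 <= S n r y by apply: sume_ge0 => m _; exact: iter_picard_ge0.
have mS n : meas2 (S n) by rewrite /meas2; apply: emeasurable_sum => m; exact: meas2_iter_picard.
have rec n r y : S n.+1 r y = Phi y + picard (S n) r y.
  rewrite (picardE r y (S0 n) (mS n)) [LHS]big_ord_recl; congr (_ + _).
  have -> : total_op T J (S n) r y = \sum_(m < n) total_op T J (iter m picard source) r y.
    rewrite /total_op exchange_big /=; apply: eq_bigr => p _.
    rewrite -(bop_sum T J (index_enum _) p (F := fun m : 'I_n => iter m picard source))//.
    - by move=> m *; exact: iter_picard_ge0.
    - by move=> m; exact: meas2_iter_picard.
  rewrite ge0_sume_distrr; last by move=> m _; apply: sume_ge0 => p _; apply: bop_ge0 => *; exact: iter_picard_ge0.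
  apply: eq_bigr => m _; rewrite -picardE//; [exact: iter_picard_ge0|exact: meas2_iter_picard].
have SG n r y : (s <= r <= T)%R -> S n r y <= G r y.
  elim: n r y => [|n ih] r y /andP[sr rT]; first by rewrite /S big_ord0.
  rewrite rec; apply: (le_trans _ (hG r y _)); last by rewrite sr.
  apply: leeD2l; apply: ge0_le_integral => //.
  - by move=> u _; exact: jump_rate_ge0.
  - exact: (measurable_funTS (meas2_time y (meas2_jump_rate (S0 n) (mS n)))).
  - exact: (measurable_funTS (meas2_time y (meas2_jump_rate G0 mG))).
  move=> u; rewrite /= in_itv/= => /andP[ru uT].
  apply: le_jump_rate => //; [exact: (meas2_section u (mS n))|exact: (meas2_section u mG)|].
  by move=> x; apply: ih; rewrite uT (le_trans sr)// ltW.
apply: lime_le; first by apply: is_cvg_nneseries => m _ _; exact: iter_picard_ge0.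
apply: nearW => k; rewrite /= big_mkord; apply: SG; by rewrite lexx.
Qed.

End source.

(** The case [kap = 0], [w = 0], [K = C] of [exp_supersolution]. *)
Lemma exp_time_integral (C s : R) : (0 <= C)%R -> (s <= T)%R ->
  \int[lebesgue_measure]_(r in `]s, T]) (C * expR (C * (T - r)))%:E <= (expR (C * (T - s)) - 1)%:E.
Proof.
move=> C0 sT.
have mq : measurable_fun [set: R] (fun r : R => (C * expR (C * (T - r)))%:E).
  apply/measurable_EFinP; apply: measurable_funM; first exact: measurable_cst.
  apply: measurableT_comp => //; apply: measurable_funM; first exact: measurable_cst.
  by apply: measurable_funB; [exact: measurable_cst|exact: measurable_id].
have := @exp_supersolution R 0 C 0 0 T s (fun=> 0%R) (fun=> 0%R) (fun r => (C * expR (C * (T - r)))%:E)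
  (lexx _) C0 (lexx _) (lexx _) sT (fun r _ => introT andP (conj (lexx _) (lexx _)))
  (fun r _ => introT andP (conj (lexx _) (lexx _))) (@measurable_cst _ _ _ _ _ _) mq.
move=> h; apply: (le_trans (h _ _ _)).
- by move=> r; rewrite lee_fin mulr_ge0// expR_ge0.
- by move=> u v _ _ _; rewrite subrr integral0.
- by move=> r _; rewrite !mulr0 subrr !mulr0 !addr0 mulrC.
- by rewrite lee_fin !mulr0 !addr0 subrr mulr0 expR0.
Qed.

End picard_series.

End PartY4a.

(** * Influence of one particle on the solution *)

Module PartY4b.
Import PartA PartB PartC PartF PartL PartM PartU PartV PartW PartY2 PartY3 PartY4a.

Lemma exp_series (R : realType) (x : R) : 
  (\sum_(n <oo) (exp_coeff x n)%:E = (expR x)%:E)%E.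
Proof.
rewrite /expR -EFin_lim; last exact: is_cvg_series_exp_coeff.
by congr (limn _); apply/funext => n; rewrite /= /series /= sumEFin.
Qed.

Section influence.
Context (R : realType) (dim N : nat).
Notation E := 'rV[R]_dim.
Notation D := (skorohod dim (+oo : \bar R)).
Notation conf := (prodspace 'I_N D).
Notation Q := (Specif_sig__canonical__fintype_Finite (fun p : 'I_N * 'I_N => (p.1 < p.2)%N)).
Variables (Lam : R) (hLam : 0 < Lam) (Px : R.-pker E ~> D).
Variables (muhat : R.-ker (E * E)%type ~> (E * E)%type).
Hypothesis muhat_bound : forall v w, (muhat (v, w) setT <= Lam%:E)%E.
Variables (T lam : R) (T0 : 0 <= T) (lam0 : 0 < lam).
Let J : Q -> R.-pker (R * conf)%type ~> conf := @pair_step _ _ _ hLam Px _ muhat_bound N.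
Hypothesis degree : forall i : 'I_N,
  lam * (count (fun p : Q => (i == lo_of p) || (i == hi_of p)) (enum Q))%:R <= Lam.
Let kap := lam * #|Q|%:R.
Local Open Scope ereal_scope.
Notation picard := (picard T lam J).
Notation jump_rate := (jump_rate lam J).

(** The one-sided inequality is in fact two-sided, since the old coordinate can be put back. *)
Definition bounded_influence (c : R) (f : conf -> \bar R) : Prop :=
  forall z i y, f (upd z i y) <= f z + c%:E.

Let kap0 : (0 <= kap)%R. Proof. by rewrite /kap mulr_ge0// ltW. Qed.

(** If the pair contains [i], the two results differ at most at [lo_of p] and [hi_of p], whatever is
    drawn, which costs [c] twice. Otherwise the draws have the same law, and for equal draws only
    coordinate [i] differs. *)
Lemma jop_influence p r f c z i y : (0 <= c)%R -> (forall z, 0 <= f z) -> measurable_fun setT f ->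
  bounded_influence c f ->
  jop J p r f (upd z i y) <= jop J p r f z +
    (c * (1 + ((i == lo_of p) || (i == hi_of p))%:R))%:E.
Proof.
move=> c0 f0 mf hf; have ij := lo_neq_hi p.
have jE x : jop J p r f x = \int[kinteract hLam Px muhat_bound (r, (x (lo_of p), x (hi_of p)))]_v
    f (upd (upd x (lo_of p) v.1) (hi_of p) v.2).
  exact: (integral_pairk _ _ _ _ _ f0 mf).
have mu2 x : measurable_fun setT (fun v : D * D => f (upd (upd x (lo_of p) v.1) (hi_of p) v.2)).
  apply: (measurableT_comp mf); apply: measurable_upd; last exact: measurable_snd.
  by apply: measurable_upd; [exact: measurable_cst|exact: measurable_fst].
have addc (k : R.-pker (R * (D * D))%type ~> (D * D)%type) a (h : D * D -> \bar R) (b : R) : (0 <= b)%R ->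
    (forall v, 0 <= h v) -> measurable_fun setT h ->
    \int[k a]_v (h v + b%:E) = \int[k a]_v h v + b%:E.
  move=> b0 h0 mh; have mb : measurable_fun setT (fun _ : D * D => b%:E) by exact: measurable_cst.
  have b0' : 0 <= b%:E by rewrite lee_fin.
  rewrite (ge0_integralD (k a) measurableT (fun v _ => h0 v) mh (fun v _ => b0') mb).
  by rewrite integral_cst// (@prob_kernel _ _ _ _ _ k) mule1.
have upper (k : R.-pker (R * (D * D))%type ~> (D * D)%type) a (h : D * D -> \bar R) (b : \bar R) :
    (forall v, 0 <= h v) -> measurable_fun setT h -> (forall v, h v <= b) -> \int[k a]_v h v <= b.
  move=> h0 mh hb; have -> : b = \int[k a]_v cst b v.
    by rewrite integral_cst// (@prob_kernel _ _ _ _ _ k) mule1.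
  by apply: ge0_le_integral.
have lower (k : R.-pker (R * (D * D))%type ~> (D * D)%type) a (h : D * D -> \bar R) (b : \bar R) :
    0 <= b -> measurable_fun setT h -> (forall v, b <= h v) -> b <= \int[k a]_v h v.
  move=> b0 mh hb; have {1}-> : b = \int[k a]_v cst b v.
    by rewrite integral_cst// (@prob_kernel _ _ _ _ _ k) mule1.
  by apply: ge0_le_integral => //; try by move=> v _; exact: b0.
set e := (_ || _); case ee : e; rewrite !jE.
- have two x x' : (forall k, k != lo_of p -> k != hi_of p -> x k = x' k) -> f x <= f x' + (c * 2)%:E.
    move=> h; have -> : x = upd (upd x' (lo_of p) (x (lo_of p))) (hi_of p) (x (hi_of p)).
      apply/funext => k; rewrite /upd; case: eqVneq => [->//|k2]; case: eqVneq => [->//|k1].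
      exact: h.
    apply: (le_trans (hf _ _ _)); apply: (le_trans (leeD2r _ (hf _ _ _))).
    by rewrite -addeA -EFinD mulr_natr mulr2n.
  rewrite -[(1 + true%:R)%R]/(2%:R : R).
  have c2 : (0 <= c * 2)%R by rewrite mulr_ge0.
  (* Every outcome [v] for the changed configuration is compared with every outcome [v'] for the
     original one, so no coupling enters. *)
  apply: upper => [v||v]; [exact: f0|exact: mu2|].
  rewrite -addc//; apply: lower => [||v']; first exact: f0.
    by apply: emeasurable_funD => //; exact: measurable_cst.
  apply: two => k k1 k2; rewrite !(upd_neq _ _ k2) !(upd_neq _ _ k1) upd_neq//.
  by apply/eqP => ki; move: ee; rewrite /e -ki (negbTE k1) (negbTE k2).
- move/negbT: (ee); rewrite /e negb_or => /andP[i1 i2].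
  rewrite addr0 mulr1 (upd_neq _ _ (_ : lo_of p != i)) 1?eq_sym//.
  rewrite (upd_neq _ _ (_ : hi_of p != i)) 1?eq_sym// -addc//.
  apply: ge0_le_integral; [exact: measurableT|by move=> v _; exact: f0|exact: mu2|
    by apply: emeasurable_funD => //; exact: measurable_cst|move=> v _].
  rewrite [upd (upd z i y) _ _]updC// [upd (upd _ i y) _ _]updC//; exact: hf.
Qed.

(** The clocks of total rate [kap] all transmit the influence [c]; those of particle [i], of total
    rate at most [Lam] by [degree], transmit it once more. *)
Lemma jump_rate_influence r f c : (0 <= c)%R -> (forall z, 0 <= f z) -> measurable_fun setT f ->
  bounded_influence c f -> bounded_influence ((kap + Lam) * c) (jump_rate r f).
Proof.
move=> c0 f0 mf hf z i y; rewrite /jump_rate.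
apply: (@le_trans _ _ (lam%:E * \sum_(p <- enum Q) (jop J p r f z +
    (c * (1 + ((i == lo_of p) || (i == hi_of p))%:R))%:E))).
  apply: lee_wpmul2l; first by rewrite lee_fin ltW.
  by apply: lee_sum => p _; exact: jop_influence.
rewrite big_split /= ge0_muleDr; last 2 first.
- by apply: sume_ge0 => p _; exact: jop_ge0.
- by apply: sume_ge0 => p _; rewrite lee_fin mulr_ge0// addr_ge0.
apply: leeD2l; rewrite sumEFin -EFinM lee_fin -mulr_sumr big_split /=.
rewrite big_const_seq count_predT -cardE iter_addr_0.
have -> : (\sum_(p <- enum Q) ((i == lo_of p) || (i == hi_of p))%:R =
    (count (fun p : Q => (i == lo_of p) || (i == hi_of p)) (enum Q))%:R :> R)%R.
  by rewrite -sum1_count natr_sum [RHS]big_mkcond /=; apply: eq_bigr => p _; case: (_ || _).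
have := ler_wpM2r c0 (degree i); rewrite /kap; lra.
Qed.

Section solution.
Variables (phi : conf -> R) (M del : R).
Hypotheses (mphi : measurable_fun setT phi) (phi0 : forall z, (0 <= phi z)%R).
Hypotheses (phiM : forall z, (phi z <= M)%R) (del0 : (0 <= del)%R).
Hypothesis phi_inf : forall z i y, (phi (upd z i y) <= phi z + del)%R.

Let Phi z := (phi z)%:E.
Let Phi0 z : 0 <= Phi z. Proof. by rewrite lee_fin. Qed.
Let mPhi : measurable_fun setT Phi. Proof. exact/measurable_EFinP. Qed.
Let M0 : (0 <= M)%R. Proof. exact: le_trans (phi0 point) (phiM point). Qed.

Definition value (s : R) (z : conf) : \bar R := solution T lam J Phi s z.

Let v0 s z : 0 <= value s z. Proof. exact: solution_ge0. Qed.
Let mv : meas2 value. Proof. exact: meas2_solution. Qed.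

Lemma value_le s z : (s <= T)%R -> value s z <= (M * expR (kap * (T - s)))%:E.
Proof.
move=> sT; apply: (@solution_le R Q T lam lam0 _ conf J Phi Phi0 mPhi
  (fun s _ => (M * expR (kap * (T - s)))%:E)) => //.
- by move=> r x; rewrite lee_fin mulr_ge0// expR_ge0.
- apply/measurable_EFinP; apply: measurable_funM; first exact: measurable_cst.
  apply: measurableT_comp => //; apply: measurable_funM; first exact: measurable_cst.
  by apply: measurable_funB; [exact: measurable_cst|exact: measurable_fst].
move=> r x /andP[_ rT].
have -> : picard (fun s _ => (M * expR (kap * (T - s)))%:E) r x =
    M%:E * \int[lebesgue_measure]_(u in `]r, T]) (kap * expR (kap * (T - u)))%:E.
  have mm : measurable_fun (`]r, T]%classic : set (measurableTypeR R)) (fun u : R => (kap * expR (kap * (T - u)))%:E).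
    apply/measurable_EFinP/measurable_funTS; apply: measurable_funM; first exact: measurable_cst.
    apply: measurableT_comp => //; apply: measurable_funM; first exact: measurable_cst.
    by apply: measurable_funB; [exact: measurable_cst|exact: measurable_id].
  rewrite -ge0_integralZl//; last by move=> u _; rewrite lee_fin mulr_ge0// expR_ge0.
  apply: eq_integral => u _; rewrite jump_rate_cst ?mulr_ge0 ?expR_ge0// -EFinM.
  by congr EFin; rewrite -/kap; ring.
have h := lee_wpmul2l (_ : 0 <= M%:E) (exp_time_integral kap0 rT).
apply: (le_trans (leeD2l _ (h _))); first by rewrite lee_fin.
by rewrite -EFinM -EFinD lee_fin; have := phiM x; lra.
Qed.

(** The [n]-th iterate has influence [g n], the term of an exponential series. The part
    [expR (kap * (T - s))] is the mass of the jump series, so normalisation leaves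
    [expR (Lam * (T - s))]. *)
Lemma value_influence s : (s <= T)%R ->
  bounded_influence (del * expR ((kap + Lam) * (T - s))) (value s).
Proof.
move=> sT z i y; have C0 : (0 <= kap + Lam)%R by rewrite addr_ge0// ltW.
pose g n r : R := (del * ((kap + Lam) * (T - r)) ^+ n / n`!%:R)%R.
have g0 n r : (r <= T)%R -> (0 <= g n r)%R.
  by move=> rT; rewrite /g divr_ge0// mulr_ge0// exprn_ge0// mulr_ge0// subr_ge0.
have itn n r : (r <= T)%R -> bounded_influence (g n r) (iter n picard (fun=> Phi) r).
  elim: n r => [|n ih] r rT x j u.
    by rewrite /g /= expr0 mulr1 divr1 -EFinD lee_fin.
  rewrite !iterS.
  have f0 := iter_picard_ge0 T lam0 J Phi0 n; have mf := meas2_iter_picard T lam0 J Phi0 mPhi n.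
  have mr w := measurable_funTS (meas2_time w (meas2_jump_rate lam J f0 mf)) (D := `]r, T]%classic).
  have mm : measurable_fun (`]r, T]%classic : set (measurableTypeR R)) (fun u : R => ((T - u) ^+ n)%:E).
    apply/measurable_EFinP/measurable_funTS; apply: measurable_funX.
    by apply: measurable_funB; [exact: measurable_cst|exact: measurable_id].
  have c0 : (0 <= del * (kap + Lam) ^+ n.+1 / n`!%:R)%R by rewrite divr_ge0// mulr_ge0// exprn_ge0.
  have -> : (g n.+1 r)%:E = \int[lebesgue_measure]_(u in `]r, T])
      ((del * (kap + Lam) ^+ n.+1 / n`!%:R)%:E * ((T - u) ^+ n)%:E).
    rewrite ge0_integralZl//; last by move=> v; rewrite /= in_itv/= => /andP[_ vT]; rewrite lee_fin exprn_ge0// subr_ge0.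
    rewrite integral_monomial// -EFinM /g factS natrM invfM exprMn; congr EFin; ring.
  rewrite -ge0_integralD//; last 4 first.
  - by move=> v _; exact: jump_rate_ge0.
  - exact: mr.
  - by move=> v; rewrite /= in_itv/= => /andP[_ vT]; rewrite -EFinM lee_fin mulr_ge0// exprn_ge0// subr_ge0.
  - by apply: emeasurable_funM => //; exact: measurable_cst.
  apply: ge0_le_integral => //.
  - by move=> v _; exact: jump_rate_ge0.
  - exact: mr.
  - apply: emeasurable_funD; first exact: mr.
    by apply: emeasurable_funM => //; exact: measurable_cst.
  move=> v; rewrite /= in_itv/= => /andP[_ vT].
  apply: (le_trans (jump_rate_influence v (g0 n v vT) (fun x => f0 v x) (meas2_section v mf) (ih v vT) x j u)).
  apply: leeD2l; rewrite -EFinM lee_fin /g exprS exprMn le_eqVlt; apply/orP; left; apply/eqP; ring.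
have f0 n w := iter_picard_ge0 T lam0 J Phi0 n s w.
apply: (@le_trans _ _ (\sum_(n <oo) (iter n picard (fun=> Phi) s z + (g n s)%:E))).
  by apply: lee_nneseries => n _ *; [exact: f0|exact: itn].
rewrite nneseriesD//; last by move=> n _ _; rewrite lee_fin g0.
apply: leeD2l.
have -> : \sum_(n <oo) (g n s)%:E = \sum_(n <oo) (del%:E * (exp_coeff ((kap + Lam) * (T - s)) n)%:E).
  by apply: eq_eseriesr => n _; rewrite -EFinM /exp_coeff /= /g mulrA.
rewrite nneseriesZl; first by rewrite exp_series -EFinM.
by move=> n _; rewrite lee_fin exp_coeff_ge0// mulr_ge0// subr_ge0.
Qed.

End solution.
End influence.

End PartY4b.

(** * Exponential moments under a product law *)

Module PartY4c.
Import PartA PartB PartC PartL PartM PartY3.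

Section tensorization.
Context (R : realType) (I : choiceType) dW dX (W : measurableType dW) (X : measurableType dX).
Variables (k : I -> R.-pker W ~> X) (w : W) (B eps : R).
Hypotheses (eps0 : 0 <= eps) (eps_half : eps <= 2^-1).
Notation conf := (prodspace I X).
Local Open Scope ereal_scope.

(* Subgaussian bound for functions of independent coordinates, with a non-optimal constant. *)
Lemma prodker_exp (s : seq I) (F : conf -> R) (m : R) : measurable_fun setT F ->
  (forall z, 0 <= F z <= B)%R -> (forall z i y, F (upd z i y) <= F z + eps)%R ->
  \int[prodker k s w]_z (F z)%:E = m%:E ->
  \int[prodker k s w]_z (expR (F z))%:E <= (expR (m + (size s)%:R * (2 * eps ^+ 2)))%:E.
Proof.
elim: s F m => [|i s ih] F m mF FB Finf Fm.
  have mE : measurable_fun setT (fun z => (expR (F z))%:E).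
    by apply/measurable_EFinP; exact: measurableT_comp.
  rewrite integral_prodker_nil//; rewrite integral_prodker_nil in Fm; last exact/measurable_EFinP.
  by case: Fm => ->; rewrite mul0r addr0.
have F0 z : (0 <= F z)%R by have /andP[] := FB z.
have FB' z : (F z <= B)%R by have /andP[] := FB z.
have B0 : (0 <= B)%R := le_trans (F0 point) (FB' point).
have mE : measurable_fun setT (fun z => (F z)%:E) by exact/measurable_EFinP.
have mX : measurable_fun setT (fun z => (expR (F z))%:E).
  by apply/measurable_EFinP; exact: measurableT_comp.
have X0 z : 0 <= (expR (F z))%:E by rewrite lee_fin expR_ge0.
have E0 z : 0 <= (F z)%:E by rewrite lee_fin.
have k1 : k i w setT = 1 by exact: prob_kernel.
have mu2 : measurable_fun setT (fun x : X * conf => upd x.2 i x.1).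
  by apply: measurable_upd; [exact: measurable_snd|exact: measurable_fst].
have mu1 z : measurable_fun setT (fun y : X => upd z i y).
  by apply: measurable_upd => //; exact: measurable_cst.
have mF1 z : measurable_fun setT (fun y : X => (F (upd z i y))%:E) by exact: (measurableT_comp mE (mu1 z)).
have cst c : \int[k i w]_y (cst c%:E) y = c%:E by rewrite integral_cst// [X in _ * X]k1 mule1.
(* The head coordinate is averaged out. [G] inherits the range and the influence bound of [F], so
   the induction hypothesis applies to it. *)
pose G z : R := fine (\int[k i w]_y (F (upd z i y))%:E).
have GE z : \int[k i w]_y (F (upd z i y))%:E = (G z)%:E.
  rewrite /G fineK// ge0_fin_numE; last by apply: integral_ge0.
  apply: (@le_lt_trans _ _ B%:E); last exact: ltry.
  by rewrite -cst; apply: ge0_le_integral => // y _; rewrite lee_fin.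
have lowG z c : (forall y, c <= F (upd z i y))%R -> (0 <= c)%R -> (c <= G z)%R.
  by move=> h c0; rewrite -lee_fin -GE -cst; apply: ge0_le_integral => // y _; rewrite lee_fin.
have uppG z c : (forall y, F (upd z i y) <= c)%R -> (0 <= c)%R -> (G z <= c)%R.
  by move=> h c0; rewrite -lee_fin -GE -(cst c); apply: ge0_le_integral => // y _; rewrite lee_fin.
have GB z : (0 <= G z <= B)%R by rewrite lowG// uppG.
have mG : measurable_fun setT G.
  apply: measurableT_comp; first exact: fine_measurable.
  have mUnit : measurable_fun [set: conf] (fun=> w) by exact: measurable_cst.
  apply: (@measurable_integral_pker R _ _ _ _ (kcomap (k i) mUnit) (fun x : conf * X => (F (upd x.1 i x.2))%:E)) => //.
  apply: (measurableT_comp mE); apply: measurable_upd; [exact: measurable_fst|exact: measurable_snd].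
have Gstep z z' : (forall y, F (upd z i y) <= F (upd z' i y) + eps)%R -> (G z <= G z' + eps)%R.
  move=> h; rewrite -lee_fin EFinD -!GE -(cst eps) -ge0_integralD//.
  apply: ge0_le_integral => // [|y _].
    by apply: emeasurable_funD => //; exact: measurable_cst.
  by rewrite -EFinD lee_fin.
have Ginf z j y : (G (upd z j y) <= G z + eps)%R.
  apply: Gstep => u; case: (eqVneq j i) => [->|ji]; first by rewrite upd_upd lerDl.
  by rewrite updC// Finf.
(* A mean over the head coordinate is within [eps] of every value, since any two values are. *)
have near z y : (`|F (upd z i y) - G z| <= eps)%R.
  have h1 : (F (upd z i y) <= G z + eps)%R.
    rewrite -lerBlDr; case: (leP 0%R (F (upd z i y) - eps)%R) => h; last first.
      by rewrite (le_trans (ltW h))//; have /andP[] := GB z.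
    by apply: lowG => // y'; rewrite lerBlDr -(upd_upd z i y' y) Finf.
  have h2 : (G z <= F (upd z i y) + eps)%R.
    by apply: uppG => [y'|]; [rewrite -(upd_upd z i y y') Finf|rewrite addr_ge0].
  by rewrite ler_norml; apply/andP; split; lra.
have Gm : \int[prodker k s w]_z (G z)%:E = m%:E.
  rewrite -Fm (integral_prodker_cons _ _ _ _ E0 mE).
  apply: (etrans _ (esym (prob_tonelli (prob_kernel _) (prob_kernel _) (fun y z => E0 _) (measurableT_comp mE mu2)))).
  by apply: eq_integral => z _; rewrite GE.
rewrite (integral_prodker_cons _ _ _ _ X0 mX).
rewrite (prob_tonelli (prob_kernel _) (prob_kernel _) (fun y z => X0 _) (measurableT_comp mX mu2)).
have mGE : measurable_fun setT (fun z => (expR (G z))%:E).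
  by apply/measurable_EFinP; exact: measurableT_comp.
have e2 : (0 <= 1 + 2 * eps ^+ 2)%R by rewrite addr_ge0// mulr_ge0// sqr_ge0.
apply: (@le_trans _ _ (\int[prodker k s w]_z ((1 + 2 * eps ^+ 2)%:E * (expR (G z))%:E))).
  apply: ge0_le_integral => //.
  - by move=> z _; apply: integral_ge0.
  - have mUnit : measurable_fun [set: conf] (fun=> w) by exact: measurable_cst.
    apply: (@measurable_integral_pker R _ _ _ _ (kcomap (k i) mUnit) (fun x : conf * X => (expR (F (upd x.1 i x.2)))%:E)) => //.
    apply: (measurableT_comp mX); apply: measurable_upd; [exact: measurable_fst|exact: measurable_snd].
  - by apply: emeasurable_funM => //; exact: measurable_cst.
  move=> z _; have /andP[Gz0 _] := GB z.
  have mFr : measurable_fun setT (fun y => F (upd z i y)) by exact: (measurableT_comp mF (mu1 z)).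
  apply: (le_trans (exp_step k1 mFr (fun y => F0 _) Gz0 eps_half (near z) (GE z))).
  (* The reference is the mean [G z], so the first order term of [exp_step] vanishes. *)
  by rewrite -EFinM lee_fin addrK mulrC.
have XG z : 0 <= (expR (G z))%:E by rewrite lee_fin expR_ge0.
have e2' : 0 <= (1 + 2 * eps ^+ 2)%:E by rewrite lee_fin.
rewrite (ge0_integralZl (prodker k s w) measurableT mGE (fun z _ => XG z) e2').
apply: (le_trans (lee_wpmul2l e2' (ih G m mG GB Ginf Gm))).
rewrite -EFinM lee_fin [leRHS](_ : _ = expR (2 * eps ^+ 2) * expR (m + (size s)%:R * (2 * eps ^+ 2)))%R.
  by rewrite ler_wpM2r ?expR_ge0// expR_ge1Dx.
by rewrite -expRD /= -natr1; congr expR; ring.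
Qed.

End tensorization.

End PartY4c.

(** * An exponential supersolution for the particle dynamics *)

Module PartY4d.
Import PartA PartB PartC PartF PartL PartM PartU PartV PartW PartY2 PartY3 PartY4a PartY4b.

Section exponential_moment.
Context (R : realType) (dim N : nat).
Notation E := 'rV[R]_dim.
Notation D := (skorohod dim (+oo : \bar R)).
Notation conf := (prodspace 'I_N D).
Notation Q := (Specif_sig__canonical__fintype_Finite (fun p : 'I_N * 'I_N => (p.1 < p.2)%N)).
Variables (Lam : R) (hLam : 0 < Lam) (Px : R.-pker E ~> D).
Variables (muhat : R.-ker (E * E)%type ~> (E * E)%type).
Hypothesis muhat_bound : forall v w, (muhat (v, w) setT <= Lam%:E)%E.
Variables (T lam : R) (T0 : 0 <= T) (lam0 : 0 < lam).
Let J : Q -> R.-pker (R * conf)%type ~> conf := @pair_step _ _ _ hLam Px _ muhat_bound N.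
Hypothesis degree : forall i : 'I_N,
  lam * (count (fun p : Q => (i == lo_of p) || (i == hi_of p)) (enum Q))%:R <= Lam.
Let kap := lam * #|Q|%:R.
Local Open Scope ereal_scope.
Variables (phi : conf -> R) (M del : R).
Hypotheses (mphi : measurable_fun setT phi) (phi0 : forall z, (0 <= phi z)%R).
Hypotheses (phiM : forall z, (phi z <= M)%R) (del0 : (0 <= del)%R).
Hypothesis phi_inf : forall z i y, (phi (upd z i y) <= phi z + del)%R.
Let eps := (del * expR (Lam * T))%R.
Hypothesis eps_small : (2 * eps <= 2^-1)%R.

Let V s z := value hLam Px muhat_bound T lam phi s z.
Let w s z : R := fine (V s z).
(** A jump changes two coordinates and moves [X] by at most [2 * eps]; hence [exp_step] costs
    [2 * (2 * eps) ^+ 2] per jump, and jumps come at rate [kap]. *)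
Let K := (kap * (1 + 8 * eps ^+ 2))%R.
Let theta s : R := expR (- (kap * (T - s))).
(** [theta] normalises [w] by the mass of the series from time [s], so [theta s * w s z] is a
    genuine mean. The term with [K] pays for the mass of the exponential series and for the
    fluctuations of the jumps still to come. *)
Let X s z : R := (K * (T - s) + theta s * w s z)%R.

Let kap0 : (0 <= kap)%R. Proof. by rewrite /kap mulr_ge0// ltW. Qed.
Let K0 : (0 <= K)%R. Proof. by rewrite /K mulr_ge0// addr_ge0// mulr_ge0// sqr_ge0. Qed.
Let Phi0 z : 0 <= (phi z)%:E. Proof. by rewrite lee_fin. Qed.
Let mPhi : measurable_fun setT (fun z => (phi z)%:E). Proof. exact/measurable_EFinP. Qed.
Let M0 : (0 <= M)%R. Proof. exact: le_trans (phi0 point) (phiM point). Qed.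
Let v0 s z : 0 <= V s z. Proof. exact: (solution_ge0 T lam0 J Phi0). Qed.
Let mv : meas2 V. Proof. exact: (meas2_solution T lam0 J Phi0 mPhi). Qed.
Let vle s z : (s <= T)%R -> V s z <= (M * expR (kap * (T - s)))%:E.
Proof. exact: (value_le hLam Px muhat_bound lam0 mphi phi0 phiM). Qed.

Let vE s z : (s <= T)%R -> V s z = (w s z)%:E.
Proof.
by move=> sT; rewrite /w fineK// ge0_fin_numE// (le_lt_trans (vle z sT)) ?ltry.
Qed.

Let w0 s z : (0 <= w s z)%R. Proof. exact: fine_ge0. Qed.
Let wM s z : (s <= T)%R -> (w s z <= M * expR (kap * (T - s)))%R.
Proof. by move=> sT; rewrite -lee_fin -vE// vle. Qed.

Let theta0 s : (0 <= theta s)%R. Proof. exact: expR_ge0. Qed.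

Let X0 s z : (s <= T)%R -> (0 <= X s z)%R.
Proof. by move=> sT; apply: addr_ge0; apply: mulr_ge0 => //; rewrite subr_ge0. Qed.

Let mw : measurable_fun setT (fun x : R * conf => w x.1 x.2).
Proof. by apply: (measurableT_comp _ mv); exact: fine_measurable. Qed.

Let mX : measurable_fun setT (fun x : R * conf => X x.1 x.2).
Proof.
have mT : measurable_fun setT (fun x : R * conf => T - x.1)%R.
  by apply: measurable_funB; [exact: measurable_cst|exact: measurable_fst].
apply: measurable_funD; first by apply: measurable_funM => //; exact: measurable_cst.
apply: measurable_funM => //.
rewrite (_ : (fun x : R * conf => theta x.1) = (fun x => expR (0 - kap * (T - x.1))%R)); last first.
  by apply/funext => x; rewrite sub0r.
apply: measurableT_comp => //; apply: measurable_funB; first exact: measurable_cst.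
by apply: measurable_funM => //; exact: measurable_cst.
Qed.

Let w_near u z i y : (u <= T)%R -> (`|w u (upd z i y) - w u z| <= del * expR ((kap + Lam) * (T - u)))%R.
Proof.
move=> uT; have inf := value_influence hLam Px muhat_bound lam0 degree mphi phi0 del0 phi_inf uT.
have h x j v : (w u (upd x j v) <= w u x + del * expR ((kap + Lam) * (T - u)))%R.
  by rewrite -lee_fin EFinD -!vE//; exact: inf.
have h1 := h z i y; have := h (upd z i y) i (z i).
rewrite upd_upd (_ : upd z i (z i) = z).
  by move=> h2; rewrite ler_norml; apply/andP; split; lra.
by apply/funext => j; rewrite /upd; case: eqVneq => [->|].
Qed.

(** The two coordinates are changed one after the other, and [theta] cancels the factor
    [expR (kap * (T - u))] in each influence. *)
Let X_near u z i j y y' : (0 <= u <= T)%R ->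
  (`|X u (upd (upd z i y) j y') - X u z| <= 2 * eps)%R.
Proof.
move=> /andP[u0 uT].
have -> : (X u (upd (upd z i y) j y') - X u z =
  theta u * ((w u (upd (upd z i y) j y') - w u (upd z i y)) + (w u (upd z i y) - w u z)))%R.
  by rewrite /X; ring.
rewrite normrM (ger0_norm (theta0 u)).
have h1 := w_near (upd z i y) j y' uT; have h2 := w_near z i y uT.
have h3 := le_trans (ler_normD _ _) (lerD h1 h2).
apply: (le_trans (ler_wpM2l (theta0 u) h3)).
have -> : (theta u * (del * expR ((kap + Lam) * (T - u)) + del * expR ((kap + Lam) * (T - u))) =
    2 * (del * expR (Lam * (T - u))))%R.
  have -> : expR (Lam * (T - u)) = (theta u * expR ((kap + Lam) * (T - u)))%R.
    by rewrite /theta -expRD; congr expR; ring.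
  ring.
have lT : (Lam * (T - u) <= Lam * T)%R by apply: ler_wpM2l; [exact: ltW|lra].
by rewrite ler_wpM2l// /eps ler_wpM2l// ler_expR.
Qed.

Let jv p u z : R := fine (jop J p u (V u) z).

Let mVu u : measurable_fun setT (V u). Proof. exact: meas2_section. Qed.

Let jV_le p u z : (u <= T)%R -> jop J p u (V u) z <= (M * expR (kap * (T - u)))%:E.
Proof.
move=> uT; have -> : (M * expR (kap * (T - u)))%:E = \int[J p (u, z)]_y cst (M * expR (kap * (T - u)))%:E y.
  by rewrite integral_cst// (@prob_kernel _ _ _ _ _ (J p)) mule1.
apply: ge0_le_integral; [exact: measurableT|by move=> *; exact: v0|exact: mVu|exact: measurable_cst|].
by move=> y _; exact: vle.
Qed.

Let jvE p u z : (u <= T)%R -> jop J p u (V u) z = (jv p u z)%:E.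
Proof.
move=> uT; rewrite /jv fineK// ge0_fin_numE; last exact: jop_ge0.
by rewrite (le_lt_trans (jV_le p z uT)) ?ltry.
Qed.

Let a u z : R := (lam * \sum_(p <- enum Q) jv p u z)%R.

Let aE u z : (u <= T)%R -> jump_rate lam J u (V u) z = (a u z)%:E.
Proof.
by move=> uT; rewrite /jump_rate (eq_bigr (fun p => (jv p u z)%:E)) => [|p _]; rewrite ?sumEFin ?jvE.
Qed.

Let a_bound u z : (0 <= u <= T)%R -> (0 <= a u z <= kap * (M * expR (kap * T)))%R.
Proof.
move=> /andP[u0 uT]; apply/andP; split.
  apply: mulr_ge0; first exact: ltW.
  by apply: sumr_ge0 => p _; apply: fine_ge0; exact: jop_ge0.
rewrite /kap -mulrA; apply: ler_wpM2l; first exact: ltW.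
apply: (@le_trans _ _ (\sum_(p <- enum Q) M * expR (kap * T))%R).
  apply: ler_sum => p _; rewrite -lee_fin -jvE//; apply: (le_trans (jV_le p z uT)).
  by rewrite lee_fin ler_wpM2l// ler_expR ler_wpM2l//; lra.
by rewrite big_const_seq count_predT -cardE iter_addr_0 mulr_natl.
Qed.

Let ma z : measurable_fun setT (fun u => a u z).
Proof.
apply: measurable_funM; first exact: measurable_cst.
apply: measurable_sum => p; apply: measurableT_comp; first exact: fine_measurable.
exact: (meas2_time z (meas2_jop J p v0 mv)).
Qed.

(** The fixed-point equation read between [s] and [t]: [w] decreases at rate [a]. *)
Let w_decrease z s t : (s <= t)%R -> (t <= T)%R ->
  \int[lebesgue_measure]_(r in `]s, t]) (a r z)%:E = (w s z - w t z)%:E.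
Proof.
move=> st tT; have sT := le_trans st tT.
have mj := meas2_time z (meas2_jump_rate lam J v0 mv).
have split : picard T lam J V s z =
    \int[lebesgue_measure]_(r in `]s, t]) (a r z)%:E + picard T lam J V t z.
  have e : (`]s, T]%classic : set R) = `]s, t]%classic `|` `]t, T]%classic.
    by rewrite -itv_bndbnd_setU// bnd_simp.
  rewrite /picard e ge0_integral_setU; [|exact: measurable_itv|exact: measurable_itv|exact: measurable_funTS| |].
  - congr (_ + _); apply: eq_integral => r; rewrite inE/= in_itv/= => /andP[_ rt].
    by rewrite aE// (le_trans rt).
  - by move=> r _; exact: (jump_rate_ge0 lam0).
  - apply/disj_setPS => x [] /=; rewrite !in_itv/= => /andP[_ h4] /andP[h5 _].
    by have := le_lt_trans h4 h5; rewrite ltxx.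
have fs : V s z = (phi z)%:E + picard T lam J V s z := solution_fix T lam0 J Phi0 mPhi s z.
have ft : V t z = (phi z)%:E + picard T lam J V t z := solution_fix T lam0 J Phi0 mPhi t z.
have : V s z = \int[lebesgue_measure]_(r in `]s, t]) (a r z)%:E + V t z.
  by rewrite fs split ft addeCA.
by rewrite !vE// => h; rewrite EFinB h addeK.
Qed.

(** [exp_step] for each pair, with the value before the jump as reference. As [kap] is [lam] times
    the number of pairs, the first order terms add up to [theta u * (a u z - kap * w u z)]. *)
Let jump_exp u z : (0 <= u <= T)%R ->
  jump_rate lam J u (fun y => (expR (X u y))%:E) z <=
  (expR (X u z) * (K + theta u * (a u z - kap * w u z)))%:E.
Proof.
move=> u0T; have /andP[u0 uT] := u0T.
have mXu : measurable_fun setT (X u).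
  have mt : measurable_fun setT (fun z : conf => (u, z)).
    by apply: measurable_fun_pair => //; exact: measurable_cst.
  exact: (measurableT_comp mX mt).
have one p : jop J p u (fun y => (expR (X u y))%:E) z <=
    (expR (X u z) * (1 + 8 * eps ^+ 2 + theta u * (jv p u z - w u z)))%:E.
  pose mu := kinteract hLam Px muhat_bound (u, (z (lo_of p), z (hi_of p))).
  pose f (v : D * D) := X u (upd (upd z (lo_of p) v.1) (hi_of p) v.2).
  have mu2 : measurable_fun setT (fun v : D * D => upd (upd z (lo_of p) v.1) (hi_of p) v.2).
    apply: measurable_upd; last exact: measurable_snd.
    by apply: measurable_upd; [exact: measurable_cst|exact: measurable_fst].
  have mXE : measurable_fun setT (fun y => (X u y)%:E) by exact/measurable_EFinP.
  have mXX : measurable_fun setT (fun y => (expR (X u y))%:E).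
    by apply/measurable_EFinP; exact: measurableT_comp.
  have X0E y : 0 <= (X u y)%:E by rewrite lee_fin X0.
  have XX0 y : 0 <= (expR (X u y))%:E by rewrite lee_fin expR_ge0.
  have mean : \int[mu]_v (f v)%:E = (K * (T - u) + theta u * jv p u z)%:E.
    transitivity (jop J p u (fun y => (X u y)%:E) z).
      exact: (esym (integral_pairk _ _ _ _ _ X0E mXE)).
    have c0 : 0 <= (K * (T - u))%:E by rewrite lee_fin mulr_ge0// subr_ge0.
    have t0 : 0 <= (theta u)%:E by rewrite lee_fin.
    transitivity (\int[J p (u, z)]_y ((K * (T - u))%:E + (theta u)%:E * V u y)).
      by apply: eq_integral => y _; rewrite vE.
    have mtV : measurable_fun setT (fun y => (theta u)%:E * V u y).
      by apply: emeasurable_funM => //; exact: measurable_cst.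
    have mc : measurable_fun [set: conf] (fun=> (K * (T - u))%:E) by exact: measurable_cst.
    rewrite (ge0_integralD (J p (u, z)) measurableT (fun y _ => c0) mc (fun y _ => mule_ge0 t0 (v0 u y)) mtV).
    rewrite (ge0_integralZl (J p (u, z)) measurableT (mVu u) (fun y _ => v0 u y) t0).
    rewrite integral_cst// (@prob_kernel _ _ _ _ _ (J p)) mule1.
    by rewrite [X in _ + _ * X](jvE p z uT).
  have near v : (`|f v - X u z| <= 2 * eps)%R by exact: X_near.
  have mf : measurable_fun setT f by exact: (measurableT_comp mXu mu2).
  have st := exp_step (prob_kernel _) mf (fun v => X0 _ uT) (X0 z uT) eps_small near mean.
  apply: (@le_trans _ _ (\int[mu]_v (expR (f v))%:E)).
    by rewrite le_eqVlt; apply/orP; left; apply/eqP; exact: (integral_pairk _ _ _ _ _ XX0 mXX).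
  apply: (le_trans st); rewrite lee_fin; apply: ler_wpM2l; first exact: expR_ge0.
  by rewrite le_eqVlt; apply/orP; left; apply/eqP; rewrite /X; ring.
rewrite /jump_rate; apply: (le_trans (lee_wpmul2l _ (lee_sum _ (fun p _ => one p)))).
  by rewrite lee_fin ltW.
rewrite sumEFin -EFinM lee_fin -mulr_sumr big_split /= -mulr_sumr.
rewrite (_ : \sum_(p <- enum Q) (jv p u z - w u z) = \sum_(p <- enum Q) jv p u z - #|Q|%:R * w u z)%R; last first.
  rewrite big_split /= sumrN; congr (_ - _)%R.
  by rewrite big_const_seq count_predT -cardE iter_addr_0 mulr_natl.
rewrite big_const_seq count_predT -cardE iter_addr_0 -mulr_natl le_eqVlt; apply/orP; left; apply/eqP.
by rewrite /K /a /kap; ring.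
Qed.

(** [expR (X r z)] equals [expR (phi z)] at [r = T] and is a supersolution by [jump_exp] and
    [exp_supersolution]; hence it dominates the series. *)
Theorem solution_exp z :
  solution T lam J (fun z => (expR (phi z))%:E) 0%R z <=
  (expR (kap * (1 + 8 * eps ^+ 2) * T + expR (- (kap * T)) * w 0%R z))%:E.
Proof.
have mE : measurable_fun setT (fun z => (expR (phi z))%:E).
  by apply/measurable_EFinP; exact: measurableT_comp.
have E0 x : 0 <= (expR (phi x))%:E by rewrite lee_fin expR_ge0.
have Y0 r x : 0 <= (expR (X r x))%:E by rewrite lee_fin expR_ge0.
have mY : meas2 (fun r x => (expR (X r x))%:E).
  by apply/measurable_EFinP; exact: measurableT_comp.
have XT x : X T x = phi x.
  rewrite /X /theta subrr !mulr0 oppr0 expR0 mul1r add0r.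
  have : V T x = (phi x)%:E.
    rewrite /V /value (solution_fix T lam0 J Phi0 mPhi) /picard set_itvoc0.
    by rewrite integral_set0 adde0.
  by rewrite vE// => -[].
have -> : (expR (kap * (1 + 8 * eps ^+ 2) * T + expR (- (kap * T)) * w 0%R z))%R = expR (X 0%R z).
  by rewrite /X /theta /K subr0.
apply: (@solution_le R Q T lam lam0 _ conf J _ E0 mE (fun r x => (expR (X r x))%:E) 0%R z Y0 mY _ T0).
move=> r x /andP[r0 rT].
have Br u : (r <= u <= T)%R -> (0 <= w u x <= M * expR (kap * T))%R.
  move=> /andP[ru uT]; rewrite w0 (le_trans (wM x uT))// ler_wpM2l// ler_expR ler_wpM2l//.
  by have := le_trans r0 ru; lra.
have ar u : (r < u <= T)%R -> (0 <= a u x <= kap * (M * expR (kap * T)))%R.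
  by move=> /andP[ru uT]; apply: a_bound; rewrite uT (le_trans r0 (ltW ru)).
have B0 : (0 <= M * expR (kap * T))%R by rewrite mulr_ge0// expR_ge0.
have q0 u : 0 <= jump_rate lam J u (fun y => (expR (X u y))%:E) x by exact: (jump_rate_ge0 lam0).
have mq := meas2_time x (meas2_jump_rate lam J Y0 mY).
have wa s t : (r <= s)%R -> (s <= t)%R -> (t <= T)%R ->
   \int[lebesgue_measure]_(v in `]s, t]) (a v x)%:E = (w s x - w t x)%:E.
  by move=> _; exact: w_decrease.
have qX u : (r < u <= T)%R -> jump_rate lam J u (fun y => (expR (X u y))%:E) x <=
    (expR (X u x) * (K + theta u * (a u x - kap * w u x)))%:E.
  by move=> /andP[ru uT]; apply: jump_exp; rewrite uT (le_trans r0 (ltW ru)).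
have main := exp_supersolution kap0 K0 (mulr_ge0 kap0 B0) B0 rT Br ar (ma x) mq q0 wa qX.
have XTx : (expR (K * (T - T) + expR (- (kap * (T - T))) * w T x) = expR (phi x))%R by rewrite -(XT x).
apply: (le_trans (leeD2l _ main)); rewrite XTx -EFinD lee_fin /X /theta; lra.
Qed.

End exponential_moment.

End PartY4d.

(** * Counting pairs, and invariance under permutations *)

Module PartY5a.
Import PartA PartB PartC PartF PartH PartL PartM PartU PartV PartW PartX1 PartY1 PartY2 PartY2b PartY3 PartY4a PartY4b PartY4c PartY4d.

Section pair_counting.
Variable N : nat.
Notation Q := (Specif_sig__canonical__fintype_Finite (fun p : 'I_N * 'I_N => (p.1 < p.2)%N)).

Lemma pair_inj (p p' : Q) : lo_of p = lo_of p' -> hi_of p = hi_of p' -> p = p'.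
Proof. by move=> h1 h2; apply: val_inj; rewrite [LHS]surjective_pairing [RHS]surjective_pairing; congr pair. Qed.

(** A pair that contains [i] is determined by its other member. *)
Lemma count_pairs_with (i : 'I_N) :
  (count (fun p : Q => (i == lo_of p) || (i == hi_of p)) (enum Q) <= N.-1)%N.
Proof.
rewrite -size_filter; pose other (p : Q) := if i == lo_of p then hi_of p else lo_of p.
rewrite -(size_map other).
have -> : N.-1 = size (rem i (enum 'I_N)) by rewrite size_rem ?mem_enum// size_enum_ord.
apply: uniq_leq_size.
  rewrite map_inj_in_uniq; first by apply: filter_uniq; exact: enum_uniq.
  move=> p p'; rewrite !mem_filter /other => /andP[hp _] /andP[hp' _].
  have lp : (lo_of p < hi_of p)%N := valP p; have lp' : (lo_of p' < hi_of p')%N := valP p'.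
  case: (boolP (i == lo_of p)) hp => [/eqP e1 _|n1 /= /eqP e1];
    case: (boolP (i == lo_of p')) hp' => [/eqP e2 _|n2 /= /eqP e2] e.
  - by apply: pair_inj; [rewrite -e1|].
  - by move: lp lp'; rewrite -e1 e -e2 => l1 l2; have := ltn_trans l1 l2; rewrite ltnn.
  - by move: lp lp'; rewrite -e1 -e2 -e => l1 l2; have := ltn_trans l1 l2; rewrite ltnn.
  - by apply: pair_inj; [|rewrite -e1].
move=> _ /mapP[p _ ->]; rewrite mem_rem_uniq ?enum_uniq// !inE mem_enum andbT /other.
have := lo_neq_hi p; case: (eqVneq i (lo_of p)) => [->|n1] h; first by rewrite eq_sym.
by rewrite eq_sym.
Qed.

(** Pairs are sorted by their lower member; the bound is twice the true number, which affects
    constants only. *)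
Lemma card_pairs : (#|Q| <= N * N.-1)%N.
Proof.
rewrite -sum1_card (partition_big (fun p : Q => lo_of p) xpredT)//=.
apply: (@leq_trans (\sum_(i < N) N.-1)); last by rewrite sum_nat_const card_ord.
apply: leq_sum => i _; apply: leq_trans (count_pairs_with i).
rewrite sum1_card cardE -size_filter; apply: uniq_leq_size; first exact: enum_uniq.
move=> p; rewrite mem_enum mem_filter mem_enum andbT => hp.
have -> : i = lo_of p by apply: val_inj; move: hp; rewrite unfold_in /= => /eqP ->.
by rewrite eqxx.
Qed.

(** Pairs are stored with the smaller index first, so the image of a pair may have to be turned
    around. *)
Definition swap_pair (g : 'I_N -> 'I_N) (gK : involutive g) (p : Q) : Q.
Proof.
refine (if (g (lo_of p) < g (hi_of p))%N =P true is ReflectT h then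
  exist _ (g (lo_of p), g (hi_of p)) h else exist _ (g (hi_of p), g (lo_of p)) _) => /=.
rewrite ltnNge leq_eqVlt negb_or; apply/andP; split; last exact/negP.
by apply: contraNneq (lo_neq_hi p) => h; rewrite -(gK (lo_of p)) -(gK (hi_of p)) (val_inj h).
Defined.

Lemma swap_pairP (g : 'I_N -> 'I_N) (gK : involutive g) p :
  (lo_of (swap_pair gK p) = g (lo_of p) /\ hi_of (swap_pair gK p) = g (hi_of p)) \/
  (lo_of (swap_pair gK p) = g (hi_of p) /\ hi_of (swap_pair gK p) = g (lo_of p)).
Proof. by rewrite /swap_pair; case: eqP => h; [left|right]. Qed.

Lemma swap_pair_inj (g : 'I_N -> 'I_N) (gK : involutive g) : injective (swap_pair gK).
Proof.
have gi := can_inj gK; move=> p p' e.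
have lp := valP p; have lp' := valP p'; rewrite -/(lo_of p) -/(hi_of p) -/(lo_of p') -/(hi_of p') in lp lp'.
have := swap_pairP gK p; have := swap_pairP gK p'; rewrite e.
case=> [[-> ->]|[-> ->]] [[/gi h1 /gi h2]|[/gi h1 /gi h2]].
- exact: pair_inj.
- by move: lp'; rewrite h1 h2 ltnNge ltnW.
- by move: lp'; rewrite h1 h2 ltnNge ltnW.
- exact: pair_inj.
Qed.

End pair_counting.

Section exchangeability.
Context (R : realType) (dim N : nat).
Notation E := 'rV[R]_dim.
Notation D := (skorohod dim (+oo : \bar R)).
Notation conf := (prodspace 'I_N D).
Notation Q := (Specif_sig__canonical__fintype_Finite (fun p : 'I_N * 'I_N => (p.1 < p.2)%N)).
Variables (Lam : R) (hLam : 0 < Lam) (Px : R.-pker E ~> D).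
Variables (muhat : R.-ker (E * E)%type ~> (E * E)%type).
Hypothesis muhat_bound : forall v w, (muhat (v, w) setT <= Lam%:E)%E.
Hypothesis muhat_sym : forall v w A, measurable A ->
  muhat (v, w) A = muhat (w, v) [set hk | A (hk.2, hk.1)].
Local Open Scope ereal_scope.
Notation kint := (kinteract hLam Px muhat_bound).

(** The symmetry of [muhat] passes to the jump law, because the point mass for no jump is itself
    symmetric. *)
Lemma jk_swap v w (H : E * E -> \bar R) : (forall h, 0 <= H h) -> measurable_fun setT H ->
  \int[jk hLam muhat_bound (v, w)]_h H h = \int[jk hLam muhat_bound (w, v)]_h H (h.2, h.1).
Proof.
move=> H0 mH.
have ms : measurable_fun setT (fun h : E * E => (h.2, h.1)).
  by apply: measurable_fun_pair; [exact: measurable_snd|exact: measurable_fst].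
pose k := kbind (jk hLam muhat_bound)
  (@kdirac _ _ _ _ R _ (measurableT_comp ms (@measurable_snd _ _ (E * E)%type (E * E)%type))).
have e := integral_kbind (jk hLam muhat_bound)
  (@kdirac _ _ _ _ R _ (measurableT_comp ms (@measurable_snd _ _ (E * E)%type (E * E)%type))) (w, v) H0 mH.
transitivity (\int[k (w, v)]_h H h).
  apply: eq_measure_integral => A mA _.
  transitivity (\int[k (w, v)]_h (\1_A h)%:E); last by rewrite integral_indic ?setIT.
  have mi : measurable_fun setT (fun h => (\1_A h)%:E : \bar R) by apply/measurable_EFinP; exact: measurable_indic.
  have i0 h : 0 <= (\1_A h)%:E :> \bar R by rewrite lee_fin.
  apply: (etrans _ (esym (integral_kbind (jk hLam muhat_bound)
    (@kdirac _ _ _ _ R _ (measurableT_comp ms (@measurable_snd _ _ (E * E)%type (E * E)%type))) (w, v) i0 mi))).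
  have mS : measurable [set h : E * E | A (h.2, h.1)].
    by rewrite -[X in measurable X]setTI; exact: (ms measurableT _ mA).
  transitivity (jk hLam muhat_bound (w, v) [set h : E * E | A (h.2, h.1)]).
    rewrite /jk /= !jumpmE /jump_law /= (muhat_sym v w mA) (muhat_sym v w measurableT).
    by [].
  rewrite -[in LHS](setIT [set h | _]) -integral_indic//; apply: eq_integral => h _.
  by rewrite integral_kdirac.
by rewrite e; apply: eq_integral => h _; rewrite integral_kdirac.
Qed.

Lemma pairk_swap (i j : 'I_N) r z (f : conf -> \bar R) : i != j ->
  (forall z, 0 <= f z) -> measurable_fun setT f ->
  \int[pairk kint i j (r, z)]_y f y = \int[pairk kint j i (r, z)]_y f y.
Proof.
move=> ij f0 mf.
have mu2 (k l : 'I_N) : measurable_fun setT (fun y : D * D => f (upd (upd z k y.1) l y.2)).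
  apply: (measurableT_comp mf); apply: measurable_upd; last exact: measurable_snd.
  by apply: measurable_upd; [exact: measurable_cst|exact: measurable_fst].
have mg y : measurable_fun setT (fun w : D => glue y r w) by apply: measurable_glue => //; exact: measurable_cst.
have mgg : measurable_fun setT (fun x : D * D => f (upd (upd z i (glue (z i) r x.1)) j (glue (z j) r x.2))).
  apply: (measurableT_comp mf); apply: measurable_upd; [apply: measurable_upd|].
  - exact: measurable_cst.
  - exact: (measurableT_comp (mg _) measurable_fst).
  - exact: (measurableT_comp (mg _) measurable_snd).
apply: (etrans (integral_pairk _ i j r z f0 mf)).
apply: (etrans _ (esym (integral_pairk _ j i r z f0 mf))).
apply: (etrans (integral_kinteract hLam Px muhat_bound r (z i) (z j) (fun y => f0 _) (mu2 i j))).
apply: (etrans _ (esym (integral_kinteract hLam Px muhat_bound r (z j) (z i) (fun y => f0 _) (mu2 j i)))).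
pose H h := \int[Px (left_val (z i) r + h.1)%R]_w \int[Px (left_val (z j) r + h.2)%R]_w'
  f (upd (upd z i (glue (z i) r w)) j (glue (z j) r w')).
have H0 h : 0 <= H h by apply: integral_ge0 => w _; exact: integral_ge0.
have mp1 : measurable_fun setT (fun h : E * E => left_val (z i) r + h.1)%R.
  by apply: measurable_rVD; [exact: measurable_cst|exact: measurable_fst].
have mp2 : measurable_fun setT (fun h : (E * E) * D => left_val (z j) r + h.1.2)%R.
  by apply: measurable_rVD; [exact: measurable_cst|exact: (measurableT_comp measurable_snd measurable_fst)].
have mH : measurable_fun setT H.
  apply: (@measurable_integral_pker R _ _ _ _ (kcomap Px mp1) (fun x : (E * E) * D =>
    \int[Px (left_val (z j) r + x.1.2)%R]_w' f (upd (upd z i (glue (z i) r x.2)) j (glue (z j) r w')))).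
    by move=> x; exact: integral_ge0.
  apply: (@measurable_integral_pker R _ _ _ _ (kcomap Px mp2) (fun x : (E * E) * D * D =>
    f (upd (upd z i (glue (z i) r x.1.2)) j (glue (z j) r x.2)))) => [x|]; first exact: f0.
  have mx : measurable_fun setT (fun x : (E * E) * D * D => (x.1.2, x.2)).
    by apply: measurable_fun_pair; [exact: (measurableT_comp measurable_snd measurable_fst)|exact: measurable_snd].
  exact: (measurableT_comp mgg mx).
apply: (etrans (jk_swap _ _ H0 mH)); apply: eq_integral => h _; rewrite /H /=.
apply: (etrans (prob_tonelli (prob_kernel _) (prob_kernel _) (fun x y => f0 _) mgg)).
by apply: eq_integral => w _; apply: eq_integral => w' _; rewrite updC.
Qed.

Variables (T lam : R) (lam0 : (0 < lam)%R) (g : 'I_N -> 'I_N) (gK : involutive g).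
Let J : Q -> R.-pker (R * conf)%type ~> conf := @pair_step _ _ _ hLam Px _ muhat_bound N.

Let mperm : measurable_fun setT (permute g : conf -> conf). Proof. exact: measurable_permute. Qed.

Lemma sum_enum_inj (I : finType) (k : I -> I) (G : I -> \bar R) : injective k ->
  (\sum_(p <- enum I) G (k p) = \sum_(p <- enum I) G p)%E.
Proof.
move=> ki.
first
  [ by rewrite !big_enum [RHS](reindex_inj ki)
  | rewrite !big_enum [RHS](reindex_inj ki); by apply: eq_bigl => p; rewrite !inE
  | transitivity (\sum_(p <- map k (enum I)) G p)%E; [by rewrite big_map|];
    apply: perm_big; apply: uniq_perm; [by rewrite map_inj_uniq ?enum_uniq|exact: enum_uniq|];
    move=> p; rewrite mem_enum; apply/idP/idP => // _; apply/mapP;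
    by exists (invF ki p); rewrite ?mem_enum ?f_invF ].
Qed.

Lemma sum_swap_pair (G : Q -> \bar R) :
  (\sum_(p <- enum Q) G (swap_pair gK p) = \sum_(p <- enum Q) G p)%E.
Proof. exact: (@sum_enum_inj Q (swap_pair gK) G (@swap_pair_inj N g gK)). Qed.

(** A permutation of the particles permutes the clocks, up to the order inside a pair, which
    [pairk_swap] makes irrelevant; all clocks have the same rate. *)
Lemma jump_rate_permute r z (f : conf -> \bar R) : (forall z, 0 <= f z) -> measurable_fun setT f ->
  jump_rate lam J r (fun y => f (permute g y)) z = jump_rate lam J r f (permute g z).
Proof.
move=> f0 mf; have sw p : jop J p r (fun y => f (permute g y)) z = jop J (swap_pair gK p) r f (permute g z).
  have ij := lo_neq_hi p; have gij : g (lo_of p) != g (hi_of p) by rewrite (can_eq gK).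
  transitivity (\int[pairk kint (g (lo_of p)) (g (hi_of p)) (r, permute g z)]_y f y).
    apply: (etrans (integral_pairk _ (lo_of p) (hi_of p) r z (fun y => f0 _) (measurableT_comp mf mperm))).
    apply: (etrans _ (esym (integral_pairk _ (g (lo_of p)) (g (hi_of p)) r (permute g z) f0 mf))).
    rewrite {2 3}/permute !gK; apply: eq_integral => y _; congr f; apply/funext => k.
    by rewrite /permute /upd !(can2_eq gK gK).
  have jE : jop J (swap_pair gK p) r f (permute g z) =
      \int[pairk kint (lo_of (swap_pair gK p)) (hi_of (swap_pair gK p)) (r, permute g z)]_y f y by [].
  have swI a b : (a = g (lo_of p) /\ b = g (hi_of p)) \/ (a = g (hi_of p) /\ b = g (lo_of p)) ->
      \int[pairk kint (g (lo_of p)) (g (hi_of p)) (r, permute g z)]_y f y =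
      \int[pairk kint a b (r, permute g z)]_y f y.
    by case=> -[-> ->]; [reflexivity|exact: (pairk_swap r (permute g z) gij f0 mf)].
  exact: (etrans (swI _ _ (swap_pairP gK p)) (esym jE)).
apply: (congr1 (fun x => lam%:E * x)).
apply: (etrans (eq_bigr _ (fun p _ => sw p))).
exact: (sum_swap_pair (fun p => jop J p r f (permute g z))).
Qed.

Lemma solution_permute (Phi : conf -> \bar R) s z : (forall z, 0 <= Phi z) -> measurable_fun setT Phi ->
  solution T lam J (fun y => Phi (permute g y)) s z = solution T lam J Phi s (permute g z).
Proof.
move=> Phi0 mPhi; apply: eq_eseriesr => n _.
elim: n s z => [//|n ih] s z; rewrite !iterS.
apply: eq_integral => r _.
have -> : iter n (picard T lam J) (fun=> fun y => Phi (permute g y)) r =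
    fun y => iter n (picard T lam J) (fun=> Phi) r (permute g y) by apply/funext => y; exact: ih.
apply: jump_rate_permute; first by move=> y; exact: iter_picard_ge0.
exact: (meas2_section r (meas2_iter_picard T lam0 J Phi0 mPhi n)).
Qed.

End exchangeability.

End PartY5a.

(** * Total variation and Borel-Cantelli *)

Module PartY5b.
Import PartA PartL PartM PartH.

(** Layer cake: [h x] is the length of the set of [t] in []0, 1]] with [t < h x], so the integral
    averages the measures of level sets, each of which changes by at most [del]. *)
Lemma integral_le_tv (R : realType) dX (X : measurableType dX) (mu nu : probability X R)
    (h : X -> R) (del : R) : measurable_fun setT h -> (forall x, 0 <= h x <= 1) -> 0 <= del ->
  (forall A, measurable A -> (mu A <= nu A + del%:E)%E) ->
  (\int[mu]_x (h x)%:E <= \int[nu]_x (h x)%:E + del%:E)%E.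
Proof.
move=> mh h01 del0 hmn.
have mI : measurable (`]0, 1]%classic : set R) by exact: measurable_itv.
pose F (t : R) (x : X) : \bar R := (\1_[set y | t < h y] x)%:E.
have F0 t x : (0 <= F t x)%E by rewrite lee_fin.
have mF : measurable_fun setT (fun p : R * X => F p.1 p.2).
  apply/measurable_EFinP.
  rewrite (_ : (fun p : R * X => _) = \1_[set p : R * X | p.1 < h p.2]).
    apply: measurable_indic; apply: measurable_ltr; first exact: measurable_fst.
    exact: (measurableT_comp mh measurable_snd).
  by apply/funext => p; rewrite !indicE; congr (_%:R); congr nat_of_bool; apply/idP/idP => /set_mem ?; apply/mem_set.
have mA t : measurable [set y | t < h y] by apply: measurable_ltr => //; exact: measurable_cst.
have layer (P : probability X R) : (\int[P]_x (h x)%:E =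
    \int[lebesgue_measure]_(t in `]0%R, 1%R]) P [set y | (t < h y)%R])%E.
  have P1 : P setT = 1%E by exact: probability_setT.
  transitivity (\int[lebesgue_measure]_(t in `]0%R, 1%R]) \int[P]_x F t x)%E.
    rewrite (time_tonelli P1 mI F0 mF); apply: eq_integral => x _.
    have /andP[hx0 hx1] := h01 x.
    rewrite (_ : (fun t => F t x) = (fun t => (\1_(`]-oo, (h x)[%classic : set (measurableTypeR R)) t)%:E)); last first.
      apply/funext => t; rewrite /F !indicE.
      have -> : (x \in [set y | t < h y]) = (t < h x) by apply/idP/idP => [/set_mem|th]; [|apply/mem_set].
      have -> // : (t \in (`]-oo, (h x)[%classic : set (measurableTypeR R))) = (t < h x).
      by apply/idP/idP => [/set_mem|th]; [|apply/mem_set]; rewrite /= in_itv.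
    have mhx : measurable (`]-oo, (h x)[%classic : set (measurableTypeR R)) by exact: measurable_itv.
    rewrite (integral_indic lebesgue_measure mI mhx).
    rewrite (_ : _ `&` _ = `]0, (h x)[%classic); last first.
      apply/seteqP; split => t /=; rewrite !in_itv/=; first by move=> [-> /andP[-> _]].
      by move=> /andP[t0 th]; rewrite t0 th (ltW (lt_le_trans th hx1)).
    have lm : lebesgue_measure (`]0, (h x)[%classic : set (measurableTypeR R)) = (h x)%:E.
      rewrite lebesgue_measure_itv/= lte_fin; move: hx0; rewrite le_eqVlt => /orP[/eqP <-|->].
        by rewrite ltxx.
      by rewrite sube0.
    exact: (esym lm).
  by apply: eq_integral => t _; rewrite integral_indic ?setIT.
have mP (P : probability X R) : measurable_fun (`]0, 1]%classic : set (measurableTypeR R)) (fun t => P [set y | t < h y]).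
  apply: measurable_funTS.
  rewrite (_ : (fun t => _) = (fun t => \int[P]_x F t x)%E).
    apply: (@measurable_fun_fubini_tonelli_F _ _ _ X R P (fun p : R * X => F p.1 p.2)) => //.
  by apply/funext => t; rewrite integral_indic ?setIT.
rewrite !layer.
have c1 : (\int[lebesgue_measure]_(t in `]0%R, 1%R]) (cst del%:E) t = del%:E)%E.
  by rewrite integral_cst//= lebesgue_measure_itv/= lte_fin ltr01 sube0 mule1.
rewrite -c1 -ge0_integralD//.
apply: ge0_le_integral => //; last by move=> t _; exact: hmn.
by apply: emeasurable_funD => //; exact: measurable_cst.
Qed.

Lemma ae_eventually (R : realType) dO (Omega : measurableType dO) (P : probability Omega R)
    (A : (set Omega)^nat) (rho C : R) : (forall n, measurable (A n)) -> 0 <= rho < 1 -> 0 <= C ->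
  (forall n, P (A n) <= (C * rho ^+ n)%:E)%E ->
  {ae P, forall w, \forall n \near \oo, ~ A n w}.
Proof.
move=> mA /andP[r0 r1] C0 hA.
have sumA : (\sum_(n <oo) P (A n) < +oo)%E.
  apply: (@le_lt_trans _ _ (\sum_(n <oo) (C * rho ^+ n)%:E)%E); first exact: lee_nneseries.
  have cg : cvgn (series (geometric C rho)) by apply: is_cvg_geometric_series; rewrite ger0_norm.
  rewrite (_ : (\sum_(n <oo) _)%E = (limn (series (geometric C rho)))%:E) ?ltry//.
  rewrite -EFin_lim//; congr (limn _); apply/funext => n.
  by rewrite /= /series /= sumEFin.
exists (lim_sup_set A); split.
- apply: bigcap_measurable => [|n _]; first by exists 0%N.
  by apply: bigcup_measurable => m _; exact: mA.
- exact: lim_sup_set_cvg0.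
- move=> w /= h n _; apply: contrapT => nA; apply: h.
  exists n => //= m nm Am; apply: nA; exists m => //.
Qed.

End PartY5b.

(** * Concentration for the particle system *)

Module PartY5c.
Import PartA PartB PartC PartF PartH PartL PartM PartU PartV PartW PartX1 PartY1 PartY2 PartY2b PartY3 PartY4a PartY4b PartY4c PartY4d PartY5a PartY5b.

Section system.
Context (R : realType) (dim N : nat).
Notation E := 'rV[R]_dim.
Notation D := (skorohod dim (+oo : \bar R)).
Notation conf := (prodspace 'I_N D).
Notation Q := (Specif_sig__canonical__fintype_Finite (fun p : 'I_N * 'I_N => (p.1 < p.2)%N)).
Variables (Lam : R) (hLam : 0 < Lam) (Px : R.-pker E ~> D) (hPx : markov_process Px).
Variables (muhat : R.-ker (E * E)%type ~> (E * E)%type).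
Hypothesis muhat_sym : forall v w A, measurable A ->
  muhat (v, w) A = muhat (w, v) [set hk | A (hk.2, hk.1)].
Hypothesis muhat_bound : forall v w, (muhat (v, w) setT <= Lam%:E)%E.
Variables (P0 : probability E R) (dO : measure_display) (Omega : measurableType dO).
Variables (P : probability Omega R) (tau : Q -> nat -> {RV P >-> R}) (Z : 'I_N -> {RV P >-> D}).
Hypothesis hps : particle_system Lam Px muhat P0 tau Z.
Variables (T : R) (T0 : 0 <= T) (N2 : (2 <= N)%N).
Let lam := Lam / N.-1%:R.
Let kap := lam * #|Q|%:R.
Let J : Q -> R.-pker (R * conf)%type ~> conf := @pair_step _ _ _ hLam Px _ muhat_bound N.
Local Open Scope ereal_scope.
Notation particles := (particles Z).

Let N1 : (0 < N.-1%:R :> R)%R. Proof. by rewrite ltr0n; case: N N2 => [|[]]. Qed.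
Let lam0 : (0 < lam)%R. Proof. by rewrite divr_gt0. Qed.

Let degree (i : 'I_N) :
  (lam * (count (fun p : Q => (i == lo_of p) || (i == hi_of p)) (enum Q))%:R <= Lam)%R.
Proof.
rewrite /lam mulrAC ler_pdivrMr// ler_wpM2l ?ler_nat ?count_pairs_with//; exact: ltW.
Qed.

Let kapN : (kap <= Lam * N%:R)%R.
Proof.
rewrite /kap /lam mulrAC ler_pdivrMr// -mulrA -natrM; apply: ler_wpM2l; first exact: ltW.
by rewrite ler_nat card_pairs.
Qed.

Let kap0 : (0 <= kap)%R. Proof. by rewrite /kap mulr_ge0// ltW. Qed.

Let nu0_ex : {nu0 : probability conf R |
  nu0 = prodker (fun=> free_law Px P0) (enum 'I_N) tt :> {measure set conf -> \bar R}}.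
Proof. by apply/cid; apply: prob_pack; exact: prob_kernel. Qed.
Let nu0 := sval nu0_ex.
Let nu0_free : nu0 = prodker (fun=> free_law Px P0) (enum 'I_N) tt :> {measure set conf -> \bar R} := svalP nu0_ex.

(** All terms of [total_formula] share one factor of silence, [expR (- (kap * T))]; the powers of
    [lam] turn iterates of [total_op] into Picard iterates. *)
Lemma expectation_solution (Phi : conf -> \bar R) : (forall z, 0 <= Phi z) ->
  measurable_fun setT Phi -> (forall z, Phi z = Phi (stop_all z T)) ->
  \int[P]_w Phi (particles w) = (expR (- (kap * T)))%:E * \int[nu0]_z solution T lam J Phi 0%R z.
Proof.
move=> Phi0 mPhi hPhi.
apply: (etrans (total_formula hLam hPx muhat_bound hps T0 lam0 nu0_free Phi0 mPhi hPhi)).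
have mi n : measurable_fun setT (fun z => iter n (picard T lam J) (fun=> Phi) 0%R z).
  exact: (meas2_section 0%R (meas2_iter_picard T lam0 J Phi0 mPhi n)).
have i0 n z : 0 <= iter n (picard T lam J) (fun=> Phi) 0%R z by exact: iter_picard_ge0.
rewrite /solution integral_nneseries//.
rewrite -nneseriesZl; last by move=> n _; exact: integral_ge0.
apply: eq_eseriesr => n _.
have -> : (lam ^+ n * expR (- lam * T) ^+ #|Q|)%R = (expR (- (kap * T)) * lam ^+ n)%R.
  rewrite mulrC -expRM_natl; congr (expR _ * _)%R; rewrite /kap; ring.
rewrite EFinM -muleA; congr (_ * _).
have ln : 0 <= (lam ^+ n)%:E by rewrite lee_fin exprn_ge0// ltW.
have mt : measurable_fun setT (fun z => iter n (total_op T J) (fun=> Phi) 0%R z).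
  have l0 : (lam ^+ n)%R != 0%R by rewrite expf_neq0// gt_eqF.
  rewrite (_ : (fun z => _) = (fun z => ((lam ^+ n)^-1)%:E * iter n (picard T lam J) (fun=> Phi) 0%R z)).
    by apply: emeasurable_funM => //; exact: measurable_cst.
  by apply/funext => z; rewrite iter_picardE// muleA -EFinM mulVf// mul1e.
have t0 z : 0 <= iter n (total_op T J) (fun=> Phi) 0%R z.
  have := i0 n z; rewrite iter_picardE// pmule_rge0// lte_fin exprn_gt0//.
rewrite -(ge0_integralZl nu0 measurableT mt (fun z _ => t0 z) ln).
by apply: eq_integral => z _; rewrite iter_picardE.
Qed.

(** There are two sources of randomness. Given the free initial paths, [solution_exp] reduces the
    exponential moment to that of the normalised mean [F]; then [prodker_exp] treats [F] as a
    function of independent paths with influence [eps]. The first gives [8 * (Lam * T)], through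
    [kap <= Lam * N], the second gives 2. *)
Lemma moment_bound (phi : conf -> R) (M del m : R) : measurable_fun setT phi ->
  (forall z, 0 <= phi z)%R -> (forall z, phi z <= M)%R -> (0 <= del)%R ->
  (forall z i y, phi (upd z i y) <= phi z + del)%R -> (forall z, phi z = phi (stop_all z T)) ->
  (2 * (del * expR (Lam * T)) <= 2^-1)%R -> \int[P]_w (phi (particles w))%:E = m%:E ->
  \int[P]_w (expR (phi (particles w)))%:E <=
    (expR (m + (8 * (Lam * T) + 2) * N%:R * (del * expR (Lam * T)) ^+ 2))%:E.
Proof.
move=> mphi phi0 phiM del0 phi_inf hphi esmall phim.
set eps := (del * expR (Lam * T))%R in esmall *.
have mE : measurable_fun setT (fun z => (phi z)%:E) by exact/measurable_EFinP.
have mX : measurable_fun setT (fun z => (expR (phi z))%:E).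
  by apply/measurable_EFinP; exact: measurableT_comp.
have E0 z : 0 <= (phi z)%:E by rewrite lee_fin.
have X0 z : 0 <= (expR (phi z))%:E by rewrite lee_fin expR_ge0.
rewrite (expectation_solution X0 mX (fun z => congr1 (fun x => (expR x)%:E) (hphi z))).
have phiE := expectation_solution E0 mE (fun z => congr1 EFin (hphi z)).
pose V z := value hLam Px muhat_bound T lam phi 0%R z.
have vle z : V z <= (M * expR (kap * T))%:E.
  have := value_le hLam Px muhat_bound lam0 mphi phi0 phiM z T0; by rewrite subr0.
have v0 z : 0 <= V z by exact: (solution_ge0 T lam0 J E0).
have vE z : V z = (fine (V z))%:E.
  by rewrite fineK// ge0_fin_numE// (le_lt_trans (vle z)) ?ltry.
have mV : measurable_fun setT V by exact: (meas2_section 0%R (meas2_solution T lam0 J E0 mE)).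
pose F z := (expR (- (kap * T)) * fine (V z))%R.
have mF : measurable_fun setT F.
  apply: measurable_funM; first exact: measurable_cst.
  by apply: measurableT_comp mV; exact: fine_measurable.
have eK : (expR (- (kap * T)) * expR (kap * T) = 1)%R by rewrite -expRD addNr expR0.
have FB z : (0 <= F z <= M)%R.
  rewrite /F mulr_ge0 ?expR_ge0 ?fine_ge0//=.
  have : (fine (V z) <= M * expR (kap * T))%R by rewrite -lee_fin -vE.
  move=> /(ler_wpM2l (expR_ge0 (- (kap * T)))) h; apply: (le_trans h).
  by rewrite mulrCA eK mulr1.
have Finf z i y : (F (upd z i y) <= F z + eps)%R.
  have inf := value_influence hLam Px muhat_bound lam0 degree mphi phi0 del0 phi_inf T0.
  have h : (fine (V (upd z i y)) <= fine (V z) + del * expR ((kap + Lam) * T))%R.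
    by rewrite -lee_fin EFinD -!vE -[in X in _ + X](subr0 T); exact: inf.
  have := ler_wpM2l (expR_ge0 (- (kap * T))) h; rewrite mulrDr /F => /le_trans; apply.
  rewrite lerD2l /eps mulrCA -expRD; have -> : (- (kap * T) + (kap + Lam) * T = Lam * T)%R by ring.
  by [].
have e0 : (0 <= eps)%R by rewrite mulr_ge0// expR_ge0.
have ce0 : 0 <= (expR (- (kap * T)))%:E by rewrite lee_fin expR_ge0.
have FE z : (F z)%:E = (expR (- (kap * T)))%:E * V z by rewrite vE -EFinM.
have meanF : \int[prodker (fun=> free_law Px P0) (enum 'I_N) tt]_z (F z)%:E = m%:E.
  have mFE : measurable_fun setT (fun z => (F z)%:E) by exact/measurable_EFinP.
  have FE0 z : 0 <= (F z)%:E by rewrite lee_fin; have /andP[] := FB z.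
  rewrite -(nu0_prodker nu0_free (enum_uniq 'I_N) (mem_enum 'I_N) FE0 mFE).
  rewrite -phim phiE -(ge0_integralZl nu0 measurableT mV (fun z _ => v0 z) ce0).
  by apply: eq_integral => z _; exact: FE.
have eh : (eps <= 2^-1)%R by lra.
have main : \int[prodker (fun=> free_law Px P0) (enum 'I_N) tt]_z (expR (F z))%:E <=
    (expR (m + (size (enum 'I_N))%:R * (2 * eps ^+ 2)))%:E.
  first [exact: (prodker_exp e0 eh mF FB Finf meanF)
        |exact: (prodker_exp _ e0 eh mF FB Finf meanF)
        |exact: (prodker_exp _ _ e0 eh mF FB Finf meanF)
        |exact: (prodker_exp (B := M) e0 eh mF FB Finf meanF)
        |exact: (prodker_exp eh mF FB Finf meanF)
        |exact: (prodker_exp eh e0 mF FB Finf meanF)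
        |apply: (prodker_exp (B := M) (eps := eps)); eassumption
        |eapply prodker_exp; eassumption
        |eapply prodker_exp; first [eassumption|exact: prob_kernel]].
pose K := (kap * (1 + 8 * eps ^+ 2) * T)%R.
have mXF : measurable_fun setT (fun z => (expR (F z))%:E).
  by apply/measurable_EFinP; exact: measurableT_comp.
have XF0 z : 0 <= (expR (F z))%:E by rewrite lee_fin expR_ge0.
have mS := meas2_section 0%R (meas2_solution T lam0 J X0 mX).
have sol : \int[nu0]_z solution T lam J (fun z => (expR (phi z))%:E) 0%R z <=
    (expR K)%:E * (expR (m + (size (enum 'I_N))%:R * (2 * eps ^+ 2)))%:E.
  have K0 : 0 <= (expR K)%:E by rewrite lee_fin expR_ge0.
  apply: (@le_trans _ _ (\int[nu0]_z ((expR K)%:E * (expR (F z))%:E))).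
    apply: ge0_le_integral; [exact: measurableT|by move=> z _; exact: (solution_ge0 T lam0 J X0)|exact: mS| |].
      by apply: emeasurable_funM => //; exact: measurable_cst.
    move=> z _; rewrite -EFinM -expRD.
    exact: (solution_exp hLam Px muhat_bound T0 lam0 degree mphi phi0 phiM del0 phi_inf esmall z).
  rewrite (ge0_integralZl nu0 measurableT mXF (fun z _ => XF0 z) K0).
  apply: lee_wpmul2l => //.
  by rewrite (nu0_prodker nu0_free (enum_uniq 'I_N) (mem_enum 'I_N) XF0 mXF).
apply: (le_trans (lee_wpmul2l ce0 sol)); rewrite -!EFinM -!expRD lee_fin ler_expR size_enum_ord /K.
have h : (kap * (8 * eps ^+ 2 * T) <= Lam * N%:R * (8 * eps ^+ 2 * T))%R.
  by apply: ler_wpM2r => //; rewrite !mulr_ge0// sqr_ge0.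
lra.
Qed.

(** The initial law and the jump rates are invariant under the transposition of [i] and [j]. *)
Lemma exchangeable (h : D -> R) (i j : 'I_N) : measurable_fun setT h -> (forall y, 0 <= h y)%R ->
  (forall y, h y = h (stop y T)) -> \int[P]_w (h (Z i w))%:E = \int[P]_w (h (Z j w))%:E.
Proof.
move=> mh h0 hT; pose g (k : 'I_N) := if k == i then j else if k == j then i else k.
have gK : involutive g.
  move=> k; rewrite /g; have [->|ki] := eqVneq k i.
    by have [->|ji] := eqVneq j i; rewrite /= ?eqxx.
  have [->|kj] := eqVneq k j; first by rewrite /= eqxx.
  by rewrite (negbTE ki) (negbTE kj).
have mhi k : measurable_fun setT (fun z : conf => (h (z k))%:E).
  by apply/measurable_EFinP; apply: (measurableT_comp mh); exact: measurable_coord.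
have hi0 k (z : conf) : 0 <= (h (z k))%:E by rewrite lee_fin.
have st k (z : conf) : (h (z k))%:E = (h (stop_all z T k))%:E by rewrite /stop_all -hT.
have ei k : \int[P]_w (h (Z k w))%:E = (expR (- (kap * T)))%:E *
    \int[nu0]_z solution T lam J (fun z => (h (z k))%:E) 0%R z.
  first [exact: (@expectation_solution (fun z : conf => (h (z k))%:E) (hi0 k) (mhi k) (st k))
        |apply: (etrans _ (@expectation_solution (fun z : conf => (h (z k))%:E) (hi0 k) (mhi k) (st k))); by apply: eq_integral].
rewrite (ei i) (ei j); congr (_ * _).
have mS := meas2_section 0%R (meas2_solution T lam0 J (hi0 i) (mhi i)).
have S0 z : 0 <= solution T lam J (fun z => (h (z i))%:E) 0%R z by exact: (solution_ge0 T lam0 J (hi0 i)).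
have gi : g i = j by rewrite /g eqxx.
clearbody g.
have pe z : solution T lam J (fun y => (h (y j))%:E) 0%R z =
    solution T lam J (fun y => (h (y i))%:E) 0%R (permute g z).
  have fE : (fun y : conf => (h (y j))%:E) = (fun y : conf => (h (permute g y i))%:E).
    by apply/funext => y; rewrite /permute gi.
  have sp := @solution_permute R dim N Lam hLam Px muhat muhat_bound muhat_sym T lam lam0 g gK
    (fun y : conf => (h (y i))%:E) 0%R z (hi0 i) (mhi i).
  rewrite fE; first [timeout 100 (exact sp)|timeout 100 (unfold J; exact sp)|timeout 100 (rewrite sp; reflexivity)].
transitivity (\int[nu0]_z solution T lam J (fun z => (h (z i))%:E) 0%R (permute g z)).
  first [exact: (esym (nu0_permute nu0_free gK S0 mS))
        |exact: (nu0_permute nu0_free gK S0 mS)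
        |symmetry; apply: (nu0_permute nu0_free gK); [exact: S0|exact: mS]
        |symmetry; eapply nu0_permute; eassumption].
by apply: eq_integral => z _; rewrite pe.
Qed.

(** A Chernoff bound with parameter [al]. The last condition on [al] lets the quadratic term use up
    at most half of the gain [al * N * e]. *)
Lemma tail_bound (h : D -> R) (i : 'I_N) (m al e : R) : measurable_fun setT h ->
  (forall y, 0 <= h y <= 1)%R -> (forall y, h y = h (stop y T)) ->
  \int[P]_w (h (Z i w))%:E = m%:E -> (0 <= al)%R -> (2 * (al * expR (Lam * T)) <= 2^-1)%R ->
  (al * ((8 * (Lam * T) + 2) * expR (Lam * T) ^+ 2) <= e / 2)%R ->
  P [set w | N%:R * (m + e) <= \sum_(j < N) h (Z j w)]%R <= (expR (- (al * e / 2)) ^+ N)%:E.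
Proof.
move=> mh h01 hT hm al0 al1 al2.
have h0 y : (0 <= h y)%R by have /andP[] := h01 y.
have mhj j : measurable_fun setT (fun z : conf => h (z j)) by apply: (measurableT_comp mh); exact: measurable_coord.
pose phi (z : conf) := (al * \sum_(j < N) h (z j))%R.
have mphi : measurable_fun setT phi.
  by apply: measurable_funM; [exact: measurable_cst|apply: measurable_sum => j; exact: mhj].
have phi0 z : (0 <= phi z)%R by rewrite mulr_ge0// sumr_ge0.
have phiM z : (phi z <= al * N%:R)%R.
  apply: ler_wpM2l => //; apply: (@le_trans _ _ (\sum_(j < N) 1)%R).
    by apply: ler_sum => j _; have /andP[] := h01 (z j).
  by rewrite sumr_const card_ord.
have phi_inf z k y : (phi (upd z k y) <= phi z + al)%R.
  rewrite /phi -[X in (_ + X)%R]mulr1 -mulrDr; apply: ler_wpM2l => //.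
  rewrite (bigD1 k)//= [in leRHS](bigD1 k)//= updE.
  have -> : (\sum_(j < N | j != k) h (upd z k y j) = \sum_(j < N | j != k) h (z j))%R.
    by apply: eq_bigr => j jk; rewrite upd_neq.
  by have /andP[_ h1] := h01 y; have := h0 (z k); lra.
have hphi z : phi z = phi (stop_all z T).
  by rewrite /phi; congr (_ * _)%R; apply: eq_bigr => j _; exact: hT.
have mhZ j : measurable_fun setT (fun w => (h (Z j w))%:E).
  by apply/measurable_EFinP; exact: (measurableT_comp mh).
have phim : \int[P]_w (phi (particles w))%:E = (al * (N%:R * m))%:E.
  transitivity (\int[P]_w (al%:E * \sum_(j < N) (h (Z j w))%:E)).
    by apply: eq_integral => w _; rewrite sumEFin -EFinM.
  rewrite ge0_integralZl//; last 2 first.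
  - by apply: emeasurable_sum => j; exact: mhZ.
  - by move=> w _; apply: sume_ge0 => j _; rewrite lee_fin.
  rewrite ge0_integral_sum//; last by move=> j w _; rewrite lee_fin.
  rewrite (eq_bigr (fun=> m%:E)) => [|j _]; last by rewrite (exchangeable j i mh h0 hT).
  by rewrite sumEFin -EFinM sumr_const card_ord mulr_natl.
have mb := moment_bound mphi phi0 phiM al0 phi_inf hphi al1 phim.
pose c := (al * (N%:R * (m + e)))%R.
set A := [set w | _].
have mS : measurable_fun setT (fun w => \sum_(j < N) h (Z j w))%R.
  by apply: measurable_sum => j; exact: (measurableT_comp mh).
have mA : measurable A.
  rewrite -[A]setTI; apply: measurable_fun_le => //; exact: measurable_cst.
have cA : (expR c)%:E * P A <= \int[P]_w (expR (phi (particles w)))%:E.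
  have -> : (expR c)%:E * P A = \int[P]_w ((expR c)%:E * (\1_A w)%:E).
    rewrite ge0_integralZl//; first by rewrite integral_indic ?setIT.
    by apply/measurable_EFinP; exact: measurable_indic.
  apply: ge0_le_integral; [exact: measurableT| | | |].
  - by move=> w _; rewrite -EFinM lee_fin mulr_ge0// expR_ge0.
  - by apply: emeasurable_funM; [exact: measurable_cst|apply/measurable_EFinP; exact: measurable_indic].
  - apply/measurable_EFinP; apply: measurableT_comp => //.
    exact: (measurableT_comp mphi (measurable_particles Z)).
  - move=> w _; rewrite -EFinM lee_fin indicE; case: (boolP (w \in A)) => [/set_mem wA|_].
      by rewrite mulr1 ler_expR /c /phi ler_wpM2l.
    by rewrite mulr0 expR_ge0.
have -> : P A = (expR (- c))%:E * ((expR c)%:E * P A).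
  by rewrite muleA -EFinM -expRD addNr expR0 mul1e.
have cn0 : 0 <= (expR (- c))%:E by rewrite lee_fin expR_ge0.
apply: (le_trans (lee_wpmul2l cn0 (le_trans cA mb))).
rewrite -EFinM -expRD lee_fin -expRM_natl ler_expR /c.
set X := expR (Lam * T) in al2 *.
have := ler_wpM2l (mulr_ge0 (ler0n R N) al0) al2.
rewrite !exprMn; set Y := (X ^+ 2)%R; first [lra | nra].
Qed.

End system.

End PartY5c.

(** * From concentration to almost sure convergence *)

Import PartA PartB PartC PartF PartH PartL PartM PartU PartV PartW PartX1 PartY1 PartY2 PartY2b PartY3 PartY4a PartY4b PartY4c PartY4d PartY5a PartY5b PartY5c.

Lemma window_stop (R : realType) (dim : nat) (T : R) (y : skorohod dim (+oo : \bar R)) :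
  window 0 T%:E (stop y T) = window 0 T%:E y.
Proof.
have e : path_fun (window 0 T%:E (stop y T)) = path_fun (window 0 T%:E y).
  apply/funext => t; change (y (clamp T%:E (0 + clamp T%:E t)) = y (0 + clamp T%:E t)).
  by rewrite add0r clamp_idem.
move: e; move: (window 0 T%:E (stop y T)) (window 0 T%:E y) => [p c fz] [p' c' fz'] /= e.
by subst p'; rewrite (Prop_irrelevance c c') (Prop_irrelevance fz fz').
Qed.

Lemma integral_empirical (R : realType) dX (X : measurableType dX) N (x : 'I_N -> X) (g : X -> R) :
  measurable_fun setT g -> (forall y, 0 <= g y) ->
  (\int[empirical R x]_y (g y)%:E = (N%:R^-1 * \sum_(j < N) g (x j))%:E)%E.
Proof.
move=> mg g0.
pose m (k : nat) : {measure set X -> \bar R} := if insub k is Some i then \d_(x i) else mzero.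
pose r : {nonneg R} := NngNum (etrans (invr_ge0 N%:R) (ler0n R N)).
have mgE : measurable_fun setT (fun y => (g y)%:E) by exact/measurable_EFinP.
have gE0 y : setT y -> (0 <= (g y)%:E)%E by rewrite lee_fin.
have e1 : (\int[empirical R x]_y (g y)%:E = \int[mscale r (msum m N)]_y (g y)%:E)%E.
  apply: eq_measure_integral => A _ _; rewrite /mscale /= /empirical; congr (_ * _)%E.
  by apply: eq_bigr => i _; rewrite /m valK.
rewrite e1 ge0_integral_mscale// ge0_integral_measure_sum//.
rewrite (eq_bigr (fun i : 'I_N => (g (x i))%:E)) => [|i _]; last first.
  by rewrite /m valK integral_dirac// diracT mul1e.
by rewrite sumEFin -EFinM.
Qed.

(** Reduces a bounded function to one with values in [[0, 1]], for which the tail bounds are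
    stated. *)
Lemma Rintegral_affine (R : realType) dX (X : measurableType dX) (nu : {measure set X -> \bar R})
    (f : X -> R) (C c : R) : nu setT = 1%E -> measurable_fun setT f -> (forall x, `|f x| <= C) -> 0 < c ->
  \int[nu]_x f x = 2 * c * fine (\int[nu]_x ((f x + c) / (2 * c))%:E)%E - c.
Proof.
move=> n1 mf fC c0.
have bi (g : X -> R) (K : R) : measurable_fun setT g -> (forall x, `|g x| <= K) ->
    nu.-integrable setT (EFin \o g).
  move=> mg gK; apply: measurable_bounded_integrable => //; first by rewrite n1 ltry.
  exists K; split; first exact: num_real.
  by move=> x Kx y _; exact: (le_trans (gK y) (ltW Kx)).
have c2 : 2 * c != 0 by rewrite mulf_neq0// gt_eqF.
have mg : measurable_fun setT (fun x => (f x + c) / (2 * c)).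
  apply: measurable_funM; last exact: measurable_cst.
  by apply: measurable_funD => //; exact: measurable_cst.
have gb x : `|(f x + c) / (2 * c)| <= (C + c) / (2 * c).
  have i0 : 0 <= (2 * c)^-1 by rewrite invr_ge0 mulr_ge0// ltW.
  rewrite normrM (ger0_norm i0); apply: ler_wpM2r => //.
  by apply: (le_trans (ler_normD _ _)); rewrite lerD// ger0_norm// ltW.
have fE x : f x = 2 * c * ((f x + c) / (2 * c)) + - c.
  by rewrite mulrCA mulfV// mulr1 addrK.
have e1 : \int[nu]_x f x = \int[nu]_x (2 * c * ((f x + c) / (2 * c)) + - c).
  by apply: eq_Rintegral => x _; exact: fE.
have ig := bi _ _ mg gb.
have i1 : nu.-integrable setT (EFin \o (fun x => 2 * c * ((f x + c) / (2 * c)))).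
  apply: (bi _ (2 * c * ((C + c) / (2 * c)))).
    by apply: measurable_funM => //; exact: measurable_cst.
  have c20 : 0 <= 2 * c by rewrite mulr_ge0// ltW.
  by move=> x; rewrite normrM (ger0_norm c20); exact: ler_wpM2l.
have i2 : nu.-integrable setT (EFin \o (fun _ : X => - c)) by apply: (bi _ `|- c|).
by rewrite e1 RintegralD// RintegralZl// Rintegral_cst// n1 /= mulr1.
Qed.

Section law_of_large_numbers.
Context (R : realType) (d : nat).
Notation E := 'rV[R]_d.
Notation D := (skorohod d (+oo : \bar R)).
Variables (Lam : R) (hLam : 0 < Lam) (Px : R.-pker E ~> D) (hPx : markov_process Px).
Variable muhat : R.-ker (E * E)%type ~> (E * E)%type.
Hypothesis muhat_sym : forall v w A, measurable A ->
  muhat (v, w) A = muhat (w, v) [set hk | A (hk.2, hk.1)].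
Hypothesis muhat_bound : forall v w, (muhat (v, w) setT <= Lam%:E)%E.
Variables (P0 : probability E R) (dO : measure_display) (Omega : measurableType dO).
Variable P : probability Omega R.
Variable tau : forall N : nat, pair_index N -> nat -> {RV P >-> R}.
Variable Z : forall N : nat, 'I_N -> {RV P >-> D}.
Hypothesis hZ : forall N : nat, (2 <= N)%N -> particle_system Lam Px muhat P0 (@tau N) (@Z N).
Variable Pt : probability D R.
Hypothesis Pt_tv : forall (t : R) (N : nat) (i : 'I_N), 0 <= t -> (2 <= N)%N ->
  i = 0%N :> nat ->
  (tv_dist (pushforward P (fun omega => window 0 t%:E (Z i omega)))
           (pushforward Pt (window 0 t%:E)) <= (6 * (expR (Lam * t) - 1) / N.+1%:R)%:E)%E.
Variables (T : R) (hT : 0 <= T).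

(** One [e] covers the distance between the mean of a particle and the limit mean, the other covers
    the fluctuation. *)
Lemma eventually_mean_le (g : skorohod d (T%:E : \bar R) -> R) (m e : R) :
  measurable_fun setT g -> (forall y, 0 <= g y <= 1) ->
  (\int[distribution Pt (window 0 T%:E)]_y (g y)%:E = m%:E)%E -> 0 < e ->
  {ae P, forall w, \forall N \near \oo,
    ~ (N%:R * (m + e + e) <= \sum_(j < N) g (window 0 T%:E (Z j w)))}.
Proof.
move=> mg g01 hm e0.
set X := expR (Lam * T); set K := (8 * (Lam * T) + 2) * X ^+ 2.
have X0 : 0 < X by exact: expR_gt0.
have LT : 0 <= Lam * T by rewrite mulr_ge0// ltW.
have K0 : 0 < K by rewrite mulr_gt0// ?exprn_gt0//; lra.
(* The two terms of the minimum are the two smallness conditions of [tail_bound]. *)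
pose al := Num.min ((4 * X)^-1) (e / 2 / K).
have al0 : 0 < al by rewrite lt_min invr_gt0 !divr_gt0// mulr_gt0.
have al1 : 2 * (al * X) <= 2^-1.
  have h : al <= (4 * X)^-1 by rewrite ge_min lexx.
  have := ler_wpM2r (ltW X0) h; rewrite invfM -mulrA mulVf ?gt_eqF// mulr1 => h'; lra.
have al2 : al * K <= e / 2 by rewrite -ler_pdivlMr// ge_min lexx orbT.
set rho := expR (- (al * e / 2)).
have rho0 : 0 < rho by exact: expR_gt0.
have ale : 0 < al * e / 2 by rewrite !divr_gt0// mulr_gt0.
have rho1 : rho < 1 by rewrite expR_lt1 oppr_lt0.
(* As soon as [N.+1] is at least [q], the total variation bound is at most [e]. *)
pose q := 6 * (X - 1) / e.
have [n0 hn0] : exists n0 : nat, q <= n0%:R.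
  exists (Num.bound `|q|); exact: (le_trans (ler_norm _) (ltW (archi_boundP (normr_ge0 _)))).
(* The 2 ensures at least two particles, as [hZ] and [Pt_tv] require. *)
pose n1 := (n0 + 2)%N.
have mgw N (j : 'I_N) : measurable_fun setT (fun w => g (window 0 T%:E (Z j w))).
  apply: (measurableT_comp mg); exact: (measurableT_comp (@measurable_window R d 0 T%:E)).
pose A N := [set w | N%:R * (m + e + e) <= \sum_(j < N) g (window 0 T%:E (Z j w))].
have mS N : measurable_fun setT (fun w => \sum_(j < N) g (window 0 T%:E (Z j w))).
  by apply: measurable_sum => j; exact: mgw.
have mle N (x : R) : measurable [set w | x <= \sum_(j < N) g (window 0 T%:E (Z j w))].
  rewrite -[X in measurable X]setTI; apply: measurable_fun_le => //; solve [exact: measurable_cst|exact: mS].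
have mA N : measurable (A N) by exact: mle.
have tail N : (n1 <= N)%N -> (P (A N) <= (rho ^+ N)%:E)%E.
  move=> nN; have N2 : (2 <= N)%N by apply: leq_trans nN; rewrite leq_addl.
  pose i : 'I_N := Ordinal (ltn_trans (ltn0Sn 0) N2).
  pose h (y : D) := g (window 0 T%:E y).
  have mh : measurable_fun setT h by apply: (measurableT_comp mg); exact: measurable_window.
  have hst (y : D) : h y = h (stop y T) by rewrite /h window_stop.
  have h01 (y : D) : 0 <= h y <= 1 by exact: g01.
  pose W : {RV P >-> skorohod d (T%:E : \bar R)} := window 0 T%:E \o Z i.
  have mgE : measurable_fun setT (fun y => (g y)%:E) by exact/measurable_EFinP.
  have gE0 y : (0 <= (g y)%:E)%E by rewrite lee_fin; have /andP[] := g01 y.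
  have iW : (\int[distribution P W]_y (g y)%:E = \int[P]_w (h (Z i w))%:E)%E.
    by rewrite ge0_integral_distribution.
  have eN : e != 0 by rewrite gt_eqF.
  have hq : q <= N.+1%:R.
    apply: (le_trans hn0); rewrite ler_nat; apply: (leq_trans _ (leqnSn N)).
    by apply: (leq_trans _ nN); exact: leq_addr.
  have tvW B : measurable B -> (distribution P W B <= distribution Pt (window 0 T%:E) B + e%:E)%E.
    move=> mB; have tv := Pt_tv hT N2 (erefl : i = 0%N :> nat).
    have : (`|distribution P W B - distribution Pt (window 0 T%:E) B| <= e%:E)%E.
      apply: (@le_trans _ _ (6 * (X - 1) / N.+1%:R)%:E).
        by apply: (le_trans _ tv); apply: ereal_sup_ubound; exists B.
      rewrite lee_fin ler_pdivrMr ?ltr0n// -[6 * (X - 1)](divfK eN) [e * _]mulrC.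
      exact: (ler_wpM2r (ltW e0) hq).
    have f1 : distribution P W B \is a fin_num by exact: fin_num_measure.
    have f2 : distribution Pt (window 0 T%:E) B \is a fin_num by exact: fin_num_measure.
    rewrite -(fineK f1) -(fineK f2) -EFinB -EFinD abse_EFin !lee_fin => /(le_trans (ler_norm _)).
    by rewrite lerBlDl.
  have le1 := integral_le_tv mg g01 (ltW e0) tvW.
  rewrite hm iW -EFinD in le1.
  have I0 : (0 <= \int[P]_w (h (Z i w))%:E)%E.
    by apply: integral_ge0 => w _; rewrite lee_fin; have /andP[] := h01 (Z i w).
  have [mn hmn] : exists mn, (\int[P]_w (h (Z i w))%:E = mn%:E)%E.
    exists (fine (\int[P]_w (h (Z i w))%:E)%E); rewrite fineK// ge0_fin_numE//.
    exact: (le_lt_trans le1 (ltry _)).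
  rewrite hmn lee_fin in le1.
  have tb := tail_bound hLam hPx muhat_sym muhat_bound (hZ N2) hT N2 mh h01 hst hmn (ltW al0) al1 al2.
  apply: (le_trans _ tb); apply: le_measure; [by rewrite inE; exact: mA|by rewrite inE; exact: mle|].
  move=> w; rewrite /A /=; apply: le_trans; apply: ler_wpM2l => //; lra.
(* With this factor the geometric bound is at least 1 for [N < n1], where it holds trivially. *)
have C1 : 1 <= (rho ^+ n1)^-1 by rewrite invf_ge1 ?exprn_gt0// exprn_ile1// ltW.
apply: (@ae_eventually R dO Omega P A rho (rho ^+ n1)^-1 mA).
- by rewrite ltW.
- exact: le_trans ler01 C1.
- move=> N; have [nN|Nn] := leqP n1 N.
    by apply: (le_trans (tail N nN)); rewrite lee_fin ler_peMl// exprn_ge0// ltW.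
  apply: (le_trans (probability_le1 P (mA N))); rewrite lee_fin mulrC ler_pdivlMr ?exprn_gt0// mul1r.
  by apply: (ler_wiXn2l (ltW rho0) (ltW rho1)); exact: ltnW Nn.
Qed.

End law_of_large_numbers.

Theorem theorem2p7 (R : realType) (d : nat) (hd : (1 <= d)%N)
    (Lam : R) (hLam : 0 < Lam)
    (Px : R.-pker 'rV[R]_d ~> skorohod d (+oo : \bar R))
    (hPx : markov_process Px)
    (DL : set ('rV[R]_d -> R)) (L : ('rV[R]_d -> R) -> 'rV[R]_d -> R)
    (hL : is_generator Px DL L)
    (muhat : R.-ker ('rV[R]_d * 'rV[R]_d)%type ~> ('rV[R]_d * 'rV[R]_d)%type)
    (muhat_sym : forall v w A, measurable A ->
       muhat (v, w) A = muhat (w, v) [set hk | A (hk.2, hk.1)])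
    (muhat_bound : forall v w, (muhat (v, w) setT <= Lam%:E)%E)
    (P0 : probability 'rV[R]_d R)
    (dO : measure_display) (Omega : measurableType dO)
    (P : probability Omega R)
    (tau : forall N : nat, pair_index N -> nat -> {RV P >-> R})
    (Z : forall N : nat, 'I_N -> {RV P >-> skorohod d (+oo : \bar R)})
    (hZ : forall N : nat, (2 <= N)%N ->
       particle_system Lam Px muhat P0 (@tau N) (@Z N))
    (Pt : probability (skorohod d (+oo : \bar R)) R)
    (Pt_sol : solves_nonlinear_martingale_problem DL L muhat P0 Pt)
    (Pt_tv : forall (t : R) (N : nat) (i : 'I_N), 0 <= t -> (2 <= N)%N ->
       i = 0%N :> nat ->
       (tv_dist (pushforward P (fun omega => window 0 t%:E (Z N i omega)))
                (pushforward Pt (window 0 t%:E))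
        <= (6 * (expR (Lam * t) - 1) / N.+1%:R)%:E)%E)
    (T : R) (hT : 0 <= T)
    (f : skorohod d (T%:E : \bar R) -> R)
    (f_meas : measurable_fun setT f)
    (f_bounded : exists C : R, forall w, `|f w| <= C) :
  {ae P, forall omega,
    \int[empirical R (fun i : 'I_N => window 0 T%:E (Z N i omega))]_w f w
      @[N --> \oo] -->
    \int[distribution Pt (window 0 T%:E)]_w f w}.

Proof.
(* Adding 1 keeps [c] positive even if [f] vanishes. *)
have [C fC] := f_bounded; pose c := `|C| + 1.
have c0 : 0 < c by rewrite ltr_wpDl.
have c20 : 0 < 2 * c by rewrite mulr_gt0.
pose g y := (f y + c) / (2 * c).
have mg : measurable_fun setT g.
  apply: measurable_funM; last exact: measurable_cst.
  by apply: measurable_funD => //; exact: measurable_cst.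
have g01 y : 0 <= g y <= 1.
  have := fC y; rewrite ler_norml => /andP[h1 h2]; have hC := ler_norm C.
  apply/andP; split; first by rewrite /g divr_ge0 ?ltW// /c; lra.
  by rewrite /g ler_pdivrMr// mul1r /c; lra.
(* The upper bound for [1 - g] is the lower bound for [g]. *)
pose g' y := 1 - g y.
have mg' : measurable_fun setT g' by apply: measurable_funB => //; exact: measurable_cst.
have g'01 y : 0 <= g' y <= 1 by have /andP[h1 h2] := g01 y; rewrite /g'; apply/andP; split; lra.
pose nu := distribution Pt (window 0 T%:E).
have nu1 : nu setT = 1%E by exact: probability_setT.
have gE : measurable_fun setT (fun y => (g y)%:E) by exact/measurable_EFinP.
have gE' : measurable_fun setT (fun y => (g' y)%:E) by exact/measurable_EFinP.
have ge0 y : (0 <= (g y)%:E)%E by rewrite lee_fin; have /andP[] := g01 y.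
have ge0' y : (0 <= (g' y)%:E)%E by rewrite lee_fin; have /andP[] := g'01 y.
have I0 : (0 <= \int[nu]_y (g y)%:E)%E by exact: integral_ge0.
have I0' : (0 <= \int[nu]_y (g' y)%:E)%E by exact: integral_ge0.
have I1 : (\int[nu]_y (g y)%:E + \int[nu]_y (g' y)%:E = 1)%E.
  rewrite -ge0_integralD//.
  have e1 : (\int[nu]_y ((g y)%:E + (g' y)%:E) = \int[nu]_y (cst 1%:E) y)%E.
    by apply: eq_integral => y _; rewrite -EFinD /g' addrC subrK.
  transitivity (\int[nu]_y (\1_[set: skorohod d (T%:E : \bar R)] y)%:E)%E.
    by rewrite e1; apply: eq_integral => y _; rewrite indicE in_setT.
  by rewrite integral_indic// setIT.
have [m hm] : exists m, (\int[nu]_y (g y)%:E = m%:E)%E.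
  exists (fine (\int[nu]_y (g y)%:E)%E); rewrite fineK// ge0_fin_numE//.
  by apply: (@le_lt_trans _ _ 1%E); rewrite ?ltry// -I1 leeDl.
have hm' : (\int[nu]_y (g' y)%:E = (1 - m)%:E)%E.
  move: I1; rewrite hm; case: (\int[nu]_y (g' y)%:E)%E => [r||]//=.
  by rewrite -EFinD => -[<-]; rewrite addrAC subrr add0r.
(* A countable family of tolerances, so that one null set serves all of them. *)
pose ek (k : nat) : R := k.+1%:R^-1.
have ek0 k : 0 < ek k by rewrite invr_gt0 ltr0n.
have up := ae_foralln (fun k => eventually_mean_le hLam hPx muhat_sym muhat_bound hZ Pt_tv hT mg g01 hm (ek0 k)).
have lo := ae_foralln (fun k => eventually_mean_le hLam hPx muhat_sym muhat_bound hZ Pt_tv hT mg' g'01 hm' (ek0 k)).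
apply: filterS2 up lo => w hu hl.
have fnu : \int[nu]_w f w = 2 * c * m - c by rewrite (Rintegral_affine nu1 f_meas fC c0) -/g hm.
rewrite -/nu fnu; apply/cvgrPdist_le => eps eps0.
(* The means of [g] differ by less than [2 * ek k], and those of [f] by [2 * c] times as much. *)
pose k := Num.bound (4 * c / eps).
have hk : 4 * c * ek k <= eps.
  have k0 : 0 <= 4 * c / eps by rewrite divr_ge0 ?mulr_ge0 ?ltW.
  have kb := archi_boundP k0.
  rewrite ltr_pdivrMr// in kb; rewrite /ek ler_pdivrMr ?ltr0n//; apply: (le_trans (ltW kb)).
  by rewrite mulrC; apply: ler_wpM2l; [exact: ltW|rewrite ler_nat].
(* Excluding [N = 0] makes the empirical measure a probability. *)
apply: filterS3 (hu k) (hl k) (nbhs_infty_ge 2) => N hN hN' N2.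
have N0 : 0 < N%:R :> R by rewrite ltr0n; exact: ltn_trans N2.
pose x := fun i : 'I_N => window 0 T%:E (Z N i w).
have e1 : empirical R x setT = 1%E.
  rewrite /empirical (eq_bigr (fun=> 1%:E)) => [|i _]; last by rewrite diracT.
  by rewrite sumEFin -EFinM sumr_const card_ord mulVf// gt_eqF.
have g0 y : 0 <= g y by have /andP[] := g01 y.
pose S := \sum_(j < N) g (x j).
have e2 : \int[empirical R x]_w f w = 2 * c * (N%:R^-1 * S) - c.
  by rewrite (Rintegral_affine e1 f_meas fC c0) (integral_empirical x mg g0).
rewrite e2.
have hS : S < N%:R * (m + ek k + ek k) by rewrite ltNge; apply/negP; exact: hN.
have sE : \sum_(j < N) g' (x j) = N%:R - S by rewrite /g' sumrB sumr_const card_ord.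
have hS' : N%:R - S < N%:R * (1 - m + ek k + ek k).
  by rewrite ltNge -sE; apply/negP; exact: hN'.
set a := N%:R^-1 * S.
have Sa : S = N%:R * a by rewrite /a mulrA mulfV ?gt_eqF// mul1r.
have a1 : a < m + ek k + ek k by rewrite -(ltr_pM2l N0) -Sa.
have a2 : 1 - a < 1 - m + ek k + ek k by rewrite -(ltr_pM2l N0) mulrBr mulr1 -Sa.
have -> : 2 * c * m - c - (2 * c * a - c) = 2 * c * (m - a) by ring.
rewrite normrM (ger0_norm (ltW c20)); apply: (le_trans _ hk).
have -> : 4 * c * ek k = 2 * c * (2 * ek k) by ring.
apply: ler_wpM2l; first exact: ltW.
by rewrite ler_norml; apply/andP; split; lra.
Qed.
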